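(* Let $M$ be a complete noncompact $n$-dimensional Alexandrov space with curvature $\ge\kappa$ (for some $\kappa\le 0$). If $\mathrm{ob}_\infty(M)=\pi/2$, then $1\text{-}\mathrm{inj}(M)=\infty$. Suppose in addition that $M$ has nonempty boundary. Then $M$ is homeomorphic to the Euclidean half space $\mathbb R^n_+$, and any two distinct points of $\partial M$ lie on a line of $M$ which is contained in $\partial M$.
   Context: Alexandrov spaces of curvature $\ge\kappa$ are taken in the sense of Burago–Gromov–Perelman and are assumed finite-dimensional. $|x,y|$ denotes distance; $\partial M$ is the boundary of $M$ in the sense of Alexandrov geometry. A minimal geodesic is an isometric embedding of an interval; a line is an isometric embedding of $\mathbb R$ (or its image). For a point $p$, $\Sigma_p$ is the space of directions at $p$ with its angle metric $\angle$. For $p\ne q$, $\Uparrow_p^q\subset\Sigma_p$ is the set of all directions at $p$ of minimal geodesics from $p$ to $q$, and $\uparrow_p^q$ denotes an element of $\Uparrow_p^q$. For a set $A\subset \Sigma_p$, $\angle(A,\xi)$ is the distance in $\Sigma_p$ from $\xi$ to $A$. For $p\ne q\in M$ define $$\mathrm{ob}_\infty(p,q)=\limsup_{x\to\infty}\max\{\angle(\Uparrow_p^q,\uparrow_p^x),\angle(\Uparrow_q^p,\uparrow_q^x)\}-\pi/2$$ (the limsup is as $x$ leaves every bounded set, over all choices of $\uparrow_p^x\in\Uparrow_p^x$, $\uparrow_q^x\in\Uparrow_q^x$), and $\mathrm{ob}_\infty(M)=\liminf_{|p,q|\to0}\mathrm{ob}_\infty(p,q)\in[0,\pi/2]$, over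 pairs $p\ne q$ in $M$. For $\xi\in\Sigma_p$, the opposite direction $-\xi$, if it exists, is the element of $\Sigma_p$ with $\angle(\xi,-\xi)=\pi$. The one-side injectivity radius $1\text{-}\mathrm{inj}(M)$ is the supremum of those $r\ge0$ such that for every $p\in M$ and every $\xi\in\Sigma_p$ there exists a minimal geodesic of length $\ge r$ starting from $p$ in the direction of at least one of $\xi$ or $-\xi$ (the latter if it exists). *)

(* Defs.v *)
From HB Require Import structures.
From mathcomp Require Import all_boot all_order all_algebra.
From mathcomp Require Import all_classical all_reals all_analysis.
From mathcomp Require Import ring lra.

Set Implicit Arguments.
Unset Strict Implicit.
Unset Printing Implicit Defensive.
Import Order.TTheory GRing.Theory Num.Theory.
Import numFieldNormedType.Exports.
Local Open Scope classical_set_scope.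
Local Open Scope ring_scope.

Section MetricNotions.
Context {R : realType}.

Definition complete_space (X : metricType R) : Prop :=
  forall F : set_system X, ProperFilter F -> cauchy F -> exists x : X, F --> x.

Definition bounded_subset (X : metricType R) (B : set X) : Prop :=
  exists x r, forall y, B y -> mdist x y <= r.

Definition at_infinity (X : metricType R) : set_system X :=
  filter_from (@bounded_subset X) (fun B => ~` B).

Definition curve_length (X : metricType R) (c : R -> X) : \bar R :=
  ereal_sup [set (\sum_(i < size s)
    mdist (c (nth 0 (0 :: s) i)) (c (nth 0 (0 :: s) i.+1)))%:E
    | s in itv_partition 0 1].

Definition intrinsic (X : metricType R) : Prop :=
  forall x y : X, (mdist x y)%:E = ereal_inf [set curve_length c
    | c in [set c : R -> X |
        [/\ {within `[0, 1], continuous c}, c 0 = x & c 1 = y]]].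

Definition ediam (X : metricType R) (A : set X) : \bar R :=
  ereal_sup [set (mdist xy.1 xy.2)%:E | xy in A `*` A].

(* Used for 0 < s only, so that empty sets of a cover (of diameter -oo)
   contribute poweR -oo s = 0. *)
Definition hausdorff_content (X : metricType R) (s delta : R) (A : set X)
    : \bar R :=
  ereal_inf [set (\sum_(0 <= k <oo) poweR (ediam (U k)) s)%E
    | U in [set U : nat -> set X |
        A `<=` \bigcup_k U k /\ forall k, (ediam (U k) <= delta%:E)%E]].

Definition hausdorff_measure (X : metricType R) (s : R) (A : set X) : \bar R :=
  ereal_sup [set hausdorff_content s delta A | delta in [set delta | 0 < delta]].

Definition hausdorff_dim (X : metricType R) (A : set X) : \bar R :=
  ereal_inf [set s%:E | s in [set s : R | 0 < s /\ hausdorff_measure s A = 0%E]].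

(* f and g are mutually inverse homeomorphisms between the subspaces A and B *)
Definition homeomorphism (X Y : topologicalType) (A : set X) (B : set Y)
    (f : X -> Y) (g : Y -> X) : Prop :=
  [/\ {within A, continuous f}, {within B, continuous g},
      forall x, A x -> B (f x) /\ g (f x) = x &
      forall y, B y -> A (g y) /\ f (g y) = y].

End MetricNotions.

Section Comparison.
Context {R : realType}.

Definition cosh (x : R) : R := (expR x + expR (- x)) / 2.
Definition sinh (x : R) : R := (expR x - expR (- x)) / 2.

(* Angle opposite to the side a of the triangle with sides a, b, c in the
   simply connected surface of constant curvature kappa, by the law of cosines.
   Only meant for kappa <= 0. *)
Definition model_angle (kappa a b c : R) : R :=
  if kappa < 0 then
    let k := Num.sqrt (- kappa) in
    acos ((cosh (k * b) * cosh (k * c) - cosh (k * a))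
          / (sinh (k * b) * sinh (k * c)))
  else acos ((b ^+ 2 + c ^+ 2 - a ^+ 2) / (2 * b * c)).

Definition comparison_angle (X : metricType R) (kappa : R) (x y z : X) : R :=
  model_angle kappa (mdist y z) (mdist x y) (mdist x z).

(* The quadruple condition of Burago-Gromov-Perelman. *)
Definition curvature_ge (X : metricType R) (kappa : R) : Prop :=
  forall x : X, exists2 U, nbhs x U & forall a b c d : X,
    U a -> U b -> U c -> U d -> uniq [:: a; b; c; d] ->
    comparison_angle kappa a b c + comparison_angle kappa a c d
      + comparison_angle kappa a d b <= 2 * pi.

End Comparison.

(* A finite-dimensional complete Alexandrov space; the dimension is the Hausdorff
   dimension. *)
Definition complete_alexandrov {R : realType} (n : nat) (kappa : R)
    (X : metricType R) : Prop :=
  [/\ complete_space X, intrinsic X, curvature_ge X kappa &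
      hausdorff_dim [set: X] = (n%:R : R)%:E].

Section Directions.
Context {R : realType}.

(* Nonconstant minimal geodesics from p; only the values of gcurve on [0, glen]
   are meaningful. *)
Record geodesic (X : metricType R) (p : X) := Geodesic {
  glen : R ;
  gcurve :> R -> X ;
  glen_gt0 : 0 < glen ;
  gcurve0 : gcurve 0 = p ;
  gcurve_isom : forall s t, 0 <= s <= glen -> 0 <= t <= glen ->
    mdist (gcurve s) (gcurve t) = `|s - t| }.

Definition gend (X : metricType R) (p : X) (g : geodesic p) : X := g (glen g).

(* The upper angle; under a lower curvature bound it is a limit. *)
Definition angle (X : metricType R) (p : X) (g h : geodesic p) : R :=
  fine (limf_esup (fun st : R * R =>
                     (comparison_angle 0 p (g st.1) (h st.2))%:E)
                  (filter_prod 0^'+ 0^'+)).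

End Directions.

Section AngleTheory.
Context {R : realType} {X : metricType R} {p : X}.
Implicit Types (g h k : geodesic p) (s t r e : R).

Let cmp g h s t : R := comparison_angle 0 p (g s) (h t).

Let cosarg g h s t : R :=
  (s ^+ 2 + t ^+ 2 - mdist (g s) (h t) ^+ 2) / (2 * s * t).

Let mdist_geo g s : 0 < s -> s <= glen g -> mdist p (g s) = s.
Proof.
move=> s0 sl; rewrite -{1}(gcurve0 g) gcurve_isom ?lexx ?(ltW (glen_gt0 g)) //.
  by rewrite sub0r normrN gtr0_norm.
by rewrite ltW.
Qed.

Let cmpE g h s t : 0 < s -> s <= glen g -> 0 < t -> t <= glen h ->
  cmp g h s t = acos (cosarg g h s t).
Proof.
by move=> s0 sl t0 tl; rewrite /cmp /comparison_angle /model_angle ltxx !mdist_geo.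
Qed.

Let cosarg_itv g h s t : 0 < s -> s <= glen g -> 0 < t -> t <= glen h ->
  -1 <= cosarg g h s t <= 1.
Proof.
move=> s0 sl t0 tl.
have gs := mdist_geo s0 sl; have ht := mdist_geo t0 tl.
have := metric_triangle (g s) p (h t).
rewrite (metric_sym (g s) p) gs ht => d1.
have := metric_triangle p (g s) (h t); rewrite gs ht => d2.
have := metric_triangle p (h t) (g s).
rewrite gs ht (metric_sym (h t)) => d3.
have d0 := mdist_ge0 (g s) (h t).
have st0 : 0 < 2 * s * t by rewrite !mulr_gt0.
rewrite /cosarg ler_pdivlMr // ler_pdivrMr //.
by apply/andP; split; nra.
Qed.

Let cmp_itv g h s t : 0 < s -> s <= glen g -> 0 < t -> t <= glen h ->
  0 <= cmp g h s t <= pi.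
Proof.
by move=> *; rewrite cmpE // acos_ge0 ?acos_lepi ?cosarg_itv.
Qed.

Let corner (e : R) : set (R * R) :=
  [set st | (0 < st.1 < e) /\ (0 < st.2 < e)].

Let corner_nbhs e : 0 < e -> filter_prod 0^'+ 0^'+ (corner e).
Proof.
move=> e0; have H : (0 : R)^'+ `]0, e[%classic.
  exists e => //= x /=; rewrite sub0r normrN in_itv /= => xe x0.
  by rewrite x0 -[x]gtr0_norm.
exists (`]0, e[%classic, `]0, e[%classic) => //.
Qed.

Let corner_sub (V : set (R * R)) : filter_prod 0^'+ 0^'+ V ->
  exists2 e, 0 < e & corner e `<=` V.
Proof.
move=> [[A B] /= [A0 B0] ABV].
have ritv (C : set R) : (0 : R)^'+ C ->
    exists2 e, 0 < e & forall x, 0 < x < e -> C x.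
  move=> [e /= e0 eC]; exists e => // x /andP[x0 xe].
  by apply: eC => //=; rewrite sub0r normrN gtr0_norm.
have [a a0 aA] := ritv _ A0; have [b b0 bB] := ritv _ B0.
exists (Num.min a b); first by rewrite lt_min a0.
move=> [s t] /= [/andP[s0 sm] /andP[t0 tm]]; apply: ABV => /=.
move: sm tm; rewrite !lt_min => /andP[sa _] /andP[_ tb].
by split; [apply: aA; rewrite s0|apply: bB; rewrite t0].
Qed.

Let esup g h : \bar R := limf_esup (fun st : R * R => (cmp g h st.1 st.2)%:E)
   (filter_prod 0^'+ 0^'+).

Let esup_itv g h : (0 <= esup g h <= (pi : R)%:E)%E.
Proof.
pose e0 := Num.min (glen g) (glen h).
have e00 : 0 < e0 by rewrite lt_min !glen_gt0.
have inC st : corner e0 st -> 0 <= cmp g h st.1 st.2 <= pi.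
  case: st => s t [/= /andP[s0 sm] /andP[t0 tm]].
  move: sm tm; rewrite !lt_min => /andP[sa _] /andP[_ tb].
  by apply: cmp_itv => //; rewrite ltW.
apply/andP; split.
  apply: le_ereal_inf_tmp => _ [V FV <-].
  have [e e0' eV] := corner_sub FV.
  pose m := Num.min e e0 / 2.
  have m0 : 0 < m by rewrite divr_gt0 // lt_min e0'.
  have mm : m < Num.min e e0 by rewrite ltr_pdivrMr // ltr_pMr ?ltr1n // lt_min e0'.
  have [me me0] : m < e /\ m < e0 by move: mm; rewrite lt_min => /andP.
  apply: le_ereal_sup_tmp; exists (cmp g h m m)%:E.
    by exists (m, m) => //; apply: eV; split; rewrite /= m0.
  have /andP[] := inC (m, m) ltac:(by split; rewrite /= m0).
  by rewrite lee_fin.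
apply: ge_ereal_inf; exists (ereal_sup ((fun st : R * R => (cmp g h st.1 st.2)%:E) @` corner e0)).
  by exists (corner e0) => //; exact: corner_nbhs.
by apply: ge_ereal_sup => _ [st /inC/andP[_ st1] <-]; rewrite lee_fin.
Qed.

Let esupE g h : esup g h = (angle g h)%:E.
Proof.
rewrite /angle -/(esup g h) fineK // fin_numE; have /andP[h0 hpi] := esup_itv g h.
by rewrite gt_eqF ?(lt_le_trans _ h0) ?ltNyr // lt_eqF // (le_lt_trans hpi) // ltry.
Qed.

Lemma angle_ge0 g h : 0 <= angle g h.
Proof. by rewrite -lee_fin -esupE; case/andP: (esup_itv g h). Qed.

Lemma angle_le_pi g h : angle g h <= pi.
Proof. by rewrite -lee_fin -esupE; case/andP: (esup_itv g h). Qed.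

Let angle_lt g h a : angle g h < a ->
  exists2 e, 0 < e & forall s t, 0 < s < e -> 0 < t < e -> cmp g h s t < a.
Proof.
rewrite -lte_fin -esupE => /ereal_inf_lt[_ [V FV <-] Va].
have [e e0 eV] := corner_sub FV; exists e => // s t se te.
rewrite -lte_fin; apply: le_lt_trans Va.
by apply: ereal_sup_ubound; exists (s, t) => //; apply: eV.
Qed.

Let angle_gt g h a : a < angle g h -> forall e, 0 < e ->
  exists s t, [/\ 0 < s < e, 0 < t < e & a < cmp g h s t].
Proof.
move=> ag e e0; apply: contrapT => /forallNP H; move: ag; apply/negP.
rewrite -leNgt -lee_fin -esupE; apply: ge_ereal_inf.
exists (ereal_sup ((fun st : R * R => (cmp g h st.1 st.2)%:E) @` corner e)).
  by exists (corner e) => //; exact: corner_nbhs.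
apply: ge_ereal_sup => _ [[s t] [/= se te] <-]; rewrite lee_fin leNgt.
by apply/negP => ast; apply: (H s); exists t.
Qed.

Lemma anglexx g : angle g g = 0.
Proof.
apply/eqP; rewrite eq_le angle_ge0 andbT leNgt; apply/negP => a0.
have [s [t [/andP[s0 sl] /andP[t0 tl]]]] := angle_gt a0 (glen_gt0 g).
rewrite cmpE ?ltW // /cosarg gcurve_isom ?ltW // ?(ltW s0) ?(ltW t0) //=.
rewrite real_normK ?num_real // [X in acos X](_ : _ = 1) ?acos1 ?ltxx //.
by field; rewrite !gt_eqF.
Qed.


Lemma angleC g h : angle g h = angle h g.
Proof.
suff H g' h' : angle g' h' <= angle h' g' by apply/eqP; rewrite eq_le !H.
rewrite leNgt; apply/negP => a0.
have [/angle_lt[e e0 He] /angle_gt Hg] := midf_lt a0.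
have := Hg (Num.min e (Num.min (glen g') (glen h'))).
rewrite !lt_min e0 !glen_gt0 => /(_ isT)[s [t [/andP[s0 sm] /andP[t0 tm]]]].
move: sm tm; rewrite !lt_min => /and3P[se sg sh] /and3P[te tg th].
have := He t s; rewrite t0 te s0 se => /(_ isT isT).
rewrite !cmpE ?ltW // /cosarg metric_sym (addrC (t ^+ 2)) (mulrAC 2 t).
by move=> /lt_trans H /H; rewrite ltxx.
Qed.

Let cos_acos_lt g h s t a : 0 < s -> s <= glen g -> 0 < t -> t <= glen h ->
  0 <= a <= pi ->
  (cmp g h s t < a ->
     mdist (g s) (h t) ^+ 2 < s ^+ 2 + t ^+ 2 - 2 * s * t * cos a) /\
  (a < cmp g h s t ->
     s ^+ 2 + t ^+ 2 - 2 * s * t * cos a < mdist (g s) (h t) ^+ 2).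
Proof.
move=> s0 sl t0 tl api; have cI := cosarg_itv s0 sl t0 tl.
have aI : acos (cosarg g h s t) \in `[0, pi].
  by rewrite in_itv /= acos_ge0 ?acos_lepi.
have st0 : 0 < 2 * s * t by rewrite !mulr_gt0.
have E : mdist (g s) (h t) ^+ 2 = s ^+ 2 + t ^+ 2 - 2 * s * t * cosarg g h s t.
  by rewrite /cosarg mulrC divfK ?gt_eqF //; ring.
rewrite E cmpE //; split=> H; rewrite ltrD2l ltrN2 ltr_pM2l //.
  by rewrite -(@acosK _ (cosarg g h s t)) ?in_itv // ltr_cos // in_itv /=.
by rewrite -(@acosK _ (cosarg g h s t)) ?in_itv // ltr_cos // in_itv /=.
Qed.

Let cut_segment s r a b : s * sin a + r * sin b != 0 ->
  let D := s * sin a + r * sin b in let t := s * r * sin (a + b) / D in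
  s ^+ 2 + t ^+ 2 - 2 * s * t * cos a =
  (s * sin a / D) ^+ 2 * (s ^+ 2 + r ^+ 2 - 2 * s * r * cos (a + b)).
Proof.
move=> D0 D t; apply: (@mulIf _ (D ^+ 2)); first by rewrite expf_neq0.
have tD : t * D = s * r * sin (a + b) by rewrite divfK.
transitivity (s ^+ 2 * D ^+ 2 + (t * D) ^+ 2 - 2 * s * (t * D) * cos a * D).
  by ring.
have -> : (s * sin a / D) ^+ 2 * (s ^+ 2 + r ^+ 2 - 2 * s * r * cos (a + b))
    * D ^+ 2 =
  (s * sin a / D * D) ^+ 2 * (s ^+ 2 + r ^+ 2 - 2 * s * r * cos (a + b)).
  by ring.
rewrite tD divfK // /D sinD cosD.
have ua := cos2Dsin2 a; have ub := cos2Dsin2 b.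
apply/eqP; rewrite -subr_eq0 [X in X == 0](_ : _ = s ^+ 2 *
  ((2 * s * r * sin a * sin b + r ^+ 2 * sin b ^+ 2)
     * (1 - (cos a ^+ 2 + sin a ^+ 2))
   + r ^+ 2 * sin a ^+ 2 * (cos b ^+ 2 + sin b ^+ 2 - 1))); last by ring.
by rewrite ua ub !subrr !mulr0 addr0 mulr0.
Qed.

Lemma angle_triangle h g k : angle g k <= angle g h + angle h k.
Proof.
rewrite leNgt; apply/negP => H.
pose e := (angle g k - (angle g h + angle h k)) / 3.
have e0 : 0 < e by rewrite divr_gt0 // subr_gt0.
pose a := angle g h + e; pose b := angle h k + e.
have abk : a + b < angle g k by rewrite /a /b /e; lra.
have a0 : 0 < a by have := angle_ge0 g h; rewrite /a; lra.
have b0 : 0 < b by have := angle_ge0 h k; rewrite /b; lra.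
have kpi := angle_le_pi g k.
have [d1 d10 H1] := @angle_lt g h a ltac:(by rewrite ltrDl).
have [d2 d20 H2] := @angle_lt h k b ltac:(by rewrite ltrDl).
pose d := Num.min (Num.min d1 d2) (Num.min (glen g) (Num.min (glen h) (glen k))).
have [|s [r [/andP[s0 sd] /andP[r0 rd] skr]]] := angle_gt abk (_ : 0 < d).
  by rewrite !lt_min d10 d20 !glen_gt0.
have sa0 : 0 < sin a by rewrite sin_gt0_pi // a0 /=; lra.
have sb0 : 0 < sin b by rewrite sin_gt0_pi // b0 /=; lra.
have sab0 : 0 < sin (a + b) by rewrite sin_gt0_pi // addr_gt0 //=; lra.
pose D := s * sin a + r * sin b.
have D0 : 0 < D by rewrite addr_gt0 // mulr_gt0.
pose t := s * r * sin (a + b) / D.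
have t0 : 0 < t by rewrite divr_gt0 // !mulr_gt0.
have td : t < d.
  rewrite ltr_pdivrMr // /D sinD.
  have := cos_le1 a; have := cos_le1 b => cb ca.
  have : s * r * (sin a * cos b + cos a * sin b) <= s * r * (sin a + sin b).
    rewrite ler_pM2l ?mulr_gt0 //; nra.
  move=> /le_lt_trans; apply.
  have h1 : s * r * sin a < d * (s * sin a).
    by rewrite mulrA (mulrC d) ltr_pM2r // ltr_pM2l.
  have h2 : s * r * sin b < d * (r * sin b).
    by rewrite mulrA ltr_pM2r // ltr_pM2r.
  by rewrite !mulrDr ltrD.
have lims x : x < d -> [/\ x < d1, x < d2 &
    [/\ x <= glen g, x <= glen h & x <= glen k]].
  by rewrite !lt_min => /andP[/andP[-> ->] /and3P[? ? ?]]; split=> //; split; apply: ltW.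
have [s1 s2 [sg sh sk]] := lims _ sd.
have [r1 r2 [rg rh rk]] := lims _ rd.
have [t1 t2 [tg th tk]] := lims _ td.
have api : 0 <= a <= pi by apply/andP; split; lra.
have bpi : 0 <= b <= pi by apply/andP; split; lra.
have abpi : 0 <= a + b <= pi by apply/andP; split; lra.
have := (cos_acos_lt s0 sg r0 rk abpi).2 skr.
have := (cos_acos_lt s0 sg t0 th api).1 (H1 _ _ _ _).
rewrite s0 s1 t0 t1 => /(_ isT isT).
have := (cos_acos_lt t0 th r0 rk bpi).1 (H2 _ _ _ _).
rewrite t0 t2 r0 r2 => /(_ isT isT).
set z2 := s ^+ 2 + r ^+ 2 - _.
have -> : s ^+ 2 + t ^+ 2 - 2 * s * t * cos a = (s * sin a / D) ^+ 2 * z2.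
  by apply: cut_segment; rewrite gt_eqF.
have -> : t ^+ 2 + r ^+ 2 - 2 * t * r * cos b = (r * sin b / D) ^+ 2 * z2.
  have := @cut_segment r s b a.
  rewrite (addrC (r * sin b)) -/D gt_eqF // (addrC b a) (mulrC r s).
  move=> /(_ isT) /=; rewrite -/t => E2.
  rewrite (_ : 2 * t * r = 2 * r * t); last by ring.
  by rewrite (addrC (t ^+ 2)) E2 /z2; ring.
set lb := r * sin b / D; set la := s * sin a / D => hd2 hd1 hz.
have la0 : 0 < la by rewrite divr_gt0 // mulr_gt0.
have lb0 : 0 < lb by rewrite divr_gt0 // mulr_gt0.
have lab : la + lb = 1 by rewrite /la /lb -mulrDl divff // gt_eqF.
clearbody la lb.
have z20 : 0 <= z2.
  by rewrite -(pmulr_rge0 _ (exprn_gt0 2 la0)) ltW // (le_lt_trans _ hd1) ?sqr_ge0.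
have w0 : 0 <= Num.sqrt z2 by exact: sqrtr_ge0.
move: hd2 hd1 hz; rewrite -(sqr_sqrtr z20) -!exprMn.
rewrite !ltr_pXn2r ?nnegrE ?mdist_ge0 ?mulr_ge0 ?(ltW la0) ?(ltW lb0) //.
move=> hd2 hd1; rewrite ltNge => /negP; apply.
rewrite (le_trans (metric_triangle _ (h t) _)) // ltW //.
by rewrite (lt_le_trans (ltrD hd1 hd2)) // -mulrDl lab mul1r.
Qed.

End AngleTheory.

(* The space of directions at p is the completion of the set of minimal
   geodesics from p, modulo angle 0, for the angle pseudometric. It is realized
   by Kuratowski's embedding: a point xi of the completion is given by the
   function h |-> angle from xi to h, and these functions are exactly the
   uniform limits of the functions angle g; the distance is the uniform one.
   mdist_dir, dir_dense and direction_complete state that this is a completion. *)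
Record direction {R : realType} (X : metricType R) (p : X) := Direction {
  dangle :> geodesic p -> R ;
  dangleP : forall e, 0 < e ->
    exists g, forall h, `|dangle h - angle g h| <= e }.

HB.instance Definition _ {R : realType} (X : metricType R) (p : X) :=
  gen_eqMixin (direction p).
HB.instance Definition _ {R : realType} (X : metricType R) (p : X) :=
  gen_choiceMixin (direction p).

Section DirectionMetric.
Context {R : realType} {X : metricType R} {p : X}.
Implicit Types (xi eta zeta : direction p) (g h : geodesic p).

Definition direction_dist xi eta : R :=
  sup (range (fun h => `|xi h - eta h|)).

Let geo xi : geodesic p := sval (cid (dangleP xi ltr01)).

Let has_sup_dist xi eta : has_sup (range (fun h => `|xi h - eta h|)).
Proof.
split; first by exists (`|xi (geo xi) - eta (geo xi)|); exists (geo xi).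
have [g gP] := dangleP xi ltr01; have [h hP] := dangleP eta ltr01.
exists (1 + pi + 1) => _ [k _ <-].
rewrite (_ : xi k - eta k = (xi k - angle g k) + (angle g k - angle h k)
  + (angle h k - eta k)); last by ring.
rewrite (le_trans (ler_normD _ _)) // lerD ?(distrC (angle h k)) //.
rewrite (le_trans (ler_normD _ _)) // lerD // ler_norml.
have := angle_ge0 g k; have := angle_ge0 h k.
have := angle_le_pi g k; have := angle_le_pi h k.
by move=> *; apply/andP; split; lra.
Qed.

Let dist_ub xi eta h : `|xi h - eta h| <= direction_dist xi eta.
Proof. by apply: ub_le_sup; [exact: (has_sup_dist xi eta).2|exists h]. Qed.

Let dist_lub xi eta r :
  (forall h, `|xi h - eta h| <= r) -> direction_dist xi eta <= r.
Proof.
move=> H; apply: ge_sup; first by have [] := has_sup_dist xi eta.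
by move=> _ [h _ <-].
Qed.

Let direction_distxx xi : direction_dist xi xi = 0.
Proof.
apply/eqP; rewrite eq_le; apply/andP; split.
  by apply: dist_lub => h; rewrite subrr normr0.
exact: le_trans (normr_ge0 _) (dist_ub xi xi (geo xi)).
Qed.

Let direction_dist_eq0 xi eta : direction_dist xi eta = 0 -> xi = eta.
Proof.
move=> H; have : dangle xi = dangle eta.
  apply/funext => h; apply/eqP; rewrite -subr_eq0 -normr_le0 -H.
  exact: dist_ub.
by case: xi eta {H} => [x xP] [y yP] /= E; subst y; congr Direction.
Qed.

Let direction_distC xi eta : direction_dist xi eta = direction_dist eta xi.
Proof.
congr (sup _); apply/seteqP.
by split=> _ [h _ <-]; exists h => //; rewrite distrC.
Qed.

Let direction_dist_triangle eta xi zeta :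
  direction_dist xi zeta <= direction_dist xi eta + direction_dist eta zeta.
Proof.
apply: dist_lub => h; rewrite (le_trans (ler_distD (eta h) _ _)) //.
by rewrite lerD ?dist_ub.
Qed.

HB.instance Definition _ := @isMetric.Build R (direction p) direction_dist
  direction_distxx direction_dist_eq0 direction_distC direction_dist_triangle.

Let dir_subproof g e : 0 < e ->
  exists g', forall h, `|angle g h - angle g' h| <= e.
Proof. by move=> e0; exists g => h; rewrite subrr normr0 ltW. Qed.

Definition dir g : direction p := Direction (dir_subproof g).

Lemma mdist_dirE xi g : mdist xi (dir g) = xi g.
Proof.
suff H eta : direction_dist eta (dir g) = eta g by exact: H.
apply/eqP; rewrite eq_le; apply/andP; split.
  apply: dist_lub => h /=; apply/ler_addgt0Pr => e e0.
  have e20 : 0 < e / 2 by rewrite divr_gt0.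
  have [k kP] := dangleP eta e20.
  have := kP h; have := kP g; rewrite !ler_norml.
  have := angle_triangle g k h; have := angle_triangle k g h.
  have := angle_triangle h k g; rewrite !(angleC g k) (angleC h g).
  by move=> ? ? ? /andP[? ?] /andP[? ?]; apply/andP; split; lra.
by rewrite (le_trans _ (dist_ub eta (dir g) g)) //= anglexx subr0 ler_norm.
Qed.

Lemma mdist_dir g h : mdist (dir g) (dir h) = angle g h.
Proof. by rewrite mdist_dirE. Qed.

Lemma dir_dense xi e : 0 < e -> exists g, mdist xi (dir g) <= e.
Proof.
move=> e0; have [g gP] := dangleP xi e0; exists g.
by rewrite mdist_dirE; have := gP g; rewrite anglexx subr0; exact: le_trans (ler_norm _).
Qed.

Lemma direction_complete : complete_space (direction p).
Proof.
move=> F FF Fc.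
have /choice[c cP] : forall e : R, exists xi : direction p,
    0 < e -> F (ball xi e).
  move=> e; have [e0|e0] := ltP 0 e.
    by have [xi ?] := (cauchyP F).1 Fc e e0; exists xi.
  have [xi _] := @filter_ex _ F FF _ filterT.
  by exists xi.
have cc e e' h : 0 < e -> 0 < e' -> c e h - e <= c e' h + e'.
  move=> e0 e'0.
  have [xi []] := @filter_ex _ F FF _ (filterI (cP _ e0) (cP _ e'0)).
  rewrite !ballEmdist /= => h1 h2.
  have := le_lt_trans (dist_ub (c e) xi h) h1.
  have := le_lt_trans (dist_ub (c e') xi h) h2.
  by rewrite !ltr_norml => /andP[? ?] /andP[? ?]; lra.
pose A h := [set c e h - e | e in [set e : R | 0 < e]].
pose f h := sup (A h).
have A0 h : A h !=set0 by exists (c 1 h - 1); exists 1 => //=.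
have fP e h : 0 < e -> `|f h - c e h| <= e.
  move=> e0; rewrite ler_norml; apply/andP; split.
    rewrite lerBrDl; apply: sup_ubound; last by exists e.
    by exists (c e h + e) => _ [e' e'0 <-]; exact: cc.
  rewrite lerBlDl; apply: ge_sup => // _ [e' e'0 <-]; exact: cc.
have fD e : 0 < e -> exists g, forall h, `|f h - angle g h| <= e.
  move=> e0; have e20 : 0 < e / 2 by rewrite divr_gt0.
  have [g gP] := dangleP (c (e / 2)) e20; exists g => h.
  rewrite (le_trans (ler_distD (c (e / 2) h) _ _)) // [leRHS]splitr.
  by rewrite lerD // fP.
pose xi : direction p := Direction fD.
exists xi; apply/(@metricType_numDomainType.fcvgrPdist_lt R (direction p)) => e e0.
have e20 : 0 < e / 2 by rewrite divr_gt0.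
have := cP _ e20; apply: filterS => eta; rewrite ballEmdist /= => H.
rewrite (le_lt_trans (metric_triangle _ (c (e / 2)) _)) // [ltRHS]splitr.
rewrite ler_ltD //; apply: dist_lub => h; exact: fP.
Qed.

End DirectionMetric.

Section AlexandrovNotions.
Context {R : realType}.

(* A zero-dimensional space of directions never occurs in this recursion, whose
   base case is the boundary of a topological 1-manifold. *)
Fixpoint boundary (n : nat) (X : metricType R) : set X :=
  match n with
  | 0 => set0
  | 1 => [set p : X | exists (U : set X) (f : X -> R) (g : R -> X),
            [/\ open U, U p, homeomorphism U (`[0, 1[ : set R) f g & f p = 0]]
  | n'.+1 => [set p : X | @boundary n' (direction p) !=set0]
  end.
Arguments boundary n X _ : clear implicits.

Definition directions_to (X : metricType R) (p q : X) : set (direction p) :=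
  [set dir g | g in [set g : geodesic p | gend g = q]].
Arguments directions_to {X} p q _.

Definition angle_to_set (X : metricType R) (p : X) (A : set (direction p))
    (xi : direction p) : \bar R :=
  ereal_inf [set (mdist xi eta)%:E | eta in A].

Definition ob_infty_pair (X : metricType R) (p q : X) : \bar R :=
  (limf_esup (fun x : X => ereal_sup
     [set maxe (angle_to_set (directions_to p q) xe.1)
               (angle_to_set (directions_to q p) xe.2)
       | xe in directions_to p x `*` directions_to q x])
     (@at_infinity R X)
   - (pi / 2)%:E)%E.

Definition ob_infty (X : metricType R) : \bar R :=
  limf_einf (fun pq : X * X => ob_infty_pair pq.1 pq.2)
    (filter_from (fun delta : R => 0 < delta)
       (fun delta => [set pq : X * X |
          pq.1 != pq.2 /\ mdist pq.1 pq.2 < delta])).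

Definition opposite (X : metricType R) (p : X) (xi eta : direction p) : Prop :=
  mdist xi eta = pi.

(* For r = 0 the condition is void: a constant geodesic has no direction. *)
Definition one_side_inj (X : metricType R) : \bar R :=
  ereal_sup [set r%:E | r in [set r : R | 0 <= r /\ (0 < r ->
    forall (p : X) (xi : direction p), exists g : geodesic p,
      r <= glen g /\ (dir g = xi \/ opposite xi (dir g)))]].

Definition line (X : metricType R) (l : R -> X) : Prop :=
  forall s t, mdist (l s) (l t) = `|s - t|.

(* The closed half space of R^n where the last coordinate is nonnegative. *)
Definition half_space (n : nat) : set 'rV[R]_n :=
  [set x | forall i : 'I_n, i.+1 = n -> 0 <= x ord0 i].

End AlexandrovNotions.

Arguments boundary {R} n X _.
Arguments half_space {R} n _.
Arguments directions_to {R X} p q _.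

(* Main.v *)
Require Import Defs.
From HB Require Import structures.
From mathcomp Require Import all_boot all_order all_algebra.
From mathcomp Require Import all_classical all_reals all_analysis.
From mathcomp Require Import ring lra.

Set Implicit Arguments.
Unset Strict Implicit.
Unset Printing Implicit Defensive.
Import Order.TTheory GRing.Theory Num.Theory.
Import numFieldNormedType.Exports.
Local Open Scope classical_set_scope.
Local Open Scope ring_scope.

(* Geometry is reduced to the local four-point comparison.  Limits are taken along one ultrafilter, and a
   point of the tangent cone at p is a limit of a sequence of points of M rescaled around p.

   Far points see both ends of a short geodesic under almost opposite directions, so the geodesic extends
   arbitrarily far beyond one of its ends.  In the limit, each direction or its opposite is the direction of
   a ray, whence the first claim.  So a point at which some direction has no opposite is a pole: all
   directions at it are those of rays.  Blowing up around a pole, every geodesic of its space of directions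
   extends, to prescribed lengths, at one end or at the other.  With the suspension structure given by
   opposite directions and induction on the dimension, a space of directions with boundary and with this
   property is a unit half sphere; at a boundary point the exponential map is then a homeomorphism from the
   half space.

   Let gamma be a ray from a pole q.  By the Stewart inequality, applied in both directions, pushing the
   points by h along their rays from q changes small distances near gamma by a factor close to 1.  So the
   tangent cones at two nearby points of gamma are almost isometric, and a space of directions whose cone
   is close to a half space is a half sphere.  Hence a ray from a boundary point that meets the boundary
   again stays in it; the ray from q through p and the ray from p through q form the line. *)

(* With large contexts, lra and nra are slow: use the listed hypotheses only. *)
Tactic Notation "lrao" hyp_list(h) := revert h; clear; intros; lra.
Tactic Notation "nrao" hyp_list(h) := revert h; clear; intros; nra.

(** * Hyperbolic trigonometry and the laws of cosines *)

(** No global comparison theorem is available: comparison is applied inside one small ball at a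
    time, and large-scale information comes from minimality, the triangle inequality and
    nonbranching. Hence the transport along a ray is estimated with reference points at a fixed
    short distance [rho] and spread over the ray by connectedness. A direction need not be that of a
    geodesic. Claims are proved for geodesics up to an error and then closed up, which works once a
    lower bound on the lengths makes the geodesics converge. Volume comparison is replaced by
    packing: too many separated points in one ball could be contracted into every smaller ball, and
    the resulting tree would have positive Hausdorff measure. That boundary points propagate along a
    ray usually rests on stability or parallel transport. Here half spheres are recognized by a
    criterion that survives small distortion: a bound on the size of the set of points at distance
    pi / 2 from all points with an antipode. Their dimension is recovered from almost orthonormal
    frames. *)

Section HyperbolicTrig.
Context {R : realType}.
Implicit Types (x y b c a k e d : R).

(* Sealed copies: unification must not unfold them to differences. *)
Lemma hyp_seal : {f : (R -> R) * (R -> R) | f = (@cosh R, @sinh R)}.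
Proof. by exists (@cosh R, @sinh R). Qed.

Definition ch : R -> R := (sval hyp_seal).1.
Definition sh : R -> R := (sval hyp_seal).2.

Lemma hypE : (ch = @cosh R) * (sh = @sinh R).
Proof. by rewrite /ch /sh (svalP hyp_seal). Qed.

Lemma ch0 : ch 0 = 1 :> R.
Proof. by rewrite !hypE /cosh /sinh oppr0 expR0; field. Qed.

Lemma sh0 : sh 0 = 0 :> R.
Proof. by rewrite !hypE /cosh /sinh oppr0 subrr mul0r. Qed.

Lemma chN x : ch (- x) = ch x.
Proof. by rewrite !hypE /cosh /sinh opprK addrC. Qed.

Lemma shN x : sh (- x) = - sh x.
Proof. by rewrite !hypE /cosh /sinh opprK -mulNr opprB. Qed.

Lemma ch_abs x : ch `|x| = ch x.
Proof. by case: (ler0P x) => // _; rewrite chN. Qed.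

Lemma chD x y : ch (x + y) = ch x * ch y + sh x * sh y.
Proof. by rewrite !hypE /cosh /sinh opprD !expRD; field. Qed.

Lemma shD x y : sh (x + y) = sh x * ch y + ch x * sh y.
Proof. by rewrite !hypE /cosh /sinh opprD !expRD; field. Qed.

Lemma chB x y : ch (x - y) = ch x * ch y - sh x * sh y.
Proof. by rewrite chD chN shN mulrN. Qed.

Lemma shB x y : sh (x - y) = sh x * ch y - ch x * sh y.
Proof. by rewrite shD chN shN mulrN. Qed.

Lemma ch2Bsh2 x : ch x ^+ 2 - sh x ^+ 2 = 1.
Proof. by have := chB x x; rewrite subrr ch0 !expr2 => <-. Qed.

Lemma is_derive_ch x : is_derive x 1 ch (sh x).
Proof.
rewrite !hypE /sinh; have -> : @cosh R = (fun x => 2^-1 * (expR x + expR (- x))).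
  by apply/funext => y; rewrite /cosh mulrC.
by apply: is_derive_eq; rewrite /GRing.scale /=; field.
Qed.

Lemma is_derive_sh x : is_derive x 1 sh (ch x).
Proof.
rewrite !hypE /cosh; have -> : @sinh R = (fun x => 2^-1 * (expR x - expR (- x))).
  by apply/funext => y; rewrite /sinh mulrC.
by apply: is_derive_eq; rewrite /GRing.scale /=; field.
Qed.

Lemma derive_continuous (f df : R -> R) :
  (forall x, is_derive x 1 f (df x)) -> continuous f.
Proof.
move=> H x; apply: differentiable_continuous; apply/derivable1_diffP.
by have [] := H x.
Qed.

Lemma continuous_ch : continuous ch.
Proof. exact: derive_continuous is_derive_ch. Qed.

Lemma MVTd (f df : R -> R) a b : (forall x, is_derive x 1 f (df x)) -> a < b ->
  exists2 c, a < c < b & f b - f a = df c * (b - a).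
Proof.
move=> H ab; have [|c + E] := MVT ab (fun x _ => H x).
  by apply: continuous_subspaceT; exact: derive_continuous H.
by rewrite in_itv /=; exists c.
Qed.

Lemma ch_ge1 x : 1 <= ch x.
Proof.
have E : ch x = ch (x/2) ^+2 + sh (x/2) ^+2.
  by rewrite {1}(splitr x) chD -!expr2.
by have := ch2Bsh2 (x/2); have := sqr_ge0 (sh (x/2)); rewrite E; lra.
Qed.

Lemma ch_gt0 x : 0 < ch x.
Proof. exact: lt_le_trans (ch_ge1 x). Qed.

Lemma sh_ltr : {mono sh : x y / x < y}.
Proof.
apply: leW_mono; apply: le_mono => x y xy.
have [c _ E] := MVTd is_derive_sh xy.
by rewrite -subr_gt0 E mulr_gt0 ?ch_gt0 // subr_gt0.
Qed.

Lemma sh_ler : {mono sh : x y / x <= y}.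
Proof. by move=> x y; rewrite !leNgt sh_ltr. Qed.

Lemma sh_gt0 x : 0 < x -> 0 < sh x.
Proof. by move=> x0; rewrite -sh0 sh_ltr. Qed.

Lemma sh_ge0 x : 0 <= x -> 0 <= sh x.
Proof. by move=> x0; rewrite -sh0 sh_ler. Qed.

Lemma ch_ltr x y : 0 <= x -> 0 <= y -> (ch x < ch y) = (x < y).
Proof.
move=> x0 y0; suff H (u v : R) : 0 <= u -> u < v -> ch u < ch v.
  have [xy|yx|->] := ltrgtP x y; last by rewrite ltxx.
    by rewrite H.
  by apply/negbTE; rewrite -leNgt ltW // H.
move=> u0 uv; have [c /andP[uc _] E] := MVTd is_derive_ch uv.
by rewrite -subr_gt0 E mulr_gt0 ?subr_gt0 // sh_gt0 // (le_lt_trans u0).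
Qed.

Lemma ch_ler x y : 0 <= x -> 0 <= y -> (ch x <= ch y) = (x <= y).
Proof. by move=> *; rewrite !leNgt ch_ltr. Qed.

Lemma sh_ge x : 0 <= x -> x <= sh x.
Proof.
rewrite le_eqVlt => /orP[/eqP <-|x0]; first by rewrite sh0.
have [c _] := MVTd is_derive_sh x0; rewrite sh0 !subr0 => ->.
by rewrite ler_peMl ?ch_ge1 // ltW.
Qed.

Lemma sh_le x y : 0 <= x <= y -> sh x <= x * ch y.
Proof.
move=> /andP[]; rewrite le_eqVlt => /orP[/eqP <- _|x0 xy].
  by rewrite sh0 mul0r.
have [c /andP[c0 cx]] := MVTd is_derive_sh x0; rewrite sh0 !subr0 => ->.
by rewrite mulrC ler_pM2l // ch_ler; lra.
Qed.

Lemma ch_ge x : x ^+ 2 / 2 <= ch x - 1.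
Proof.
wlog x0 : x / 0 <= x => [H|].
  have [/H //|/ltW x0] := leP 0 x.
  by have := H (- x); rewrite oppr_ge0 sqrrN chN; apply.
have -> : ch x - 1 = 2 * sh (x / 2) ^+ 2.
  by rewrite {1}(splitr x) chD; have := ch2Bsh2 (x/2); lra.
have := @sh_ge (x/2); have : 0 <= x / 2 by lra.
by move=> h /(_ h) ?; nra.
Qed.

Lemma ch_le x y : 0 <= x <= y -> ch x - 1 <= x ^+ 2 / 2 * ch y ^+ 2.
Proof.
move=> /andP[x0 xy].
have -> : ch x - 1 = 2 * sh (x / 2) ^+ 2.
  by rewrite {1}(splitr x) chD; have := ch2Bsh2 (x/2); lra.
have := @sh_le (x/2) y; have h : 0 <= x / 2 <= y by apply/andP; split; lra.
have := @sh_ge0 (x/2); have := ch_gt0 y.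
have h2 : 0 <= x / 2 by lra.
move=> ? /(_ h2) ? /(_ h) ?.
have -> : x ^+ 2 / 2 * ch y ^+ 2 = 2 * (x / 2 * ch y) ^+ 2 by field.
by rewrite ler_pM2l // ler_sqr ?nnegrE // mulr_ge0 // ltW.
Qed.

(* [F \o sqrt] is convex when F' is convex on the half line and vanishes at 0:
   this compares the laws of cosines of the three model planes. *)
Lemma sqrt_chord (F f h : R -> R) B l a m :
  (forall x, is_derive x 1 F (f x)) -> (forall x, is_derive x 1 f (h x)) ->
  f 0 = 0 -> (forall x y, 0 <= x -> x <= y -> y <= B -> h x <= h y) ->
  0 <= l -> l <= a -> a <= m -> m <= B ->
  (F a - F l) * (m ^+ 2 - l ^+ 2) <= (F m - F l) * (a ^+ 2 - l ^+ 2).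
Proof.
move=> dF df f0 hh l0; rewrite le_eqVlt => /orP[/eqP <-|la].
  by rewrite !subrr mul0r mulr0.
rewrite le_eqVlt => /orP[/eqP <-//|am] mB.
(* [f c / c] is twice the derivative of [F \o sqrt] at [c ^+ 2]. It is nondecreasing because [f]
   vanishes at 0 and has a nondecreasing derivative. Cauchy's mean value theorem against the square,
   next, avoids differentiating sqrt at 0. *)
have ratio c1 c2 : 0 < c1 -> c1 < c2 -> c2 <= B -> f c1 / c1 <= f c2 / c2.
  move=> c10 c12 c2B.
  have [d1 /andP[d10 d11]] := MVTd df c10; rewrite f0 !subr0 => E1.
  have [d2 /andP[d20 d21] E2] := MVTd df c12.
  have hd : h d1 <= h d2 by apply: hh; lra.
  rewrite ler_pdivrMr // mulrAC ler_pdivlMr; last by lra.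
  have -> : f c2 = h d1 * c1 + h d2 * (c2 - c1) by rewrite -E1 -E2; ring.
  rewrite E1; have := mulr_ge0 (ltW c10) (_ : 0 <= c2 - c1).
  by rewrite subr_ge0 ltW // => /(_ isT) ?; nra.
have cau u v : 0 <= u -> u < v -> exists2 c, u < c < v &
    F v - F u = f c / c / 2 * (v ^+ 2 - u ^+ 2).
  move=> u0 uv.
  have dg x : is_derive x 1 (fun x : R => x ^+ 2) (2 * x).
    by apply: is_derive_eq; rewrite /GRing.scale /=; ring.
  have cf : {within `[u, v], continuous F}.
    by apply: continuous_subspaceT; exact: derive_continuous dF.
  have cg : {within `[u, v], continuous (fun x : R => x ^+ 2)}.
    by apply: continuous_subspaceT; exact: derive_continuous dg.
  have nz x : x \in `]u, v[ -> 2 * x != 0.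
    by rewrite in_itv /= => /andP[ux _]; rewrite mulf_neq0 // gt_eqF // (le_lt_trans u0).
  have [c] := cauchy_MVT uv cf cg (fun x _ => dF x) (fun x _ => dg x) nz.
  rewrite in_itv /= => cuv E; exists c => //.
  have c0 : c != 0 by rewrite gt_eqF // (le_lt_trans u0) //; case/andP: cuv.
  have vu : v ^+ 2 - u ^+ 2 != 0.
    by rewrite subr_eq0 gt_eqF // ltr_pXn2r ?nnegrE // ltW // (le_lt_trans u0).
  have -> : f c / c / 2 = f c / (2 * c) by field.
  by rewrite E divfK.
have [c1 /andP[c1l c1a] E1] := cau _ _ l0 la.
have [c2 /andP[c2a c2m] E2] := cau _ _ (ltW (le_lt_trans l0 la)) am.
have r12 : f c1 / c1 <= f c2 / c2 by apply: ratio; lra.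
have -> : F m - F l = (F m - F a) + (F a - F l) by ring.
rewrite E1 E2; set r1 := f c1 / c1 in r12 *; set r2 := f c2 / c2 in r12 *.
have p1 : 0 <= a ^+ 2 - l ^+ 2 by nra.
have p2 : 0 <= m ^+ 2 - a ^+ 2 by nra.
have := mulr_ge0 (mulr_ge0 p1 p2) (_ : 0 <= r2 - r1).
by rewrite subr_ge0 => /(_ r12) ?; nra.
Qed.

(** Cosine of the angle opposite to [a] in the Euclidean plane; [cH] below is that of the plane of
    curvature [- k ^+ 2]. Leaving acos out makes comparisons algebraic. *)
Definition cE b c a : R := (b ^+ 2 + c ^+ 2 - a ^+ 2) / (2 * b * c).
Definition cH k b c a : R :=
  (ch (k * b) * ch (k * c) - ch (k * a)) / (sh (k * b) * sh (k * c)).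
Definition tri b c a : Prop := `|b - c| <= a /\ a <= b + c.

Lemma triP b c a : tri b c a <-> [/\ b <= c + a, c <= b + a & a <= b + c].
Proof.
rewrite /tri ler_norml; split; first by move=> [/andP[? ?] ?]; split; lra.
by move=> [? ? ?]; split => //; apply/andP; split; lra.
Qed.

Lemma tri_scale k b c a : 0 <= k -> tri b c a -> tri (k * b) (k * c) (k * a).
Proof. by move=> k0 /triP[? ? ?]; apply/triP; split; rewrite -mulrDr ler_wpM2l. Qed.

Lemma cE_scale k b c a : k != 0 -> cE (k * b) (k * c) (k * a) = cE b c a.
Proof.
move=> k0; rewrite /cE !exprMn -mulrDr -mulrBr.
have -> : 2 * (k * b) * (k * c) = k ^+ 2 * (2 * b * c) by ring.
by rewrite -mulf_div divff ?mul1r // expf_neq0.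
Qed.

Lemma cH_scale k b c a : cH k b c a = cH 1 (k * b) (k * c) (k * a).
Proof. by rewrite /cH !mul1r. Qed.

Lemma cE_itv b c a : 0 < b -> 0 < c -> tri b c a -> -1 <= cE b c a <= 1.
Proof.
move=> b0 c0 /triP[h1 h2 h3]; have bc : 0 < 2 * b * c by rewrite !mulr_gt0.
by rewrite /cE ler_pdivlMr // ler_pdivrMr //; apply/andP; split; nra.
Qed.

Lemma cH_itv k b c a : 0 < k -> 0 < b -> 0 < c -> tri b c a ->
  -1 <= cH k b c a <= 1.
Proof.
move=> k0 b0 c0 /(tri_scale (ltW k0)) /triP[h1 h2 h3].
have sb := sh_gt0 (mulr_gt0 k0 b0); have sc := sh_gt0 (mulr_gt0 k0 c0).
have kb := mulr_gt0 k0 b0; have kc := mulr_gt0 k0 c0.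
have ss : 0 < sh (k * b) * sh (k * c) by rewrite mulr_gt0.
apply/andP; split; rewrite /cH; [rewrite ler_pdivlMr //|rewrite ler_pdivrMr //].
  have : ch (k * a) <= ch (k * b + k * c) by rewrite ch_ler //; lra.
  by rewrite chD; lra.
have : ch `|k * b - k * c| <= ch (k * a).
  by rewrite ch_ler //; [rewrite ler_norml; apply/andP; split; lra|lra].
by rewrite ch_abs chB; lra.
Qed.

(** At the extreme values [|b - c|] and [b + c] of [a] both cosines are 1 and -1. In between, the
    Euclidean one is affine in [a ^+ 2] and the hyperbolic one affine in [ch a], so that
    [sqrt_chord] for [ch] compares them. *)
Lemma cE_le_cH k b c a : 0 < k -> 0 < b -> 0 < c -> tri b c a ->
  cE b c a <= cH k b c a.
Proof.
move=> k0 b0 c0 t; rewrite -(@cE_scale k) ?gt_eqF // cH_scale /cH !mul1r.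
have := tri_scale (ltW k0) t; have := mulr_gt0 k0 b0; have := mulr_gt0 k0 c0.
move: (k * b) (k * c) (k * a) => {b0 c0 t}b {}c {}a c0 b0 [t1 t2].
have sb := sh_gt0 b0; have sc := sh_gt0 c0.
rewrite ler_pdivlMr ?mulr_gt0 //.
have hm (x y : R) : 0 <= x -> x <= y -> y <= b + c -> ch x <= ch y.
  by move=> x0 xy _; rewrite ch_ler //; lra.
have := sqrt_chord is_derive_ch is_derive_sh sh0 hm
  (normr_ge0 (b - c)) t1 t2 (lexx _).
rewrite ch_abs real_normK ?num_real // chB chD.
have -> : a ^+ 2 - (b - c) ^+ 2 = 2 * b * c * (1 - cE b c a).
  by rewrite /cE; field; rewrite !gt_eqF.
have -> : (b + c) ^+ 2 - (b - c) ^+ 2 = 2 * b * c * 2 by ring.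
have w0 : 0 < 2 * b * c by rewrite !mulr_gt0.
rewrite (mulrA _ (2 * b * c)) (mulrA _ (2 * b * c)) !(mulrAC _ (2 * b * c)).
by rewrite ler_pM2r // => ?; lra.
Qed.

Definition cS b c a : R := (cos a - cos b * cos c) / (sin b * sin c).

(** The chord inequality again, for cos: its second derivative [- cos] is nondecreasing up to pi,
    which [b + c] does not reach. *)
Lemma cS_le_cE b c a : 0 < b -> 0 < c -> b + c < pi -> tri b c a ->
  cS b c a <= cE b c a.
Proof.
move=> b0 c0 bc [t1 t2]; have sb : 0 < sin b by apply: sin_gt0_pi; lra.
have sc : 0 < sin c by apply: sin_gt0_pi; lra.
rewrite ler_pdivrMr ?mulr_gt0 //.
have dcos (x : R) : is_derive x 1 (@cos R) (- sin x) by exact: is_derive_cos.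
have dsin (x : R) : is_derive x 1 (fun x => - sin x : R) (- cos x).
  by apply: is_derive_eq.
have s0 : - sin 0 = 0 :> R by rewrite sin0 oppr0.
have hm (x y : R) : 0 <= x -> x <= y -> y <= b + c -> - cos x <= - cos y.
  move=> x0 xy ybc; rewrite lerN2 leNgt ltr_cos ?in_itv /= -?leNgt //.
    by apply/andP; split; lra.
  by apply/andP; split; lra.
have := sqrt_chord dcos dsin s0 hm (normr_ge0 (b - c)) t1 t2 (lexx _).
have -> : cos `|b - c| = cos (b - c).
  by case: (ler0P (b - c)) => // _; rewrite cosN.
rewrite real_normK ?num_real // cosB cosD.
have -> : a ^+ 2 - (b - c) ^+ 2 = 2 * b * c * (1 - cE b c a).
  by rewrite /cE; field; rewrite !gt_eqF.
have -> : (b + c) ^+ 2 - (b - c) ^+ 2 = 2 * b * c * 2 by ring.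
have w0 : 0 < 2 * b * c by rewrite !mulr_gt0.
rewrite (mulrA _ (2 * b * c)) (mulrA _ (2 * b * c)) !(mulrAC _ (2 * b * c)).
by rewrite ler_pM2r // => ?; lra.
Qed.

Lemma ch_near (e : R) : 0 < e ->
  exists2 d, 0 < d & forall x, 0 <= x < d -> ch x < 1 + e.
Proof.
move=> e0; have /cvgr_dist_lt /(_ e e0) := @continuous_ch 0.
rewrite ch0 => -[d /= d0 H]; exists d => // x /andP[x0 xd].
have := H x; rewrite /= sub0r normrN ger0_norm // => /(_ xd).
by rewrite distrC ger0_norm ?subr_ge0 ?ch_ge1 //; lra.
Qed.

(** With [X] and [Y] the half sums [(b + c + a) / 2] and [(b + c - a) / 2], 1 plus the cosine is
    twice [sh X sh Y / (sh b sh c)]. In this product form the bounds [t <= sh t <= t ch t] control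
    relative errors, uniformly over all shapes of triangles, degenerate ones included. *)
Lemma cH_near_cE k e : 0 < k -> 0 < e -> exists2 d, 0 < d &
  forall b c a, 0 < b < d -> 0 < c < d -> tri b c a ->
    `|cH k b c a - cE b c a| <= e.
Proof.
move=> k0 e0; have e160 : 0 < Num.min (e / 16) 1 by rewrite lt_min divr_gt0 //=.
have [d d0 Hd] := ch_near e160.
exists (d / k / 2); first by rewrite !divr_gt0.
move=> b c a /andP[b0 bd] /andP[c0 cd] t.
rewrite -(@cE_scale k) ?gt_eqF // cH_scale /cH !mul1r.
have := tri_scale (ltW k0) t; have := mulr_gt0 k0 b0; have := mulr_gt0 k0 c0.
have : k * b < d / 2 by rewrite mulrC -ltr_pdivlMr // mulrAC.
have : k * c < d / 2 by rewrite mulrC -ltr_pdivlMr // mulrAC.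
move: (k * b) (k * c) (k * a) => {b0 c0 bd cd t}b {}c {}a cd bd c0 b0 /triP[t1 t2 t3].
have sb := sh_gt0 b0; have sc := sh_gt0 c0.
pose X := (b + c + a) / 2; pose Y := (b + c - a) / 2.
have X0 : 0 <= X by rewrite /X; lra.
have Y0 : 0 <= Y by rewrite /Y; lra.
have Xd : X <= b + c by rewrite /X; lra.
have Yd : Y <= b + c by rewrite /Y; lra.
set q := ch (b + c).
have q1 : 1 <= q by exact: ch_ge1.
have qe : q < 1 + Num.min (e / 16) 1 by apply: Hd; apply/andP; split; lra.
have sXl := sh_ge X0; have sYl := sh_ge Y0.
have sXu : sh X <= X * q by apply: sh_le; rewrite X0.
have sYu : sh Y <= Y * q by apply: sh_le; rewrite Y0.
have sbl := sh_ge (ltW b0); have scl := sh_ge (ltW c0).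
have sbu : sh b <= b * q by apply: sh_le; apply/andP; split; lra.
have scu : sh c <= c * q by apply: sh_le; apply/andP; split; lra.
have E1 : ch b * ch c - ch a = 2 * (sh X * sh Y) - sh b * sh c.
  have -> : a = X - Y by rewrite /X /Y; field.
  have : b + c = X + Y by rewrite /X /Y; field.
  by move=> /(congr1 ch); rewrite !chD chN shN => ?; lra.
have E2 : b ^+ 2 + c ^+ 2 - a ^+ 2 = 2 * (2 * (X * Y) - b * c) by rewrite /X /Y; field.
have cEE : cE b c a = 2 * (X * Y) / (b * c) - 1.
  by rewrite /cE E2; field; rewrite !gt_eqF.
have cEi : 0 <= 2 * (X * Y) / (b * c) <= 2.
  have tr : tri b c a by apply/triP.
  by have := cE_itv b0 c0 tr; rewrite cEE => /andP[? ?]; apply/andP; split; lra.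
move: cEi; set u := 2 * (X * Y) / (b * c) => /andP[u0 u2].
set v := 2 * (sh X * sh Y) / (sh b * sh c).
rewrite cEE E1 (_ : _ - (u - 1) = v - u); last first.
  by rewrite /v /u; field; rewrite !gt_eqF.
have sXY : sh X * sh Y <= X * Y * q ^+ 2.
  have -> : X * Y * q ^+ 2 = (X * q) * (Y * q) by ring.
  by rewrite ler_pM ?sh_ge0.
have vu : v <= u * q ^+ 2.
  rewrite /v ler_pdivrMr ?mulr_gt0 //.
  have -> : u * q ^+ 2 * (sh b * sh c) = 2 * (X * Y * q ^+ 2) * ((sh b * sh c) / (b * c)).
    by rewrite /u; field; rewrite !gt_eqF.
  rewrite (le_trans (_ : _ <= 2 * (X * Y * q ^+ 2))) ?ler_pM2l //.
  have B1 : 1 <= sh b * sh c / (b * c).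
    rewrite ler_pdivlMr ?mul1r; last exact: mulr_gt0.
    by rewrite ler_pM // ltW.
  have A0 : 0 <= 2 * (X * Y * q ^+ 2) by rewrite mulr_ge0 // mulr_ge0 ?sqr_ge0 // mulr_ge0.
  by rewrite ler_peMr.
have uv : u <= v * q ^+ 2.
  have -> : u = 2 * (X * Y) * ((sh b * sh c) / (b * c)) / (sh b * sh c).
    by rewrite /u; field; rewrite !gt_eqF.
  have ss : 0 < sh b * sh c by exact: mulr_gt0.
  have bc : 0 < b * c by exact: mulr_gt0.
  rewrite /v [leRHS]mulrAC ler_pM2r ?invr_gt0 //.
  have h1 : 2 * (X * Y) <= 2 * (sh X * sh Y) by rewrite ler_pM2l // ler_pM.
  have h0 : 0 <= 2 * (X * Y) by rewrite mulr_ge0 // mulr_ge0.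
  rewrite ler_pM // ?(divr_ge0 (ltW ss) (ltW bc)) // ler_pdivrMr //.
  have -> : q ^+ 2 * (b * c) = (b * q) * (c * q) by ring.
  by rewrite ler_pM ?sh_ge0 // ltW.
have v0 : 0 <= v by rewrite divr_ge0 ?mulr_ge0 ?sh_ge0 // ltW.
have [q2 qe16] : q < 2 /\ q < 1 + e / 16.
  by move: qe; rewrite -ltrBlDl lt_min => /andP[? ?]; split; lra.
rewrite ler_norml; clear - u0 u2 vu uv v0 q1 q2 qe16 e0; clearbody u v q.
have v8 : v <= 8 by nra.
have qq : q ^+ 2 - 1 <= e / 16 * 3 by nra.
by apply/andP; split; nra.
Qed.

End HyperbolicTrig.

Section Acos.
Context {R : realType}.
Implicit Types (x y e d t : R).

Lemma cos_lip x y : `|cos x - cos y| <= `|x - y|.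
Proof.
wlog xy : x y / x < y => [H|].
  have [xy|yx|->] := ltgtP x y; [exact: H| |by rewrite !subrr normr0].
  by rewrite distrC (distrC x) H.
have [c _ E] := MVTd (fun x => is_derive_cos x) xy.
rewrite distrC (distrC x) E normrM ler_piMl // normrN.
by rewrite ler_norml sin_geN1 sin_le1.
Qed.

Lemma cos_ler x y : 0 <= x -> x <= y -> y <= pi -> cos y <= cos x.
Proof.
move=> x0 xy yp; rewrite leNgt ltr_cos ?in_itv /= -?leNgt //.
  by apply/andP; split; lra.
by apply/andP; split; lra.
Qed.

Lemma cos_ltr x y : 0 <= x -> x < y -> y <= pi -> cos y < cos x.
Proof.
move=> x0 xy yp; rewrite ltr_cos ?in_itv /= //.
  by apply/andP; split; lra.
by apply/andP; split; lra.
Qed.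

Lemma acos_itv x : -1 <= x <= 1 -> 0 <= acos x <= pi.
Proof. by move=> h; rewrite acos_ge0 // acos_lepi. Qed.

Lemma acosK' x : -1 <= x <= 1 -> cos (acos x) = x.
Proof. by move=> h; rewrite acosK // in_itv. Qed.

Lemma cosK' x : 0 <= x <= pi -> acos (cos x) = x.
Proof. by move=> h; rewrite cosK // in_itv. Qed.

Lemma acos_ler x y : -1 <= x -> x <= y -> y <= 1 -> acos y <= acos x.
Proof.
move=> h1 h2 h3; have hx : -1 <= x <= 1 by apply/andP; split; lra.
have hy : -1 <= y <= 1 by apply/andP; split; lra.
rewrite leNgt; apply/negP => H.
have /andP[x0 xp] := acos_itv hx; have /andP[y0 yp] := acos_itv hy.
by have := cos_ltr x0 H yp; rewrite !acosK' //; lra.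
Qed.

Lemma acos_cont x e : -1 <= x <= 1 -> 0 < e -> exists2 d, 0 < d &
  forall y, -1 <= y <= 1 -> `|x - y| < d -> `|acos x - acos y| < e.
Proof.
move=> hx e0; have /andP[t0 tp] := acos_itv hx; set t := acos x in t0 tp *.
have ct : cos t = x by rewrite acosK'.
have [d1 d10 H1] : exists2 d, 0 < d & forall y, -1 <= y <= 1 -> `|x - y| < d ->
    acos y < t + e.
  have [tpi|tpi] := ltP pi (t + e).
    by exists 1 => // y /acos_itv/andP[_ ?] _; lra.
  exists (cos t - cos (t + e)); first by rewrite subr_gt0 cos_ltr //; lra.
  move=> y hy; rewrite ct ltr_norml => /andP[_ xy].
  rewrite ltNge; apply/negP => H; have /andP[y0 yp] := acos_itv hy.
  have := cos_ler (_ : 0 <= t + e) H yp; rewrite acosK' // => h.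
  by have := h ltac:(lra); lra.
have [d2 d20 H2] : exists2 d, 0 < d & forall y, -1 <= y <= 1 -> `|x - y| < d ->
    t - e < acos y.
  have [tpi|tpi] := ltP (t - e) 0.
    by exists 1 => // y /acos_itv/andP[? _] _; lra.
  exists (cos (t - e) - cos t); first by rewrite subr_gt0 cos_ltr //; lra.
  move=> y hy; rewrite ct ltr_norml => /andP[xy _].
  rewrite ltNge; apply/negP => H; have /andP[y0 yp] := acos_itv hy.
  have := cos_ler y0 H (_ : t - e <= pi); rewrite acosK' // => h.
  by have := h ltac:(lra); lra.
exists (Num.min d1 d2); first by rewrite lt_min d10.
move=> y hy; rewrite lt_min => /andP[/(H1 _ hy) ? /(H2 _ hy) ?].
by rewrite ltr_norml; apply/andP; split; lra.
Qed.

Lemma acos_sum_le_pi x y : -1 <= x <= 1 -> -1 <= y <= 1 ->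
  (acos x + acos y <= pi) = (0 <= x + y).
Proof.
move=> hx hy; have -> : (0 <= x + y) = (- x <= y) by rewrite -lerBlDl sub0r.
have hNx : -1 <= - x <= 1 by apply/andP; split; lra.
rewrite -lerBrDl -acosN //; apply/idP/idP => H.
  have /andP[a0 ap] := acos_itv hNx; have /andP[b0 bp] := acos_itv hy.
  by have := cos_ler b0 H ap; rewrite !acosK'.
by apply: acos_ler => //; lra.
Qed.

(* A defect [n] in "the first angle is pi" costs at most [n] on the sum of the
   cosines of the two others. *)
Lemma cos_sum_defect x y n : 0 <= x -> 0 <= y <= pi -> 0 <= n ->
  x + y <= pi + n -> - n <= cos x + cos y.
Proof.
move=> x0 /andP[y0 yp] n0 H; have c1 := cos_le1 x; have cN := cos_geN1 y.
have [xn|xn] := leP x n.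
  have := cos_lip x 0; rewrite cos0 subr0 (ger0_norm x0) ler_norml => /andP[? _].
  lra.
have yp2 : y <= pi - (x - n) by lra.
have : cos (pi - (x - n)) <= cos y by apply: cos_ler => //; lra.
rewrite cosB cospi sinpi; have := cos_lip (x - n) x.
by rewrite ler_norml [X in `|X|](_ : _ = - n); [rewrite normrN ger0_norm // => /andP[? ?]; lra|lra].
Qed.

Lemma limf_esup_corner (f : R -> R -> R) t :
  (forall e, 0 < e -> exists2 d, 0 < d &
     forall u v, 0 < u < d -> 0 < v < d -> `|f u v - t| <= e) ->
  fine (limf_esup (fun uv : R * R => (f uv.1 uv.2)%:E)
    (filter_prod 0^'+ 0^'+)) = t.
Proof.
move=> H; suff -> : limf_esup (fun uv : R * R => (f uv.1 uv.2)%:E)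
    (filter_prod 0^'+ 0^'+) = t%:E by [].
have cn e : 0 < e -> filter_prod (0 : R)^'+ (0 : R)^'+
    [set uv : R * R | 0 < uv.1 < e /\ 0 < uv.2 < e].
  move=> e0; have Hr : (0 : R)^'+ `]0, e[%classic.
    exists e => //= x /=; rewrite sub0r normrN in_itv /= => xe x0.
    by rewrite x0 -[x]gtr0_norm.
  by exists (`]0, e[%classic, `]0, e[%classic).
have FF : ProperFilter (filter_prod (0 : R)^'+ (0 : R)^'+) by apply: filter_prod_proper.
apply/eqP; rewrite eq_le; apply/andP; split.
  apply/lee_addgt0Pr => e e0; have [d d0 Hd] := H e e0.
  apply: ge_ereal_inf; exists (ereal_sup ((fun uv : R * R => (f uv.1 uv.2)%:E) @`
    [set uv : R * R | 0 < uv.1 < d /\ 0 < uv.2 < d])).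
    by eexists; [exact: cn d0|].
  apply: ge_ereal_sup => _ [[u v] /= [ud vd] <-]; rewrite -EFinD lee_fin.
  by have := Hd _ _ ud vd; rewrite ler_norml => /andP[_ ?]; lra.
apply: le_ereal_inf_tmp => _ [V FV <-].
apply/lee_addgt0Pr => e e0; have [d d0 Hd] := H e e0.
have [[u v] [/= [ud vd] Vuv]] := filter_ex (filterI (cn _ d0) FV).
rewrite -leeBlDr // -EFinB; apply: le_ereal_sup_tmp; exists (f u v)%:E.
  by exists (u, v).
by rewrite lee_fin; have := Hd _ _ ud vd; rewrite ler_norml => /andP[? _]; lra.
Qed.

End Acos.

(** * Four-point comparison *)

Section FourPoints.
Context {R : realType}.

Definition fourpt (X : metricType R) (k : R) (p : X) (r : R) : Prop :=
  forall a b c e : X, mdist p a < r -> mdist p b < r -> mdist p c < r ->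
    mdist p e < r -> uniq [:: a; b; c; e] ->
    acos (cH k (mdist a b) (mdist a c) (mdist b c))
    + acos (cH k (mdist a c) (mdist a e) (mdist c e))
    + acos (cH k (mdist a e) (mdist a b) (mdist e b)) <= 2 * pi.

(** The local curvature bound [- k ^+ 2], always strictly negative: a bound 0 is weakened to -1, so
    that the hyperbolic law of cosines covers all cases. *)
Definition curv4 (X : metricType R) : Prop :=
  exists2 k : R, 0 < k & forall p : X, exists2 r : R, 0 < r & fourpt k p r.

Lemma tri_mdist (X : metricType R) (a b c : X) :
  tri (mdist a b) (mdist a c) (mdist b c).
Proof.
apply/triP; split.
- by rewrite (metric_sym b c) metric_triangle.
- exact: metric_triangle.
- by rewrite (metric_sym a b) metric_triangle.
Qed.

Lemma mdist0_eq (X : metricType R) (a b : X) : mdist a b = 0 -> a = b.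
Proof. exact: mdist_positivity. Qed.

Section Local.
Context {X : metricType R} {k : R} {p : X} {r : R}.
Hypotheses (k0 : 0 < k) (F : fourpt k p r).
Implicit Types (a b x y : X) (s t n : R).

(** Stewart's inequality for a point [x] that is only almost between [a] and [b], as needed before
    geodesics are known to exist. Since the angle at [x] between [a] and [b] is within [n] of pi,
    the four-point condition leaves at most [pi + n] for the other two; then [cos_sum_defect]
    applies, and the denominators are cleared. *)
Lemma stewart_defect a b x y n : mdist p a < r -> mdist p b < r ->
  mdist p x < r -> mdist p y < r -> 0 <= n -> a != b ->
  (x != a -> x != b ->
    pi - acos (cH k (mdist x a) (mdist x b) (mdist a b)) <= n) ->
  ch (k * mdist y a) * sh (k * mdist x b) + ch (k * mdist y b) * sh (k * mdist x a)
  - n * (sh (k * mdist x y) * sh (k * mdist x a) * sh (k * mdist x b))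
  <= ch (k * mdist x y) * sh (k * mdist x a + k * mdist x b).
Proof.
move=> pa pb px py n0 ab H.
have [E|xa] := eqVneq x a.
  by rewrite E mdistxx !mulr0 !sh0 !(mulr0, mul0r) subr0 addr0 add0r (metric_sym y).
have [E|xb] := eqVneq x b.
  by rewrite E mdistxx !mulr0 !sh0 !(mulr0, mul0r) subr0 addr0 add0r (metric_sym y).
have h := H xa xb; rewrite shD.
have kd (u v : X) : u != v -> 0 < k * mdist u v by move=> uv; rewrite mulr_gt0 // mdist_gt0.
have A0 := sh_gt0 (kd _ _ xa); have B0 := sh_gt0 (kd _ _ xb).
have kn u v : 0 <= k * mdist u v by rewrite mulr_ge0 ?mdist_ge0 // ltW.
have [<-|yx] := eqVneq x y.
  by rewrite mdistxx mulr0 sh0 ch0 !mul0r mulr0 subr0 mul1r; lra.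
have D0 := sh_gt0 (kd _ _ yx).
have tr : ch (k * mdist a b) <= ch (k * mdist x a) * ch (k * mdist x b)
    + sh (k * mdist x a) * sh (k * mdist x b).
  rewrite -chD ch_ler //; last by rewrite addr_ge0.
  by rewrite -mulrDr ler_pM2l // (metric_sym x a) metric_triangle.
have ca : ch (k * mdist x a) ^+ 2 - sh (k * mdist x a) ^+ 2 = 1 by exact: ch2Bsh2.
have cb : ch (k * mdist x b) ^+ 2 - sh (k * mdist x b) ^+ 2 = 1 by exact: ch2Bsh2.
(* The four-point condition needs four distinct points; when [y] is one of the ends, the triangle
   inequality [tr] is enough. *)
have [E|ya] := eqVneq y a.
  rewrite E in D0 *; rewrite mdistxx mulr0 ch0.
  have : 0 <= n * (sh (k * mdist x a) * sh (k * mdist x a) * sh (k * mdist x b)).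
    by rewrite !mulr_ge0 // ltW.
  move: tr ca A0 B0; clear; move: (ch _) (sh _) (ch _) (sh _) (ch _) => ab a' sa b' sb.
  by nra.
have [E|yb] := eqVneq y b.
  rewrite E in D0 *; rewrite mdistxx mulr0 ch0 (metric_sym b a).
  have : 0 <= n * (sh (k * mdist x b) * sh (k * mdist x a) * sh (k * mdist x b)).
    by rewrite !mulr_ge0 // ltW.
  move: tr cb A0 B0; clear; move: (ch _) (sh _) (ch _) (sh _) (ch _) => ab b' sb a' sa.
  by nra.
have u4 : uniq [:: x; a; b; y].
  by rewrite /= !inE !negb_or xa xb yx ab (eq_sym a) ya (eq_sym b) yb.
have itv u v : x != u -> x != v -> -1 <= cH k (mdist x u) (mdist x v) (mdist u v) <= 1.
  by move=> xu xv; apply: cH_itv => //; rewrite ?mdist_gt0 //; exact: tri_mdist.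
have := F px pa pb py u4.
set t1 := acos _ in h *; set t2 := acos _; set t3 := acos _ => S.
have /andP[t20 _] : 0 <= t2 <= pi by apply: acos_itv; exact: itv.
have t3i : 0 <= t3 <= pi by apply: acos_itv; exact: itv.
have := cos_sum_defect t20 t3i n0 ltac:(lra).
rewrite /t2 /t3 !acosK' ?itv // /cH.
set cd := ch (k * mdist x y); set sd := sh (k * mdist x y) in D0 *.
set ya' := ch (k * mdist y a); rewrite (metric_sym b y); set yb' := ch (k * mdist y b).
move: A0 B0; set sa := sh (k * mdist x a); set sb := sh (k * mdist x b) => A0 B0.
set c_a := ch (k * mdist x a); set c_b := ch (k * mdist x b).
move=> ineq; have := mulr_gt0 (mulr_gt0 D0 A0) B0 => P0.
have := ler_wpM2r (ltW P0) ineq.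
have -> : ((c_b * cd - yb') / (sb * sd) + (cd * c_a - ya') / (sd * sa)) * (sd * sa * sb)
  = (c_b * cd - yb') * sa + (cd * c_a - ya') * sb by field; rewrite !gt_eqF.
by lra.
Qed.

Lemma stewart a b x y : mdist p a < r -> mdist p b < r -> mdist p x < r ->
  mdist p y < r -> mdist x a + mdist x b = mdist a b ->
  ch (k * mdist y a) * sh (k * mdist x b) + ch (k * mdist y b) * sh (k * mdist x a)
  <= ch (k * mdist x y) * sh (k * mdist a b).
Proof.
move=> pa pb px py E.
have [ab|ab] := eqVneq a b.
  move: E; rewrite -ab mdistxx => E; have xa : mdist x a = 0.
    by have := mdist_ge0 x a; lra.
  by rewrite xa mulr0 sh0 !mulr0 addr0.
have := @stewart_defect a b x y 0 pa pb px py (lexx 0) ab.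
rewrite mul0r subr0 -mulrDr E; apply=> xa xb.
suff -> : cH k (mdist x a) (mdist x b) (mdist a b) = -1 by rewrite acosN1 subrr.
have kd (u v : X) : u != v -> 0 < k * mdist u v by move=> uv; rewrite mulr_gt0 // mdist_gt0.
rewrite /cH -E mulrDr chD opprD addrA subrr sub0r mulNr divff //.
by rewrite mulf_neq0 // gt_eqF // sh_gt0 // kd.
Qed.

End Local.
End FourPoints.

(** * Geodesics and angles *)

Section Geodesics.
Context {R : realType} {X : metricType R}.
Implicit Types (p q : X) (s t u : R).

Lemma geo_dist p (g : geodesic p) s : 0 <= s <= glen g -> mdist p (g s) = s.
Proof.
move=> /andP[s0 sl]; rewrite -{1}(gcurve0 g) gcurve_isom ?lexx ?s0 //.
  by rewrite sub0r normrN ger0_norm.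
exact: ltW (glen_gt0 g).
Qed.

Lemma geo_isom p (g : geodesic p) s t : 0 <= s -> s <= t -> t <= glen g ->
  mdist (g s) (g t) = t - s.
Proof.
move=> s0 st tl; rewrite gcurve_isom ?s0 ?(le_trans s0 st) ?(le_trans st) //.
by rewrite distrC ger0_norm // subr_ge0.
Qed.

Lemma mk_geodesic p (l : R) (c : R -> X) : 0 < l -> c 0 = p ->
  (forall s t, 0 <= s -> s <= t -> t <= l -> mdist (c s) (c t) = t - s) ->
  {g : geodesic p | glen g = l /\ gcurve g = c}.
Proof.
move=> l0 c0 H; have I s t : 0 <= s <= l -> 0 <= t <= l ->
    mdist (c s) (c t) = `|s - t|.
  move=> /andP[s0 sl] /andP[t0 tl]; have [st|ts] := leP s t.
    by rewrite H // distrC ger0_norm // subr_ge0.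
  by rewrite metric_sym H ?(ltW ts) // ger0_norm // subr_ge0 ltW.
by exists (Geodesic l0 c0 I).
Qed.

Lemma geo_restrict p (g : geodesic p) l : 0 < l -> l <= glen g ->
  {h : geodesic p | glen h = l /\ gcurve h = g}.
Proof.
move=> l0 lg; apply: mk_geodesic => //; first exact: gcurve0.
by move=> s t s0 st tl; rewrite geo_isom // (le_trans tl).
Qed.

Lemma geo_forward p (g : geodesic p) s : 0 <= s -> s < glen g ->
  {h : geodesic (g s) | glen h = glen g - s /\ gcurve h = (fun u => g (s + u))}.
Proof.
move=> s0 sl; apply: mk_geodesic; rewrite ?subr_gt0 ?addr0 //.
move=> u v u0 uv vl; rewrite geo_isom //; [lra|lra|lra|lra].
Qed.

Lemma geo_backward p (g : geodesic p) s : 0 < s -> s <= glen g ->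
  {h : geodesic (g s) | glen h = s /\ gcurve h = (fun u => g (s - u))}.
Proof.
move=> s0 sl; apply: mk_geodesic; rewrite ?subr0 //.
by move=> u v u0 uv vl; rewrite metric_sym geo_isom //; lra.
Qed.

End Geodesics.

Section Angles.
Context {R : realType}.
Implicit Types (s t u e : R).

Definition phi (X : metricType R) (k : R) (p : X) (g h : geodesic p) s t : R :=
  cH k s t (mdist (g s) (h t)).

Section Local.
Context {X : metricType R} {k : R} {p : X} {r : R}.
Hypotheses (k0 : 0 < k) (r0 : 0 < r) (F : fourpt k p r).
Implicit Types (g h l : geodesic p).

Lemma phiC g h s t : phi k g h s t = phi k h g t s.
Proof. by rewrite /phi /cH metric_sym (mulrC (ch _)) (mulrC (sh _)). Qed.

Lemma geo_tri g h s t : 0 <= s <= glen g -> 0 <= t <= glen h ->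
  tri s t (mdist (g s) (h t)).
Proof.
by move=> sg th; have := tri_mdist p (g s) (h t); rewrite !geo_dist.
Qed.

Lemma phi_itv g h s t : 0 < s <= glen g -> 0 < t <= glen h ->
  -1 <= phi k g h s t <= 1.
Proof.
move=> /andP[s0 sl] /andP[t0 tl]; apply: cH_itv => //.
by apply: geo_tri; rewrite ltW.
Qed.

(** Angle monotonicity: it is Stewart's inequality for [g s'] between [p] and [g s], seen from
    [h t], after clearing denominators. *)
Let phi_monol g h s' s t : 0 < s' -> s' <= s -> s <= glen g -> s < r ->
  0 < t -> t <= glen h -> t < r -> phi k g h s' t <= phi k g h s t.
Proof.
move=> s'0 s's sl sr t0 tl tr.
have s0 : 0 < s by exact: lt_le_trans s's.
have gs : mdist p (g s) = s by rewrite geo_dist // ltW.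
have gs' : mdist p (g s') = s' by rewrite geo_dist // ltW //= (le_trans s's).
have ht : mdist p (h t) = t by rewrite geo_dist // ltW.
have := @stewart _ _ _ _ _ k0 F p (g s) (g s') (h t).
rewrite mdistxx gs gs' ht (metric_sym (g s') p) gs' geo_isom ?(ltW s'0) //.
rewrite (metric_sym (h t) p) ht => /(_ r0 sr (le_lt_trans s's sr) tr ltac:(lra)).
rewrite mulrBr shB (metric_sym (h t)) => S.
have S0 := sh_gt0 (mulr_gt0 k0 s0); have S0' := sh_gt0 (mulr_gt0 k0 s'0).
have T0 := sh_gt0 (mulr_gt0 k0 t0).
have ST0 : 0 < sh (k * s') * sh (k * t) by exact: mulr_gt0.
rewrite /phi /cH ler_pdivrMr //; set B := ch (k * s) * _ - _.
have -> : B / (sh (k * s) * sh (k * t)) * (sh (k * s') * sh (k * t)) =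
    B * sh (k * s') / sh (k * s) by field; rewrite !gt_eqF.
by rewrite ler_pdivlMr // /B; lra.
Qed.

Lemma phi_mono g h s' t' s t : 0 < s' -> s' <= s -> s <= glen g -> s < r ->
  0 < t' -> t' <= t -> t <= glen h -> t < r -> phi k g h s' t' <= phi k g h s t.
Proof.
move=> s'0 s's sl sr t'0 t't tl tr; have t0 := lt_le_trans t'0 t't.
apply: le_trans (phi_monol s'0 s's sl sr t0 tl tr).
rewrite phiC (phiC _ _ s'); apply: phi_monol => //; first by rewrite (le_trans s's).
exact: le_lt_trans s's sr.
Qed.

Let inf_phi g h : exists2 m, -1 <= m <= 1 &
  (forall s t, 0 < s < r -> s <= glen g -> 0 < t < r -> t <= glen h -> m <= phi k g h s t) /\
  forall e, 0 < e -> exists2 d, 0 < d & [/\ d <= glen g, d <= glen h, d <= r &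
    forall s t, 0 < s < d -> 0 < t < d -> phi k g h s t <= m + e].
Proof.
pose A := [set phi k g h s s | s in [set s | [/\ 0 < s, s < r, s <= glen g & s <= glen h]]].
pose d0 := Num.min r (Num.min (glen g) (glen h)) / 2.
have m0 : 0 < Num.min r (Num.min (glen g) (glen h)) by rewrite !lt_min r0 !glen_gt0.
have d00 : 0 < d0 by rewrite divr_gt0.
have : d0 < Num.min r (Num.min (glen g) (glen h)) by rewrite /d0; lra.
rewrite !lt_min => /and3P[d0r d0g d0h].
have A0 : A !=set0 by exists (phi k g h d0 d0), d0 => //; split => //; exact: ltW.
have Alb : lbound A (-1).
  by move=> _ [s [s0 sr sg sh] <-]; have /andP[] := @phi_itv g h s s ltac:(by rewrite s0) ltac:(by rewrite s0).
have hA : has_inf A by split => //; exists (-1).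
have mlb s : [/\ 0 < s, s < r, s <= glen g & s <= glen h] -> inf A <= phi k g h s s.
  by move=> H; apply: ge_inf; [case: hA|exists s].
exists (inf A).
  apply/andP; split; first by apply: lb_le_inf.
  apply: (le_trans (mlb d0 _)); first by split => //; exact: ltW.
  by have /andP[] := @phi_itv g h d0 d0 ltac:(by rewrite d00 ltW) ltac:(by rewrite d00 ltW).
split=> [s t /andP[s0 sr] sg /andP[t0 tr] th|e e0].
  pose u := Num.min s t; have u0 : 0 < u by rewrite lt_min s0.
  have us : u <= s by rewrite ge_min lexx.
  have ut : u <= t by rewrite ge_min lexx orbT.
  apply: (le_trans (mlb u _)); last exact: phi_mono.
  by split=> //; [exact: le_lt_trans sr|exact: le_trans sg|exact: le_trans th].
have [_ [s [s0 sr sg sh] <-]] := inf_adherent e0 hA => H.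
exists s => //; split=> //; first exact: ltW.
move=> u v /andP[u0 us] /andP[v0 vs]; apply: le_trans (ltW H).
by apply: phi_mono => //; exact: ltW.
Qed.

(** By monotonicity the infimum of the hyperbolic cosines on the diagonal is their limit. The angle
    is defined with Euclidean comparison, which differs from the hyperbolic one by an arbitrarily
    small amount near [p], so it is a limit too and has this cosine. *)
Let angle_spec g h : [/\ forall s t, 0 < s < r -> s <= glen g -> 0 < t < r ->
    t <= glen h -> cos (angle g h) <= phi k g h s t,
  forall e, 0 < e -> exists2 d, 0 < d & forall s t, 0 < s < d -> 0 < t < d ->
    phi k g h s t <= cos (angle g h) + e &
  forall e, 0 < e -> exists2 d, 0 < d & forall s t, 0 < s < d -> 0 < t < d ->
    `|comparison_angle 0 p (g s) (h t) - angle g h| <= e].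
Proof.
have [m mi [lb ub]] := inf_phi g h.
have lim e : 0 < e -> exists2 d, 0 < d & forall s t, 0 < s < d -> 0 < t < d ->
    `|comparison_angle 0 p (g s) (h t) - acos m| <= e.
  move=> e0; have [d1 d10 H1] := acos_cont mi e0.
  have d120 : 0 < d1 / 2 / 2 by rewrite !divr_gt0.
  have [d2 d20 [dg dh dr H2]] := ub _ d120.
  have [d3 d30 H3] := @cH_near_cE R k _ k0 d120.
  exists (Num.min d2 d3); first by rewrite lt_min d20.
  move=> s t /andP[s0]; rewrite lt_min => /andP[sd2 sd3].
  move=> /andP[t0]; rewrite lt_min => /andP[td2 td3].
  have sg : s <= glen g by rewrite ltW // (lt_le_trans sd2).
  have th : t <= glen h by rewrite ltW // (lt_le_trans td2).
  have tr : tri s t (mdist (g s) (h t)).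
    by apply: geo_tri; rewrite ?sg ?th ltW.
  rewrite distrC ltW // /comparison_angle /model_angle ltxx !geo_dist ?sg ?th ?ltW //.
  apply: H1; first exact: (cE_itv s0 t0 tr).
  have := H2 s t; rewrite s0 sd2 t0 td2 => /(_ isT isT) u1.
  have := lb s t; rewrite s0 t0 (lt_le_trans sd2 dr) (lt_le_trans td2 dr) => /(_ isT sg isT th) l1.
  have := H3 s t (mdist (g s) (h t)) ltac:(by rewrite s0) ltac:(by rewrite t0) tr.
  rewrite -/(phi k g h s t) ler_norml => /andP[h1 h2].
  by rewrite -/(cE s t _) ltr_norml; apply/andP; split; lra.
have aE : angle g h = acos m.
  exact: (@limf_esup_corner _ (fun s t => comparison_angle 0 p (g s) (h t))).
rewrite aE acosK' //; split => // e e0.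
by have [d d0 [_ _ _ H]] := ub _ e0; exists d.
Qed.

Lemma cos_angle_le g h s t : 0 < s < r -> s <= glen g -> 0 < t < r ->
  t <= glen h -> cos (angle g h) <= phi k g h s t.
Proof. by have [H _ _] := angle_spec g h; exact: H. Qed.

Lemma phi_le_cos_angle g h e : 0 < e -> exists2 d, 0 < d &
  forall s t, 0 < s < d -> 0 < t < d -> phi k g h s t <= cos (angle g h) + e.
Proof. by have [_ H _] := angle_spec g h; exact: H. Qed.

Lemma angle_lim g h e : 0 < e -> exists2 d, 0 < d &
  forall s t, 0 < s < d -> 0 < t < d ->
    `|comparison_angle 0 p (g s) (h t) - angle g h| <= e.
Proof. by have [_ _ H] := angle_spec g h; exact: H. Qed.

Lemma angle_itv g h : 0 <= angle g h <= pi.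
Proof. by rewrite angle_ge0 angle_le_pi. Qed.

Lemma angle_near_phi g h e : 0 < e -> exists2 d, 0 < d &
  [/\ d <= glen g, d <= glen h, d <= r & forall s t, 0 < s < d -> 0 < t < d ->
    angle g h - e <= acos (phi k g h s t)].
Proof.
move=> e0; have ai := angle_itv g h.
have ci : -1 <= cos (angle g h) <= 1 by rewrite cos_geN1 cos_le1.
have [d1 d10 H1] := acos_cont ci e0.
have d120 : 0 < d1 / 2 by rewrite divr_gt0.
have [d2 d20 H2] := phi_le_cos_angle g h d120.
exists (Num.min d2 (Num.min r (Num.min (glen g) (glen h)))).
  by rewrite !lt_min d20 r0 !glen_gt0.
split; [by rewrite !ge_min lexx !orbT|by rewrite !ge_min lexx !orbT|by rewrite !ge_min lexx !orbT|].
move=> s t /andP[s0]; rewrite !lt_min => /and4P[sd sr sg sh'].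
move=> /andP[t0] /and4P[td tr tg th].
have pi1 : -1 <= phi k g h s t <= 1 by apply: phi_itv; rewrite ?s0 ?t0 ltW.
have := @cos_angle_le g h s t; rewrite s0 t0 sr tr => /(_ isT (ltW sg) isT (ltW th)) h1.
have := H2 s t; rewrite s0 t0 sd td => /(_ isT isT) h2.
have h3 : `|cos (angle g h) - phi k g h s t| < d1.
  by rewrite ltr_norml; apply/andP; split; lra.
by have := H1 _ pi1 h3; rewrite cosK' // ltr_norml => /andP[? ?]; lra.
Qed.

Lemma angle_sum3 g h l : angle g h + angle h l + angle l g <= 2 * pi.
Proof.
apply/ler_addgt0Pr => e e0; have e30 : 0 < e / 3 by rewrite divr_gt0.
have [d1 d10 [g1 h1 r1 H1]] := angle_near_phi g h e30.
have [d2 d20 [h2 l2 r2 H2]] := angle_near_phi h l e30.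
have [d3 d30 [l3 g3 r3 H3]] := angle_near_phi l g e30.
pose s := Num.min d1 (Num.min d2 d3) / 2.
have m0 : 0 < Num.min d1 (Num.min d2 d3) by rewrite !lt_min d10 d20.
have s0 : 0 < s by rewrite divr_gt0.
have : s < Num.min d1 (Num.min d2 d3) by rewrite /s; lra.
rewrite !lt_min => /and3P[s1 s2 s3].
have := H1 s s; rewrite s0 s1 => /(_ isT isT).
have := H2 s s; rewrite s0 s2 => /(_ isT isT).
have := H3 s s; rewrite s0 s3 => /(_ isT isT).
have sg : 0 < s <= glen g by rewrite s0 ltW // (lt_le_trans s1).
have sh' : 0 < s <= glen h by rewrite s0 ltW // (lt_le_trans s1).
have sl : 0 < s <= glen l by rewrite s0 ltW // (lt_le_trans s2).
have dg : mdist p (g s) = s by rewrite geo_dist // ltW //; case/andP: sg.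
have dh : mdist p (h s) = s by rewrite geo_dist // ltW //; case/andP: sh'.
have dl : mdist p (l s) = s by rewrite geo_dist // ltW //; case/andP: sl.
have sr : s < r by exact: lt_le_trans r1.
have pd x : mdist p x = s -> p != x.
  by move=> px; apply/eqP => E; move: px s0; rewrite E mdistxx => ->; rewrite ltxx.
have ub g1' h1' : 0 < s <= glen g1' -> 0 < s <= glen h1' -> acos (phi k g1' h1' s s) <= pi.
  by move=> a1 a2; have /andP[] := acos_itv (phi_itv a1 a2).
have z g1' h1' : 0 < s <= glen g1' -> 0 < s <= glen h1' -> g1' s = h1' s -> acos (phi k g1' h1' s s) = 0.
  move=> a1 a2 E; rewrite /phi /cH E mdistxx mulr0 ch0.
  have := ch2Bsh2 (k * s); rewrite -!expr2 => <-.
  have S0 := sh_gt0 (mulr_gt0 k0 s0).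
  by rewrite opprB addrCA subrr addr0 divff ?acos1 // expf_neq0 // gt_eqF.
have ugh := ub _ _ sg sh'; have uhl := ub _ _ sh' sl; have ulg := ub _ _ sl sg.
(* If two of the three points coincide, the angle between them is 0 and the two others are at most
   pi, so that the bound holds without the four-point condition. *)
have [E|gh] := eqVneq (g s) (h s); first by rewrite (z _ _ sg sh' E); lra.
have [E|hl] := eqVneq (h s) (l s); first by rewrite (z _ _ sh' sl E); lra.
have [E|lg] := eqVneq (l s) (g s); first by rewrite (z _ _ sl sg E); lra.
have := F _ _ _ _ (_ : uniq [:: p; g s; h s; l s]); rewrite mdistxx dg dh dl.
move=> /(_ r0 sr sr sr); rewrite /= !inE !negb_or !pd // gh hl (eq_sym (g s)) lg.
move=> /(_ isT); rewrite -/(phi k g h s s) -/(phi k h l s s) -/(phi k l g s s).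
by lra.
Qed.

End Local.

Lemma angle_opp_pi (X : metricType R) (p : X) (g h : geodesic p) d : 0 < d ->
  (forall s t, 0 < s < d -> 0 < t < d -> mdist (g s) (h t) = s + t) ->
  angle g h = pi.
Proof.
move=> d0 H.
apply: (@limf_esup_corner _ (fun s t => comparison_angle 0 p (g s) (h t))) => e e0.
exists (Num.min d (Num.min (glen g) (glen h))); first by rewrite !lt_min d0 !glen_gt0.
move=> s t /andP[s0]; rewrite !lt_min => /and3P[sd sg sh'].
move=> /andP[t0] /and3P[td tg th].
rewrite /comparison_angle /model_angle ltxx !geo_dist ?(ltW s0) ?(ltW t0) ?(ltW sg) ?(ltW th) //.
rewrite H ?s0 ?t0 // (_ : _ / _ = -1); first by rewrite acosN1 subrr normr0 ltW.
by field; rewrite !gt_eqF.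
Qed.

Lemma curv4_fourpt (X : metricType R) (p : X) : curv4 X ->
  exists k r, [/\ 0 < k, 0 < r & fourpt k p r].
Proof. by move=> [k k0 H]; have [r r0 F] := H p; exists k, r. Qed.

Section Global.
Context {X : metricType R} (c4 : curv4 X).
Implicit Types (p : X).

Lemma angle3 p (g h l : geodesic p) : angle g h + angle h l + angle l g <= 2 * pi.
Proof. by have [k [r [k0 r0 F]]] := curv4_fourpt p c4; exact: (angle_sum3 k0 r0 F). Qed.

Lemma angle_adjacent p (g g' h : geodesic p) : angle g g' = pi ->
  angle h g + angle h g' = pi.
Proof.
move=> E; have := angle3 g g' h; have := angle_triangle h g g'.
by rewrite E (angleC g' h) (angleC g h); lra.
Qed.

Lemma angle0_agree p (g h : geodesic p) : angle g h = 0 ->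
  exists2 d, 0 < d & forall s, 0 <= s <= d -> g s = h s.
Proof.
move=> a0; have [k [r [k0 r0 F]]] := curv4_fourpt p c4.
pose d := Num.min (r / 2) (Num.min (glen g) (glen h)).
exists d; first by rewrite !lt_min !glen_gt0 divr_gt0.
move=> s /andP[]; rewrite le_eqVlt => /orP[/eqP <- _|s0]; first by rewrite !gcurve0.
rewrite !le_min => /and3P[sr sg sh'].
have := @cos_angle_le _ _ _ _ k0 r0 F g h s s; rewrite s0 a0 cos0.
have -> : s < r by lra.
move=> /(_ isT sg isT sh'); have S0 := sh_gt0 (mulr_gt0 k0 s0).
rewrite /phi /cH ler_pdivlMr ?mulr_gt0 // mul1r => H.
apply: mdist0_eq; apply/eqP; rewrite eq_le mdist_ge0 andbT.
rewrite -(ler_pM2l k0) mulr0 -ch_ler ?mulr_ge0 ?mdist_ge0 ?(ltW k0) // ch0.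
by have := ch2Bsh2 (k * s); lra.
Qed.

(** At the last point of agreement the common backward geodesic makes the angle pi with both
    continuations. By [angle3] these enclose the angle 0, hence agree a little further by
    [angle0_agree]. *)
Lemma geo_nonbranching p (g h : geodesic p) : angle g h = 0 ->
  forall s, 0 <= s -> s <= glen g -> s <= glen h -> g s = h s.
Proof.
move=> a0; have [d0 d00 H0] := angle0_agree a0.
pose m := Num.min (glen g) (glen h).
pose A := [set s | 0 <= s <= m /\ forall u, 0 <= u <= s -> g u = h u].
have m0 : 0 < m by rewrite lt_min !glen_gt0.
have Aub : ubound A m by move=> s [/andP[]].
have A0 : A !=set0.
  exists 0; split; first by rewrite lexx ltW.
  by move=> u /andP[u0 u1]; rewrite (@le_anti _ _ u 0) ?u0 ?u1 ?gcurve0.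
have hA : has_sup A by split => //; exists m.
have tm : sup A <= m by exact: ge_sup.
have t0 : 0 < sup A.
  apply: (@lt_le_trans _ _ (Num.min d0 m)); first by rewrite lt_min d00.
  apply: ub_le_sup; first by case: hA.
  split; first by rewrite ge_min lexx orbT le_min (ltW d00) ltW.
  by move=> u /andP[u0]; rewrite le_min => /andP[ud _]; apply: H0; rewrite u0.
have below u : 0 <= u -> u < sup A -> g u = h u.
  move=> u0 /(sup_gt A0)[s [_ H]] us; apply: H; rewrite u0 ltW //.
have [mg mh] : m <= glen g /\ m <= glen h by rewrite !ge_min !lexx orbT.
have at_sup : g (sup A) = h (sup A).
  apply: mdist0_eq; apply/eqP; rewrite eq_le mdist_ge0 andbT.
  apply/ler_addgt0Pr => e e0; rewrite add0r.
  pose u := Num.max 0 (sup A - e / 2).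
  have u0 : 0 <= u by rewrite le_max lexx.
  have ut : u < sup A by rewrite gt_max t0 ltrBlDr ltrDl divr_gt0.
  have ue : sup A - u <= e / 2 by rewrite lerBlDl -lerBlDr le_max lexx orbT.
  rewrite (le_trans (metric_triangle _ (g u) _)) // [X in _ + mdist X _](below _ u0 ut).
  rewrite metric_sym (geo_isom u0 (ltW ut) (le_trans tm mg)).
  by rewrite (geo_isom u0 (ltW ut) (le_trans tm mh)); lra.
have [tm'|tm'] := ltP (sup A) m; last first.
  move=> s s0 sg sh'; have := le_trans (_ : s <= m) tm'; rewrite le_min sg sh' => /(_ isT).
  by rewrite le_eqVlt => /orP[/eqP ->//|]; exact: below.
have tg : sup A < glen g by exact: lt_le_trans mg.
have th : sup A < glen h by exact: lt_le_trans mh.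
have [gf [gfl gfc]] := geo_forward (ltW t0) tg.
have [gb [gbl gbc]] := geo_backward t0 (ltW tg).
have [hf' [hfl hfc]] := geo_forward (ltW t0) th.
have [hf [hfl' hfc']] : {f : geodesic (g (sup A)) | glen f = glen h - sup A /\
    gcurve f = (fun u => h (sup A + u))}.
  by rewrite at_sup; exists hf'.
have b1 : angle gb gf = pi.
  apply: (@angle_opp_pi _ _ _ _ (Num.min (sup A) (glen g - sup A))).
    by rewrite lt_min t0 subr_gt0.
  move=> s t /andP[s0]; rewrite lt_min => /andP[s1 s2] /andP[u0]; rewrite lt_min => /andP[u1 u2].
  by rewrite gbc gfc geo_isom; lra.
have b2 : angle gb hf = pi.
  apply: (@angle_opp_pi _ _ _ _ (Num.min (sup A) (glen h - sup A))).
    by rewrite lt_min t0 subr_gt0.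
  move=> s t /andP[s0]; rewrite lt_min => /andP[s1 s2] /andP[u0]; rewrite lt_min => /andP[u1 u2].
  by rewrite gbc hfc' below ?geo_isom; lra.
have fh0 : angle gf hf = 0.
  apply/eqP; rewrite eq_le angle_ge0 andbT.
  by have := angle3 gf gb hf; rewrite (angleC gf gb) b1 b2 (angleC hf); lra.
have [d d_gt0 Hd] := angle0_agree fh0.
pose v := Num.min d (m - sup A).
have v0 : 0 < v by rewrite lt_min d_gt0 subr_gt0.
suff : A (sup A + v) by move=> /(ub_le_sup (proj2 hA)); rewrite gerDl leNgt v0.
split; first by have : v <= m - sup A by [rewrite ge_min lexx orbT]; move=> ?; apply/andP; split; lra.
move=> u /andP[u0 uv]; have [us|us] := ltP u (sup A); first exact: below.
have := Hd (u - sup A); rewrite gfc hfc' (addrC (sup A)) subrK; apply.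
by have : v <= d by [rewrite ge_min lexx]; move=> ?; apply/andP; split; lra.
Qed.

End Global.
End Angles.

(* All limits of sequences of points are taken along one nonprincipal
   ultrafilter, which spares the extraction of subsequences. *)
Lemma oou_ex : {F : set_system nat | UltraFilter F /\ \oo `<=` F}.
Proof. exact: cid (ultraFilterLemma eventually_filter). Qed.

Definition oou : set_system nat := sval oou_ex.

Instance oou_ultra : UltraFilter oou.
Proof. by case: (svalP oou_ex). Qed.

Instance oou_proper : ProperFilter oou.
Proof. exact: ultra_proper. Qed.

Lemma oou_eventually (P : set nat) : (\forall n \near \oo, P n) -> oou P.
Proof. by case: (svalP oou_ex) => _; apply. Qed.

Lemma oou_ge (N : nat) : oou [set n | (N <= n)%N].
Proof. by apply: oou_eventually; exists N. Qed.

Lemma oou_all (P : set nat) : (forall n, P n) -> oou P.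
Proof. by move=> H; apply: filterE. Qed.

Lemma oou_imply (P Q : set nat) : (forall n, P n -> Q n) -> oou P -> oou Q.
Proof. by move=> H; apply: filterS. Qed.

Lemma oou_or (P Q : set nat) : oou [set n | P n \/ Q n] -> oou P \/ oou Q.
Proof.
move=> H; have [?|nP] := in_ultra_setVsetC P oou_ultra; first by left.
by right; apply: filterS2 H nP => n [].
Qed.

Lemma oou_dec (P : set nat) : oou P \/ oou [set n | ~ P n].
Proof. exact: (in_ultra_setVsetC P oou_ultra). Qed.

Lemma oou_image T (w : nat -> T) : UltraFilter (w @ oou).
Proof.
split; first exact: fmap_proper_filter.
move=> G GF FG; apply/seteqP; split=> // A GA.
have [//|H] := oou_dec (w @^-1` A).
have GC : G (~` A) by apply: FG; exact: H.
by have [x []] := @filter_ex _ G _ _ (filterI GA GC).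
Qed.

(** * Limits along an ultrafilter *)

Section UltraLimits.
Context {R : realType}.
Implicit Types (u v : nat -> R) (l a b e : R).

Lemma cvg_oou u l : u @ \oo --> l -> u @ oou --> l.
Proof. by apply: cvg_trans; apply: cvg_app => P; exact: oou_eventually. Qed.

Lemma ulim_bounded u a b : oou [set n | a <= u n <= b] ->
  exists2 l, a <= l <= b & u @ oou --> l.
Proof.
move=> H; have := @segment_compact R a b; rewrite compact_ultra.
move=> /(_ (u @ oou) (oou_image u))[|l [lab ul]].
  by apply: (oou_imply _ H) => n; rewrite /= in_itv.
by exists l => //; move: lab; rewrite /= in_itv.
Qed.

Lemma ulim_le u v l l' : u @ oou --> l -> v @ oou --> l' ->
  oou [set n | u n <= v n] -> l <= l'.
Proof.
move=> ul vl H; rewrite leNgt; apply/negP => ll.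
have e0 : 0 < (l - l') / 2 by rewrite divr_gt0 // subr_gt0.
have /cvgr_dist_lt/(_ _ e0) h1 := ul; have /cvgr_dist_lt/(_ _ e0) h2 := vl.
have [n [[/= a1 a2] a3]] := filter_ex (filterI (filterI h1 h2) H).
move: a1 a2 a3; rewrite /= !ltr_norml => /andP[? ?] /andP[? ?]; lra.
Qed.

Lemma ulim_uniq u l l' : u @ oou --> l -> u @ oou --> l' -> l = l'.
Proof.
by move=> h1 h2; apply/eqP; rewrite eq_le !(ulim_le h1 h2, ulim_le h2 h1) //; apply: oou_all => n; exact: lexx.
Qed.

Lemma ulim_cst a : (fun _ : nat => a) @ oou --> a.
Proof. exact: cvg_cst. Qed.

Lemma ulim_eq u v l : oou [set n | u n = v n] -> u @ oou --> l -> v @ oou --> l.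
Proof.
move=> H ul; apply/cvgrPdist_lt => e e0; have /cvgrPdist_lt/(_ _ e0) h := ul.
by apply: filterS2 H h => n /= ->.
Qed.

Lemma ulim0 u : (forall e, 0 < e -> oou [set n | `|u n| < e]) -> u @ oou --> (0 : R).
Proof.
move=> H; apply/cvgrPdist_lt => e /H; apply: oou_imply => n /=.
by rewrite sub0r normrN.
Qed.

Lemma ulim0P u e : u @ oou --> (0 : R) -> 0 < e -> oou [set n | `|u n| < e].
Proof.
move=> /cvgrPdist_lt H /H; apply: oou_imply => n /=.
by rewrite sub0r normrN.
Qed.

Lemma ulim_squeeze0 u v : (forall n, 0 <= u n) -> oou [set n | u n <= v n] ->
  v @ oou --> (0 : R) -> u @ oou --> (0 : R).
Proof.
move=> u0 uv v0; apply: ulim0 => e /(ulim0P v0) h.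
apply: filterS2 uv h => n /= uvn vn; rewrite ger0_norm //.
by rewrite (le_lt_trans uvn) // (le_lt_trans (ler_norm _) vn).
Qed.

Lemma inv_ulim0 : (fun n => n.+1%:R^-1 : R) @ oou --> (0 : R).
Proof. by apply: cvg_oou; exact: cvg_harmonic. Qed.

End UltraLimits.

Section TotallyBounded.
Context {R : realType}.

Definition tbounded (X : metricType R) (A : set X) : Prop :=
  forall e : R, 0 < e -> exists N : nat, forall f : nat -> X,
    (forall i, (i < N)%N -> A (f i)) ->
    exists i j, [/\ (i < j)%N, (j < N)%N & mdist (f i) (f j) < e].

Definition utends (X : metricType R) (w : nat -> X) (x : X) : Prop :=
  (fun n => mdist (w n) x) @ oou --> (0 : R).

Lemma utendsP (X : metricType R) (w : nat -> X) x e : utends w x -> 0 < e ->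
  oou [set n | mdist (w n) x < e].
Proof.
move=> /ulim0P H /H; apply: oou_imply => n /=.
by rewrite ger0_norm // mdist_ge0.
Qed.

Lemma utends_of (X : metricType R) (w : nat -> X) x :
  (forall e, 0 < e -> oou [set n | mdist (w n) x < e]) -> utends w x.
Proof.
move=> H; apply: ulim0 => e /H; apply: oou_imply => n /=.
by rewrite ger0_norm // mdist_ge0.
Qed.

Lemma utends_mdist (X : metricType R) (w v : nat -> X) x y :
  utends w x -> utends v y -> (fun n => mdist (w n) (v n)) @ oou --> mdist x y.
Proof.
move=> wx vy; apply/cvgrPdist_lt => e e0; have e20 : 0 < e / 2 by rewrite divr_gt0.
apply: filterS2 (utendsP wx e20) (utendsP vy e20) => n /= h1 h2.
have := metric_triangle x (w n) y; have := metric_triangle (w n) (v n) y.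
have := metric_triangle (w n) x (v n); have := metric_triangle x y (v n).
rewrite (metric_sym x (w n)) (metric_sym y (v n)) => *.
by rewrite ltr_norml; apply/andP; split; lra.
Qed.

Lemma utends_cst (X : metricType R) (x : X) : utends (fun _ => x) x.
Proof. by rewrite /utends mdistxx; exact: cvg_cst. Qed.

Lemma utends_mdistl (X : metricType R) (w : nat -> X) x y : utends w x ->
  (fun n => mdist (w n) y) @ oou --> mdist x y.
Proof. by move=> wx; apply: utends_mdist => //; exact: utends_cst. Qed.

Lemma utends_uniq (X : metricType R) (w : nat -> X) x y :
  utends w x -> utends w y -> x = y.
Proof.
move=> h1 h2; apply: mdist0_eq; move: (@utends_mdistl _ _ _ y h1) h2; exact: ulim_uniq.
Qed.

Lemma complete_utends (X : metricType R) (w : nat -> X) :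
  complete_space X -> (forall e, 0 < e -> exists x, oou [set n | mdist x (w n) < e]) ->
  exists x, utends w x.
Proof.
move=> cX H; have Fc : cauchy (w @ oou).
  apply/cauchyP => e /H[x hx]; exists x.
  by apply: (oou_imply _ hx) => n /=; rewrite ballEmdist.
have [x wx] := cX _ _ Fc; exists x; apply: utends_of => e e0.
have /wx : nbhs x (ball x e) by exact: nbhsx_ballx.
by apply: oou_imply => n /=; rewrite ballEmdist /= metric_sym.
Qed.

(** If the sequence were not Cauchy along [oou], some [e] would be such that almost no term is
    [e]-close to any given point. Then arbitrarily many [e]-separated terms could be picked one
    after another. *)
Lemma tbounded_utends (X : metricType R) (A : set X) (w : nat -> X) :
  complete_space X -> tbounded A -> oou [set n | A (w n)] ->
  exists x, utends w x.
Proof.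
move=> cX tA wA; apply: complete_utends => // e e0; apply: contrapT => /forallNP H.
have [N HN] := tA e e0.
have pack m : exists f : nat -> X, (forall i, (i < m)%N -> A (f i)) /\
    forall i j, (i < j)%N -> (j < m)%N -> e <= mdist (f i) (f j).
  elim: m => [|m [f [fA fe]]].
    by exists (fun _ => w 0%N); split.
  have : oou [set n | A (w n) /\ forall i, (i < m)%N -> e <= mdist (f i) (w n)].
    elim: m {fA fe} => [|m IH]; first by apply: (oou_imply _ wA) => n /= ?; split.
    have [/H //|fm] := oou_dec [set n | mdist (f m) (w n) < e].
    apply: filterS2 IH fm => n /= [An Hn] /negP; rewrite -leNgt => hm.
    by split=> // i; rewrite ltnS leq_eqVlt => /orP[/eqP ->|/Hn].
  move=> /filter_ex[n [An Hn]].
  exists (fun i => if (i < m)%N then f i else w n); split=> [i|i j ij].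
    by rewrite ltnS; case: ltnP => // im _; exact: fA.
  rewrite ltnS leq_eqVlt => /orP[/eqP jm|jm].
    by rewrite jm in ij *; rewrite ij ltnn; exact: Hn.
  by rewrite jm (ltn_trans ij jm); exact: fe.
have [f [fA fe]] := pack N; have [i [j [ij jN]]] := HN f fA.
by rewrite ltNge fe.
Qed.

End TotallyBounded.

(** * Doubling from finite dimension *)

Section Hausdorff.
Context {R : realType}.

(** Half of [eta] is spent on the cover and half on a geometric series added to the weights. These
    become positive, so that every set of the cover, even a single point, is excluded at some stage
    of the mass distribution below. *)
Lemma hausdorff_measure0_cover (X : metricType R) (s eta : R) : 0 < s -> 0 < eta ->
  hausdorff_measure s [set: X] = 0%E ->
  exists (U : nat -> set X) (w : nat -> R),
    [/\ forall x, exists k, U k x, forall k, 0 < w k,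
        forall k x y, U k x -> U k y -> mdist x y `^ s <= w k &
        forall K, \sum_(k < K) w k <= eta].
Proof.
move=> s0 e0 H; pose e2 := eta / 2; have e20 : 0 < e2 by rewrite divr_gt0.
have : (hausdorff_content s 1 [set: X] <= 0)%E.
  by rewrite -H; apply: ereal_sup_ubound; exists 1 => /=.
have p2 : (0 < e2%:E :> \bar R)%E by rewrite lte_fin.
move=> /le_lt_trans/(_ p2)/ereal_inf_lt[_ [U [UX Ud] <-] Usum].
pose v k := fine (poweR (ediam (U k)) s).
have dub k x y : U k x -> U k y -> ((mdist x y)%:E <= ediam (U k))%E.
  by move=> Ux Uy; apply: ereal_sup_ubound; exists (x, y).
have vE k : poweR (ediam (U k)) s = (v k)%:E /\ 0 <= v k.
  rewrite /v; have := Ud k; have := dub k; case: (ediam (U k)) => [r| |] H1 H2.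
  - by rewrite poweR_EFin /= powR_ge0.
  - by [].
  - by rewrite /poweR gt_eqF.
have sumE K : \sum_(k < K) v k <= e2.
  rewrite -lee_fin; apply: le_trans (ltW Usum).
  rewrite -sumEFin -(big_mkord xpredT (fun k => (v k)%:E)).
  rewrite (eq_bigr (fun k => poweR (ediam (U k)) s)); last by move=> k _; case: (vE k).
  by apply: nneseries_lim_ge => k _ _; case: (vE k) => -> ?; rewrite lee_fin.
pose w k := v k + e2 / 2 ^+ k.+1.
have w0 k : 0 < e2 / 2 ^+ k.+1 by rewrite divr_gt0 // exprn_gt0.
have geo K : \sum_(k < K) e2 / 2 ^+ k.+1 = e2 - e2 / 2 ^+ K.
  elim: K => [|K IH]; first by rewrite big_ord0 expr0 divr1 subrr.
  rewrite big_ord_recr /= IH exprS; field.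
  by rewrite expf_neq0.
exists U, w; split.
- by move=> x; have [k _ Ux] := UX x I; exists k.
- by move=> k; rewrite ltr_wpDl //; case: (vE k).
- move=> k x y Ux Uy; rewrite (@le_trans _ _ (v k)) ?lerDl ?(ltW (w0 k)) //.
  have := dub _ _ _ Ux Uy; have [] := vE k; rewrite /v; have := Ud k.
  case: (ediam (U k)) => [r| |] //= _ _ _; rewrite lee_fin => dr.
  by apply: ge0_ler_powR; rewrite ?nnegrE ?(ltW s0) ?mdist_ge0 // (le_trans _ dr) ?mdist_ge0.
- move=> K; rewrite big_split /= geo.
  have : 0 < e2 / 2 ^+ K by rewrite divr_gt0 // exprn_gt0.
  by have := sumE K; rewrite /e2; lra.
Qed.

Lemma powR_lt_inv (a b s : R) : 0 < s -> 0 <= a -> 0 <= b -> a `^ s <= b `^ s -> a <= b.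
Proof.
move=> s0 a0 b0 H; rewrite leNgt; apply/negP => ba.
by have := gt0_ltr_powR s0 (_ : b \in Num.nneg) (_ : a \in Num.nneg) ba; rewrite !nnegrE => /(_ b0 a0); lra.
Qed.

(* Mass distribution: at each scale some child of the current ball meets at
   most an N-th of the total weight of the sets of the cover, so that a nested
   sequence of balls escapes from all of them. *)
Lemma tree_hausdorff_measure (X : metricType R) (q s : R) (N : nat)
    (good : X -> R -> Prop) (y0 : X) (r0 : R) :
  complete_space X -> 0 < q -> q <= 1 / 4 -> 0 < s -> 1 <= N%:R * q `^ s ->
  (forall y r, 0 < r -> good y r -> exists z : nat -> X,
     (forall i, (i < N)%N -> good (z i) (q * r) /\ mdist y (z i) <= r / 2) /\
     forall i j, (i < j)%N -> (j < N)%N -> 4 * (q * r) <= mdist (z i) (z j)) ->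
  0 < r0 -> good y0 r0 -> hausdorff_measure s [set: X] <> 0%E.
Proof.
move=> cX q0 q4 s0 Nq child r00 g0 /hausdorff_measure0_cover.
have eta0 : 0 < (q * r0) `^ s by apply: powR_gt0; exact: mulr_gt0.
move=> /(_ _ s0 eta0)[U [w [Ucov w0 wd wsum]]].
pose meets k y r := `[< exists2 x, U k x & mdist y x <= r >].
pose load y r := forall K, \sum_(k < K | meets k y r) w k <= (q * r) `^ s.
have N0 : (0 < N)%N.
  by rewrite lt0n; apply/eqP => E; move: Nq; rewrite E mul0r; lra.
have step y r : 0 < r -> good y r -> load y r -> exists z,
    [/\ good z (q * r), load z (q * r) & mdist y z <= r / 2].
  move=> r0' gy ly; have [z [zg zd]] := child y r r0' gy.
  set L := (q * r) `^ s; have qr0 : 0 < q * r by rewrite mulr_gt0.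
  have wL k : meets k y r -> w k <= L.
    move=> mk; apply: le_trans (ly k.+1); rewrite (bigD1 ord_max) //= lerDl.
    by apply: sumr_ge0 => i _; exact: ltW.
  have sub k i : (i < N)%N -> meets k (z i) (q * r) -> meets k y r.
    move=> iN /asboolP[x Ux zx]; apply/asboolP; exists x => //.
    have := metric_triangle y (z i) x; have [_] := zg i iN.
    by have := ler_wpM2r (ltW r0') q4; lra.
  (* A set meeting a child weighs at most [L], hence has diameter at most [q * r], while the centers
     of the children are at least [4 * (q * r)] apart. So it meets at most one child, and the loads
     of the children add up to at most that of the parent. *)
  have one k i j : (i < j)%N -> (j < N)%N -> meets k (z i) (q * r) ->
      ~~ meets k (z j) (q * r).
    move=> ij jN mi; apply/negP => mj; have iN := ltn_trans ij jN.
    have := wL k (sub _ _ iN mi).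
    move: mi mj => /asboolP[x Ux zx] /asboolP[x' Ux' zx'] wk.
    have := le_trans (wd _ _ _ Ux Ux') wk.
    move=> /(powR_lt_inv s0 (mdist_ge0 _ _) (ltW qr0)).
    have := zd i j ij jN; have := metric_triangle (z i) x (z j).
    by have := metric_triangle x x' (z j); rewrite (metric_sym x' (z j)); lra.
  have [i iN Hi] : exists2 i, (i < N)%N & forall K,
      \sum_(k < K | meets k (z i) (q * r)) w k <= L / N%:R.
    apply: contrapT => /forall2NP H.
    have /choice[Kf KfP] : forall i, exists K, (i < N)%N ->
        L / N%:R < \sum_(k < K | meets k (z i) (q * r)) w k.
      move=> i; case: (H i) => [ni|]; first by exists 0%N.
      by move=> /existsNP[K /negP]; rewrite -ltNge; exists K.
    pose K := (\max_(i < N) Kf i)%N.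
    have mono i : (i < N)%N -> L / N%:R < \sum_(k < K | meets k (z i) (q * r)) w k.
      move=> iN; apply: lt_le_trans (KfP i iN) _.
      have KK : (Kf i <= K)%N by exact: (leq_bigmax (Ordinal iN)).
      rewrite (big_ord_widen_cond K (fun k => meets k (z i) (q * r)) w KK).
      rewrite [leRHS](bigID (fun k : 'I_K => (k < Kf i)%N)) /= lerDl.
      by apply: sumr_ge0 => j _; exact: ltW.
    have : \sum_(i < N) \sum_(k < K | meets k (z i) (q * r)) w k <= L.
      apply: le_trans (ly K); rewrite (exchange_big_dep xpredT) //= [leRHS]big_mkcond /=.
      apply: ler_sum => k _.
      case: (pickP (fun i : 'I_N => meets k (z i) (q * r))) => [i0 m0|no].
        rewrite (sub _ _ (ltn_ord i0) m0) (big_pred1 i0) // => j; apply/idP/eqP => [mj|-> //].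
        apply/val_inj; have [ji|ij|//] := ltngtP j i0.
          by move: (one k _ _ ji (ltn_ord i0) mj); rewrite m0.
        by move: (one k _ _ ij (ltn_ord j) m0); rewrite mj.
      by rewrite big_pred0 //; case: ifP => // _; exact: ltW.
    rewrite leNgt; apply/negP; rewrite negbK.
    apply: (@le_lt_trans _ _ (\sum_(i < N) L / N%:R)).
      by rewrite sumr_const card_ord -(mulr_natr (L / N%:R)) divfK // pnatr_eq0 -lt0n.
    apply: ltr_sum => [|i _]; last exact: mono.
    by apply/hasP; exists (Ordinal N0) => //; rewrite mem_index_enum.
  exists (z i); have [gz yz] := zg i iN; split=> // K; apply: le_trans (Hi K) _.
  rewrite powRM ?(ltW q0) ?(ltW qr0) // ler_pdivrMr ?ltr0n // -/L.
  by rewrite mulrC mulrA ler_peMl // powR_ge0.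
have load0 : load y0 r0.
  move=> K; apply: le_trans (wsum K); rewrite [leRHS](bigID (fun k : 'I_K => meets k y0 r0)) /= lerDl.
  by apply: sumr_ge0 => j _; exact: ltW.
pose rr j := q ^+ j * r0; have rr0 j : 0 < rr j by rewrite mulr_gt0 // exprn_gt0.
have /choice[nx nxP] : forall jy : nat * X, exists z, good jy.2 (rr jy.1) ->
    load jy.2 (rr jy.1) -> [/\ good z (rr jy.1.+1), load z (rr jy.1.+1) &
      mdist jy.2 z <= rr jy.1 / 2].
  move=> [j y] /=; have [g|ng] := pselect (good y (rr j)); last by exists y.
  have [l|nl] := pselect (load y (rr j)); last by exists y.
  have [z zP] := step y _ (rr0 j) g l; exists z => _ _.
  by move: zP; rewrite /rr exprS mulrA.
pose f := fix f j := if j is j'.+1 then nx (j', f j') else y0.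
have fP j : good (f j) (rr j) /\ load (f j) (rr j).
  elim: j => [|j [gj lj]]; first by rewrite /rr expr0 mul1r.
  by have [] := nxP (j, f j) gj lj.
have fd j m : (j <= m)%N -> mdist (f j) (f m) <= rr j - rr m.
  move=> /subnKC <-; elim: (m - j)%N => [|i IH]; first by rewrite addn0 mdistxx subrr.
  rewrite addnS; have [gj lj] := fP (j + i)%N; have [_ _ /=] := nxP (_, _) gj lj.
  have := metric_triangle (f j) (f (j + i)%N) (f (j + i).+1) => /= h1 h2.
  have : rr (j + i).+1 <= rr (j + i)%N / 4.
    by rewrite /rr exprS -mulrA; have := ler_wpM2r (ltW (rr0 (j + i)%N)) q4; rewrite /rr; lra.
  have := rr0 (j + i)%N; move: h1 h2 IH; lra.
have small e : 0 < e -> exists j, rr j < e.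
  move=> e0; have q1 : `|q| < 1 by rewrite ger0_norm; [lra|exact: ltW].
  have /cvgr_dist_lt/(_ _ (divr_gt0 e0 r00)) [j _ /(_ j (leqnn j))] := cvg_expr q1.
  rewrite /= sub0r normrN ger0_norm ?exprn_ge0 ?(ltW q0) // ltr_pdivlMr // => h.
  by exists j.
have [z fz] : exists z, utends f z.
  apply: complete_utends => // e /small[j je]; exists (f j).
  apply: oou_imply (oou_ge j) => m jm; apply: le_lt_trans (fd _ _ jm) _.
  by have := rr0 m; lra.
have zj j : mdist (f j) z <= rr j.
  have h1 := utends_mdist (utends_cst (f j)) fz.
  have h2 := @ulim_cst R (rr j).
  apply: (ulim_le h1 h2).
  by apply: oou_imply (oou_ge j) => m /fd /=; have := rr0 m; lra.
(* The limit lies in the balls of all stages. A set containing it meets them all, so its weight is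
   below loads that tend to 0. *)
have [k Uz] := Ucov z; have wk := w0 k.
have wkj j : w k <= (q * rr j) `^ s.
  have [_ lj] := fP j; apply: le_trans (lj k.+1).
  rewrite (bigD1 ord_max) /=; last by apply/asboolP; exists z.
  by rewrite lerDl; apply: sumr_ge0 => i _; exact: ltW.
have c0 : 0 < w k `^ s^-1 by exact: powR_gt0.
have [j jc] := small _ c0.
have := wkj j; have -> : w k = (w k `^ s^-1) `^ s by rewrite -powRrM mulVf ?powRr1 ?(ltW wk) // gt_eqF.
move=> /(powR_lt_inv s0 (ltW c0)) h; have := h ltac:(by rewrite mulr_ge0 // ltW).
have : q * rr j <= 1 / 4 * rr j by rewrite ler_pM2r.
by have := rr0 j; lra.
Qed.

End Hausdorff.

Section Doubling.
Context {R : realType}.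

Definition approx_geodesic (X : metricType R) : Prop :=
  forall (y x : X) a e, 0 <= a -> a <= mdist y x -> 0 < e ->
    exists2 z, mdist y z = a & mdist z x <= mdist y x - a + e.

(** Doubling in packing form, uniform in the center [y] and in the scale [s]. Being scale invariant
    it passes to tangent cones, and from there to spaces of directions. *)
Definition ldoubling (X : metricType R) : Prop :=
  forall p : X, exists2 r : R, 0 < r & forall c, 0 < c -> exists N : nat,
    forall (y : X) s (f : nat -> X), mdist p y < r -> 0 < s -> s < r ->
      (forall i, (i < N)%N -> mdist y (f i) <= s) ->
      exists i j, [/\ (i < j)%N, (j < N)%N & mdist (f i) (f j) < c * s].

Lemma mdist_continuous (X : metricType R) (y : X) : continuous (mdist y : X -> R).
Proof.
move=> x; apply/cvgrPdist_lt => e e0.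
have : nbhs x (ball x e) by exact: nbhsx_ballx.
apply: filterS => u; rewrite /= ballEmdist /= => xu.
have := metric_triangle y x u; have := metric_triangle y u x.
by rewrite (metric_sym u) => *; rewrite ltr_norml; apply/andP; split; lra.
Qed.

Lemma intrinsic_approx (X : metricType R) : intrinsic X -> approx_geodesic X.
Proof.
move=> iX y x a e a0 ax e0.
have [E|a_neq] := eqVneq a 0; first by exists y; rewrite E ?mdistxx //; lra.
have [E|x_neq] := eqVneq a (mdist y x); first by exists x; rewrite E ?mdistxx //; lra.
have : ((mdist y x)%:E < (mdist y x + e)%:E)%E by rewrite lte_fin ltrDl.
rewrite {1}iX => /ereal_inf_lt[_ [c [cc c0 c1] <-] cl].
have fc : {within `[0, 1], continuous (fun t => mdist y (c t))}.
  by move=> t; apply: (continuous_comp (cc t) (@mdist_continuous _ y _)).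
have [|t t01 tE] := @IVT _ _ 0 1 a ler01 fc.
  rewrite c0 c1 mdistxx; have -> : Num.min 0 (mdist y x) = 0 by rewrite min_l ?mdist_ge0.
  by rewrite max_r ?mdist_ge0 // a0.
exists (c t) => //; move: t01; rewrite in_itv /= => /andP[t0 t1].
have t0' : 0 < t.
  by rewrite lt_neqAle t0 andbT; apply/eqP => E; move: tE a_neq; rewrite -E c0 mdistxx => ->; rewrite eqxx.
have t1' : t < 1.
  by rewrite lt_neqAle t1 andbT; apply/eqP => E; move: tE x_neq; rewrite E c1 => ->; rewrite eqxx.
have : ((mdist y (c t) + mdist (c t) x)%:E <= curve_length c)%E.
  apply: ereal_sup_ubound; exists [:: t; 1]; last by rewrite /= !big_ord_recl big_ord0 /= c0 c1 addr0.
  by rewrite /itv_partition /= t0' t1' eqxx.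
by move=> /le_lt_trans/(_ cl); rewrite lte_fin tE; lra.
Qed.

Section Contraction.
Context {X : metricType R} {k : R} {p : X} {r : R}.
Hypotheses (k0 : 0 < k) (F : fourpt k p r) (kr : k * r <= 1 / 2) (aX : approx_geodesic X).

(** A substitute for a point of a geodesic: as the excess of [z] over the distance of [y] and [x]
    tends to 0, the cosine at [z] tends to -1, and acos is continuous there. *)
Lemma approx_point (y x : X) a n : 0 < a -> a < mdist y x -> 0 < n ->
  exists z, [/\ mdist y z = a, mdist z x <= mdist y x - a + n &
    pi - acos (cH k (mdist z y) (mdist z x) (mdist y x)) <= n].
Proof.
move=> a0 ax n0; have l0 : 0 < mdist y x by exact: lt_trans ax.
have i1 : -1 <= (-1 : R) <= 1 by rewrite lexx /=; lra.
have [d d0 Hd] := acos_cont i1 n0; rewrite acosN1 in Hd.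
set l := mdist y x in ax l0 *.
have b0 : 0 < l - a by rewrite subr_gt0.
have Sa := sh_gt0 (mulr_gt0 k0 a0); have Sb := sh_gt0 (mulr_gt0 k0 b0).
pose e1 := d * (sh (k * a) * sh (k * (l - a))) / 2.
have e10 : 0 < e1 by rewrite !mulr_gt0.
have /cvgr_dist_lt/(_ _ e10) := @continuous_ch R (k * l).
move=> -[d' /= d'0 Hd'].
pose e := Num.min n (d' / k / 2).
have e0 : 0 < e by rewrite lt_min n0 !divr_gt0.
have [z yz zx] := aX (ltW a0) (ltW ax) e0; exists z; rewrite -/l in zx.
have en : e <= n by rewrite ge_min lexx.
have ed : e <= d' / k / 2 by rewrite ge_min lexx orbT.
have zx' : mdist z x <= l - a + n by apply: le_trans zx _; rewrite lerD2l.
split=> //; have zxl : l - a <= mdist z x.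
  by have := metric_triangle y z x; rewrite yz -/l; lra.
have zx0 : 0 < mdist z x by exact: lt_le_trans zxl.
have itv : -1 <= cH k (mdist z y) (mdist z x) l <= 1.
  apply: cH_itv; rewrite ?zx0 // (metric_sym z) yz //.
  by have := tri_mdist z y x; rewrite (metric_sym z y) yz.
suff h : `|-1 - cH k (mdist z y) (mdist z x) l| < d.
  by have := Hd _ itv h; rewrite ltr_norml => /andP[_ /ltW].
have Sz : sh (k * (l - a)) <= sh (k * mdist z x) by rewrite sh_ler ler_pM2l.
have -> : -1 - cH k (mdist z y) (mdist z x) l =
    - ((ch (k * a + k * mdist z x) - ch (k * l)) / (sh (k * a) * sh (k * mdist z x))).
  rewrite /cH (metric_sym z y) yz chD; field.
  by rewrite !gt_eqF // (lt_le_trans Sb).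
have SS := mulr_gt0 Sa Sb; have SS' : 0 < sh (k * a) * sh (k * mdist z x).
  by rewrite mulr_gt0 // (lt_le_trans Sb).
rewrite normrN normrM normrV ?unitfE ?gt_eqF // (gtr0_norm SS') ltr_pdivrMr //.
have : `|k * l - (k * a + k * mdist z x)| < d'.
  have -> : k * l - (k * a + k * mdist z x) = - (k * (mdist z x - (l - a))) by ring.
  have h : 0 <= mdist z x - (l - a) by lra.
  rewrite normrN ger0_norm ?mulr_ge0 ?(ltW k0) //.
  have : k * (mdist z x - (l - a)) <= k * (d' / k / 2) by rewrite ler_pM2l //; lra.
  have -> : k * (d' / k / 2) = d' / 2 by field; rewrite gt_eqF.
  lra.
move=> /Hd' /=; rewrite distrC => /lt_le_trans; apply.
rewrite /e1; apply: (@le_trans _ _ (d * (sh (k * a) * sh (k * (l - a))))).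
  by have := mulr_gt0 d0 SS; lra.
by rewrite !ler_pM2l.
Qed.

Lemma sh_small (x : R) : 0 <= x -> x <= 1 / 2 -> sh x <= 2 * x /\ ch x <= 2.
Proof.
move=> kx0 kx.
have c2 : ch (1 / 2 : R) <= 2.
  have h1 : 0 <= (1 / 2 : R) <= 1 / 2 by rewrite lexx andbT; lra.
  have h := sh_le h1; have := @ch2Bsh2 R (1/2); have := @ch_gt0 R (1/2).
  have : 0 <= sh (1 / 2 : R) by apply: sh_ge0; lra.
  by nra.
have cx : ch x <= 2 by apply: le_trans c2; rewrite ch_ler.
split=> //; have := @sh_le _ x x; rewrite kx0 lexx => /(_ isT) h.
by apply: le_trans h _; rewrite mulrC ler_wpM2r.
Qed.

End Contraction.

(* [b1], [b2]: what remains of the sides of lengths [l1], [l2] after cutting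
   [a] from both of them at their common vertex; [D] is the third side, [d] its
   contraction. *)
Lemma contraction_ineq (k a b1 b2 l1 l2 D d12 d s c n : R) :
  0 < k -> 0 < a -> 0 < s -> 0 < c -> 0 < n -> n <= c * s / 16 -> n <= s / 2 ->
  (2 + k) * n <= (k * a) ^+ 2 * (k * (c * s)) ^+ 2 / 8 ->
  3 * s * k <= 1 / 2 -> d * k <= 1 / 2 -> d12 * k <= 1 / 2 -> 0 <= d -> 0 <= d12 ->
  a < l1 -> a < l2 -> l1 <= 2 * s -> l2 <= 2 * s ->
  l1 <= a + b1 -> a + b1 <= l1 + n -> l2 <= a + b2 -> a + b2 <= l2 + n ->
  `|l1 - l2| <= c * s / 4 -> c * s <= D ->
  ch (k * l2) * sh (k * b1) + ch (k * D) * sh (k * a)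
   - n * (sh (k * d12) * sh (k * a) * sh (k * b1)) <= ch (k * d12) * sh (k * a + k * b1) ->
  ch (k * a) * sh (k * b2) + ch (k * d12) * sh (k * a)
   - n * (sh (k * d) * sh (k * a) * sh (k * b2)) <= ch (k * d) * sh (k * a + k * b2) ->
  c * a / 20 <= d.
Proof.
move=> k0 a0 s0 c0 n0 ncs ns nka sk dk d12k d0 d120 al1 al2 l1s l2s l1a l1b l2a l2b l12 cD.
have small x : 0 <= x -> x * k <= 1 / 2 ->
    [/\ 0 <= sh (k * x), sh (k * x) <= 2 * (k * x), sh (k * x) <= 1 & ch (k * x) <= 2].
  move=> x0 xk; have kx : k * x <= 1 / 2 by rewrite mulrC.
  have kx0 : 0 <= k * x by rewrite mulr_ge0 // ltW.
  have [h1 h2] := sh_small kx0 kx; have h3 := sh_ge0 kx0; split=> //; lrao h1 kx.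
have sz : s * k > 0 by exact: mulr_gt0.
have mk x y : x <= y -> x * k <= y * k by rewrite ler_pM2r.
have b10 : 0 <= b1 by lrao l1a al1.
have b20 : 0 <= b2 by lrao l2a al2.
have ak := mk _ _ (_ : a <= 3 * s). have {}ak := ak ltac:(lrao al1 l1s s0).
have b1k := mk _ _ (_ : b1 <= 3 * s). have {}b1k := b1k ltac:(lrao l1b l1s ns a0 s0).
have b2k := mk _ _ (_ : b2 <= 3 * s). have {}b2k := b2k ltac:(lrao l2b l2s ns a0 s0).
have L1k := mk _ _ (_ : a + b1 <= 3 * s). have {}L1k := L1k ltac:(lrao l1b l1s ns s0).
have L2k := mk _ _ (_ : a + b2 <= 3 * s). have {}L2k := L2k ltac:(lrao l2b l2s ns s0).
have [A0 A2 A1 _] := small a (ltW a0) (le_trans ak sk).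
have [B10 _ B11 _] := small b1 b10 (le_trans b1k sk).
have [B20 _ B21 _] := small b2 b20 (le_trans b2k sk).
have [S10 S12 S11 _] := small (a + b1) (addr_ge0 (ltW a0) b10) (le_trans L1k sk).
have [S20 S22 S21 C2] := small (a + b2) (addr_ge0 (ltW a0) b20) (le_trans L2k sk).
have [dz0 _ dz1 dz2] := small d d0 dk.
have [d12z0 _ d12z1 _] := small d12 d120 d12k.
rewrite -!mulrDr; set Y := ch (k * d) in dz2 *; set S1 := sh (k * (a + b1)) in S10 S12 S11 *.
set S2 := sh (k * (a + b2)) in S20 S22 S21 *; set C12 := ch (k * d12).
have chl2 : ch (k * (a + b2)) - k * n <= ch (k * l2).
  have [->|l2ab] := eqVneq l2 (a + b2); first by have kn := mulr_gt0 k0 n0; lrao kn.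
  have lt : k * l2 < k * (a + b2) by rewrite ltr_pM2l // lt_neqAle l2ab.
  have [e /andP[e1 e2] E] := MVTd is_derive_ch lt.
  have : sh e <= 1 by apply: le_trans S21; rewrite /S2 sh_ler; exact: ltW.
  have : k * (a + b2) - k * l2 <= k * n by rewrite -mulrBr ler_pM2l //; lrao l2b.
  have : 0 <= sh e by apply: sh_ge0; apply: ltW; apply: le_lt_trans e1; rewrite mulr_ge0 ?(ltW k0) //; lrao al2 a0.
  by move: E lt; clear; nra.
(* The configuration in which both sides lie on one line, so that [d = 0]: there the two Stewart
   inequalities without defect are equalities. Subtracting it leaves [Y - 1]. *)
have id : ch (k * a) * sh (k * b2) * S1 + sh (k * a) * ch (k * (a + b2)) * sh (k * b1)
    + sh (k * a) ^+ 2 * ch (k * (a + b1) - k * (a + b2)) = S1 * S2.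
  rewrite /S1 /S2 !mulrDr chB !chD !shD.
  have := ch2Bsh2 (k * a).
  move: (ch (k * a)) (sh (k * a)) (ch (k * b1)) (sh (k * b1)) (ch (k * b2)) (sh (k * b2)).
  move=> ca sa cb1 sb1 cb2 sb2; clear => E1; apply/eqP; rewrite -subr_eq0.
  rewrite [X in X == 0](_ : _ = sa ^+ 2 * (cb1 * cb2 - sb1 * sb2) * (ca ^+ 2 - sa ^+ 2 - 1)).
    by rewrite E1 subrr mulr0.
  by ring.
rewrite -/S1 -/S2 -/Y -/C12 => I1 I2.
have A_ge : k * a <= sh (k * a) by apply: sh_ge; rewrite mulr_ge0 // ltW.
have I1' : ch (k * l2) * sh (k * b1) + ch (k * D) * sh (k * a) - n <= C12 * S1.
  apply: le_trans I1; rewrite lerD2l lerN2 ler_piMr ?(ltW n0) //.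
  by rewrite mulr_ile1 ?mulr_ile1 ?mulr_ge0.
have I2' : ch (k * a) * sh (k * b2) + C12 * sh (k * a) - n <= Y * S2.
  apply: le_trans I2; rewrite lerD2l lerN2 ler_piMr ?(ltW n0) //.
  by rewrite mulr_ile1 ?mulr_ile1 ?mulr_ge0.
have kn0 : 0 < k * n by exact: mulr_gt0.
(* Eliminating [C12] between the two Stewart inequalities: contraction towards the common vertex
   keeps the fraction [sh (k * a) ^+ 2 / (S1 * S2)] of what [ch (k * D)] has in excess over two
   overlapping sides. *)
have key : sh (k * a) ^+ 2 * (ch (k * D) - ch (k * (a + b1) - k * (a + b2)))
    - (2 + k) * n <= (Y - 1) * (S1 * S2).
  have J2 := ler_wpM2r S10 I2'.
  have J1 := ler_wpM2r A0 I1'.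
  have J3 := ler_wpM2r (mulr_ge0 A0 B10) chl2.
  have e1 : n * S1 <= n by rewrite ler_piMr // ltW.
  have e2 : n * sh (k * a) <= n by rewrite ler_piMr // ltW.
  have e3 : k * n * (sh (k * a) * sh (k * b1)) <= k * n.
    by rewrite ler_piMr ?(ltW kn0) // mulr_ile1.
  rewrite mulrBl mul1r; move: id J1 J2 J3 e1 e2 e3; clear.
  by lra.
pose E := k * (c * s); have E0 : 0 < E by rewrite !mulr_gt0.
(* The ends are at least [c * s] apart, whereas the prolonged sides differ by at most half of that
   ([LE]); so the excess is quadratic in [E]. *)
have hE : E ^+ 2 * (3 / 8) <= ch E - ch (E / 2).
  have -> : ch E = 2 * ch (E / 2) ^+ 2 - 1.
    rewrite {1}(splitr E) chD; have := ch2Bsh2 (E / 2); rewrite -!expr2; lra.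
  have h1 := ch_ge (E / 2); have -> : E ^+ 2 * (3 / 8) = (E / 2) ^+ 2 / 2 * 3 by field.
  by have h2 := sqr_ge0 (ch (E / 2) - 1); lrao h1 h2.
have DE : ch E <= ch (k * D).
  by rewrite ch_ler ?(ltW E0) ?ler_pM2l // mulr_ge0 ?(ltW k0) // (le_trans _ cD) // mulr_ge0 // ltW.
have LE : ch (k * (a + b1) - k * (a + b2)) <= ch (E / 2).
  rewrite -ch_abs ch_ler ?divr_ge0 ?(ltW E0) // -mulrBr normrM (gtr0_norm k0).
  rewrite /E -mulrA ler_pM2l //; move: l12; rewrite !ler_norml => /andP[h1 h2].
  have cs0 := mulr_gt0 c0 s0.
  by apply/andP; split; [lrao l1a l2b ncs h1 cs0|lrao l1b l2a ncs h2 cs0].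
have low : (k * a) ^+ 2 * (E ^+ 2 * (3 / 8)) <=
    sh (k * a) ^+ 2 * (ch (k * D) - ch (k * (a + b1) - k * (a + b2))).
  have ka0 : 0 <= k * a by rewrite mulr_ge0 // ltW.
  apply: ler_pM; rewrite ?sqr_ge0 ?ler_sqr ?nnegrE //.
    by rewrite mulr_ge0 ?sqr_ge0.
  by lrao hE DE LE.
have up : (Y - 1) * (S1 * S2) <= 2 * (k * d) ^+ 2 * (36 * (k * s) ^+ 2).
  have h1 : Y - 1 <= 2 * (k * d) ^+ 2.
    have dk0 : 0 <= k * d <= k * d by rewrite lexx andbT mulr_ge0 // ltW.
    apply: le_trans (ch_le dk0) _; rewrite -/Y.
    have := ch_gt0 (k * d); rewrite -/Y => Y0; have s2 := sqr_ge0 (k * d).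
    have Y4 : Y ^+ 2 <= 4 by nrao Y0 dz2.
    by have h := ler_wpM2l s2 Y4; lrao h.
  have h2 : S1 * S2 <= 36 * (k * s) ^+ 2.
    have -> : 36 * (k * s) ^+ 2 = (6 * (k * s)) * (6 * (k * s)) by ring.
    by apply: ler_pM => //; [lrao S12 L1k|lrao S22 L2k].
  apply: ler_pM => //; last exact: mulr_ge0.
  by rewrite subr_ge0 ch_ge1.
have fin : (c * a) ^+ 2 <= 288 * d ^+ 2.
  have p0 : 0 < k ^+ 4 * s ^+ 2 / 4 by rewrite divr_gt0 // mulr_gt0 // exprn_gt0.
  rewrite -(ler_pM2l p0).
  have -> : k ^+ 4 * s ^+ 2 / 4 * (c * a) ^+ 2 = (k * a) ^+ 2 * E ^+ 2 / 4 by rewrite /E; field.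
  have -> : k ^+ 4 * s ^+ 2 / 4 * (288 * d ^+ 2) = 2 * (k * d) ^+ 2 * (36 * (k * s) ^+ 2) by field.
  by move: nka; rewrite -/E => nka; lrao up low key nka.
have ca0 : 0 <= c * a by rewrite mulr_ge0 // ltW.
rewrite -ler_sqr ?nnegrE ?divr_ge0 // expr_div_n; have d2 := sqr_ge0 d.
by lrao fin d2.
Qed.

End Doubling.

Lemma pigeonhole_seq (M B N : nat) (h : nat -> nat) :
  (forall i, (i < M)%N -> (h i < B)%N) -> (B * N < M)%N ->
  exists (b : nat) (g : nat -> nat),
    (forall i, (i <= N)%N -> (g i < M)%N /\ h (g i) = b) /\
    (forall i j, (i < j)%N -> (j <= N)%N -> (g i < g j)%N).
Proof.
move=> hB BN; pose s b := [seq i <- iota 0 M | h i == b].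
have [b Hb] : exists b, (N < size (s b))%N.
  apply: contrapT => /forallNP H; move: BN; apply/negP; rewrite -leqNgt.
  have : (\sum_(b < B) count (fun i => h i == b) (iota 0 M) = M)%N.
    rewrite -[RHS](size_iota 0 M).
    have : all (fun i => h i < B)%N (iota 0 M).
      by apply/allP => i; rewrite mem_iota add0n => /hB.
    elim: (iota 0 M) => [|i l IH] /=; first by rewrite big1.
    move=> /andP[iB /IH El]; rewrite big_split /= El.
    rewrite (bigD1 (Ordinal iB)) //= eqxx big1 ?addn0 // => j jB.
    by case: eqP => // E; move: jB; rewrite -val_eqE /= E eqxx.
  move=> {1}<-; rewrite -[X in (X * N)%N]card_ord -sum_nat_const; apply: leq_sum => b _.
  by have := H b; rewrite /s size_filter => /negP; rewrite -leqNgt.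
exists b, (nth 0%N (s b)); split=> [i iN|i j ij jN].
  have : nth 0%N (s b) i \in s b by rewrite mem_nth // (leq_ltn_trans iN).
  by rewrite mem_filter mem_iota add0n => /andP[/eqP].
have := sorted_ltn_nth ltn_trans 0%N (_ : sorted ltn (s b)).
move=> /(_ _)/(_ i j); rewrite !inE (leq_ltn_trans jN) // (ltn_trans ij) ?(leq_ltn_trans jN) //.
apply=> //; exact: (sorted_filter ltn_trans _ (iota_ltn_sorted 0 M)).
Qed.

Section LocalDoubling.
Context {R : realType}.

(** Suppose some ball of radius [s] contains [B * N + 1] points pairwise [c * s] apart. Around any
    [y] in it, [N] of them have almost the same distance from [y], and contracting these to distance
    [a] from [y] gives [N] separated points in the ball of radius [rho] around [y]. This works at
    every [y] and [rho], so a tree with [N] children per ball and ratio [q] exists, and the measure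
    for the exponent [s0] cannot vanish. *)
Lemma ldoubling_of_dim (X : metricType R) (s0 : R) : complete_space X -> curv4 X ->
  approx_geodesic X -> 0 < s0 -> hausdorff_measure s0 [set: X] = 0%E -> ldoubling X.
Proof.
move=> cX c4 aX s00 H0 p; have [k [r0 [k0 r00 F]]] := curv4_fourpt p c4.
pose r := Num.min (r0 / 4) (1 / (6 * k)).
have r_gt0 : 0 < r by rewrite lt_min !divr_gt0 // mulr_gt0.
have r4 : 4 * r <= r0 by have : r <= r0 / 4 by [rewrite ge_min lexx]; lra.
have kr : 3 * r * k <= 1 / 2.
  have : r <= 1 / (6 * k) by rewrite ge_min lexx orbT.
  rewrite ler_pdivlMr ?mulr_gt0 // => h; lrao h.
exists r => // c1 c10; pose c := Num.min c1 1.
have c0 : 0 < c by rewrite lt_min c10 ltr01.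
have cc1 : c <= c1 by rewrite ge_min lexx.
have c_1 : c <= 1 by rewrite ge_min lexx orbT.
(* By [contraction_ineq] the children are [c * a / 20] apart, where [a = c * rho / 4]; this is
   [4 * (q * rho)] for the present [q]. *)
pose q := c ^+ 2 / 320; have c2 : 0 < c ^+ 2 by rewrite exprn_gt0.
have q0 : 0 < q by apply: divr_gt0; rewrite ?ltr0n.
have q4 : q <= 1 / 4.
  have : c ^+ 2 <= 1 by rewrite expr_le1 // ltW.
  by rewrite /q => h; lrao h.
have [N0 HN0] : exists N, (q `^ s0)^-1 <= N%:R :> R.
  by exists (Num.bound (q `^ s0)^-1); apply: ltW; apply: archi_boundP; rewrite invr_ge0 powR_ge0.
pose N := N0.+1.
have HN : 1 <= N%:R * q `^ s0.
  rewrite -ler_pdivrMr ?powR_gt0 // div1r; apply: le_trans HN0 _.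
  by rewrite ler_nat leqnSn.
pose B := (Num.bound (8 / c)).+1.
have HB : 8 / c < B%:R.
  apply: (@lt_le_trans _ _ (Num.bound (8 / c))%:R); last by rewrite ler_nat leqnSn.
  by apply: archi_boundP; rewrite divr_ge0 // ltW.
exists (B * N).+1 => y0 s f py0 s_gt0 sr fs; apply: contrapT => H.
have sep i j : (i < j)%N -> (j < (B * N).+1)%N -> c * s <= mdist (f i) (f j).
  move=> ij jM; apply: (@le_trans _ _ (c1 * s)); first by rewrite ler_pM2r.
  by rewrite leNgt; apply/negP => h; apply: H; exists i, j.
pose good (y : X) (rho : R) := mdist y0 y + rho <= s.
apply: (@tree_hausdorff_measure _ X q s0 N good y0 s) H0 => //; last first.
  by rewrite /good mdistxx add0r.
move=> y rho rho0 gy.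
have y0y : mdist y0 y <= s by move: gy; rewrite /good => h; lrao h rho0.
have rhos : rho <= s by move: gy (mdist_ge0 y0 y); rewrite /good => h h'; lrao h h'.
(* Annuli of width [c * s / 4] around [y]: fewer than [B] of them reach the distance [2 * s], which
   no point exceeds. Inside one annulus the sides differ by at most the amount that the contraction
   tolerates. *)
pose bin i := Num.truncn (mdist y (f i) / (c * s / 4)).
have cs4 : 0 < c * s / 4 by rewrite divr_gt0 // mulr_gt0.
have l2s i : (i < (B * N).+1)%N -> mdist y (f i) <= 2 * s.
  by move=> /fs h; have h' := metric_triangle y y0 (f i); rewrite (metric_sym y y0) in h'; lrao h h' y0y.
have binP i : (bin i)%:R * (c * s / 4) <= mdist y (f i) < (bin i).+1%:R * (c * s / 4).
  have /truncn_itv : 0 <= mdist y (f i) / (c * s / 4) by rewrite divr_ge0 ?mdist_ge0 // ltW.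
  by rewrite ler_pdivlMr // ltr_pdivrMr.
have [b [g [gP gm]]] : exists (b : nat) (g : nat -> nat),
    (forall i, (i <= N)%N -> (g i < (B * N).+1)%N /\ bin (g i) = b) /\
    (forall i j, (i < j)%N -> (j <= N)%N -> (g i < g j)%N).
  apply: (@pigeonhole_seq _ B) => // i iM; rewrite -(ltr_nat R).
  apply: le_lt_trans HB; rewrite ler_pdivlMr // -(ler_pM2r s_gt0).
  have /andP[h _] := binP i; have h' := l2s i iM; lrao h h'.
have lN i : (i < N)%N -> c * s / 2 <= mdist y (f (g i)).
  move=> iN; have [gi bi] := gP i (ltnW iN); have /andP[h _] := binP (g i).
  (* The two innermost annuli form a ball of radius [c * s / 2], which cannot contain two points
     that are [c * s] apart. *)
  have [b2|b2] := leqP 2 b.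
    have : 2 * (c * s / 4) <= (bin (g i))%:R * (c * s / 4) by rewrite bi ler_pM2r // ler_nat.
    by move=> h'; lrao h h'.
  exfalso; have [g0 b0] := gP 0%N isT; have [g1 b1] := gP 1%N isT.
  have := sep _ _ (gm 0%N 1%N isT isT) g1.
  have := metric_triangle (f (g 0%N)) y (f (g 1%N)); rewrite (metric_sym _ y).
  have /andP[_ h0] := binP (g 0%N); have /andP[_ h1] := binP (g 1%N).
  have u i' : bin (g i') = b -> (bin (g i')).+1%:R * (c * s / 4) <= 2 * (c * s / 4).
    by move=> ->; rewrite ler_pM2r // ler_nat.
  by have := u _ b0; have := u _ b1 => u1 u0 t1 t2; lrao h0 h1 u1 u0 t1 t2.
pose a := c * rho / 4; have a0 : 0 < a by rewrite divr_gt0 // mulr_gt0.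
have a_cs : a <= c * s / 4 by rewrite /a ler_pM2r // ler_pM2l.
have a_s : a <= s / 4.
  by apply: le_trans a_cs _; rewrite ler_pM2r // ler_piMl // ltW.
have al i : (i < N)%N -> a < mdist y (f (g i)).
  by move=> /lN h; lrao h a_cs cs4.
pose n := Num.min (Num.min (c * s / 16) (s / 2))
  ((k * a) ^+ 2 * (k * (c * s)) ^+ 2 / 8 / (2 + k)).
have n0 : 0 < n.
  have cs0 := mulr_gt0 c0 s_gt0; have ka0 := mulr_gt0 k0 a0; have kcs0 := mulr_gt0 k0 cs0.
  have k20 : 0 < 2 + k by rewrite addr_gt0.
  have pp : 0 < (k * a) ^+ 2 * (k * (c * s)) ^+ 2 by rewrite mulr_gt0 // exprn_gt0.
  by rewrite !lt_min; apply/andP; split; [apply/andP; split|]; rewrite !divr_gt0.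
have ncs : n <= c * s / 16 by rewrite !ge_min lexx.
have ns : n <= s / 2 by rewrite !ge_min lexx !orbT.
have nk : (2 + k) * n <= (k * a) ^+ 2 * (k * (c * s)) ^+ 2 / 8.
  by rewrite mulrC -ler_pdivlMr ?addr_gt0 // !ge_min lexx !orbT.
have /choice[z zP] : forall i, exists z, (i < N)%N -> [/\ mdist y z = a,
    mdist z (f (g i)) <= mdist y (f (g i)) - a + n &
    pi - acos (cH k (mdist z y) (mdist z (f (g i))) (mdist y (f (g i)))) <= n].
  move=> i; have [iN|//] := ltnP i N; last by exists y.
  by have [z zP] := approx_point k0 aX a0 (al i iN) n0; exists z.
exists z; split=> [i iN|i j ij jN].
  have [yz _ _] := zP i iN; rewrite yz; split; last first.
    by rewrite /a ler_pdivrMr //; have := ler_wpM2r (ltW rho0) c_1; lra.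
  move: gy; rewrite /good => gy; have := metric_triangle y0 y (z i); rewrite yz.
  have h1 := ler_wpM2r (ltW rho0) c_1; have h2 := ler_wpM2r (ltW rho0) q4.
  by rewrite /a => h3; lrao gy h1 h2 h3 rho0.
have iN := ltn_trans ij jN.
have [yzi zi hi] := zP i iN; have [yzj zj hj] := zP j jN.
have [gi bi] := gP i (ltnW iN); have [gj bj] := gP j (ltnW jN).
have -> : 4 * (q * rho) = c * a / 20 by rewrite /q /a; field.
have py : mdist p y < 2 * r.
  have h := metric_triangle p y0 y; lrao h py0 y0y sr.
have pf i' : (i' < (B * N).+1)%N -> mdist p (f i') < r0.
  move=> /fs h; have h' := metric_triangle p y0 (f i'); lrao h h' py0 sr r4 r_gt0.
have pz i' : mdist y (z i') = a -> mdist p (z i') < r0.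
  move=> h; have h' := metric_triangle p y (z i'); rewrite h in h'; lrao h' py a_s sr r4 r_gt0.
have py' : mdist p y < r0 by lrao py r4 r_gt0.
have yf i' : (i' < N)%N -> y != f (g i').
  by move=> /al h; rewrite -mdist_gt0 (lt_trans a0).
have d3 u v : mdist u v <= 3 * s -> mdist u v * k <= 1 / 2.
  move=> h; apply: le_trans kr; rewrite ler_pM2r //; lrao h sr.
have st1 := stewart_defect k0 F py' (pf _ gi) (pz _ yzi) (pf _ gj) (ltW n0) (yf i iN) (fun _ _ => hi).
have st2 := stewart_defect k0 F py' (pf _ gj) (pz _ yzj) (pz _ yzi) (ltW n0) (yf j jN) (fun _ _ => hj).
move: st1 st2; rewrite (metric_sym (z i) y) (metric_sym (z j) y) yzi yzj.
rewrite (metric_sym (f (g j)) y) (metric_sym (f (g j)) (f (g i))) (metric_sym (z j) (z i)).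
have tri1 := metric_triangle y (z i) (f (g i)); have tri2 := metric_triangle y (z j) (f (g j)).
rewrite yzi in tri1; rewrite yzj in tri2.
apply: (@contraction_ineq R k a _ _ (mdist y (f (g i))) (mdist y (f (g j)))) ncs ns nk _ _ _ _ _ _ _ _ _ _ _ _ _ _ _ => //.
- by apply: le_trans kr; rewrite ler_pM2r //; lrao sr.
- apply: d3; have h := metric_triangle (z i) y (z j).
  by rewrite (metric_sym (z i) y) yzi yzj in h; lrao h a_s s_gt0.
- apply: d3; have h := metric_triangle (z i) y (f (g j)).
  by have h' := l2s _ gj; rewrite (metric_sym (z i) y) yzi in h; lrao h h' a_s s_gt0.
- exact: mdist_ge0.
- exact: mdist_ge0.
- exact: al.
- exact: al.
- exact: l2s.
- exact: l2s.
- by lrao zi.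
- by lrao zj.
- have := binP (g i); have := binP (g j); rewrite bi bj -natr1 => /andP[h1 h2] /andP[h3 h4].
  by rewrite ler_norml; apply/andP; split; [lrao h2 h3|lrao h1 h4].
- by apply: sep => //; exact: gm ij (ltnW jN).
Qed.

End LocalDoubling.

(** * Hopf-Rinow *)

Section Proper.
Context {R : realType}.

Definition proper_space (X : metricType R) : Prop :=
  forall (w : nat -> X) (x : X) (r : R), oou [set n | mdist x (w n) <= r] ->
    exists y, utends w y.

Lemma ldoubling_local (X : metricType R) (p : X) : complete_space X -> ldoubling X ->
  exists2 r : R, 0 < r & forall w : nat -> X, oou [set n | mdist p (w n) <= r] ->
    exists y, utends w y.
Proof.
move=> cX /(_ p)[r r0 D]; exists (r / 2) => [|w]; first by rewrite divr_gt0.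
apply: (@tbounded_utends _ _ [set y | mdist p y <= r / 2] w cX) => e e0.
have r20 : 0 < r / 2 by rewrite divr_gt0.
have [N HN] := D (e / (r / 2)) (divr_gt0 e0 r20); exists N => f fN.
have := HN p (r / 2) f; rewrite mdistxx divfK ?gt_eqF //; apply=> //.
by lra.
Qed.

(** Let [rho] be the supremum of the radii of balls around [x] in which sequences converge along
    [oou]. Points at distance [rho] are approximated by slightly closer ones, so [rho] itself is
    such a radius; local compactness is then uniform on that ball, and [rho + d / 2] would be such a
    radius too. *)
Lemma hopf_rinow (X : metricType R) : complete_space X -> approx_geodesic X ->
  ldoubling X -> proper_space X.
Proof.
move=> cX aX dX w0 x r1 H1; apply: contrapT => Hw0.
pose UC x r := forall w : nat -> X, oou [set n | mdist x (w n) <= r] -> exists y, utends w y.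
have UCle y r r' : r' <= r -> UC y r -> UC y r'.
  by move=> rr H w wr; apply: H; apply: (oou_imply _ wr) => n /le_trans; apply.
have loc y : exists2 r, 0 < r & UC y r by exact: ldoubling_local.
pose A := [set r | 0 <= r /\ UC x r].
have Aub : ubound A r1.
  move=> r [r_ge0 ur]; rewrite leNgt; apply/negP => rr1; apply: Hw0.
  by apply: (UCle _ _ _ (ltW rr1) ur).
have [r0 r00 ur0] := loc x.
have hA : has_sup A by split; [exists r0; split => //; exact: ltW|exists r1].
pose rho := sup A.
have rho0 : 0 < rho.
  apply: (lt_le_trans r00); apply: ub_le_sup; first exact: (proj2 hA).
  by split; [exact: ltW|exact: ur0].
have near_pt a y e : 0 <= a -> 0 < e -> mdist x y <= a + e -> exists2 z, mdist x z <= a & mdist z y <= e + e.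
  move=> a0 e0 xy; have [ya|ay] := leP (mdist x y) a.
    by exists y; rewrite ?mdistxx // addr_ge0 // ltW.
  have [z xz zy] := aX _ _ _ _ a0 (ltW ay) e0; exists z; rewrite ?xz //.
  by lrao zy xy.
have urho : UC x rho.
  move=> w wr; apply: complete_utends => // e e0.
  pose b := Num.min (e / 4) (rho / 2).
  have b0 : 0 < b by rewrite lt_min !divr_gt0.
  have be : b <= e / 4 by rewrite ge_min lexx.
  have br : b <= rho / 2 by rewrite ge_min lexx orbT.
  have [s [s0 us] bs] := sup_adherent b0 hA.
  have us' : UC x (rho - b) by apply: (UCle _ _ _ (ltW bs)).
  have /choice[w' w'P] : forall n, exists z, mdist x (w n) <= rho ->
      mdist x z <= rho - b /\ mdist z (w n) <= b + b.
    move=> n; have [h|h] := leP (mdist x (w n)) rho; last by exists x; lra.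
    have rb : 0 <= rho - b by lrao br rho0.
    have [|z z1 z2] := near_pt (rho - b) (w n) b rb b0; first by rewrite subrK.
    by exists z.
  have [|y w'y] := us' w'; first by apply: (oou_imply _ wr) => n /w'P[].
  have b20 : 0 < e / 2 by rewrite divr_gt0.
  exists y; apply: filterS2 wr (utendsP w'y b20) => n /= /w'P[_ h1] h2.
  have := metric_triangle y (w' n) (w n); rewrite (metric_sym y (w' n)) => h3.
  by lrao h1 h2 h3 be.
have [d d0 Hd] : exists2 d, 0 < d & forall y, mdist x y <= rho -> UC y d.
  apply: contrapT => /forall2NP H.
  have /choice[y yP] : forall n : nat, exists y, mdist x y <= rho /\ ~ UC y (n.+1%:R^-1).
    move=> n; have [|] := H (n.+1%:R^-1); first by rewrite invr_gt0 ltr0n.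
    by move=> /existsNP[y /not_implyP[? ?]]; exists y.
  have [|z yz] := urho y; first by apply: oou_all => n; case: (yP n).
  have [r r_gt0 ur] := loc z; have r20 : 0 < r / 2 by rewrite divr_gt0.
  have := filter_ex (filterI (utendsP yz r20) (ulim0P inv_ulim0 r20)).
  move=> [n [/= h1]]; rewrite ger0_norm ?invr_ge0 // => h2.
  have [_] := yP n; apply=> w wr; apply: ur; apply: (oou_imply _ wr) => m /= h3.
  have := metric_triangle z (y n) (w m); rewrite (metric_sym z (y n)) => h4.
  by have h5 := le_lt_trans h3 h2; lrao h1 h5 h4.
suff : A (rho + d / 2).
  by move=> /(ub_le_sup (proj2 hA)); rewrite -/rho; lra.
split; first by rewrite addr_ge0 ?divr_ge0 // ltW.
move=> w wr; have d20 : 0 < d / 2 by rewrite divr_gt0.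
have /choice[z zP] : forall n, exists z, mdist x (w n) <= rho + d / 2 ->
    mdist x z <= rho /\ mdist z (w n) <= d / 2 + d / 2 - d / 8.
  move=> n; have [h|h] := leP (mdist x (w n)) (rho + d / 2); last by exists x; lra.
  have [ya|ay] := leP (mdist x (w n)) rho.
    by exists (w n) => _; rewrite mdistxx; split=> //; lrao d0.
  have d80 : 0 < d / 8 by rewrite divr_gt0.
  have [z xz zy] := aX _ _ _ _ (ltW rho0) (ltW ay) d80; exists z => _.
  by rewrite xz lexx; split=> //; lrao zy h d0.
have [|y zy] := urho z; first by apply: (oou_imply _ wr) => n /zP[].
have xy : mdist x y <= rho.
  apply: (ulim_le (utends_mdist (utends_cst x) zy) (@ulim_cst R rho)).
  by apply: (oou_imply _ wr) => n /zP[].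
apply: (Hd y xy); have d80 : 0 < d / 8 by rewrite divr_gt0.
apply: filterS2 wr (utendsP zy d80) => n /= /zP[_ h1] h2.
have := metric_triangle y (z n) (w n); rewrite (metric_sym y (z n)) => h3.
by lrao h1 h2 h3.
Qed.

Lemma between_point (X : metricType R) (x y : X) (a : R) : proper_space X ->
  approx_geodesic X -> 0 <= a -> a <= mdist x y ->
  exists z, mdist x z = a /\ mdist z y = mdist x y - a.
Proof.
move=> pX aX a0 ay.
have /choice[z zP] : forall n : nat, exists z, mdist x z = a /\
    mdist z y <= mdist x y - a + n.+1%:R^-1.
  move=> n; have [|z z1 z2] := aX x y a (n.+1%:R^-1) a0 ay; last by exists z.
  by rewrite invr_gt0 ltr0n.
have [|z0 zz] := pX z x a; first by apply: oou_all => n /=; case: (zP n) => ->.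
exists z0; have xz : mdist x z0 = a.
  apply: (ulim_uniq (utends_mdist (utends_cst x) zz)).
  by apply: ulim_eq (@ulim_cst R a); apply: oou_all => n; case: (zP n).
split=> //; apply/eqP; rewrite eq_le; apply/andP; split; last first.
  by have := metric_triangle x z0 y; rewrite xz; lra.
have h : (fun n => mdist x y - a + n.+1%:R^-1) @ oou --> mdist x y - a.
  rewrite -[X in _ --> X]addr0; apply: cvgD; [exact: ulim_cst|exact: inv_ulim0].
apply: (ulim_le (utends_mdistl zz) h).
by apply: oou_all => n /=; case: (zP n).
Qed.

(* Chains of n consecutive points at distance d / n converge to a geodesic. *)
Lemma geodesic_of_between (X : metricType R) (x y : X) :
  (forall w : nat -> X, (forall n, mdist x (w n) <= mdist x y) -> exists z, utends w z) ->
  (forall z a, mdist x z + mdist z y = mdist x y -> 0 <= a -> a <= mdist z y ->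
     exists z', mdist z z' = a /\ mdist z' y = mdist z y - a) ->
  exists c : R -> X, [/\ c 0 = x, c (mdist x y) = y &
    forall s t, 0 <= s -> s <= t -> t <= mdist x y -> mdist (c s) (c t) = t - s].
Proof.
move=> cX btw; set d := mdist x y; have d0 : 0 <= d by exact: mdist_ge0.
have [d_eq0|d_neq0] := eqVneq d 0.
  exists (fun _ => x); split=> //; first by rewrite (mdist0_eq d_eq0).
  by rewrite d_eq0 => s t s0 st t0; rewrite mdistxx; lra.
have d_gt0 : 0 < d by rewrite lt_neqAle eq_sym d_neq0.
have chain n : exists f : nat -> X, [/\ f 0%N = x, forall i, (i <= n.+1)%N ->
      mdist x (f i) <= d /\ mdist (f i) y = d - i%:R * (d / n.+1%:R) & forall i j, (i <= j)%N -> (j <= n.+1)%N ->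
      mdist (f i) (f j) = (j - i)%:R * (d / n.+1%:R)].
  set h := d / n.+1%:R; have h0 : 0 < h by rewrite divr_gt0 // ltr0n.
  have nh : n.+1%:R * h = d by rewrite /h mulrC divfK // pnatr_eq0.
  have /choice[nx nxP] : forall z, exists z', mdist x z + mdist z y = d -> h <= mdist z y ->
      mdist z z' = h /\ mdist z' y = mdist z y - h.
    move=> z; have [E|] := pselect (mdist x z + mdist z y = d); last by exists x.
    have [hz|] := leP h (mdist z y); last by exists x => //; lra.
    by have [z' z'P] := btw z h E (ltW h0) hz; exists z'.
  pose f i := iter i nx x; exists f.
  have ih i j : (i <= j)%N -> i%:R * h <= j%:R * h :> R by move=> ij; rewrite ler_pM2r // ler_nat.
  have fP i : (i <= n.+1)%N -> mdist x (f i) = i%:R * h /\ mdist (f i) y = d - i%:R * h.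
    elim: i => [|i IH] iN; first by rewrite /f /= mdistxx mul0r subr0.
    have [h1 h2] := IH (ltnW iN); have := ih _ _ iN; rewrite nh -natr1 => h3.
    have [|| h4 h5] := nxP (f i); [by rewrite h1 h2; lra|by rewrite h2; lra|].
    have -> : f i.+1 = nx (f i) by [].
    have t1 := metric_triangle x (f i) (nx (f i)); have t2 := metric_triangle x (nx (f i)) y.
    by rewrite -/d in t2; split; lra.
  split=> // [i iN|i j ij jN].
    by have [-> ->] := fP i iN; split => //; rewrite -[leRHS]nh; exact: ih.
  have iN := leq_trans ij jN; have [h1 h2] := fP i iN; have [h3 h4] := fP j jN.
  have := metric_triangle (f i) (f j) y; rewrite h2 h4 => t1.
  rewrite natrB // mulrBl; apply/eqP; rewrite eq_le; apply/andP; split; last by lra.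
  elim: j ij jN {h3 h4 t1} => [|j IHj]; first by rewrite leqn0 => /eqP -> _; rewrite mdistxx subrr.
  rewrite leq_eqVlt => /orP[/eqP -> _|]; first by rewrite mdistxx subrr.
  rewrite ltnS => ij jN; have := IHj ij (ltnW jN); have [_ h5] := fP j (ltnW jN).
  have := ih _ _ jN; rewrite nh -natr1 => h6.
  have [h7 _] := fP j (ltnW jN).
  have [||h8 _] := nxP (f j); [by rewrite h7 h5; lra|by rewrite h5; lra|].
  have := metric_triangle (f i) (f j) (f j.+1); have -> : f j.+1 = nx (f j) by [].
  by rewrite h8; lra.
have /choice[f fP] := chain.
(* The minimum acts only for [t > d]; it keeps all points in the ball, so that the limit [c t]
   exists for every real [t]. *)
pose ix n t := minn (Num.truncn (t / (d / n.+1%:R))) n.+1.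
have ixP n t : 0 <= t -> t <= d -> (ix n t)%:R * (d / n.+1%:R) <= t < ((ix n t)%:R + 1) * (d / n.+1%:R).
  move=> t0 td; have h0 : 0 < d / n.+1%:R by rewrite divr_gt0 // ltr0n.
  have : 0 <= t / (d / n.+1%:R) by rewrite divr_ge0 // ltW.
  move=> /truncn_itv; rewrite ler_pdivlMr // ltr_pdivrMr // -[(Num.truncn _).+1%:R]natr1 => /andP[h1 h2].
  have le_n : (Num.truncn (t / (d / n.+1%:R)) <= n.+1)%N.
    have nE : n.+1%:R * (d / n.+1%:R) = d by rewrite mulrC divfK // pnatr_eq0.
    have h3 : (Num.truncn (t / (d / n.+1%:R)))%:R * (d / n.+1%:R) <= n.+1%:R * (d / n.+1%:R).
      by rewrite nE; exact: le_trans td.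
    by move: h3; rewrite ler_pM2r // ler_nat.
  by rewrite /ix (minn_idPl le_n) h1.
have /choice[c cP] : forall t, exists z, utends (fun n => f n (ix n t)) z.
  move=> t; apply: cX => n; by have [_ H _] := fP n; have [] := H (ix n t) (geq_minr _ _).
have fend n i : (i <= n.+1)%N -> mdist (f n i) y = d - i%:R * (d / n.+1%:R).
  by move=> iN; have [_ H _] := fP n; case: (H _ iN).
exists c.
have ciso s t : 0 <= s -> s <= t -> t <= d -> mdist (c s) (c t) = t - s.
  move=> s0 st td; apply: (ulim_uniq (utends_mdist (cP s) (cP t))).
  apply/cvgrPdist_lt => e e0; have e20 : 0 < e / (2 * d) by rewrite divr_gt0 // mulr_gt0.
  apply: (oou_imply _ (ulim0P inv_ulim0 e20)) => n; rewrite /= ger0_norm ?invr_ge0 // => hn.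
  have h0 : 0 < d / n.+1%:R by rewrite divr_gt0 // ltr0n.
  have he : d / n.+1%:R < e / 2.
    rewrite (_ : e / 2 = d * (e / (2 * d))); first by rewrite ltr_pM2l.
    by field; rewrite gt_eqF.
  have /andP[s1 s2] := ixP n s s0 (le_trans st td).
  have /andP[t1 t2] := ixP n t (le_trans s0 st) td.
  have [_ _ H] := fP n.
  have st' : (ix n s <= ix n t)%N.
    rewrite /ix leq_min geq_minr andbT; apply: leq_trans (geq_minl _ _) _.
    by apply: le_truncn; rewrite ler_pM2r ?invr_gt0.
  rewrite H ?geq_minr // natrB // mulrBl ltr_norml.
  move: (d / n.+1%:R) (ix n s) (ix n t) s1 s2 t1 t2 he => {}h i j s1 s2 t1 t2 he.
  by apply/andP; split; [lrao s1 s2 t1 t2 he e0|lrao s1 s2 t1 t2 he e0].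
have cx t : 0 <= t -> t <= d -> mdist x (c t) = t.
  move=> t0 td; have c0 : c 0 = x.
    apply: (utends_uniq (cP 0)); apply: utends_of => e e0; apply: oou_all => n /=.
    have [f0 _ _] := fP n; rewrite /ix mul0r; have -> : Num.truncn (0 : R) = 0%N.
      by apply/eqP; rewrite truncn_eq // lexx ltr01.
    by rewrite min0n f0 mdistxx.
  by rewrite -{1}c0 ciso // subr0.
have c0 : c 0 = x by apply/esym/mdist0_eq; rewrite cx.
split=> //; apply: mdist0_eq.
suff : mdist (c d) y <= 0 by have := mdist_ge0 (c d) y; lra.
have h0 : (fun n : nat => d / n.+1%:R) @ oou --> 0.
  rewrite -[X in _ --> X](mulr0 d); apply: cvgM; [exact: ulim_cst|exact: inv_ulim0].
apply: (ulim_le (utends_mdistl (cP d)) h0); apply: oou_all => n /=.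
have [f0 _ H] := fP n; have /andP[_ d2] := ixP n d d0 (lexx d).
have := fend n (ix n d) (geq_minr _ _).
by move: (d / n.+1%:R) (ix n d) d2 => h i d2; lra.
Qed.

Lemma geodesic_ex (X : metricType R) (x y : X) : proper_space X -> approx_geodesic X ->
  x != y -> exists g : geodesic x, glen g = mdist x y /\ gend g = y.
Proof.
move=> pX aX xy; have [|z a _ a0 az|c [c0 cd cis]] := @geodesic_of_between X x y.
- by move=> w wd; apply: (pX w x (mdist x y)); exact: oou_all.
- exact: between_point.
have d0 : 0 < mdist x y by rewrite mdist_gt0.
have [g [gl gc]] := mk_geodesic d0 c0 cis.
by exists g; rewrite /gend gl gc.
Qed.

End Proper.

(** * Spaces of directions and limits of geodesics *)

Section DirectionSpace.
Context {R : realType} {X : metricType R} {p : X}.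
Implicit Types (g h : geodesic p) (xi eta zeta : direction p) (e : R).

Lemma angle_gcurve g g' h : gcurve g = gcurve g' -> angle g h = angle g' h.
Proof. by rewrite /angle => ->. Qed.

Lemma dir_gcurve g g' : gcurve g = gcurve g' -> dir g = dir g'.
Proof.
by move=> E; apply: mdist0_eq; rewrite mdist_dir (angle_gcurve _ E) anglexx.
Qed.

Lemma dir_near xi e : 0 < e -> exists g, mdist xi (dir g) < e.
Proof.
move=> e0; have [|g gP] := @dir_dense _ _ _ xi (e / 2); first by rewrite divr_gt0.
by exists g; lra.
Qed.

Lemma direction_le_pi xi eta : mdist xi eta <= pi.
Proof.
apply/ler_addgt0Pr => e e0; have e20 : 0 < e / 2 by rewrite divr_gt0.
have [g gP] := dir_near xi e20; have [h hP] := dir_near eta e20.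
have := metric_triangle xi (dir g) eta; have := metric_triangle (dir g) (dir h) eta.
by have := angle_le_pi g h; rewrite -mdist_dir (metric_sym (dir h)); lra.
Qed.

Lemma direction_perimeter xi eta zeta : curv4 X ->
  mdist xi eta + mdist eta zeta + mdist zeta xi <= 2 * pi.
Proof.
move=> c4; apply/ler_addgt0Pr => e e0; have e60 : 0 < e / 6 by rewrite divr_gt0.
have [g gP] := dir_near xi e60; have [h hP] := dir_near eta e60.
have [l lP] := dir_near zeta e60.
have near2 a b u v : mdist a u < e / 6 -> mdist b v < e / 6 -> mdist a b <= mdist u v + e / 3 :> R.
  move=> h1 h2; have := metric_triangle a u b; have := metric_triangle u v b.
  by rewrite (metric_sym v b) => h3 h4; lrao h1 h2 h3 h4.
have h1 := near2 _ _ _ _ _ gP hP; have h2 := near2 _ _ _ _ _ hP lP.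
have h3 := near2 _ _ _ _ _ lP gP.
by have h4 := angle3 c4 g h l; rewrite -!mdist_dir in h4; lrao h1 h2 h3 h4.
Qed.

Lemma antipode_unique xi eta zeta : curv4 X ->
  mdist xi eta = pi -> mdist xi zeta = pi -> eta = zeta.
Proof.
move=> c4 h1 h2; apply: mdist0_eq; have := direction_perimeter xi eta zeta c4.
by rewrite (metric_sym zeta) h1 h2; have := mdist_ge0 eta zeta; lra.
Qed.

End DirectionSpace.

Section Rays.
Context {R : realType}.
Implicit Types (s t L e : R).

Definition isom_on (X : metricType R) (c : R -> X) L : Prop :=
  forall s t, 0 <= s -> s <= t -> t <= L -> mdist (c s) (c t) = t - s.

Lemma isom_ulim (X : metricType R) (c : nat -> R -> X) p L : proper_space X -> 0 < L ->
  utends (fun n => c n 0) p -> oou [set n | isom_on (c n) L] ->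
  exists g : geodesic p, glen g = L /\
    forall s, 0 <= s -> s <= L -> utends (fun n => c n s) (g s).
Proof.
move=> pX L0 cp cI.
have /choice[f fP] : forall s, exists x, 0 <= s -> s <= L -> utends (fun n => c n s) x.
  move=> s; have [s0|s0] := leP 0 s; last by exists p; lra.
  have [sL|sL] := leP s L; last by exists p; lra.
  have [|x xP] := pX (fun n => c n s) p (1 + L); last by exists x.
  apply: filterS2 cI (utendsP cp ltr01) => n /= I h.
  have := metric_triangle p (c n 0) (c n s); rewrite I // (metric_sym p (c n 0)) subr0 => h'.
  by lrao h h' sL.
have f0 : f 0 = p by apply: (utends_uniq (fP 0 (lexx 0) (ltW L0)) cp).
have fI s t : 0 <= s -> s <= t -> t <= L -> mdist (f s) (f t) = t - s.
  move=> s0 st tL; have sL := le_trans st tL; have t0 := le_trans s0 st.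
  apply: (ulim_uniq (utends_mdist (fP s s0 sL) (fP t t0 tL))).
  by apply: ulim_eq (@ulim_cst R (t - s)); apply: (oou_imply _ cI) => n /= I; rewrite I.
have [g [gl gc]] := mk_geodesic L0 f0 fI.
by exists g; split=> // s s0 sL; rewrite gc; exact: fP.
Qed.

Lemma geo_isom_on (X : metricType R) (p : X) (g : geodesic p) L : L <= glen g ->
  isom_on g L.
Proof. by move=> Lg s t s0 st tL; rewrite geo_isom // (le_trans tL). Qed.

Lemma fourpt_sub (X : metricType R) k (p q : X) r r' : fourpt k p r ->
  mdist p q + r' <= r -> fourpt k q r'.
Proof.
move=> F pq a b c e qa qb qc qe; have near x : mdist q x < r' -> mdist p x < r.
  by have := metric_triangle p q x; lra.
by apply: F; exact: near.
Qed.

Lemma hinge (X : metricType R) k (p : X) r (g h : geodesic p) s t : 0 < k -> 0 < r ->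
  fourpt k p r -> 0 < s < r -> s <= glen g -> 0 < t < r -> t <= glen h ->
  ch (k * mdist (g s) (h t)) <=
    ch (k * s) * ch (k * t) - sh (k * s) * sh (k * t) * cos (angle g h).
Proof.
move=> k0 r0 F s0 sg t0 th; have := cos_angle_le k0 r0 F s0 sg t0 th.
move: s0 t0 => /andP[s0 _] /andP[t0 _]; have S0 := sh_gt0 (mulr_gt0 k0 s0).
have T0 := sh_gt0 (mulr_gt0 k0 t0); have ST := mulr_gt0 S0 T0.
by rewrite /phi /cH ler_pdivlMr //; move: (cos _) => c h'; lrao h'.
Qed.

Lemma continuous_ulim (f : R -> R) (u : nat -> R) (l : R) : continuous f -> u @ oou --> l ->
  (fun n => f (u n)) @ oou --> f l.
Proof. by move=> fc ul; apply: cvg_comp ul (fc l). Qed.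

Lemma ch_ulim k (u : nat -> R) (l : R) : u @ oou --> l ->
  (fun n => ch (k * u n)) @ oou --> ch (k * l).
Proof.
by move=> ul; apply: continuous_ulim; [exact: continuous_ch|apply: cvgM => //; exact: ulim_cst].
Qed.

Lemma cos_ulim (u : nat -> R) (l : R) : u @ oou --> l -> (fun n => cos (u n)) @ oou --> cos l.
Proof. by apply: continuous_ulim; exact: continuous_cos. Qed.

Lemma le_angle_of_hinge (X : metricType R) k (p : X) r d (g h : geodesic p) a : 0 < k -> 0 < r ->
  fourpt k p r -> 0 < d -> 0 <= a <= pi ->
  (forall s, 0 < s < d -> ch (k * mdist (g s) (h s)) <= ch (k * s) ^+ 2 - sh (k * s) ^+ 2 * cos a) ->
  angle g h <= a.
Proof.
move=> k0 r0 F d0 /andP[a0 api] H; rewrite leNgt; apply/negP => alt.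
have := cos_ltr a0 alt (angle_le_pi g h); apply/negP; rewrite -leNgt.
apply/ler_addgt0Pr => e e0; have [d1 d10 H1] := phi_le_cos_angle k0 r0 F g h e0.
pose s := Num.min d d1 / 2; have m0 : 0 < Num.min d d1 by rewrite lt_min d0.
have s0 : 0 < s by rewrite divr_gt0.
have : s < Num.min d d1 by rewrite /s; lra.
rewrite lt_min => /andP[sd sd1].
have := H1 s s; rewrite s0 sd1 => /(_ isT isT); apply: le_trans.
have S0 := sh_gt0 (mulr_gt0 k0 s0); rewrite /phi /cH ler_pdivlMr ?mulr_gt0 //.
by have := H s; rewrite s0 sd => /(_ isT); move: (cos a) => c; rewrite !expr2; lra.
Qed.

Lemma angle0_of_agree (X : metricType R) (p : X) (g h : geodesic p) d : curv4 X -> 0 < d ->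
  (forall s, 0 < s < d -> g s = h s) -> angle g h = 0.
Proof.
move=> c4 d0 H; apply/eqP; rewrite eq_le angle_ge0 andbT.
have [k [r [k0 r0 F]]] := curv4_fourpt p c4.
apply: (le_angle_of_hinge k0 r0 F d0); first by rewrite lexx pi_ge0.
by move=> s sd; rewrite H // mdistxx mulr0 ch0 cos0 mulr1 ch2Bsh2.
Qed.

(** Directions that form a Cauchy sequence are realized in the limit by a geodesic when the lengths
    are bounded below: the hinge inequality of [h n] and [h m] passes to the limit in [m] and bounds
    the angle of [h n] with the pointwise limit. *)
Lemma cauchy_geodesics (X : metricType R) (p : X) (h : nat -> geodesic p) (e : nat -> R) L :
  proper_space X -> curv4 X -> 0 < L -> (forall n, L <= glen (h n)) ->
  (forall n m, angle (h n) (h m) <= e n + e m) -> e @ oou --> (0 : R) ->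
  exists g : geodesic p, [/\ glen g = L, forall n, angle (h n) g <= e n &
    forall s, 0 <= s -> s <= L -> utends (fun n => h n s) (g s)].
Proof.
move=> pX c4 L0 hL he e0.
have [||g [gl gs]] := @isom_ulim X (fun n => h n) p L pX L0.
- by rewrite /utends; apply: ulim0 => d d0; apply: oou_all => n /=; rewrite gcurve0 mdistxx normr0.
- by apply: oou_all => n /=; apply: geo_isom_on.
exists g; split=> // n; have [k [r [k0 r0 F]]] := curv4_fourpt p c4.
have en0 : 0 <= e n by have := he n n; rewrite anglexx; lra.
(* cos decreases only up to pi; beyond, the bound on the angle is void. *)
have [enpi|enpi] := leP pi (e n); first by rewrite (le_trans (angle_le_pi _ _)).
apply: (@le_angle_of_hinge _ k p r (Num.min r L)) => //.
- by rewrite lt_min r0.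
- by rewrite en0 ltW.
move=> s /andP[s0]; rewrite lt_min => /andP[sr sL].
have lim1 := @ch_ulim k _ _ (utends_mdist (utends_cst (h n s)) (gs s (ltW s0) (ltW sL))).
have lim2 : (fun m => ch (k * s) ^+ 2 - sh (k * s) ^+ 2 * cos (e n + e m)) @ oou -->
    ch (k * s) ^+ 2 - sh (k * s) ^+ 2 * cos (e n).
  apply: cvgB; first exact: ulim_cst.
  apply: cvgM; first exact: ulim_cst.
  by apply: cos_ulim; rewrite -[X in _ --> X]addr0; apply: cvgD => //; exact: ulim_cst.
apply: (ulim_le lim1 lim2).
have small : oou [set m | `|e m| < pi - e n] by apply: ulim0P => //; rewrite subr_gt0.
apply: (oou_imply _ small) => m /= em.
have := @hinge _ k p r (h n) (h m) s s k0 r0 F.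
rewrite s0 sr => /(_ isT (ltW (lt_le_trans sL (hL n))) isT (ltW (lt_le_trans sL (hL m)))).
move=> /le_trans; apply; rewrite -!expr2 lerD2l lerN2.
have S0 : 0 < sh (k * s) ^+ 2 by rewrite exprn_gt0 // sh_gt0 // mulr_gt0.
rewrite ler_pM2l //; apply: cos_ler => //; first exact: angle_ge0.
by move: em; rewrite ltr_norml => /andP[_]; lra.
Qed.

End Rays.

Section ObInfinity.
Context {R : realType}.

(** Since [angle_to_set] is an infimum, the lower bound holds for all geodesics between the two
    close points, while the geodesics to the far point [x] are chosen by the supremum. *)
Lemma ob_infty_spec (M : metricType R) (e : R) : ob_infty M = (pi / 2)%:E -> 0 < e ->
  exists2 d : R, 0 < d & forall (p q : M) (B : R), p != q -> mdist p q < d ->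
    exists (x : M) (h : geodesic p) (h' : geodesic q),
      [/\ B < mdist p x, gend h = x, gend h' = x &
        (forall g : geodesic p, gend g = q -> pi - e < angle g h) \/
        (forall g : geodesic q, gend g = p -> pi - e < angle g h')].
Proof.
move=> Mob e0; set F := filter_from (fun delta : R => 0 < delta)
  (fun delta => [set pq : M * M | pq.1 != pq.2 /\ mdist pq.1 pq.2 < delta]).
have [V FV VP] : exists2 V, F V & forall pq, V pq ->
    ((pi / 2 - e)%:E < ob_infty_pair pq.1 pq.2)%E.
  have : (limf_esup (\- (fun pq : M * M => ob_infty_pair pq.1 pq.2))%E F < (- (pi / 2 - e))%:E)%E.
    have : (- limf_esup (\- (fun pq : M * M => ob_infty_pair pq.1 pq.2))%E F)%E = (pi / 2)%:E by [].
    move=> /(congr1 oppe); rewrite oppeK => ->; rewrite -EFinN lte_fin; lra.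
  move=> /ereal_inf_lt[_ [V FV <-] Vlt]; exists V => // pq Vpq.
  have : (- ob_infty_pair pq.1 pq.2 < (- (pi / 2 - e))%:E)%E.
    by apply: le_lt_trans Vlt; apply: ereal_sup_ubound; exists pq.
  by rewrite EFinN lteN2.
have [d d0 dV] := FV; exists d => // p q B pq pqd.
have := VP (p, q) (dV (p, q) (conj pq pqd)); rewrite /ob_infty_pair /=.
rewrite -lteBlDr // -EFinB; set G := (X in limf_esup X _) => Glt.
pose V0 : set M := [set x | (B < mdist p x)%R].
have Finf : @at_infinity R M V0.
  exists [set x | mdist p x <= B]; first by exists p, B.
  by move=> x /= /negP; rewrite -ltNge.
have : ((pi - e)%:E < ereal_sup (G @` V0))%E.
  apply: lt_le_trans (_ : limf_esup G (@at_infinity R M) <= _)%E; last first.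
    by apply: ereal_inf_lbound; exists V0.
  by move: Glt; congr (_ < _)%E; congr (_%:E); lra.
move=> /ereal_sup_gt[_ [x /= Bx <-]] /ereal_sup_gt[_ [[xi eta] /= [[h hx <-] [h' hx' <-]] <-]].
have key (a b : M) (k : geodesic a) (A : set (direction a)) g : A = directions_to a b ->
    ((pi - e)%:E < angle_to_set A (dir k))%E -> gend g = b -> pi - e < angle g k.
  move=> -> lt gb; rewrite -lte_fin; apply: lt_le_trans lt _.
  apply: ereal_inf_lbound; exists (dir g); first by exists g.
  by rewrite mdist_dir angleC.
rewrite /maxe; case: ifP => _ lt; exists x, h, h'; split=> //.
  by right=> g; exact: key lt.
by left=> g; exact: key lt.
Qed.

End ObInfinity.

(** * Rays *)

Section Reach.
Context {R : realType} {X : metricType R} (pX : proper_space X) (c4 : curv4 X).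
Implicit Types (p : X) (e r L : R).

Definition reach p r : set (direction p) := [set xi | exists2 g : geodesic p, r <= glen g & dir g = xi].

Lemma reach_le p r r' xi : r <= r' -> reach r' xi -> @reach p r xi.
Proof. by move=> rr' [g gr <-]; exists g => //; exact: le_trans gr. Qed.

Lemma reach_closed p r xi : 0 < r ->
  (forall e, 0 < e -> exists2 zeta, reach r zeta & mdist xi zeta < e) -> @reach p r xi.
Proof.
move=> r0 H; have /choice[h hP] : forall n : nat, exists h : geodesic p, r <= glen h /\
    mdist xi (dir h) < n.+1%:R^-1.
  move=> n; have [|_ [h hr <-] hx] := H n.+1%:R^-1; first by rewrite invr_gt0 ltr0n.
  by exists h.
have [|||g [gr hg _]] := @cauchy_geodesics R X p h (fun n => n.+1%:R^-1) r pX c4 r0.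
- by move=> n; case: (hP n).
- move=> n m; rewrite -mdist_dir; have [_ h1] := hP n; have [_ h2] := hP m.
  have := metric_triangle (dir (h n)) xi (dir (h m)).
  move: h1 h2; rewrite (metric_sym _ xi).
  by move: n.+1%:R^-1 m.+1%:R^-1 => a b h1 h2; lrao h1 h2.
- exact: inv_ulim0.
exists g; first by rewrite gr.
apply: mdist0_eq; apply/eqP; rewrite eq_le mdist_ge0 andbT.
have lim : (fun n => n.+1%:R^-1 + n.+1%:R^-1 : R) @ oou --> (0 : R).
  by rewrite -[X in _ --> X]addr0; apply: cvgD; exact: inv_ulim0.
apply: (ulim_le (@ulim_cst R _) lim); apply: oou_all => n /=.
have [_ h1] := hP n; have h2 := hg n; rewrite -mdist_dir in h2.
have h3 := metric_triangle (dir g) (dir (h n)) xi.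
rewrite (metric_sym (dir g) (dir (h n))) (metric_sym (dir (h n)) xi) in h3.
by move: h1 h2 h3; move: n.+1%:R^-1 => a h1 h2 h3; lrao h1 h2 h3.
Qed.

(** Two directions that are almost opposite to [xi] are close to each other by
    [direction_perimeter]; so they form a Cauchy sequence. *)
Lemma antipode_limit p (A : set (direction p)) xi :
  (forall e, 0 < e -> exists2 zeta, A zeta & pi - e < mdist xi zeta) ->
  exists2 eta, mdist xi eta = pi &
    forall e, 0 < e -> exists2 zeta, A zeta & mdist eta zeta < e.
Proof.
move=> H; have i0 n : 0 < n.+1%:R^-1 :> R by rewrite invr_gt0 ltr0n.
have /choice[z zP] : forall n : nat, exists z, A z /\ pi - n.+1%:R^-1 < mdist xi z.
  by move=> n; have [z Az hz] := H _ (i0 n); exists z.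
have near n m : mdist (z n) (z m) <= n.+1%:R^-1 + m.+1%:R^-1.
  have := direction_perimeter xi (z n) (z m) c4; rewrite (metric_sym (z m)).
  have [_ h1] := zP n; have [_ h2] := zP m; move: h1 h2.
  by move: n.+1%:R^-1 m.+1%:R^-1 => a b h1 h2; lrao h1 h2.
have small e : 0 < e -> oou [set m : nat | m.+1%:R^-1 < e].
  move=> e0; apply: (oou_imply _ (ulim0P inv_ulim0 e0)) => m /=.
  by rewrite gtr0_norm.
have [eta zeta] : exists eta, utends z eta.
  apply: complete_utends; first exact: direction_complete.
  move=> e e0; have e20 : 0 < e / 2 by rewrite divr_gt0.
  have [N NP] := filter_ex (small _ e20); exists (z N).
  apply: (oou_imply _ (small _ e20)) => m /= mP.
  have := near N m; move: NP mP => /=.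
  by move: N.+1%:R^-1 m.+1%:R^-1 => a b NP mP; lrao NP mP.
exists eta.
  apply/eqP; rewrite eq_le direction_le_pi /=.
  have lim : (fun n => pi - n.+1%:R^-1 : R) @ oou --> pi.
    by rewrite -[X in _ --> X]subr0; apply: cvgB; [exact: ulim_cst|exact: inv_ulim0].
  apply: (ulim_le lim (utends_mdist (utends_cst xi) zeta)).
  by apply: oou_all => n /=; have [_] := zP n; exact: ltW.
move=> e e0; have [n nP] := filter_ex (utendsP zeta e0).
by exists (z n); [case: (zP n)|rewrite metric_sym].
Qed.

Lemma approx_dichotomy p (A : set (direction p)) xi :
  (forall e, 0 < e -> exists2 zeta, A zeta & mdist xi zeta < e \/ pi - e < mdist xi zeta) ->
  (forall e, 0 < e -> exists2 zeta, A zeta & mdist xi zeta < e) \/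
  (exists2 eta, mdist xi eta = pi &
    forall e, 0 < e -> exists2 zeta, A zeta & mdist eta zeta < e).
Proof.
move=> H; have [H0|/existsNP[e0 /not_implyP[e00 H0]]] :=
  pselect (forall e, 0 < e -> exists2 zeta, A zeta & mdist xi zeta < e); first by left.
right; apply: antipode_limit => e epos.
have [|zeta Az [hz|hz]] := H (Num.min e e0); first by rewrite lt_min epos.
  exfalso; apply: H0; exists zeta => //; apply: lt_le_trans hz _.
  by rewrite ge_min lexx orbT.
exists zeta => //; apply: le_lt_trans hz; rewrite lerD2l lerN2.
by rewrite ge_min lexx.
Qed.

End Reach.

Section OneSide.
Context {R : realType} {M : metricType R} (pM : proper_space M) (c4 : curv4 M)
  (M_ob : ob_infty M = (pi / 2)%:E).
Implicit Types (p : M) (e r L : R).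

(** Apply [ob_infty_spec] to [p] and [g t]. Either [p] sees a far point almost opposite to [g], or
    the geodesic from [g t] to the far point almost continues [g], by [angle_adjacent]. The latter
    is recorded as a hinge inequality, because angles based at the moving point [g t] have no limit
    to pass to. *)
Lemma ob_step p (g : geodesic p) k r e L : 0 < k -> 0 < r -> fourpt k p r ->
  0 < L -> 0 < e -> e <= pi -> exists t, [/\ 0 < t, t < e, t < glen g &
   (exists2 h : geodesic p, L <= glen h & pi - e < angle g h) \/
   (exists c : R -> M, [/\ c 0 = g t, isom_on c L & forall s, 0 < s -> s < r / 2 ->
      s < L -> s < glen g - t ->
      ch (k * mdist (c s) (g (t + s))) <= ch (k * s) ^+ 2 - sh (k * s) ^+ 2 * cos e])].
Proof.
move=> k0 r0 F L0 e0 epi; have [d d0 dP] := ob_infty_spec M_ob e0.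
pose m := Num.min (Num.min d e) (Num.min (glen g) (r / 2)).
have m0 : 0 < m by rewrite !lt_min d0 e0 glen_gt0 divr_gt0.
pose t := m / 2; have t0 : 0 < t by rewrite divr_gt0.
have : t < m by rewrite /t; lrao m0.
rewrite !lt_min => /andP[/andP[td te] /andP[tg tr]].
exists t; split=> //.
have pq : mdist p (g t) = t by rewrite geo_dist // (ltW t0) ltW.
have pneq : p != g t by apply/eqP => E; move: pq; rewrite -E mdistxx => E0; lrao E0 t0.
have [|x [h [h' [Bx hx h'x H]]]] := dP p (g t) (L + e) pneq; first by rewrite pq.
have hl : glen h = mdist p x by rewrite -hx /gend geo_dist // lexx ltW // glen_gt0.
have h'l : glen h' = mdist (g t) x by rewrite -h'x /gend geo_dist // lexx ltW // glen_gt0.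
have tr1 := metric_triangle p (g t) x; rewrite pq in tr1.
case: H => H; [left|right].
  exists h; first by rewrite hl; lrao Bx e0.
  have [g' [gl gc]] := geo_restrict t0 (ltW tg).
  by rewrite (angle_gcurve _ (esym gc)); apply: H; rewrite /gend gl gc.
have [b [bl bc]] := geo_backward t0 (ltW tg).
have [f [fl fc]] := geo_forward (ltW t0) tg.
have := H b; rewrite /gend bl bc subrr gcurve0 => /(_ erefl) Hb.
have bf : angle b f = pi.
  apply: (@angle_opp_pi _ _ _ _ _ (Num.min t (glen g - t))).
    by rewrite lt_min t0 subr_gt0.
  move=> u v /andP[u0]; rewrite lt_min => /andP[ut _] /andP[v0].
  rewrite lt_min => /andP[_ vt]; rewrite bc fc geo_isom; [ring| | |]; lrao u0 ut v0 vt t0 tg.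
have := angle_adjacent c4 h' bf; rewrite (angleC h' b) => adj.
have h'f : angle h' f < e by lrao adj Hb.
exists h'; split; first exact: gcurve0.
  by apply: geo_isom_on; rewrite h'l; lrao tr1 Bx te.
move=> s s0 sr sL sg.
have F' : fourpt k (g t) (r / 2) by apply: (fourpt_sub F); rewrite pq; lrao tr.
have r20 : 0 < r / 2 by rewrite divr_gt0.
have := @hinge R M k (g t) (r / 2) h' f s s k0 r20 F'; rewrite s0 sr fl => /(_ isT).
move=> /(_ ltac:(rewrite h'l; lrao tr1 Bx te sL) isT (ltW sg)); rewrite fc => /le_trans; apply.
rewrite -!expr2 lerD2l lerN2 ler_pM2l ?exprn_gt0 ?sh_gt0 ?mulr_gt0 //.
by apply: cos_ler; rewrite ?angle_ge0 // ltW.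
Qed.

(** Take [e] to 0 in [ob_step]. If its first alternative keeps occurring, the almost opposite
    directions converge. Otherwise the curves starting at [g (t n)] with [t n] tending to 0 converge
    to a geodesic of length [L] that coincides with [g] near [p]. *)
Lemma extend_geodesic p (g : geodesic p) L : 0 < L ->
  reach L (dir g) \/ exists2 eta, mdist (dir g) eta = pi & reach L eta.
Proof.
move=> L0; pose A : set (direction p) := @reach R M p L.
have [H|/existsNP[e0 /not_implyP[e00 H0]]] :=
  pselect (forall e, 0 < e -> exists2 zeta, A zeta & pi - e < mdist (dir g) zeta).
  right; have [eta ge etaP] := antipode_limit c4 H.
  by exists eta => //; exact: reach_closed etaP.
(* For tolerances up to [e0] the first alternative of [ob_step] is now excluded, so the second one
   holds at every scale. *)
left; have [k [r [k0 r0 F]]] := curv4_fourpt p c4.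
pose e1 := Num.min e0 pi; have e10 : 0 < e1 by rewrite lt_min e00 pi_gt0.
have ie n : [/\ 0 < e1 * n.+1%:R^-1 :> R, e1 * n.+1%:R^-1 <= pi & e1 * n.+1%:R^-1 <= e0].
  have i1 : n.+1%:R^-1 <= 1 :> R by rewrite invf_le1 ?ler1n ?ltr0n.
  have le1 : e1 * n.+1%:R^-1 <= e1 by rewrite ler_piMr // ltW.
  split; first by rewrite mulr_gt0 // invr_gt0 ltr0n.
    by apply: le_trans le1 _; rewrite ge_min lexx orbT.
  by apply: le_trans le1 _; rewrite ge_min lexx.
have /choice[t tP] : forall n, exists t, [/\ 0 < t, t < e1 * n.+1%:R^-1, t < glen g &
   exists c : R -> M, [/\ c 0 = g t, isom_on c L & forall s, 0 < s -> s < r / 2 ->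
      s < L -> s < glen g - t -> ch (k * mdist (c s) (g (t + s))) <=
      ch (k * s) ^+ 2 - sh (k * s) ^+ 2 * cos (e1 * n.+1%:R^-1)]].
  move=> n; have [ep epi ee0] := ie n.
  have [t [t0 te tg [[h hL hg]|tc]]] := ob_step g k0 r0 F L0 ep epi; last by exists t.
  exfalso; apply: H0; exists (dir h); first by exists h.
  by rewrite mdist_dir; apply: le_lt_trans hg; rewrite lerD2l lerN2.
have /choice[c cP] : forall n, exists c : R -> M, [/\ c 0 = g (t n), isom_on c L &
   forall s, 0 < s -> s < r / 2 ->
      s < L -> s < glen g - t n -> ch (k * mdist (c s) (g (t n + s))) <=
      ch (k * s) ^+ 2 - sh (k * s) ^+ 2 * cos (e1 * n.+1%:R^-1)].
  by move=> n; have [_ _ _] := tP n.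
have lim0 : (fun n => e1 * n.+1%:R^-1 : R) @ oou --> (0 : R).
  by rewrite -[X in _ --> X](mulr0 e1); apply: cvgM; [exact: ulim_cst|exact: inv_ulim0].
have tlim e : 0 < e -> oou [set n | t n < e].
  move=> ep; apply: (oou_imply _ (ulim0P lim0 ep)) => n /=.
  by have [i0 _ _] := ie n; have [_ h1 _ _] := tP n; rewrite gtr0_norm //; exact: lt_trans.
have [||h [hL hs]] := @isom_ulim R M c p L pM L0.
- apply: utends_of => e ep; apply: (oou_imply _ (tlim e ep)) => n /= tn.
  have [t0 _ tg _] := tP n; have [-> _ _] := cP n.
  by rewrite metric_sym geo_dist // (ltW t0) ltW.
- by apply: oou_all => n; have [_] := cP n.
exists h; first by rewrite hL.
apply: mdist0_eq; rewrite mdist_dir.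
pose d := Num.min (r / 2) (Num.min L (glen g)).
apply: (@angle0_of_agree _ _ _ _ _ d) => //; first by rewrite !lt_min L0 glen_gt0 divr_gt0.
move=> s /andP[s0]; rewrite !lt_min => /and3P[sr sL sg].
apply: mdist0_eq; apply/eqP; rewrite eq_le mdist_ge0 andbT.
have gt : utends (fun n => g (t n + s)) (g s).
  apply: utends_of => e ep; have ep' : 0 < Num.min e (glen g - s) by rewrite lt_min ep subr_gt0.
  apply: (oou_imply _ (tlim _ ep')) => n /=; rewrite lt_min => /andP[h1 h2].
  have [t0 _ _ _] := tP n.
  by rewrite metric_sym geo_isom; lrao h1 h2 t0 s0.
have l1 : (fun n => ch (k * mdist (c n s) (g (t n + s)))) @ oou --> ch (k * mdist (h s) (g s)).
  by apply: ch_ulim; apply: utends_mdist => //; apply: hs; exact: ltW.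
have l2 : (fun n => ch (k * s) ^+ 2 - sh (k * s) ^+ 2 * cos (e1 * n.+1%:R^-1)) @ oou -->
    ch (k * s) ^+ 2 - sh (k * s) ^+ 2 * cos 0.
  apply: cvgB; first exact: ulim_cst.
  by apply: cvgM; [exact: ulim_cst|exact: cos_ulim].
have := ulim_le l1 l2; rewrite cos0 mulr1 ch2Bsh2 => H1.
have := ch_ge (k * mdist (h s) (g s)).
have : ch (k * mdist (h s) (g s)) <= 1.
  apply: H1; have sg' : 0 < glen g - s by rewrite subr_gt0.
  apply: (oou_imply _ (tlim _ sg')) => n /= h1.
  by have [_ _] := cP n; apply => //; lrao h1.
move=> h1 h2; have : (k * mdist (h s) (g s)) ^+ 2 <= 0 by lrao h1 h2.
rewrite exprMn pmulr_rle0 ?exprn_gt0 // => h3.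
have : mdist (h s) (g s) ^+ 2 == 0 by rewrite eq_le h3 sqr_ge0.
by rewrite sqrf_eq0 => /eqP ->.
Qed.

Lemma one_side_reach p (xi : direction p) L : 0 < L ->
  reach L xi \/ exists2 eta, mdist xi eta = pi & reach L eta.
Proof.
move=> L0; have [] := @approx_dichotomy R M c4 p (@reach R M p L) xi.
- move=> e e0; have [g gP] := dir_near xi e0.
  have [gL|[eta geta etaL]] := extend_geodesic g L0; first by exists (dir g) => //; left.
  exists eta => //; right; have := metric_triangle (dir g) xi eta.
  by rewrite geta (metric_sym (dir g)); lrao gP.
- by move=> H; left; exact: reach_closed H.
- by move=> [eta xeta H]; right; exists eta => //; exact: reach_closed H.
Qed.

Lemma one_side_inj_infty : one_side_inj M = +oo%E.
Proof.
apply: eq_infty => A.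
apply: le_trans (_ : (Num.max A 0)%:E <= _)%E; first by rewrite lee_fin le_max lexx.
apply: ereal_sup_ubound; exists (Num.max A 0) => //; split; first by rewrite le_max lexx orbT.
move=> A0 p xi; have [[g gA <-]|[eta xeta [g gA ge]]] := one_side_reach xi A0.
  by exists g; split=> //; left.
by exists g; split=> //; right; rewrite /opposite ge.
Qed.

End OneSide.

Section RayDirections.
Context {R : realType} {X : metricType R} (c4 : curv4 X).
Implicit Types (p : X) (l : R -> X).

Definition ray_in p (xi : direction p) l : Prop :=
  forall L, 0 < L -> exists g : geodesic p, [/\ glen g = L, gcurve g = l & dir g = xi].

(** By nonbranching the geodesics of different lengths with direction [xi] are prolongations of one
    another. *)
Lemma ray_of_reach p (xi : direction p) : (forall L, 0 < L -> reach L xi) ->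
  exists l, ray_in xi l.
Proof.
move=> H; have /choice[g gP] : forall L, exists g : geodesic p, 0 < L -> L <= glen g /\ dir g = xi.
  move=> L; have [L0|L0] := ltP 0 L.
    by have [g gL gx] := H L L0; exists g.
  by have [g _ _] := H 1 ltr01; exists g.
have agree a b s : 0 < a -> 0 < b -> 0 <= s -> s <= a -> s <= b -> g a s = g b s.
  move=> a0 b0 s0 sa sb; have [ga gax] := gP a a0; have [gb gbx] := gP b b0.
  apply: (geo_nonbranching c4 _ s0 (le_trans sa ga) (le_trans sb gb)).
  by rewrite -mdist_dir gax gbx mdistxx.
pose l s := g (s + 1) s.
have lE a s : 0 < a -> 0 <= s -> s <= a -> l s = g a s.
  by move=> a0 s0 sa; apply: agree => //; lra.
exists l => L L0; have [gL gx] := gP L L0.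
have [||h [hl hc]] := @mk_geodesic R X p L l L0.
- by rewrite (lE L) ?gcurve0 // ltW.
- move=> s t s0 st tL; rewrite (lE L) ?(lE L t) //; first by rewrite geo_isom //; exact: le_trans gL.
  + exact: le_trans st.
  + exact: le_trans tL.
exists h; split=> //; rewrite -gx; apply: mdist0_eq; rewrite mdist_dir.
apply: (angle0_of_agree c4 L0) => s /andP[s0 sL]; rewrite hc (lE L) ?ltW //.
Qed.

Lemma ray_in0 p (xi : direction p) l : ray_in xi l -> l 0 = p.
Proof. by move=> /(_ 1 ltr01)[g [_ <- _]]; rewrite gcurve0. Qed.

Lemma ray_in_isom p (xi : direction p) l s t : ray_in xi l -> 0 <= s -> s <= t ->
  mdist (l s) (l t) = t - s.
Proof.
move=> rl s0 st; have t0 : 0 < t + 1 by lra.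
by have [g [gt <- _]] := rl _ t0; rewrite geo_isom // gt; lra.
Qed.

Lemma ray_in_dist p (xi : direction p) l s : ray_in xi l -> 0 <= s -> mdist p (l s) = s.
Proof. by move=> rl s0; rewrite -(ray_in0 rl) (ray_in_isom rl) // subr0. Qed.

Lemma ray_in_uniq p (xi : direction p) l (g : geodesic p) s : ray_in xi l -> dir g = xi ->
  0 <= s -> s <= glen g -> g s = l s.
Proof.
move=> rl gx s0 sg; have [h [hg <- hx]] := rl _ (glen_gt0 g).
by apply: (geo_nonbranching c4) => //; rewrite ?hg // -mdist_dir gx hx mdistxx.
Qed.

End RayDirections.

(** The side that extends might depend on the length. But if [xi] fails at some length [r], it fails
    at all larger ones, so the opposite direction, which is unique, extends to every length. *)
Lemma one_side_ray {R : realType} {M : metricType R} (p : M) (xi : direction p) :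
  proper_space M -> curv4 M -> ob_infty M = (pi / 2)%:E ->
  exists2 eta : direction p, eta = xi \/ mdist xi eta = pi & exists l, ray_in eta l.
Proof.
move=> pM c4 ob.
have [H|/existsNP[r /not_implyP[r0 H]]] := pselect (forall L, 0 < L -> reach L xi).
  by exists xi; [left|exact: ray_of_reach].
have big L : r <= L -> exists2 eta, mdist xi eta = pi & reach L eta.
  move=> rL; have [xL|//] := one_side_reach pM c4 ob xi (lt_le_trans r0 rL).
  by case: H; exact: reach_le xL.
have [eta xeta _] := big r (lexx r); exists eta; first by right.
apply: ray_of_reach => // L L0; have [|eta' xeta' etaL] := big (Num.max r L).
  by rewrite le_max lexx.
by rewrite (antipode_unique c4 xeta xeta'); apply: reach_le etaL; rewrite le_max lexx orbT.
Qed.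

(* Countable saturation of an ultraproduct along oou. *)
Lemma saturation (T : Type) (x0 : T) (P : nat -> nat -> T -> Prop) :
  (forall m n x, P m.+1 n x -> P m n x) -> (forall m, oou [set n | exists x, P m n x]) ->
  exists w : nat -> T, forall m, oou [set n | P m n (w n)].
Proof.
move=> Pdec Pex; have Ple m m' n x : (m <= m')%N -> P m' n x -> P m n x.
  elim: m' => [|m' IH]; first by rewrite leqn0 => /eqP ->.
  by rewrite leq_eqVlt => /orP[/eqP ->//|mm'] /Pdec; exact: IH.
have /choice[w wP] : forall n, exists x, forall m, (m <= n)%N -> (exists y, P m n y) -> P m n x.
  move=> n; suff H j : exists x, forall m, (m < j)%N -> (exists y, P m n y) -> P m n x by exact: H n.+1.
  elim: j => [|j [x xP]]; first by exists x0.
  have [[y yP]|ny] := pselect (exists y, P j n y).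
    by exists y => m; rewrite ltnS => mj _; exact: Ple mj yP.
  exists x => m; rewrite ltnS leq_eqVlt => /orP[/eqP ->//|mj]; exact: xP.
by exists w => m; apply: filterS2 (oou_ge m) (Pex m) => n mn; exact: wP.
Qed.

Section Scales.
Context {R : realType}.

Lemma ulimP (u : nat -> R) (l : R) : (forall e, 0 < e -> oou [set n | `|u n - l| < e]) -> u @ oou --> l.
Proof.
move=> H; have u0 : (fun n => u n - l) @ oou --> (0 : R) by exact: ulim0.
rewrite (_ : u = (fun n => (u n - l) + l)); last by apply/funext => n; rewrite subrK.
by rewrite -[X in _ --> X](add0r l); apply: cvgD => //; exact: ulim_cst.
Qed.

Definition scale (t : nat -> R) : Prop := (forall n, 0 < t n) /\ t @ oou --> (0 : R).

Lemma scale_lt t c d : scale t -> 0 < d -> oou [set n | c * t n < d].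
Proof.
move=> [t0 tl] d0; have [c0|c0] := leP c 0.
  by apply: oou_all => n /=; apply: le_lt_trans d0; rewrite mulr_le0_ge0 // ltW.
have dc : 0 < d / c by rewrite divr_gt0.
apply: (oou_imply _ (ulim0P tl dc)) => n /=; rewrite gtr0_norm // ltr_pdivlMr //.
by rewrite mulrC.
Qed.

Lemma scale_harmonic : scale (fun n => n.+1%:R^-1 : R).
Proof. by split; [move=> n; rewrite invr_gt0 ltr0n|exact: inv_ulim0]. Qed.

End Scales.

(** * Tangent cones *)

Section TangentCone.
Context {R : realType} {X : metricType R} (c4 : curv4 X) {p : X}.
Implicit Types (g h : geodesic p) (xi eta zeta : direction p) (e : R) (t : nat -> R) (w v : nat -> X).

Definition cd2 (a b : R) xi eta : R := a ^+ 2 + b ^+ 2 - 2 * a * b * cos (mdist xi eta).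

Lemma cd2_ge0 a b xi eta : 0 <= a -> 0 <= b -> 0 <= cd2 a b xi eta.
Proof.
move=> a0 b0; rewrite /cd2; have := cos_le1 (mdist xi eta); move: (cos _) => c c1.
by have := mulr_ge0 a0 b0; have := sqr_ge0 (a - b); nrao c1.
Qed.

(** The error is proportional to [s * u], as the law of cosines gives it; so the estimate is uniform
    in the ratio of [s] and [u], the value 0 included. *)
Lemma geo_cone g h e : 0 < e -> exists2 d, 0 < d & [/\ d <= glen g, d <= glen h &
  forall s u, 0 <= s < d -> 0 <= u < d ->
    `|mdist (g s) (h u) ^+ 2 - cd2 s u (dir g) (dir h)| <= 2 * s * u * e].
Proof.
move=> e0; have [k [r [k0 r0 F]]] := curv4_fourpt p c4.
have [d d0 dP] := angle_lim k0 r0 F g h e0.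
exists (Num.min d (Num.min (glen g) (glen h))); first by rewrite !lt_min d0 !glen_gt0.
split; first by rewrite !ge_min lexx !orbT.
  by rewrite !ge_min lexx !orbT.
move=> s u /andP[s0]; rewrite !lt_min => /and3P[sd sg sh] /andP[u0 /and3P[ud ug uh]].
rewrite /cd2; have gs : mdist p (g s) = s by rewrite geo_dist // s0 ltW.
have hu : mdist p (h u) = u by rewrite geo_dist // u0 ltW.
have [->|sn0] := eqVneq s 0.
  rewrite gcurve0 hu !(mul0r, mulr0) subr0 expr0n add0r subrr normr0 //.
have [->|un0] := eqVneq u 0.
  by rewrite gcurve0 (metric_sym _ p) gs !(mul0r, mulr0) subr0 expr0n addr0 subrr normr0.
have s0' : 0 < s by rewrite lt_neqAle eq_sym sn0.
have u0' : 0 < u by rewrite lt_neqAle eq_sym un0.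
have := dP s u; rewrite s0' sd u0' ud => /(_ isT isT).
rewrite /comparison_angle /model_angle ltxx gs hu mdist_dir.
set x := (_ - _) / _; have x1 : -1 <= x <= 1.
  have T : tri s u (mdist (g s) (h u)) by apply: geo_tri; rewrite ?s0 ?u0 ltW.
  by apply: (@cE_itv R s u).
move=> ae; have := le_trans (cos_lip _ _) ae; rewrite acosK' // distrC => ce.
have su : 0 < 2 * s * u by rewrite mulr_gt0 ?mulr_gt0.
rewrite (_ : _ - _ = 2 * s * u * (cos (angle g h) - x)); last first.
  by rewrite /x; field; rewrite sn0 un0.
by rewrite normrM gtr0_norm // ler_pM2l.
Qed.

Lemma geo_spread : exists C r, [/\ 0 < C, 0 < r & forall g h s, 0 <= s -> s < r ->
  s <= glen g -> s <= glen h -> mdist (g s) (h s) ^+ 2 <= C * s ^+ 2 * angle g h].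
Proof.
have [k [r [k0 r0 F]]] := curv4_fourpt p c4.
exists (2 * ch (k * r) ^+ 2), r; split=> //.
  by rewrite mulr_gt0 // exprn_gt0 // ch_gt0.
move=> g h s; rewrite le_eqVlt => /orP[/eqP <-|s0] sr sg sh_.
  by rewrite !gcurve0 mdistxx expr0n mulr0 mul0r.
have := @hinge R X k p r g h s s k0 r0 F; rewrite s0 sr => /(_ isT sg isT sh_).
have S0 : 0 <= sh (k * s) by rewrite sh_ge0 // mulr_ge0 ?ltW.
have ks : 0 <= k * s by rewrite mulr_ge0 ?ltW.
have := @sh_le R (k * s) (k * r); rewrite ks ler_pM2l // (ltW sr) => /(_ isT) S1.
have := ch_ge (k * mdist (g s) (h s)); rewrite -!expr2.
have := ch2Bsh2 (k * s).
have := cos_lip 0 (angle g h); rewrite cos0 sub0r normrN (ger0_norm (angle_ge0 _ _)).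
rewrite ler_norml => /andP[_ ]; move: (angle_ge0 g h) => a0 ca E1 E2 E3.
have S2 : sh (k * s) ^+ 2 <= (k * s * ch (k * r)) ^+ 2.
  by rewrite ler_sqr ?nnegrE // (le_trans S0).
have k2 : 0 < k ^+ 2 by rewrite exprn_gt0.
rewrite -(ler_pM2l k2).
have h1 : (k * mdist (g s) (h s)) ^+ 2 <= 2 * (sh (k * s) ^+ 2 * (1 - cos (angle g h))).
  by rewrite mulrBr mulr1; lrao E1 E2 E3.
have h2 : sh (k * s) ^+ 2 * (1 - cos (angle g h)) <= (k * s * ch (k * r)) ^+ 2 * angle g h.
  by apply: ler_pM; rewrite ?sqr_ge0 // subr_ge0 cos_le1.
rewrite -exprMn; apply: le_trans h1 _.
rewrite [leRHS](_ : _ = 2 * ((k * s * ch (k * r)) ^+ 2 * angle g h)); last by ring.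
by rewrite ler_pM2l.
Qed.

(* The sequence w, rescaled by t, converges to the point a xi of the tangent cone. *)
Definition blowup t w (a : R) xi : Prop := forall e, 0 < e ->
  oou [set n | exists g s, [/\ mdist (dir g) xi < e, 0 <= s <= glen g,
    `|s - a * t n| <= e * t n & mdist (w n) (g s) <= e * t n]].

(** The geodesics in [blowup] vary with the index. By [geo_spread], which is uniform over all
    geodesics at [p], each of them may be replaced by one fixed geodesic, to which [geo_cone]
    applies. *)
Lemma blowup_fix t w a xi e : scale t -> 0 <= a -> blowup t w a xi -> 0 < e ->
  exists2 g, mdist (dir g) xi < e &
    oou [set n | a * t n <= glen g /\ mdist (w n) (g (a * t n)) <= e * t n].
Proof.
move=> st a0 B e0; have [C [r [C0 r0 S]]] := geo_spread.
have a1 : 0 < a + 1 by lra.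
pose d := Num.min 1 (Num.min (e / 4) ((e / 4) ^+ 2 / (2 * C * (a + 1) ^+ 2))).
have c0 : 0 < 2 * C * (a + 1) ^+ 2 by rewrite mulr_gt0 ?mulr_gt0 // exprn_gt0.
have e40 : 0 < e / 4 by rewrite divr_gt0.
have d0 : 0 < d by rewrite !lt_min ltr01 e40 divr_gt0 // exprn_gt0.
have [d1 de dC] : [/\ d <= 1, d <= e / 4 & 2 * C * (a + 1) ^+ 2 * d <= (e / 4) ^+ 2].
  split; [|by rewrite /d !ge_min lexx !orbT|rewrite mulrC -ler_pdivlMr //];
    by rewrite /d !ge_min lexx ?orbT.
have [g gx] := dir_near xi d0; rewrite metric_sym in gx.
exists g; first by lrao gx de e40.
have m0 : 0 < Num.min r (glen g) by rewrite lt_min r0 glen_gt0.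
apply: filterS2 (B d d0) (scale_lt (a + 1) st m0) => n [h [s [hx /andP[s0 sh_] st1 ws]]] /=.
rewrite lt_min => /andP[tr tg]; have t0 := st.1 n.
have dt : d * t n <= t n by rewrite ler_piMl // ltW.
have at0 : 0 <= a * t n by rewrite mulr_ge0 // ltW.
have atg : a * t n <= glen g by move: tg; rewrite mulrDl mul1r; lrao t0.
split=> //; have sa : s <= (a + 1) * t n.
  by move: st1; rewrite ler_norml mulrDl mul1r => /andP[_]; lrao dt.
have sr : s < r by lrao sa tr. 
have sg : s <= glen g by lrao sa tg.
have := S h g s s0 sr sh_ sg; rewrite -mdist_dir => m2.
have hg : mdist (dir h) (dir g) <= 2 * d.
  by have := metric_triangle (dir h) xi (dir g); rewrite (metric_sym xi); lrao hx gx.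
have m1 : mdist (h s) (g s) <= e / 4 * t n.
  rewrite -ler_sqr ?nnegrE ?mdist_ge0 //; last by rewrite mulr_ge0 // ltW.
  apply: le_trans m2 _; rewrite exprMn.
  apply: le_trans (_ : 2 * C * (a + 1) ^+ 2 * d * t n ^+ 2 <= _); last first.
    by rewrite ler_pM2r ?exprn_gt0.
  rewrite [leRHS](_ : _ = C * ((a + 1) * t n) ^+ 2 * (2 * d)); last by ring.
  apply: ler_pM => //; [by rewrite mulr_ge0 ?sqr_ge0 // ltW|exact: mdist_ge0|].
  rewrite ler_pM2l // ler_sqr ?nnegrE //; exact: le_trans sa.
have m3 : mdist (g s) (g (a * t n)) <= d * t n.
  by rewrite gcurve_isom // ?s0 ?at0.
have h1 := metric_triangle (w n) (h s) (g (a * t n)).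
have h2 := metric_triangle (h s) (g s) (g (a * t n)).
have h3 : d * t n <= e / 4 * t n by rewrite ler_pM2r.
have et : 0 < e * t n by rewrite mulr_gt0.
by move: m1 h3; rewrite mulrAC => m1 h3; lrao ws m1 m3 h1 h2 h3 et.
Qed.

Lemma blowup_dist2 t w v a b xi eta : scale t -> 0 <= a -> 0 <= b ->
  blowup t w a xi -> blowup t v b eta ->
  (fun n => (mdist (w n) (v n) / t n) ^+ 2) @ oou --> cd2 a b xi eta.
Proof.
move=> st a0 b0 Bw Bv; apply: ulimP => e e0.
(* [4 * (a + b) + 4] bounds the factor from passing to squares in [uz2]; [6 * (a * b)] collects the
   comparison with the cone in [zS] and the change of directions in [SS]. *)
pose K := 4 * (a + b) + 4 + 6 * (a * b); have ab := mulr_ge0 a0 b0.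
have K0 : 0 < K by rewrite /K; lrao a0 b0 ab.
pose d := Num.min 1 (e / (2 * K)).
have d0 : 0 < d by rewrite lt_min ltr01 divr_gt0 // mulr_gt0.
have [d1 dK] : d <= 1 /\ d * K < e.
  split; first by rewrite /d ge_min lexx.
  have : d <= e / (2 * K) by rewrite /d ge_min lexx orbT.
  by rewrite ler_pdivlMr ?mulr_gt0 // => h; have := mulr_gt0 d0 K0; lrao h e0.
have [g gx gP] := blowup_fix st a0 Bw d0; have [h hx hP] := blowup_fix st b0 Bv d0.
have [c c0 [cg ch_ cP]] := geo_cone g h d0.
apply: filterS2 (filterI gP hP) (filterI (scale_lt a st c0) (scale_lt b st c0)).
move=> n [[ag wg] [bh vh]] [/= ac bc]; have t0 := st.1 n.
have := cP (a * t n) (b * t n); rewrite ac bc !mulr_ge0 ?(ltW t0) // => /(_ isT isT) cE1.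
set u := mdist (w n) (v n) / t n; pose z := mdist (g (a * t n)) (h (b * t n)) / t n.
have u0 : 0 <= u by rewrite divr_ge0 ?mdist_ge0 // ltW.
have z0 : 0 <= z by rewrite divr_ge0 ?mdist_ge0 // ltW.
have zab : z <= a + b.
  rewrite ler_pdivrMr // mulrDl.
  have := metric_triangle (g (a * t n)) p (h (b * t n)).
  by rewrite (metric_sym _ p) !geo_dist // !mulr_ge0 ?(ltW t0).
have uz : `|u - z| <= 2 * d.
  rewrite -mulrBl normrM [X in _ * X]gtr0_norm ?invr_gt0 // ler_pdivrMr //.
  have t1 := metric_triangle (w n) (g (a * t n)) (v n).
  have t2 := metric_triangle (g (a * t n)) (h (b * t n)) (v n).
  have t3 := metric_triangle (g (a * t n)) (w n) (h (b * t n)).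
  have t4 := metric_triangle (w n) (v n) (h (b * t n)).
  rewrite (metric_sym (h _) (v n)) in t2; rewrite (metric_sym (g _) (w n)) in t3.
  by rewrite ler_norml; apply/andP; split; lrao t1 t2 t3 t4 wg vh.
have zS : `|z ^+ 2 - cd2 a b (dir g) (dir h)| <= 2 * (a * b) * d.
  have t20 : 0 < t n ^+ 2 by rewrite exprn_gt0.
  rewrite -(ler_pM2r t20) -[X in _ * X <= _](gtr0_norm t20) -normrM mulrBl.
  rewrite -exprMn divfK ?gt_eqF // [leRHS](_ : _ = 2 * (a * t n) * (b * t n) * d); last by ring.
  by apply: le_trans cE1; rewrite le_eqVlt; apply/orP; left; apply/eqP; congr `|_|; rewrite /cd2; ring.
have SS : `|cd2 a b (dir g) (dir h) - cd2 a b xi eta| <= 4 * (a * b) * d.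
  rewrite /cd2 (_ : _ - _ = 2 * (a * b) * (cos (mdist xi eta) - cos (mdist (dir g) (dir h)))); last by ring.
  rewrite normrM ger0_norm ?mulr_ge0 // (_ : 4 * (a * b) * d = 2 * (a * b) * (2 * d)); last by ring.
  rewrite ler_wpM2l ?mulr_ge0 // (le_trans (cos_lip _ _)) //.
  have t1 := metric_triangle xi (dir g) eta; have t2 := metric_triangle (dir g) (dir h) eta.
  have t3 := metric_triangle (dir g) xi (dir h); have t4 := metric_triangle xi eta (dir h).
  rewrite (metric_sym xi (dir g)) in t1; rewrite (metric_sym eta) in t4.
  by rewrite ler_norml; apply/andP; split; lrao t1 t2 t3 t4 gx hx.
have uz2 : `|u ^+ 2 - z ^+ 2| <= d * (4 * (a + b) + 4).
  rewrite subr_sqr normrM [X in _ * X]ger0_norm ?addr_ge0 //.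
  have : u + z <= 2 * (a + b) + 2.
    by move: uz; rewrite ler_norml => /andP[_ uz]; lrao uz zab d1.
  by move=> h1; apply: le_trans (ler_pM (normr_ge0 _) (addr_ge0 u0 z0) uz h1) _; lra.
apply: le_lt_trans dK; rewrite /K.
move: zS SS uz2; rewrite !ler_norml => /andP[h1 h2] /andP[h3 h4] /andP[h5 h6].
by apply/andP; split; lrao h1 h2 h3 h4 h5 h6.
Qed.

Lemma blowup_dist t w v a b xi eta : scale t -> 0 <= a -> 0 <= b ->
  blowup t w a xi -> blowup t v b eta ->
  (fun n => mdist (w n) (v n) / t n) @ oou --> Num.sqrt (cd2 a b xi eta).
Proof.
move=> st a0 b0 Bw Bv.
have := @continuous_ulim R (@Num.sqrt R) _ _ (@sqrt_continuous R) (blowup_dist2 st a0 b0 Bw Bv).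
apply: ulim_eq; apply: oou_all => n /=.
by rewrite sqrtr_sqr ger0_norm // divr_ge0 ?mdist_ge0 // ltW //; exact: st.1.
Qed.

(** [xi] may have no geodesic, and the geodesics that approximate it may get shorter and shorter.
    Saturation lets the approximation improve slowly enough for each of them to reach the distance
    [a * t n]. *)
Lemma blowup_ex t a xi : scale t -> 0 <= a -> exists w, blowup t w a xi.
Proof.
move=> st a0; have [||w wP] := @saturation X p (fun m n x => exists2 g : geodesic p,
    mdist (dir g) xi < m.+1%:R^-1 & a * t n <= glen g /\ x = g (a * t n)).
- move=> m n x [g gx gE]; exists g => //; apply: lt_le_trans gx _.
  by rewrite lef_pV2 ?posrE ?ltr0n // ler_nat.
- move=> m; have [|g gx] := @dir_near R X p xi m.+1%:R^-1; first by rewrite invr_gt0 ltr0n.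
  apply: (oou_imply _ (scale_lt a st (glen_gt0 g))) => n /= /ltW ag.
  by exists (g (a * t n)), g => //; rewrite metric_sym.
exists w => e e0; have [m mP] := filter_ex (ulim0P inv_ulim0 e0).
apply: (oou_imply _ (wP m)) => n /= [g gx [ag ->]].
have et : 0 <= e * t n by rewrite mulr_ge0 // ltW //; exact: st.1.
exists g, (a * t n); split=> //.
- by apply: lt_trans gx _; move: mP => /=; rewrite gtr0_norm // invr_gt0 ltr0n.
- by rewrite ag mulr_ge0 // ltW //; exact: st.1.
- by rewrite subrr normr0.
- by rewrite mdistxx.
Qed.

Lemma blowup_near t w v a xi : (forall e, 0 < e -> oou [set n | mdist (w n) (v n) <= e * t n]) ->
  blowup t w a xi -> blowup t v a xi.
Proof.
move=> wv B e e0; have e20 : 0 < e / 2 by rewrite divr_gt0.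
apply: filterS2 (wv _ e20) (B _ e20) => n /= h [g [s [gx sg sa ws]]].
have ht : e * t n = e / 2 * t n + e / 2 * t n by rewrite -mulrDl -splitr.
have pos : 0 <= e / 2 * t n by apply: le_trans (mdist_ge0 _ _) h.
exists g, s; split=> //; rewrite ?ht.
- by lrao gx e0.
- by lrao sa pos.
- by have := metric_triangle (v n) (w n) (g s); rewrite (metric_sym (v n) (w n)); lrao h ws.
Qed.

Lemma blowup_geo t a g : scale t -> 0 <= a -> blowup t (fun n => g (a * t n)) a (dir g).
Proof.
move=> st a0 e e0; apply: (oou_imply _ (scale_lt a st (glen_gt0 g))) => n /= /ltW ag.
have t0 := ltW (st.1 n); have et := mulr_ge0 (ltW e0) t0.
by exists g, (a * t n); split; rewrite ?mdistxx ?subrr ?normr0 // ag mulr_ge0.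
Qed.

Lemma blowup_base t a w xi : scale t -> 0 <= a -> blowup t w a xi ->
  (fun n => mdist p (w n) / t n) @ oou --> a.
Proof.
move=> st a0 B; have B0 : blowup t (fun _ => p) 0 xi.
  move=> e e0; have [g gx] := dir_near xi e0; apply: oou_all => n.
  have et := mulr_ge0 (ltW e0) (ltW (st.1 n)).
  exists g, 0; rewrite mul0r gcurve0 mdistxx subrr normr0 lexx ltW ?glen_gt0 //.
  by rewrite metric_sym.
have := blowup_dist st (lexx 0) a0 B0 B; rewrite /cd2 mulr0 !mul0r subr0 expr0n add0r.
by rewrite sqrtr_sqr ger0_norm.
Qed.

End TangentCone.

(** * Plane trigonometry for segments in the cone *)

Section Planar.
Context {R : realType}.
Implicit Types (a b d x y : R).

Lemma sin_le_id x : 0 <= x -> sin x <= x.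
Proof.
move=> x0; have := cos_lip (pi / 2 - x) (pi / 2); rewrite cosB cos_pihalf sin_pihalf.
rewrite mul0r add0r mul1r subr0 (_ : pi / 2 - x - pi / 2 = - x) ?normrN; last by ring.
by rewrite (ger0_norm x0); apply: le_trans; exact: ler_norm.
Qed.

Lemma one_sub_cos x : 1 - cos x = 2 * sin (x / 2) ^+ 2.
Proof.
have E : cos x = cos (x / 2) ^+ 2 - sin (x / 2) ^+ 2 by rewrite {1}[x]splitr cosD !expr2.
by rewrite E; have := cos2Dsin2 (x / 2); lra.
Qed.

Lemma chord_le x : 0 <= x -> x <= pi -> 2 - 2 * cos x <= x ^+ 2.
Proof.
move=> x0 xpi; have -> : 2 - 2 * cos x = 2 * (1 - cos x) by ring.
have x20 : 0 <= x / 2 by rewrite divr_ge0.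
rewrite one_sub_cos; have := sin_le_id x20.
have : 0 <= sin (x / 2) by apply: sin_ge0_pi; rewrite x20 /=; lra.
by move=> h1 h2; have : sin (x / 2) ^+ 2 <= (x / 2) ^+ 2; [rewrite ler_sqr ?nnegrE|lra].
Qed.

(** For [x <= 1] compare the spherical isosceles triangle of sides 1/2, 1/2 and [x] with the
    Euclidean one. Beyond, the chord is at least that of 1, and [pi <= 4] fixes the loss in the
    constant. *)
Lemma chord_ge : exists2 c : R, 0 < c & forall x, 0 <= x -> x <= pi -> (c * x) ^+ 2 <= 2 - 2 * cos x.
Proof.
have pi4 : pi <= 4 :> R by have := @pihalf_02 R; lra.
have pi2 : 2 <= pi :> R by have := @pihalf_ge1 R; lra.
have s0 : 0 < sin (1 / 2) :> R by apply: sin_gt0_pi; apply/andP; split; lra.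
exists (sin (1 / 2) / 2); first by rewrite divr_gt0.
have small x : 0 < x -> x <= 1 -> (2 * sin (1 / 2) * x) ^+ 2 <= 2 - 2 * cos x.
  move=> x0 x1; have := @cS_le_cE R (1 / 2) (1 / 2) x.
  have h0 : 0 < 1 / 2 :> R by lra.
  move=> /(_ h0 h0 ltac:(lra)) H; have {H} := H ltac:(by split; rewrite ?subrr ?normr0; lra).
  rewrite /cS /cE ler_pdivrMr ?mulr_gt0 //; have := cos2Dsin2 (1 / 2 : R).
  move: (cos (1 / 2)) (sin _) (cos x) => c s cx E H.
  have -> : (2 * s * x) ^+ 2 = 4 * (x ^+ 2 * s ^+ 2) by ring.
  have : ((1 / 2) ^+ 2 + (1 / 2) ^+ 2 - x ^+ 2) / (2 * (1 / 2) * (1 / 2)) * (s * s) =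
    s ^+ 2 - 2 * (x ^+ 2 * s ^+ 2) by field.
  by move=> E2; rewrite E2 in H; lrao H E.
move=> x; rewrite le_eqVlt => /orP[/eqP <- _|x0 xpi].
  by rewrite mulr0 expr0n cos0 mulr1 subrr.
have [x1|x1] := leP x 1.
  apply: le_trans (small x x0 x1); rewrite ler_sqr ?nnegrE ?mulr_ge0 ?divr_ge0 ?ltW //.
  by have := mulr_gt0 s0 x0; lra.
have h1 := small 1 ltr01 (lexx 1).
have h2 := @cos_ler R 1 x ler01 (ltW x1) xpi.
apply: le_trans (_ : 2 - 2 * cos 1 <= _); last by lra.
apply: le_trans h1; rewrite ler_sqr ?nnegrE ?mulr_ge0 ?divr_ge0 ?(ltW s0) ?(ltW x0) //.
rewrite mulr1 mulrAC ler_pdivrMr // [leRHS](_ : _ = sin (1 / 2) * 4); last by ring.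
by rewrite ler_pM2l //; lra.
Qed.

Lemma cos_piB x : cos (pi - x) = - cos x.
Proof. by rewrite cosB cospi sinpi mulN1r mul0r addr0. Qed.

Lemma sin_piB x : sin (pi - x) = sin x.
Proof. by rewrite sinB cospi sinpi mulN1r mul0r sub0r opprK. Qed.

Lemma sin_ratio (u v a b : R) : 0 <= u -> 0 <= v -> 0 < a -> 0 < b -> u + v = a + b -> a + b < pi ->
  sin b * sin u = sin a * sin v -> u = a.
Proof.
move=> u0 v0 a0 b0 uv abpi E.
have sS : 0 < sin (a + b) by apply: sin_gt0_pi; rewrite addr_gt0.
have H : sin (a + b) * sin (u - a) = 0.
  have vE : v = (a + b) - u by lrao uv.
  move: E; rewrite vE (_ : b = (a + b) - a); last by ring.
  rewrite (_ : a + (a + b - a) = a + b); last by ring.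
  rewrite !sinB; move: (sin (a + b)) (cos (a + b)) => S C E; lrao E.
move/eqP: H; rewrite mulf_eq0 gt_eqF //= => /eqP H.
apply/eqP; rewrite eq_le; apply/andP; split; rewrite leNgt; apply/negP => lt.
  have : 0 < sin (u - a) by apply: sin_gt0_pi; apply/andP; split; lrao lt uv v0 abpi a0 b0.
  by rewrite H ltxx.
have : 0 < sin (a - u) by apply: sin_gt0_pi; apply/andP; split; lrao lt u0 b0 abpi.
by rewrite -opprB sinN H oppr0 ltxx.
Qed.

Lemma cos_ltN1 d : 0 <= d -> d < pi -> -1 < cos d.
Proof. by move=> d0 dpi; rewrite -cospi cos_ltr. Qed.

(** Develop the two triangles with common side [s] next to each other in the plane: their outer
    vertices are at most [A + B] apart. If [a + b] exceeded [d], they would be farther apart than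
    vertices seen under the angle [d], whose distance is [A + B]. *)
Lemma planar_between r1 r2 (s : R) a b d A B : 0 < r1 -> 0 < r2 -> 0 <= s ->
  0 <= a <= pi -> 0 <= b <= pi -> 0 <= d -> d < pi -> d <= a + b -> 0 <= A -> 0 <= B ->
  A ^+ 2 = r1 ^+ 2 + s ^+ 2 - 2 * r1 * s * cos a ->
  B ^+ 2 = s ^+ 2 + r2 ^+ 2 - 2 * s * r2 * cos b ->
  (A + B) ^+ 2 = r1 ^+ 2 + r2 ^+ 2 - 2 * r1 * r2 * cos d -> a + b = d.
Proof.
move=> r10 r20 s0 /andP[a0 api] /andP[b0 bpi] d0 dpi dab A0 B0 EA EB ED.
have rr := mulr_gt0 r10 r20; have cd := cos_ltN1 d0 dpi.
(* If a + b > pi, replacing b by pi - a puts the base point between the two ends. *)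
have abpi : a + b <= pi.
  rewrite leNgt; apply/negP => abpi.
  have cb : cos b <= - cos a by rewrite -cos_piB cos_ler; lra.
  have AB : r1 + r2 <= A + B.
    have u0 : (r1 - s * cos a) ^+ 2 <= A ^+ 2.
      have := mulr_ge0 (sqr_ge0 s) (sqr_ge0 (sin a)); have := cos2Dsin2 a.
      by rewrite EA; move: (cos a) (sin a) => c si E; rewrite (_ : si ^+ 2 = 1 - c ^+ 2); lra.
    have v0 : (r2 + s * cos a) ^+ 2 <= B ^+ 2.
      have := mulr_ge0 (sqr_ge0 s) (sqr_ge0 (sin a)); have := cos2Dsin2 a.
      have h := mulr_ge0 (mulr_ge0 s0 (ltW r20)) (_ : 0 <= - cos a - cos b).
      have {}h := h ltac:(by lra); rewrite EB; move: (cos a) (sin a) (cos b) h => c si c' h E.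
      by rewrite (_ : si ^+ 2 = 1 - c ^+ 2); lra.
    have := ler_norm (r1 - s * cos a); have := ler_norm (r2 + s * cos a).
    have := u0; have := v0; rewrite -[(r1 - _) ^+ 2]real_normK ?num_real // -[(r2 + _) ^+ 2]real_normK ?num_real //.
    by rewrite !ler_sqr ?nnegrE ?normr_ge0 // => h1 h2 h3 h4; lrao h1 h2 h3 h4.
  have : (r1 + r2) ^+ 2 <= (A + B) ^+ 2 by rewrite ler_sqr ?nnegrE ?addr_ge0 // ltW.
  rewrite ED; move: (cos d) cd => c cd.
  by have := mulr_gt0 rr (_ : 0 < 1 + c); move/(_ ltac:(lra)) => h; lra.
apply/eqP; rewrite eq_le dab andbT leNgt; apply/negP => dlt.
have := cos_ltr d0 dlt abpi; rewrite cosD => h.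
have AB : r1 ^+ 2 + r2 ^+ 2 - 2 * r1 * r2 * (cos a * cos b - sin a * sin b) <= (A + B) ^+ 2.
  have AB0 := mulr_ge0 A0 B0.
  have E : r1 ^+ 2 + r2 ^+ 2 - 2 * r1 * r2 * (cos a * cos b - sin a * sin b) =
     A ^+ 2 + B ^+ 2 + 2 * ((s - r1 * cos a) * (r2 * cos b - s) + (r1 * sin a) * (r2 * sin b)).
    by rewrite EA EB; ring.
  rewrite E; have : (s - r1 * cos a) * (r2 * cos b - s) + r1 * sin a * (r2 * sin b) <= A * B.
    have EA' : A ^+ 2 = (s - r1 * cos a) ^+ 2 + (r1 * sin a) ^+ 2.
      by rewrite EA; have := cos2Dsin2 a; move: (cos a) (sin a) => c si e; rewrite [(r1 * si) ^+ 2]exprMn (_ : si ^+ 2 = 1 - c ^+ 2); lra.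
    have EB' : B ^+ 2 = (r2 * cos b - s) ^+ 2 + (r2 * sin b) ^+ 2.
      by rewrite EB; have := cos2Dsin2 b; move: (cos b) (sin b) => c si e; rewrite [(r2 * si) ^+ 2]exprMn (_ : si ^+ 2 = 1 - c ^+ 2); lra.
    move: EA' EB'; move: (s - r1 * cos a) (r1 * sin a) (r2 * cos b - s) (r2 * sin b) => p q u v E1 E2.
    have : (p * u + q * v) ^+ 2 <= (A * B) ^+ 2.
      rewrite exprMn E1 E2; have := sqr_ge0 (p * v - q * u); lra.
    rewrite -[(p * u + q * v) ^+ 2]real_normK ?num_real // ler_sqr ?nnegrE ?normr_ge0 //.
    by rewrite ler_norml => /andP[].
  by lra.
move: AB; rewrite ED; move: (cos d) (_ - _) h => c c' h AB.
by have := mulr_gt0 rr (_ : 0 < c - c'); move/(_ ltac:(lra)) => h'; lra.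
Qed.

Lemma planar_point r1 r2 (s l : R) a b A B : 0 <= s ->
  A ^+ 2 = r1 ^+ 2 + s ^+ 2 - 2 * r1 * s * cos a ->
  B ^+ 2 = s ^+ 2 + r2 ^+ 2 - 2 * s * r2 * cos b ->
  (A + B) ^+ 2 = r1 ^+ 2 + r2 ^+ 2 - 2 * r1 * r2 * cos (a + b) -> A = l * (A + B) ->
  (1 - l) * r1 * sin a = l * r2 * sin b /\ s = (1 - l) * r1 * cos a + l * r2 * cos b.
Proof.
move=> s0 EA EB ED El; have EB1 : B = (1 - l) * (A + B) by rewrite mulrBl mul1r -El; ring.
(* With the first axis along the middle side, [P] and [Q] are, up to sign, the coordinates of the
   difference between the dividing point and the convex combination of the two ends. Stewart's
   theorem gives its squared norm. *)
pose P := (1 - l) * r1 * sin a - l * r2 * sin b.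
pose Q := s - ((1 - l) * r1 * cos a + l * r2 * cos b).
suff H : P ^+ 2 + Q ^+ 2 = 0.
  have P0 := sqr_ge0 P; have Q0 := sqr_ge0 Q.
  have : P ^+ 2 == 0 by rewrite eq_le P0 andbT; lra.
  have : Q ^+ 2 == 0 by rewrite eq_le Q0 andbT; lra.
  by rewrite !sqrf_eq0 /P /Q !subr_eq0 => /eqP Q1 /eqP P1.
have -> : P ^+ 2 + Q ^+ 2 = (1 - l) * A ^+ 2 + l * B ^+ 2 - l * (1 - l) * (A + B) ^+ 2.
  rewrite EA EB ED cosD /P /Q.
  have Ea := cos2Dsin2 a; have Eb := cos2Dsin2 b.
  have {}Ea : sin a ^+ 2 = 1 - cos a ^+ 2 by lra.
  have {}Eb : sin b ^+ 2 = 1 - cos b ^+ 2 by lra.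
  move: (cos a) (cos b) (sin a) (sin b) Ea Eb => ca cb sa sb Ea Eb.
  have -> : ((1 - l) * r1 * sa - l * r2 * sb) ^+ 2 = ((1 - l) * r1) ^+ 2 * sa ^+ 2
     + (l * r2) ^+ 2 * sb ^+ 2 - 2 * ((1 - l) * r1) * (l * r2) * (sa * sb) by ring.
  by rewrite Ea Eb; ring.
rewrite [in X in X + _ - _]El [in X in _ + X - _]EB1; ring.
Qed.

End Planar.

Lemma uniq4 (T : eqType) (a b c d : T) : uniq [:: a; b; c; d] ->
  [/\ a != b, a != c, a != d, b != c & b != d /\ c != d].
Proof.
by rewrite /= !inE !negb_or => /and4P[/and3P[-> -> ->] /andP[-> ->] ->].
Qed.

Section Structures.
Context {R : realType}.

Definition lgeodesic (X : metricType R) : Prop := forall p : X, exists2 r : R, 0 < r &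
  forall a b, mdist p a < r -> mdist p b < r -> a != b ->
    exists g : geodesic a, glen g = mdist a b /\ gend g = b.

Record alexl (X : metricType R) : Prop := Alexl {
  alexl_complete : complete_space X ;
  alexl_curv : curv4 X ;
  alexl_doubling : ldoubling X ;
  alexl_geodesic : lgeodesic X }.

(* The spherical Stewart inequality and the perimeter bound stand for curvature at least 1. *)
Record spherical (X : metricType R) : Prop := Spherical {
  sph_alexl : alexl X ;
  sph_tbounded : tbounded [set: X] ;
  sph_pi : forall x y : X, mdist x y <= pi ;
  sph_perimeter : forall x y z : X, mdist x y + mdist y z + mdist z x <= 2 * pi ;
  sph_between : forall (x y : X) a b, 0 <= a -> 0 <= b -> mdist x y = a + b -> a + b < pi ->
    exists z, mdist x z = a /\ mdist z y = b ;
  sph_stewart : forall w x y z : X, mdist x z + mdist z y = mdist x y -> mdist x y < pi ->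
    cos (mdist w z) * sin (mdist x y) <=
    cos (mdist w x) * sin (mdist z y) + cos (mdist w y) * sin (mdist x z) }.

Lemma oou_forall_lt (N : nat) (P : nat -> set nat) : (forall i, (i < N)%N -> oou (P i)) ->
  oou [set n | forall i, (i < N)%N -> P i n].
Proof.
elim: N => [|N IH] H; first by apply: oou_all.
apply: filterS2 (IH (fun i iN => H i (ltnW iN))) (H N (ltnSn N)) => n h1 h2 i.
by rewrite ltnS leq_eqVlt => /orP[/eqP ->//|]; exact: h1.
Qed.

Lemma oouI (A B : set nat) : oou A -> oou B -> oou (A `&` B).
Proof. exact: filterI. Qed.

Lemma ulim_lt (u : nat -> R) (l b : R) : u @ oou --> l -> l < b -> oou [set n | u n < b].
Proof.
move=> ul lb; have h : 0 < b - l by lra.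
have u0 : (fun n => u n - l) @ oou --> (0 : R).
  by rewrite -[X in _ --> X](subrr l); apply: cvgB => //; exact: ulim_cst.
by apply: (oou_imply _ (ulim0P u0 h)) => n /=; rewrite ltr_norml => /andP[_ h1]; lrao h1.
Qed.

Lemma ulim_gt (u : nat -> R) (l b : R) : u @ oou --> l -> b < l -> oou [set n | b < u n].
Proof.
move=> ul bl; have nl : (fun n => - u n) @ oou --> - l by apply: cvgN.
have h : - l < - b by rewrite ltrN2.
by apply: (oou_imply _ (ulim_lt nl h)) => n /=; rewrite ltrN2.
Qed.

Lemma acos_ulim (u : nat -> R) (l : R) : oou [set n | -1 <= u n <= 1] -> -1 <= l <= 1 ->
  u @ oou --> l -> (fun n => acos (u n)) @ oou --> acos l.
Proof.
move=> uI lI ul; apply: ulimP => e e0; have [d d0 dP] := acos_cont lI e0.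
have ul0 : (fun n => l - u n) @ oou --> (0 : R).
  by rewrite -[X in _ --> X](subrr l); apply: cvgB => //; exact: ulim_cst.
by apply: filterS2 uI (ulim0P ul0 d0) => n /= h1 h2; rewrite distrC; exact: dP.
Qed.

Lemma cE_ulim (b c a : nat -> R) (B C A : R) : 0 < B -> 0 < C -> b @ oou --> B ->
  c @ oou --> C -> a @ oou --> A -> (fun n => cE (b n) (c n) (a n)) @ oou --> cE B C A.
Proof.
move=> B0 C0 bB cC aA; rewrite /cE; apply: cvgM.
  by apply: cvgB; [apply: cvgD|]; rewrite /GRing.exp /=; apply: cvgM.
apply: cvgV; first by rewrite mulf_neq0 ?mulf_neq0 ?gt_eqF.
by apply: cvgM => //; apply: cvgM => //; exact: ulim_cst.
Qed.

(* Midpoints alone would need completing; [sph_between] gives all intermediate points. *)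
Lemma geodesic_of_tbounded (X : metricType R) (x y : X) : complete_space X -> tbounded [set: X] ->
  (forall (x y : X) a b, 0 <= a -> 0 <= b -> mdist x y = a + b -> a + b < pi ->
    exists z, mdist x z = a /\ mdist z y = b) ->
  x != y -> mdist x y < pi -> exists g : geodesic x, glen g = mdist x y /\ gend g = y.
Proof.
move=> cX tX bX xy xypi.
have xy0 : 0 < mdist x y by rewrite mdist_gt0.
have [||c [c0 cy cI]] := @geodesic_of_between R X x y.
- by move=> w _; apply: (@tbounded_utends _ _ [set: X]) => //; exact: oou_all.
- move=> z a xzy a0 azy.
  by apply: bX => //; have := mdist_ge0 x z; lra.
have [g [gl gc]] := mk_geodesic xy0 c0 cI.
by exists g; split=> //; rewrite /gend gl gc.
Qed.

End Structures.

Section ConeGeometry.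
Context {R : realType} {X : metricType R} (c4 : curv4 X) {p : X}.
Implicit Types (xi eta zeta : direction p).

Definition cdist (a b : R) xi eta : R := Num.sqrt (cd2 a b xi eta).

Lemma cdist_ge0 a b xi eta : 0 <= cdist a b xi eta.
Proof. exact: sqrtr_ge0. Qed.

Lemma cdist_sqr a b xi eta : 0 <= a -> 0 <= b -> cdist a b xi eta ^+ 2 = cd2 a b xi eta.
Proof. by move=> a0 b0; rewrite sqr_sqrtr // cd2_ge0. Qed.

Lemma cdist_gt0 a b xi eta : 0 < a -> 0 < b -> (a != b \/ xi != eta) -> 0 < cdist a b xi eta.
Proof.
move=> a0 b0 ab; rewrite sqrtr_gt0 /cd2.
have E : a ^+ 2 + b ^+ 2 - 2 * a * b * cos (mdist xi eta) =
   (a - b) ^+ 2 + 2 * (a * b) * (1 - cos (mdist xi eta)) by ring.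
rewrite E; have h0 := mulr_gt0 a0 b0.
have h1 : 0 <= 1 - cos (mdist xi eta) by rewrite subr_ge0 cos_le1.
case: ab => ab.
  apply: ltr_wpDr; first by rewrite mulr_ge0 // mulr_ge0 // ltW.
  by rewrite lt_neqAle sqr_ge0 andbT eq_sym sqrf_eq0 subr_eq0.
apply: ltr_wpDl; first exact: sqr_ge0.
rewrite mulr_gt0 ?mulr_gt0 // subr_gt0 -cos0 cos_ltr //; first by rewrite mdist_gt0.
exact: direction_le_pi.
Qed.

Lemma blowup_pos t u v a b xi eta : scale t -> 0 <= a -> 0 <= b ->
  blowup t u a xi -> blowup t v b eta -> 0 < cdist a b xi eta -> oou [set n | u n != v n].
Proof.
move=> st a0 b0 Bu Bv ab0; apply: (oou_imply _ (ulim_gt (blowup_dist c4 st a0 b0 Bu Bv) ab0)).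
by move=> n /= h; apply/eqP => E; rewrite E mdistxx mul0r ltxx in h.
Qed.

Lemma blowup_small t u v a b xi eta d : scale t -> 0 <= a -> 0 <= b ->
  blowup t u a xi -> blowup t v b eta -> 0 < d -> oou [set n | mdist (u n) (v n) < d].
Proof.
move=> st a0 b0 Bu Bv d0.
have h : cdist a b xi eta < cdist a b xi eta + 1 by rewrite ltrDl.
apply: filterS2 (ulim_lt (blowup_dist c4 st a0 b0 Bu Bv) h) (scale_lt (cdist a b xi eta + 1) st d0).
by move=> n /=; rewrite ltr_pdivrMr ?st.1 //; exact: lt_trans.
Qed.

Lemma blowup_close t u a xi d : scale t -> 0 <= a -> blowup t u a xi -> 0 < d ->
  oou [set n | mdist p (u n) < d].
Proof.
move=> st a0 Bu d0; have h : a < a + 1 by rewrite ltrDl.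
apply: filterS2 (ulim_lt (blowup_base c4 st a0 Bu) h) (scale_lt (a + 1) st d0).
by move=> n /=; rewrite ltr_pdivrMr ?st.1 //; exact: lt_trans.
Qed.

(** [cE] does not change when the triangle is rescaled by [t n], and [cH] approaches it at small
    scale; so hyperbolic angles tend to the Euclidean angles of the cone. *)
Lemma angle_ulim k t (u v w : nat -> X) a b c xi eta zeta : 0 < k -> scale t ->
  0 <= a -> 0 <= b -> 0 <= c -> blowup t u a xi -> blowup t v b eta -> blowup t w c zeta ->
  0 < cdist a b xi eta -> 0 < cdist a c xi zeta ->
  -1 <= cE (cdist a b xi eta) (cdist a c xi zeta) (cdist b c eta zeta) <= 1 /\
  (fun n => acos (cH k (mdist (u n) (v n)) (mdist (u n) (w n)) (mdist (v n) (w n)))) @ oou -->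
  acos (cE (cdist a b xi eta) (cdist a c xi zeta) (cdist b c eta zeta)).
Proof.
move=> k0 st a0 b0 c0 Bu Bv Bw ab0 ac0.
have := cE_ulim ab0 ac0 (blowup_dist c4 st a0 b0 Bu Bv) (blowup_dist c4 st a0 c0 Bu Bw)
  (blowup_dist c4 st b0 c0 Bv Bw).
rewrite -!/(cdist _ _ _ _); set S := cE _ _ _ => lS.
have pos := oouI (blowup_pos st a0 b0 Bu Bv ab0) (blowup_pos st a0 c0 Bu Bw ac0).
have E n : cE (mdist (u n) (v n) / t n) (mdist (u n) (w n) / t n) (mdist (v n) (w n) / t n) =
    cE (mdist (u n) (v n)) (mdist (u n) (w n)) (mdist (v n) (w n)).
  rewrite !(mulrC _ (t n)^-1) cE_scale // invr_neq0 // gt_eqF //; exact: st.1.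
have cEI : oou [set n | -1 <= cE (mdist (u n) (v n)) (mdist (u n) (w n)) (mdist (v n) (w n)) <= 1].
  apply: (oou_imply _ pos) => n /= [uv uw].
  by apply: cE_itv; rewrite ?mdist_gt0 //; exact: tri_mdist.
have SI : -1 <= S <= 1.
  apply/andP; split.
    by apply: (ulim_le (@ulim_cst R (-1)) lS); apply: (oou_imply _ cEI) => n /=; rewrite E => /andP[].
  by apply: (ulim_le lS (@ulim_cst R 1)); apply: (oou_imply _ cEI) => n /=; rewrite E => /andP[].
split=> //; apply: acos_ulim => //.
  apply: (oou_imply _ pos) => n /= [uv uw].
  by apply: cH_itv; rewrite ?mdist_gt0 //; exact: tri_mdist.
apply: ulimP => e e0; have e20 : 0 < e / 2 by rewrite divr_gt0.
have [d d0 dP] := cH_near_cE k0 e20.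
have S0 : (fun n => cE (mdist (u n) (v n) / t n) (mdist (u n) (w n) / t n) (mdist (v n) (w n) / t n) - S) @ oou --> (0 : R).
  by rewrite -[X in _ --> X](subrr S); apply: cvgB => //; exact: ulim_cst.
apply: filterS2 (oouI pos (ulim0P S0 e20))
  (oouI (blowup_small st a0 b0 Bu Bv d0) (blowup_small st a0 c0 Bu Bw d0)).
move=> n /= [[uv uw]]; rewrite E => h1 [h2 h3].
have := dP (mdist (u n) (v n)) (mdist (u n) (w n)) (mdist (v n) (w n)).
rewrite !mdist_gt0 uv uw h2 h3 => /(_ isT isT (tri_mdist _ _ _)); move: h1.
move: (cH _ _ _ _) (cE _ _ _) => x y; rewrite ltr_norml ler_norml => /andP[h4 h5] /andP[h6 h7].
by rewrite ltr_norml; apply/andP; split; lrao h4 h5 h6 h7.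
Qed.

Lemma cone_fourpt x0 x1 x2 x3 (a0 a1 a2 a3 : R) :
  0 <= a0 -> 0 <= a1 -> 0 <= a2 -> 0 <= a3 ->
  0 < cdist a0 a1 x0 x1 -> 0 < cdist a0 a2 x0 x2 -> 0 < cdist a0 a3 x0 x3 ->
  0 < cdist a1 a2 x1 x2 -> 0 < cdist a2 a3 x2 x3 -> 0 < cdist a3 a1 x3 x1 ->
  acos (cE (cdist a0 a1 x0 x1) (cdist a0 a2 x0 x2) (cdist a1 a2 x1 x2)) +
  acos (cE (cdist a0 a2 x0 x2) (cdist a0 a3 x0 x3) (cdist a2 a3 x2 x3)) +
  acos (cE (cdist a0 a3 x0 x3) (cdist a0 a1 x0 x1) (cdist a3 a1 x3 x1)) <= 2 * pi.
Proof.
move=> a00 a10 a20 a30 d01 d02 d03 d12 d23 d31.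
have st := @scale_harmonic R; have [k [r [k0 r0 F]]] := curv4_fourpt p c4.
have [w0 B0] := blowup_ex x0 st a00; have [w1 B1] := blowup_ex x1 st a10.
have [w2 B2] := blowup_ex x2 st a20; have [w3 B3] := blowup_ex x3 st a30.
have [_ l1] := angle_ulim k0 st a00 a10 a20 B0 B1 B2 d01 d02.
have [_ l2] := angle_ulim k0 st a00 a20 a30 B0 B2 B3 d02 d03.
have [_ l3] := angle_ulim k0 st a00 a30 a10 B0 B3 B1 d03 d01.
apply: (ulim_le (cvgD (cvgD l1 l2) l3) (@ulim_cst R (2 * pi))).
have n01 := blowup_pos st a00 a10 B0 B1 d01; have n02 := blowup_pos st a00 a20 B0 B2 d02.
have n03 := blowup_pos st a00 a30 B0 B3 d03; have n12 := blowup_pos st a10 a20 B1 B2 d12.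
have n23 := blowup_pos st a20 a30 B2 B3 d23; have n31 := blowup_pos st a30 a10 B3 B1 d31.
have s0 := blowup_close st a00 B0 r0; have s1 := blowup_close st a10 B1 r0.
have s2 := blowup_close st a20 B2 r0; have s3 := blowup_close st a30 B3 r0.
apply: filterS2 (oouI (oouI n01 n02) (oouI (oouI n03 n12) (oouI n23 n31)))
  (oouI (oouI s0 s1) (oouI s2 s3)).
move=> n [[h1 h2] [[h3 h4] [h5 h6]]] [[h7 h8] [h9 h10]]; apply: F => //.
rewrite /= in h1 h2 h3 h4 h5 h6.
by rewrite /= !inE !negb_or h1 h2 h3 h4 h5 (eq_sym (w1 n) (w3 n)) h6.
Qed.

End ConeGeometry.

(** * Spaces of directions are spherical *)

Section DirectionStructure.
Context {R : realType} {X : metricType R} (aX : alexl X) {p : X}.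
Implicit Types (xi eta zeta : direction p).

Let c4 := alexl_curv aX.

(** Place the directions at height 1 in the cone. Chords and arcs are comparable, so that points in
    a ball of radius [s] with separation [c * s] give points of [X] in a ball of radius [2 * s], in
    units of the scale, with separation [k * (c * s) / 2]: hence the ratio [k * c / 4]. *)
Lemma direction_gdoubling c : 0 < c -> exists N : nat, forall (y : direction p) s f, 0 < s -> s <= 4 ->
  (forall i, (i < N)%N -> mdist y (f i) <= s) ->
  exists i j, [/\ (i < j)%N, (j < N)%N & mdist (f i) (f j) < c * s].
Proof.
move=> c0; have [r r0 H] := alexl_doubling aX p; have [k k0 K] := @chord_ge R.
have [|N NP] := H (k * c / 4); first by rewrite divr_gt0 // mulr_gt0.
exists N => y s f s0 s4 fs; apply: contrapT => /forallNP nf.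
have sep i j : (i < j)%N -> (j < N)%N -> c * s <= mdist (f i) (f j).
  move=> ij jN; rewrite leNgt; apply/negP => h.
  by apply: (nf i); exists j.
have st := @scale_harmonic R; have [yw By] := blowup_ex y st ler01.
have /choice[F FP] : forall i, exists w, blowup (fun n => n.+1%:R^-1) w 1 (f i).
  by move=> i; exact: blowup_ex st ler01.
have chord xi eta : cdist 1 1 xi eta = Num.sqrt (2 - 2 * cos (mdist xi eta)).
  by rewrite /cdist /cd2; congr Num.sqrt; ring.
have h1 i : (i < N)%N -> oou [set n | mdist (yw n) (F i n) / n.+1%:R^-1 < 2 * s].
  move=> iN; apply: (ulim_lt (blowup_dist c4 st ler01 ler01 By (FP i))).
  rewrite -/(cdist _ _ _ _) chord; apply: le_lt_trans (_ : s < _); last by lra.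
  apply: le_trans (fs i iN); rewrite -[leRHS]ger0_norm ?mdist_ge0 // -sqrtr_sqr.
  by rewrite ler_wsqrtr // chord_le ?mdist_ge0 // direction_le_pi.
have h2 i : (i < N)%N -> oou [set n | forall j, (j < N)%N -> (i < j)%N ->
    k * (c * s) / 2 < mdist (F i n) (F j n) / n.+1%:R^-1].
  move=> iN; apply: oou_forall_lt => j jN.
  have [ij|ij] := boolP (i < j)%N; last by apply: oou_all => n.
  have lim : oou [set n | k * (c * s) / 2 < mdist (F i n) (F j n) / n.+1%:R^-1].
    apply: (ulim_gt (blowup_dist c4 st ler01 ler01 (FP i) (FP j))).
    rewrite -/(cdist _ _ _ _) chord; have kcs : 0 < k * (c * s) by rewrite mulr_gt0 // mulr_gt0.
    apply: lt_le_trans (_ : k * (c * s) <= _); first by lra.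
    apply: le_trans (_ : k * mdist (f i) (f j) <= _); first by rewrite ler_pM2l // sep.
    rewrite -[leLHS]ger0_norm ?mulr_ge0 ?mdist_ge0 ?(ltW k0) // -sqrtr_sqr ler_wsqrtr //.
    by rewrite K ?mdist_ge0 // direction_le_pi.
  by apply: (oou_imply _ lim) => n /= h _.
have s20 : 0 < r / 2 by rewrite divr_gt0.
have [n [[n1 n2] [n3 n4]]] := filter_ex (oouI (oouI (oou_forall_lt h1) (oou_forall_lt h2))
  (oouI (blowup_close c4 st ler01 By r0) (scale_lt (2 * s) st r0))).
have t0 := st.1 n; rewrite /= in n1 n2 n3 n4; move: n1 n2 n4 t0.
move: (n.+1%:R^-1) => t n1 n2 n4 t0.
have [|||i [j [ij jN]]] := NP (yw n) (2 * s * t) (fun i => F i n) n3.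
- by rewrite mulr_gt0 // mulr_gt0.
- by [].
- by move=> i iN; rewrite -ler_pdivrMr // ltW // n1.
have := n2 i (ltn_trans ij jN) j jN ij; rewrite ltr_pdivlMr // => a1 a2.
by have := lt_trans a1 a2; rewrite (_ : k * c / 4 * _ = k * (c * s) / 2 * t) ?ltxx //; field.
Qed.

Lemma direction_tbounded : tbounded [set: direction p].
Proof.
have pi4 : pi <= 4 :> R by have := @pihalf_02 R; lra.
move=> e e0; have [|N NP] := @direction_gdoubling (e / 4); first by rewrite divr_gt0.
exists N => f _; have [|||i [j [ij jN h]]] := NP (f 0%N) 4 f => //.
  by move=> i _; apply: le_trans (direction_le_pi _ _) pi4.
by exists i, j; split=> //; rewrite divfK in h.
Qed.

Lemma direction_ldoubling : ldoubling (direction p).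
Proof.
move=> xi; exists 4 => // c c0; have [N NP] := direction_gdoubling c0.
by exists N => y s f _ s0 s4; apply: NP => //; exact: ltW.
Qed.

(** Central projection from the apex: with [x] at height [1 / cos] of its distance from [y], the
    points lie in the plane tangent at [y], and the Euclidean angles of the cone at [y] are the
    spherical ones. These are at least the hyperbolic ones by [cS_le_cE] and [cE_le_cH]. The radius
    [pi / 8] keeps the cosines positive. *)
Lemma direction_curv4 : curv4 (direction p).
Proof.
have pi2 : 2 <= pi :> R by have := @pihalf_ge1 R; lra.
exists 1 => // q; exists (pi / 8); first by rewrite divr_gt0 // pi_gt0.
move=> y x1 x2 x3 qy q1 q2 q3 U; have [n01 n02 n03 n12 [n13 n23]] := uniq4 U.
have near x : mdist q x < pi / 8 -> mdist y x < pi / 4.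
  by have := metric_triangle y q x; rewrite (metric_sym y q); move=> h1 h2; lrao h1 h2 qy.
have cpos x : mdist y x < pi / 4 -> 0 < cos (mdist y x).
  move=> h; apply: cos_gt0_pihalf; have := mdist_ge0 y x; have := @pi_gt0 R.
  by move=> h1 h2; apply/andP; split; lrao h h1 h2.
pose a x := (cos (mdist y x))^-1.
have a0 x : mdist q x < pi / 8 -> 0 < a x by move=> h; rewrite invr_gt0 cpos // near.
have D0 x : mdist q x < pi / 8 -> x != y -> cdist 1 (a x) y x = sin (mdist y x) / cos (mdist y x) /\
    0 < sin (mdist y x).
  move=> h xy; have h' := near x h; have c0 := cpos x h'.
  have s0 : 0 < sin (mdist y x).
    apply: sin_gt0_pi; rewrite mdist_gt0 eq_sym xy /=; have := @pi_gt0 R; lrao h'.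
  split=> //; rewrite /cdist /cd2 -[RHS]ger0_norm; last by rewrite divr_ge0 ?ltW.
  rewrite -sqrtr_sqr; congr Num.sqrt; rewrite exprMn exprVn /a.
  have E := cos2Dsin2 (mdist y x); have {E} -> : sin (mdist y x) ^+ 2 = 1 - cos (mdist y x) ^+ 2 by lra.
  by field; rewrite gt_eqF.
have key x z : mdist q x < pi / 8 -> mdist q z < pi / 8 -> x != y -> z != y -> x != z ->
    0 < cdist (a x) (a z) x z /\
    acos (cH 1 (mdist y x) (mdist y z) (mdist x z)) <=
    acos (cE (cdist 1 (a x) y x) (cdist 1 (a z) y z) (cdist (a x) (a z) x z)).
  move=> hx hz xy zy xz; have [Dx sx] := D0 x hx xy; have [Dz sz] := D0 z hz zy.
  have ax := a0 x hx; have az := a0 z hz.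
  have cx := cpos x (near x hx); have cz := cpos z (near z hz).
  split; first by apply: cdist_gt0 => //; right.
  have -> : cE (cdist 1 (a x) y x) (cdist 1 (a z) y z) (cdist (a x) (a z) x z) =
      cS (mdist y x) (mdist y z) (mdist x z).
    rewrite /cE /cS Dx Dz cdist_sqr ?ltW // /cd2 /a !exprMn !exprVn.
    have Ex := cos2Dsin2 (mdist y x); have Ez := cos2Dsin2 (mdist y z).
    have {}Ex : cos (mdist y x) ^+ 2 = 1 - sin (mdist y x) ^+ 2 by lra.
    have {}Ez : cos (mdist y z) ^+ 2 = 1 - sin (mdist y z) ^+ 2 by lra.
    move: Ex Ez cx cz sx sz; move: (cos (mdist y x)) (sin (mdist y x)) (cos (mdist y z)) (sin (mdist y z)) (cos (mdist x z)).
    move=> c s c' s' d Ex Ez cx cz sx sz.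
    apply: (@mulIf _ (2 * (s / c) * (s' / c'))).
      by rewrite !mulf_neq0 ?invr_neq0 // gt_eqF.
    rewrite divfK ?mulf_neq0 ?invr_neq0 ?gt_eqF //.
    transitivity ((s ^+ 2 - 1) / c ^+ 2 + (s' ^+ 2 - 1) / c' ^+ 2 + 2 * d / (c * c')).
      by field; rewrite !gt_eqF.
    have -> : s ^+ 2 - 1 = - c ^+ 2 by rewrite Ex; ring.
    have -> : s' ^+ 2 - 1 = - c' ^+ 2 by rewrite Ez; ring.
    by field; rewrite !gt_eqF.
  have m1 := near x hx; have m2 := near z hz.
  have p1 : 0 < mdist y x by rewrite mdist_gt0 eq_sym.
  have p2 : 0 < mdist y z by rewrite mdist_gt0 eq_sym.
  have T := tri_mdist y x z.
  have h1 := cE_le_cH ltr01 p1 p2 T.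
  have h2 := @cS_le_cE R _ _ _ p1 p2 ltac:(have := @pi_gt0 R; lrao m1 m2) T.
  have /andP[_ h3] := cH_itv ltr01 p1 p2 T.
  have lower : -1 <= cS (mdist y x) (mdist y z) (mdist x z).
    rewrite /cS ler_pdivlMr ?mulr_gt0 //.
    have [T1 T2] := T; have := @cos_ler R (mdist x z) (mdist y x + mdist y z) (mdist_ge0 _ _) T2.
    rewrite cosD => /(_ ltac:(have := @pi_gt0 R; lrao m1 m2)).
    by move: (cos _) (sin _ * _) (_ * _) => u v w' h; lrao h.
  by apply: acos_ler => //; apply: le_trans h1.
have l1 := key _ _ q1 q2 ltac:(by rewrite eq_sym) ltac:(by rewrite eq_sym) n12.
have l2 := key _ _ q2 q3 ltac:(by rewrite eq_sym) ltac:(by rewrite eq_sym) n23.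
have l3 := key _ _ q3 q1 ltac:(by rewrite eq_sym) ltac:(by rewrite eq_sym) ltac:(by rewrite eq_sym).
have pos x : mdist q x < pi / 8 -> y != x -> 0 < cdist 1 (a x) y x.
  by move=> h yx; apply: cdist_gt0 => //; [exact: a0|right].
have := @cone_fourpt R X c4 p y x1 x2 x3 1 (a x1) (a x2) (a x3) ler01 (ltW (a0 _ q1)) (ltW (a0 _ q2))
  (ltW (a0 _ q3)) (pos _ q1 n01) (pos _ q2 n02) (pos _ q3 n03) l1.1 l2.1 l3.1.
apply: le_trans; apply: lerD; first by apply: lerD; [exact: l1.2|exact: l2.2].
exact: l3.2.
Qed.

(** Local compactness of the tangent cone: the heights are bounded, and directions have limits
    because [direction p] is totally bounded and complete. *)
Lemma blowup_compact t (w : nat -> X) (C : R) xi : scale t ->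
  oou [set n | mdist p (w n) <= C * t n] -> exists a eta, 0 <= a /\ blowup t w a eta.
Proof.
move=> st wC; have [r r0 G] := alexl_geodesic aX p.
have /choice[z zP] : forall n, exists eta : direction p, w n != p -> mdist p (w n) < r ->
    exists g : geodesic p, [/\ dir g = eta, glen g = mdist p (w n) & gend g = w n].
  move=> n; have [/andP[wp wr]|H] := boolP ((w n != p) && (mdist p (w n) < r)).
    have [|//||g [gl ge]] := G p (w n); [by rewrite mdistxx|by rewrite eq_sym|].
    by exists (dir g) => _ _; exists g.
  by exists xi => wp wr; rewrite wp wr in H.
have [eta zeta] := tbounded_utends (@direction_complete R X p) direction_tbounded (oou_all (fun n => I : [set: direction p] (z n))).
have [|a /andP[a0 _] aP] := @ulim_bounded R (fun n => mdist p (w n) / t n) 0 C.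
  apply: (oou_imply _ wC) => n /= h; rewrite ler_pdivrMr ?st.1 // h andbT.
  by rewrite divr_ge0 ?mdist_ge0 // ltW // st.1.
exists a, eta; split=> // e e0.
have a'0 : (fun n => mdist p (w n) / t n - a) @ oou --> (0 : R).
  by rewrite -[X in _ --> X](subrr a); apply: cvgB => //; exact: ulim_cst.
apply: filterS2 (oouI (utendsP zeta e0) (ulim0P a'0 e0)) (oouI wC (scale_lt C st r0)).
move=> n [/= zn an] [/= wn Cn]; have t0 := st.1 n.
have an' : `|mdist p (w n) - a * t n| <= e * t n.
  rewrite (_ : _ - _ = (mdist p (w n) / t n - a) * t n); last by field; rewrite gt_eqF.
  by rewrite normrM (gtr0_norm t0) ler_pM2r // ltW.
have [wp|wp] := eqVneq (w n) p.
  have [g gx] := dir_near eta e0; exists g, 0; rewrite metric_sym gx lexx ltW ?glen_gt0 //.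
  move: an'; rewrite wp mdistxx gcurve0 mdistxx; split=> //.
  by rewrite mulr_ge0 // ltW.
have [g [gx gl ge]] := zP n wp (le_lt_trans wn Cn).
exists g, (glen g); rewrite gx lexx ltW ?glen_gt0 // {1}gl -[g (glen g)]/(gend g) ge mdistxx.
by rewrite mulr_ge0 // ltW.
Qed.

(** Join [xi] and [eta], both at height 1, by a segment of the cone, obtained as a limit of
    geodesics of [X]. The point that divides it in the ratio [sin a : sin b] is seen from the apex
    under the angles [a] and [b]. *)
Lemma direction_between xi eta a b : 0 <= a -> 0 <= b -> mdist xi eta = a + b -> a + b < pi ->
  exists zeta, mdist xi zeta = a /\ mdist zeta eta = b.
Proof.
rewrite le_eqVlt => /orP[/eqP <- _ xe _|a0]; first by exists xi; rewrite mdistxx xe add0r.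
rewrite le_eqVlt => /orP[/eqP <- xe _|b0 xe abpi]; first by exists eta; rewrite mdistxx xe addr0.
have xn : xi != eta by rewrite -mdist_gt0 xe addr_gt0.
have D0 : 0 < cdist 1 1 xi eta by apply: cdist_gt0 => //; right.
have sa : 0 < sin a by apply: sin_gt0_pi; rewrite a0 /=; lrao abpi b0.
have sb : 0 < sin b by apply: sin_gt0_pi; rewrite b0 /=; lrao abpi a0.
pose l := sin a / (sin a + sin b); have sab := addr_gt0 sa sb.
have l0 : 0 <= l by rewrite divr_ge0 ?ltW.
have l1 : l <= 1 by rewrite ler_pdivrMr // mul1r lerDl ltW.
have st := @scale_harmonic R; have [x Bx] := blowup_ex xi st ler01; have [z Bz] := blowup_ex eta st ler01.
have [r r0 G] := alexl_geodesic aX p.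
have /choice[y yP] : forall n, exists y, x n != z n -> mdist p (x n) < r -> mdist p (z n) < r ->
    mdist (x n) y = l * mdist (x n) (z n) /\ mdist y (z n) = (1 - l) * mdist (x n) (z n).
  move=> n; have [xz|xz] := eqVneq (x n) (z n); first by exists (x n).
  have [xr|xr] := ltP (mdist p (x n)) r; last by exists (x n).
  have [zr|zr] := ltP (mdist p (z n)) r; last by exists (x n).
  have [g [gl ge]] := G _ _ xr zr xz.
  have m0 := mdist_ge0 (x n) (z n).
  have lm : 0 <= l * mdist (x n) (z n) by rewrite mulr_ge0.
  have lm1 : l * mdist (x n) (z n) <= mdist (x n) (z n) by rewrite ler_piMl.
  exists (g (l * mdist (x n) (z n))) => _ _ _; split; first by rewrite geo_dist // gl lm.
  rewrite -{2}ge /gend gl geo_isom ?gl //; ring.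
have good := oouI (blowup_pos c4 st ler01 ler01 Bx Bz D0)
  (oouI (blowup_close c4 st ler01 Bx r0) (blowup_close c4 st ler01 Bz r0)).
have l12 : 1 < 2 :> R by lra.
have lD : cdist 1 1 xi eta < cdist 1 1 xi eta + 1 by rewrite ltrDl.
have [|s [zeta [s0 By]]] := @blowup_compact _ y (cdist 1 1 xi eta + 3) xi st.
  apply: filterS2 good (oouI (ulim_lt (blowup_base c4 st ler01 Bx) l12)
    (ulim_lt (blowup_dist c4 st ler01 ler01 Bx Bz) lD)).
  move=> n [xz [xr zr]] [] /=; rewrite !ltr_pdivrMr ?st.1 // => h1 h2.
  have [h3 _] := yP n xz xr zr; have h4 := metric_triangle p (x n) (y n).
  have h5 : l * mdist (x n) (z n) <= mdist (x n) (z n) by rewrite ler_piMl ?mdist_ge0.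
  by rewrite h3 in h4; have t0 := st.1 n; rewrite /= in t0; move: (n.+1%:R^-1) t0 h1 h2 => t t0 h1 h2; rewrite mulrDl; rewrite mulrDl in h2; lrao h1 h2 h4 h5 t0.
have EA : cdist 1 s xi zeta = l * cdist 1 1 xi eta.
  apply: (ulim_uniq (blowup_dist c4 st ler01 s0 Bx By)).
  have E : (fun n => l * (mdist (x n) (z n) / n.+1%:R^-1)) @ oou --> l * cdist 1 1 xi eta.
    by apply: cvgM; [exact: ulim_cst|exact: blowup_dist].
  apply: (ulim_eq _ E).
  by apply: (oou_imply _ good) => n /= [xz [xr zr]]; have [-> _] := yP n xz xr zr; rewrite mulrA.
have EB : cdist s 1 zeta eta = (1 - l) * cdist 1 1 xi eta.
  apply: (ulim_uniq (blowup_dist c4 st s0 ler01 By Bz)).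
  have E : (fun n => (1 - l) * (mdist (x n) (z n) / n.+1%:R^-1)) @ oou --> (1 - l) * cdist 1 1 xi eta.
    by apply: cvgM; [exact: ulim_cst|exact: blowup_dist].
  apply: (ulim_eq _ E).
  by apply: (oou_imply _ good) => n /= [xz [xr zr]]; have [_ ->] := yP n xz xr zr; rewrite mulrA.
have EAB : cdist 1 s xi zeta + cdist s 1 zeta eta = cdist 1 1 xi eta by rewrite EA EB; ring.
have A2 := @cdist_sqr R X p 1 s xi zeta ler01 s0; have B2 := @cdist_sqr R X p s 1 zeta eta s0 ler01.
have D2 := @cdist_sqr R X p 1 1 xi eta ler01 ler01; rewrite -EAB /cd2 xe in D2.
have ab : mdist xi zeta + mdist zeta eta = a + b.
  apply: (planar_between ltr01 ltr01 s0 _ _ _ abpi _ (cdist_ge0 _ _ _ _) (cdist_ge0 _ _ _ _) A2 B2 D2).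
  - by rewrite mdist_ge0 direction_le_pi.
  - by rewrite mdist_ge0 direction_le_pi.
  - by rewrite addr_ge0 ?ltW.
  - by rewrite -xe metric_triangle.
rewrite -ab in D2.
have [E _] := @planar_point R 1 1 s l _ _ _ _ s0 A2 B2 D2 ltac:(by rewrite EAB).
suff xa : mdist xi zeta = a by exists zeta; split=> //; lrao xa ab.
apply: (sin_ratio (mdist_ge0 _ _) (mdist_ge0 zeta eta) a0 b0 ab abpi).
have lS : (sin a + sin b) * l = sin a by rewrite mulrC divfK ?gt_eqF.
move: E lS; rewrite !mulr1; generalize l => m E lS.
have : (sin a + sin b) * ((1 - m) * sin (mdist xi zeta)) = (sin a + sin b) * (m * sin (mdist zeta eta)).
  by rewrite E.
by rewrite !mulrA mulrBr mulr1 lS (addrC (sin a)) addrK.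
Qed.

Lemma cone_itv x0 x1 x2 (a0 a1 a2 : R) : 0 <= a0 -> 0 <= a1 -> 0 <= a2 ->
  0 < cdist a0 a1 x0 x1 -> 0 < cdist a0 a2 x0 x2 ->
  -1 <= cE (cdist a0 a1 x0 x1) (cdist a0 a2 x0 x2) (@cdist R X p a1 a2 x1 x2) <= 1.
Proof.
move=> a00 a10 a20 h1 h2; have st := @scale_harmonic R.
have [w0 B0] := blowup_ex x0 st a00; have [w1 B1] := blowup_ex x1 st a10.
have [w2 B2] := blowup_ex x2 st a20.
by have [] := angle_ulim c4 ltr01 st a00 a10 a20 B0 B1 B2 h1 h2.
Qed.

(** The heights [r1] and [r2] make [z], at height 1, the midpoint of the segment from [x] to [y] in
    the cone. The four-point condition at [z] then is the inequality for the median from [w]; its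
    quadratic terms cancel, and what remains is the claim multiplied by the height of [w]. *)
Lemma direction_stewart w x y z : mdist x z + mdist z y = mdist x y -> @mdist R (direction p) x y < pi ->
  cos (mdist w z) * sin (mdist x y) <=
  cos (mdist w x) * sin (mdist z y) + cos (mdist w y) * sin (mdist x z).
Proof.
move=> xzy; rewrite -xzy => dpi.
have [xz|xz] := eqVneq x z; first by rewrite xz mdistxx sin0 mulr0 add0r addr0.
have [zy|zy] := eqVneq z y; first by rewrite zy mdistxx sin0 mulr0 add0r addr0.
have a0 : 0 < mdist x z by rewrite mdist_gt0.
have b0 : 0 < mdist z y by rewrite mdist_gt0.
have xy : x != y by rewrite -mdist_gt0 -xzy addr_gt0.
have sa : 0 < sin (mdist x z) by apply: sin_gt0_pi; rewrite a0 /=; lrao dpi b0.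
have sb : 0 < sin (mdist z y) by apply: sin_gt0_pi; rewrite b0 /=; lrao dpi a0.
have sd : 0 < sin (mdist x z + mdist z y) by apply: sin_gt0_pi; rewrite addr_gt0.
pose r1 := 2 * sin (mdist z y) / sin (mdist x z + mdist z y).
pose r2 := 2 * sin (mdist x z) / sin (mdist x z + mdist z y).
have r10 : 0 < r1 by rewrite divr_gt0 // mulr_gt0.
have r20 : 0 < r2 by rewrite divr_gt0 // mulr_gt0.
(* A height for [w] different from those of [x], [y] and [z], so that [w] coincides with none of
   them in the cone. *)
pose s := 1 + r1 + r2; have s0 : 0 < s by rewrite /s; lrao r10 r20.
have Y10 : 0 < cdist 1 r1 z x by apply: cdist_gt0 => //; right; rewrite eq_sym.
have Y20 : 0 < cdist 1 r2 z y by apply: cdist_gt0 => //; right.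
have Z0 : 0 < cdist r1 r2 x y by apply: cdist_gt0 => //; right.
have W0 : 0 < cdist 1 s z w by apply: cdist_gt0 => //; left; apply/eqP; rewrite /s; lrao r10 r20.
have U0 : 0 < cdist r2 s y w by apply: cdist_gt0 => //; left; apply/eqP; rewrite /s; lrao r10 r20.
have V0 : 0 < cdist s r1 w x by apply: cdist_gt0 => //; left; apply/eqP; rewrite /s; lrao r10 r20.
have := cone_fourpt c4 ler01 (ltW r10) (ltW r20) (ltW s0) Y10 Y20 W0 Z0 U0 V0.
have I1 := cone_itv ler01 (ltW r20) (ltW s0) Y20 W0.
have I2 := cone_itv ler01 (ltW s0) (ltW r10) W0 Y10.
have Y1 : cdist 1 r1 z x ^+ 2 = cd2 1 r1 z x by rewrite cdist_sqr // ltW.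
have Y2 : cdist 1 r2 z y ^+ 2 = cd2 1 r2 z y by rewrite cdist_sqr // ltW.
have Z2 : cdist r1 r2 x y ^+ 2 = cd2 r1 r2 x y by rewrite cdist_sqr // ltW.
have W2 : cdist 1 s z w ^+ 2 = cd2 1 s z w by rewrite cdist_sqr // ltW.
have U2 : cdist r2 s y w ^+ 2 = cd2 r2 s y w by rewrite cdist_sqr // ltW.
have V2 : cdist s r1 w x ^+ 2 = cd2 s r1 w x by rewrite cdist_sqr // ltW.
rewrite /cd2 (metric_sym z x) in Y1; rewrite /cd2 in Y2; rewrite /cd2 -xzy in Z2.
rewrite /cd2 (metric_sym z w) in W2; rewrite /cd2 (metric_sym y w) in U2; rewrite /cd2 in V2.
move: I1 I2 Y10 Y20 Z0 W0 U0 V0 Y1 Y2 Z2 W2 U2 V2.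
move: (cdist 1 r1 z x) (cdist 1 r2 z y) (cdist r1 r2 x y) (cdist 1 s z w) (cdist r2 s y w) (cdist s r1 w x).
move=> Y Y' Z W U V I1 I2 Y0 Y'0 Z0 W0 U0 V0 EY EY' EZ EW EU EV.
move: (cos (mdist w z)) (cos (mdist w x)) (cos (mdist w y)) EW EU EV => cz cx cy EW EU EV.
have Ea := cos2Dsin2 (mdist x z); have Eb := cos2Dsin2 (mdist z y).
have sdE := sinD (mdist x z) (mdist z y); have cdE := cosD (mdist x z) (mdist z y).
have R1 : r1 * sin (mdist x z + mdist z y) = 2 * sin (mdist z y) by rewrite divfK ?gt_eqF.
have R2 : r2 * sin (mdist x z + mdist z y) = 2 * sin (mdist x z) by rewrite divfK ?gt_eqF.
move: Ea Eb sdE cdE R1 R2 EY EY' EZ sa sb sd.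
move: (cos (mdist x z)) (cos (mdist z y)) (sin (mdist x z)) (sin (mdist z y)) (sin (_ + _)) (cos (_ + _)).
move=> ca cb sa sb sd cd Ea Eb sdE cdE R1 R2 EY EY' EZ sa0 sb0 sd0.
have {}Ea : ca ^+ 2 = 1 - sa ^+ 2 by lrao Ea.
have {}Eb : cb ^+ 2 = 1 - sb ^+ 2 by lrao Eb.
have sd2 : sd ^+ 2 = sb ^+ 2 + sa ^+ 2 + 2 * sa * sb * cd.
  have -> : sd ^+ 2 = sa ^+ 2 * cb ^+ 2 + 2 * sa * sb * (ca * cb) + ca ^+ 2 * sb ^+ 2 by rewrite sdE; ring.
  by rewrite Ea Eb cdE; ring.
have r1E : r1 = 2 * sb / sd by rewrite -R1 mulfK ?gt_eqF.
have r2E : r2 = 2 * sa / sd by rewrite -R2 mulfK ?gt_eqF.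
have sdn : sd != 0 by rewrite gt_eqF.
have med : r1 ^+ 2 + r2 ^+ 2 + 2 * r1 * r2 * cd = 4.
  rewrite r1E r2E; transitivity (4 * (sb ^+ 2 + sa ^+ 2 + 2 * sa * sb * cd) / sd ^+ 2); first by field.
  by rewrite -sd2 mulfK // expf_neq0.
have m1 : r1 ^+ 2 - r2 ^+ 2 = 4 * (r1 * ca - 1).
  rewrite r1E r2E; transitivity ((4 * sb ^+ 2 - 4 * sa ^+ 2) / sd ^+ 2); first by field.
  apply: (@mulIf _ (sd ^+ 2)); first by rewrite expf_neq0.
  rewrite divfK ?expf_neq0 //; transitivity (8 * sb * ca * sd - 4 * sd ^+ 2); last by field.
  have -> : 8 * sb * ca * sd = 8 * (sa * sb * (ca * cb)) + 8 * (ca ^+ 2 * sb ^+ 2) by rewrite sdE; ring.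
  by rewrite sd2 cdE Ea; ring.
have m2 : r2 ^+ 2 - r1 ^+ 2 = 4 * (r2 * cb - 1).
  rewrite r1E r2E; transitivity ((4 * sa ^+ 2 - 4 * sb ^+ 2) / sd ^+ 2); first by field.
  apply: (@mulIf _ (sd ^+ 2)); first by rewrite expf_neq0.
  rewrite divfK ?expf_neq0 //; transitivity (8 * sa * cb * sd - 4 * sd ^+ 2); last by field.
  have -> : 8 * sa * cb * sd = 8 * (sa * sb * (ca * cb)) + 8 * (cb ^+ 2 * sa ^+ 2) by rewrite sdE; ring.
  by rewrite sd2 cdE Eb; ring.
have YY : Y' = Y.
  apply/eqP; rewrite -(eqrXn2 (_ : 0 < 2)%N) ?ltW //; apply/eqP.
  by rewrite EY EY'; lrao m1 m2.
have ZY : Z = 2 * Y.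
  apply/eqP; rewrite -(eqrXn2 (_ : 0 < 2)%N) ?mulr_ge0 ?ltW //; apply/eqP.
  by rewrite exprMn EZ EY; lrao m1 med.
have -> : cE Y Y' Z = -1.
  by rewrite /cE YY ZY; field; rewrite gt_eqF.
rewrite acosN1 YY => h.
have : acos (cE Y W U) + acos (cE W Y V) <= pi by lrao h.
rewrite YY in I1; rewrite acos_sum_le_pi //.
have -> : cE Y W U + cE W Y V = (2 * Y ^+ 2 + 2 * W ^+ 2 - U ^+ 2 - V ^+ 2) / (2 * Y * W).
  by rewrite /cE; field; rewrite !gt_eqF.
rewrite ler_pdivlMr ?mulr_gt0 ?mulr_gt0 // mul0r => h2.
have h3 : 0 <= s * (r1 * cx + r2 * cy - 2 * cz).
  by rewrite EW EU EV EY in h2; lrao h2 m1 med.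
rewrite pmulr_rge0 // in h3.
have h4 : 0 <= sd * (r1 * cx + r2 * cy - 2 * cz) by rewrite mulr_ge0 // ltW.
have E4 : sd * (r1 * cx + r2 * cy - 2 * cz) = (r1 * sd) * cx + (r2 * sd) * cy - 2 * cz * sd by ring.
by rewrite E4 R1 R2 in h4; lrao h4.
Qed.

Lemma direction_spherical : spherical (direction p).
Proof.
split; [|exact: direction_tbounded|exact: direction_le_pi| |exact: direction_between|exact: direction_stewart].
  split; [exact: direction_complete|exact: direction_curv4|exact: direction_ldoubling|].
  move=> xi; exists 1 => // x y hx hy xy.
  apply: geodesic_of_tbounded xy _; [exact: direction_complete|exact: direction_tbounded|exact: direction_between|].
  have := metric_triangle x xi y; rewrite (metric_sym x xi); have := @pihalf_ge1 R; lra.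
by move=> x y z; exact: direction_perimeter.
Qed.

End DirectionStructure.

(** * Spherical spaces *)

Section SphericalBasics.
Context {R : realType} {X : metricType R} (sX : spherical X).
Implicit Types (x y z e N T : X) (b c : R).

Let c4 := alexl_curv (sph_alexl sX).

Lemma cos_pihalfB b : cos (pi / 2 - b) = sin b :> R.
Proof. by rewrite cosB cos_pihalf sin_pihalf mul0r add0r mul1r. Qed.

Lemma sin_pihalfB b : sin (pi / 2 - b) = cos b :> R.
Proof. by rewrite sinB cos_pihalf sin_pihalf mul0r subr0 mul1r. Qed.

Lemma sph_cosK x y : acos (cos (mdist x y)) = mdist x y.
Proof. by rewrite cosK' // mdist_ge0 sph_pi. Qed.

Lemma sph_cos1 x y : cos (mdist x y) = 1 -> x = y.
Proof. by move=> h; apply: mdist0_eq; rewrite -sph_cosK h acos1. Qed.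

Lemma sph_cosN1 x y : cos (mdist x y) = -1 -> mdist x y = pi.
Proof. by move=> h; rewrite -sph_cosK h acosN1. Qed.

Lemma sph_cos0 x y : (cos (mdist x y) = 0) <-> (mdist x y = pi / 2).
Proof.
split=> [h|->]; last exact: cos_pihalf.
rewrite -sph_cosK h -(@cos_pihalf R) cosK' //.
by have := @pi_gt0 R; move=> h0; apply/andP; split; lra.
Qed.

Lemma sph_proper : proper_space X.
Proof.
move=> w x r _; apply: (@tbounded_utends _ _ [set: X]); last exact: oou_all.
  exact: alexl_complete (sph_alexl sX).
exact: sph_tbounded.
Qed.

Lemma sph_geodesic x y : x != y -> mdist x y < pi ->
  exists g : geodesic x, glen g = mdist x y /\ gend g = y.
Proof.
apply: geodesic_of_tbounded; [exact: alexl_complete (sph_alexl sX)|exact: sph_tbounded|exact: sph_between].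
Qed.

Lemma anti_sum N T x : mdist N T = pi -> mdist N x + mdist x T = pi.
Proof.
move=> NT; have h1 := metric_triangle N x T; have h2 := sph_perimeter sX N x T.
rewrite NT in h1; rewrite (metric_sym T) NT in h2; apply/eqP; rewrite eq_le h1 andbT.
by lrao h2.
Qed.

Lemma sph_anti_limit x : (forall d : R, 0 < d -> exists y, pi - d < mdist x y) -> exists y, mdist x y = pi.
Proof.
move=> H; have i0 n : 0 < n.+1%:R^-1 :> R by rewrite invr_gt0 ltr0n.
have /choice[z zP] : forall n : nat, exists z, pi - n.+1%:R^-1 < mdist x z by move=> n; exact: H.
have [y zy] : exists y, utends z y by apply: (sph_proper (x := x) (r := pi)); apply: oou_all => n; exact: sph_pi.
exists y; apply/eqP; rewrite eq_le sph_pi //=.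
have lim : (fun n => pi - n.+1%:R^-1 : R) @ oou --> pi.
  by rewrite -[X in _ --> X]subr0; apply: cvgB; [exact: ulim_cst|exact: inv_ulim0].
by apply: (ulim_le lim (utends_mdist (utends_cst x) zy)); apply: oou_all => n; exact: ltW.
Qed.

(* e is the point of the equator on the meridian of x *)
Definition eqpt N x e : Prop := mdist N e = pi / 2 /\ mdist x e = `|mdist N x - pi / 2|.

(** The inequality for [x] on the segment from [N] to [e] and the one for [e] on the segment from
    [x] to [T] are opposite to each other, since all distances from [N] and [T] add up to pi. *)
Let susp_le N T e x y : mdist N T = pi -> eqpt N x e -> mdist N x <= pi / 2 ->
  cos (mdist x y) = cos (mdist N x) * cos (mdist N y) + sin (mdist N x) * cos (mdist e y).
Proof.
move=> NT [Ne xe] bh; have pi0 := @pi_gt0 R.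
have [xN|xN] := eqVneq x N; first by rewrite xN mdistxx cos0 sin0 mul1r mul0r addr0.
have b0 : 0 < mdist N x by rewrite mdist_gt0 eq_sym.
have xe' : mdist x e = pi / 2 - mdist N x by rewrite xe distrC ger0_norm ?subr_ge0.
have xT := anti_sum x NT; have eT := anti_sum e NT; have yT := anti_sum y NT.
have := @sph_stewart _ _ sX y N e x ltac:(lra) ltac:(lrao Ne pi0).
have := @sph_stewart _ _ sX y x T e ltac:(lra) ltac:(lrao xT b0).
have -> : mdist e T = pi / 2 by lrao eT Ne.
have -> : mdist x T = pi - mdist N x by lrao xT.
rewrite (metric_sym y T) (_ : mdist T y = pi - mdist N y); last by rewrite metric_sym; lrao yT.
rewrite Ne xe' sin_piB cos_piB sin_pihalf sin_pihalfB !mulr1.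
rewrite (metric_sym y e) (metric_sym y x) (metric_sym y N) => h1 h2.
by apply/eqP; rewrite eq_le; apply/andP; split; lrao h1 h2.
Qed.

Lemma eqpt_anti N T x e : mdist N T = pi -> eqpt N x e -> eqpt T x e.
Proof.
move=> NT [Ne xe]; have h1 := anti_sum e NT; have h2 := anti_sum x NT.
split; first by rewrite metric_sym; lrao h1 Ne.
rewrite xe (metric_sym T) (_ : mdist x T - pi / 2 = - (mdist N x - pi / 2)) ?normrN //.
by rewrite {2}[pi]splitr in h2 *; lrao h2.
Qed.

Lemma susp N T e x y : mdist N T = pi -> eqpt N x e ->
  cos (mdist x y) = cos (mdist N x) * cos (mdist N y) + sin (mdist N x) * cos (mdist e y).
Proof.
move=> NT ex; have [h|h] := leP (mdist N x) (pi / 2); first exact: (susp_le y NT ex h).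
have TN : mdist T N = pi by rewrite metric_sym.
have h1 := anti_sum x NT; have h2 := anti_sum y NT.
rewrite (susp_le y TN (eqpt_anti NT ex)); last by rewrite metric_sym; lrao h1 h.
have -> : mdist T x = pi - mdist N x by rewrite metric_sym; lrao h1.
have -> : mdist T y = pi - mdist N y by rewrite metric_sym; lrao h2.
by rewrite !cos_piB sin_piB mulrNN.
Qed.

Lemma susp2 N T e e' x y : mdist N T = pi -> eqpt N x e -> eqpt N y e' ->
  cos (mdist x y) = cos (mdist N x) * cos (mdist N y) +
    sin (mdist N x) * sin (mdist N y) * cos (mdist e e').
Proof.
move=> NT xe ye; rewrite (susp y NT xe) (metric_sym e y) (susp e NT ye) xe.1 cos_pihalf.
by rewrite mulr0 add0r (metric_sym e' e) mulrA.
Qed.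

Lemma eqpt_ex N T x : mdist N T = pi -> x != N -> x != T -> exists e, eqpt N x e.
Proof.
move=> NT xN xT; have pi0 := @pi_gt0 R; have xTs := anti_sum x NT.
have a0 : 0 < mdist N x by rewrite mdist_gt0 eq_sym.
have b0 : 0 < mdist x T by rewrite mdist_gt0.
have [h|h] := leP (mdist N x) (pi / 2).
  have [||||e [xe eT]] := @sph_between _ _ sX x T (pi / 2 - mdist N x) (pi / 2); [lra|lra|lra|lra|].
  exists e; split; first by have := anti_sum e NT; lrao eT.
  by rewrite xe distrC ger0_norm ?subr_ge0.
have [||||e [Ne ex]] := @sph_between _ _ sX N x (pi / 2) (mdist N x - pi / 2); [lra|lra|lra|lra|].
by exists e; split=> //; rewrite metric_sym ex gtr0_norm ?subr_gt0.
Qed.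

Lemma eqpt_pole N T e : mdist N T = pi -> mdist N e = pi / 2 -> eqpt N N e /\ eqpt N T e.
Proof.
move=> NT Ne; have pi0 := @pi_gt0 R; have := anti_sum e NT => h.
split; split=> //; first by rewrite mdistxx Ne sub0r normrN gtr0_norm // divr_gt0.
by rewrite NT metric_sym gtr0_norm; lra.
Qed.

Lemma meridian N T e b : mdist N T = pi -> mdist N e = pi / 2 -> 0 <= b -> b <= pi ->
  exists x, mdist N x = b /\ eqpt N x e.
Proof.
move=> NT Ne b0 bpi; have pi0 := @pi_gt0 R; have eT := anti_sum e NT.
have [h|h] := leP b (pi / 2).
  have [||||x [Nx xe]] := @sph_between _ _ sX N e b (pi / 2 - b); [lra|lra|lra|lra|].
  by exists x; split=> //; split=> //; rewrite Nx xe distrC ger0_norm ?subr_ge0.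
have [||||x [ex xT]] := @sph_between _ _ sX e T (b - pi / 2) (pi - b); [lra|lra|lra|lra|].
have Nx : mdist N x = b by have := anti_sum x NT; lrao xT.
by exists x; split=> //; split=> //; rewrite Nx metric_sym ex gtr0_norm ?subr_gt0.
Qed.

Lemma eqpt_uniq N T x e e' : mdist N T = pi -> x != N -> x != T -> eqpt N x e -> eqpt N x e' -> e = e'.
Proof.
move=> NT xN xT xe [Ne' xe']; apply: sph_cos1; have := susp e' NT xe.
rewrite xe' Ne' cos_pihalf mulr0 add0r -normrN opprB cos_norm cos_pihalfB.
have s0 : 0 < sin (mdist N x).
  apply: sin_gt0_pi; rewrite mdist_gt0 eq_sym xN /=.
  by have := anti_sum x NT; have : 0 < mdist x T by [rewrite mdist_gt0]; move=> h1 h2; lrao h1 h2.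
by rewrite -{1}[sin _]mulr1 => /(mulfI (lt0r_neq0 s0)).
Qed.

Lemma sin_lower (x y : R) : 0 <= x -> x <= y -> y <= pi -> x * cos y <= sin x.
Proof.
rewrite le_eqVlt => /orP[/eqP <- _ _|x0 xy ypi]; first by rewrite mul0r sin0.
have [c /andP[c0 cx] E] := @MVTd R sin cos 0 x (fun z : R => is_derive_sin z) x0.
rewrite sin0 !subr0 in E; rewrite E mulrC ler_pM2r //.
by apply: cos_ler; [exact: ltW|lrao cx xy|].
Qed.

Lemma sin_ulim t (u : nat -> R) (c : R) : scale t -> (forall n, 0 <= u n) ->
  (fun n => u n / t n) @ oou --> c -> (fun n => sin (u n) / t n) @ oou --> c.
Proof.
move=> st u0 uc; have pi0 := @pi_gt0 R.
have u_0 : u @ oou --> (0 : R).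
  have h : (fun n => u n / t n * t n) @ oou --> c * 0 by apply: cvgM => //; exact: st.2.
  rewrite mulr0 in h; apply: (ulim_eq _ h); apply: oou_all => n /=.
  by rewrite divfK // gt_eqF // st.1.
have lim : (fun n => u n / t n - u n / t n * cos (u n)) @ oou --> (0 : R).
  rewrite -(subrr c) -[X in _ --> _ - X]mulr1 -(@cos0 R); apply: cvgB => //; apply: cvgM => //.
  exact: cos_ulim.
have diff : (fun n => u n / t n - sin (u n) / t n) @ oou --> (0 : R).
  apply: (ulim_squeeze0 _ _ lim).
    move=> n; rewrite -mulrBl divr_ge0 ?(ltW (st.1 n)) // subr_ge0; exact: sin_le_id.
  apply: (oou_imply _ (ulim_lt u_0 pi0)) => n /= upi.
  rewrite lerD2l lerN2 mulrAC ler_pM2r ?invr_gt0 ?st.1 //.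
  by apply: sin_lower => //; exact: ltW.
have h : (fun n => u n / t n - (u n / t n - sin (u n) / t n)) @ oou --> c - 0 by apply: cvgB.
by rewrite subr0 in h; apply: (ulim_eq _ h); apply: oou_all => n /=; rewrite opprB addrC subrK.
Qed.

Definition poledir N e (xi : direction N) : Prop :=
  exists h : geodesic N, [/\ glen h = pi / 2, gend h = e & dir h = xi].

Lemma poledir_eqpt N e (h : geodesic N) s : glen h = pi / 2 -> gend h = e -> 0 <= s -> s <= pi / 2 ->
  mdist N (h s) = s /\ eqpt N (h s) e.
Proof.
move=> hl he s0 sh_; have Ns : mdist N (h s) = s by rewrite geo_dist // s0 hl.
have Ne : mdist N e = pi / 2 by rewrite -he /gend hl geo_dist // hl lexx divr_ge0 // pi_ge0.
split=> //; split=> //; rewrite Ns -he /gend geo_isom ?hl //.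
by rewrite distrC ger0_norm // subr_ge0.
Qed.

(** At height [t] on the two meridians, [susp2] gives [sin (m / 2) = sin t * sin (mdist e e' / 2)].
    Divided by [t], the limit is half the chord of the angle between the meridians. *)
Lemma poledir_dist N T e e' (xi xi' : direction N) : mdist N T = pi ->
  poledir e xi -> poledir e' xi' -> mdist xi xi' = mdist e e'.
Proof.
move=> NT [h [hl he <-]] [h' [hl' he' <-]]; have pi0 := @pi_gt0 R.
have st := @scale_harmonic R.
have B := blowup_dist c4 st ler01 ler01 (blowup_geo h st ler01) (blowup_geo h' st ler01).
pose t n : R := n.+1%:R^-1; pose m n := mdist (h (1 * t n)) (h' (1 * t n)).
have L1 : (fun n => sin (m n / 2) / t n) @ oou --> Num.sqrt (cd2 1 1 (dir h) (dir h')) / 2.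
  apply: sin_ulim => //; first by move=> n; rewrite divr_ge0 ?mdist_ge0.
  rewrite (_ : (fun n => m n / 2 / t n) = (fun n => m n / t n * 2^-1)).
    by apply: cvgM; [exact: B|exact: ulim_cst].
  by apply/funext => n; rewrite mulrAC.
have L2 : (fun n => sin (t n) / t n * sin (mdist e e' / 2)) @ oou --> 1 * sin (mdist e e' / 2).
  apply: cvgM; last exact: ulim_cst.
  apply: sin_ulim => //; first by move=> n; rewrite ltW // st.1.
  by apply: (ulim_eq _ (@ulim_cst R 1)); apply: oou_all => n /=; rewrite divff // gt_eqF // st.1.
have E : Num.sqrt (cd2 1 1 (dir h) (dir h')) / 2 = sin (mdist e e' / 2).
  rewrite -[RHS]mul1r; apply: (ulim_uniq L1); apply: (ulim_eq _ L2).
  have ph : 0 < pi / 2 :> R by rewrite divr_gt0.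
  apply: (oou_imply _ (scale_lt 1 st ph)) => n; rewrite /= mul1r -/(t n) => tp.
  have t0 : 0 < t n := st.1 n.
  have [d1 q1] := poledir_eqpt hl he (ltW t0) (ltW tp).
  have [d2 q2] := poledir_eqpt hl' he' (ltW t0) (ltW tp).
  have := susp2 NT q1 q2; rewrite d1 d2 -(mul1r (t n)) -/(m n) => Em.
  rewrite mulrAC; congr (_ / _); apply/eqP.
  have r2 (v : R) : 0 <= v -> v <= pi -> 0 <= sin (v / 2).
    by move=> h1 h2; apply: sin_ge0_pi; apply/andP; split; lra.
  have st0 : 0 <= sin (1 * t n) by rewrite mul1r; apply: sin_ge0_pi; apply/andP; split; lra.
  rewrite -(eqrXn2 (_ : 0 < 2)%N) ?mulr_ge0 ?r2 ?mdist_ge0 ?sph_pi //; apply/eqP.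
  have := one_sub_cos (m n); have := one_sub_cos (mdist e e'); have := cos2Dsin2 (1 * t n).
  rewrite Em exprMn; move: (cos (1 * t n)) (sin (1 * t n)) (cos (mdist e e')) => c s c' h1 h2 h3.
  have {}h1 : c * c = 1 - s ^+ 2 by rewrite -expr2; lrao h1.
  have -> : sin (mdist e e' / 2) ^+ 2 = (1 - c') / 2 by lrao h2.
  by rewrite h1 in h3; rewrite -expr2 in h3; lrao h3.
have := cd2_ge0 (dir h) (dir h') (@ler01 R) (@ler01 R).
have -> : cd2 1 1 (dir h) (dir h') = 2 * (1 - cos (mdist (dir h) (dir h'))) by rewrite /cd2; ring.
move=> p0; have : Num.sqrt (cd2 1 1 (dir h) (dir h')) ^+ 2 = (2 * sin (mdist e e' / 2)) ^+ 2.
  by congr (_ ^+ 2); lrao E.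
rewrite sqr_sqrtr; last by rewrite /cd2; lrao p0.
move=> E2; rewrite -(cosK' (x := mdist (dir h) (dir h'))); last by rewrite mdist_ge0 direction_le_pi.
rewrite -[RHS]sph_cosK; congr acos; have := one_sub_cos (mdist e e').
by rewrite /cd2 exprMn in E2; lrao E2.
Qed.

Lemma poledir_exl N e : mdist N e = pi / 2 -> exists xi : direction N, poledir e xi.
Proof.
move=> Ne; have pi0 := @pi_gt0 R; have [||g [gl ge]] := @sph_geodesic N e.
- by rewrite -mdist_gt0 Ne divr_gt0.
- by rewrite Ne; lra.
by exists (dir g), g; split=> //; rewrite gl.
Qed.

(** A short geodesic from [N] runs along the meridian of its own points: the cosine formula for two
    of them forces their equatorial points to coincide. So every geodesic direction is that of a
    meridian of length [pi / 2], and such directions form a closed set. *)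
Lemma poledir_exr N T (xi : direction N) : mdist N T = pi -> exists e, poledir e xi.
Proof.
move=> NT; have pi0 := @pi_gt0 R; have ph : 0 < pi / 2 :> R by rewrite divr_gt0.
suff [h hl hx] : reach (pi / 2) xi.
  have [h' [h'l h'c]] := geo_restrict ph hl.
  by exists (gend h'), h'; split=> //; rewrite -hx; exact: dir_gcurve.
apply: (reach_closed sph_proper c4 ph) => d d0; have [g gx] := dir_near xi d0.
exists (dir g) => //; pose s := Num.min (glen g) (pi / 2).
have s0 : 0 < s by rewrite lt_min glen_gt0.
have [sg sp] : s <= glen g /\ s <= pi / 2 by rewrite /s !ge_min !lexx orbT.
have gs u : 0 <= u -> u <= s -> mdist N (g u) = u.
  by move=> u0 us; rewrite geo_dist // u0 (le_trans us).
have far u : 0 < u -> u <= s -> g u != N /\ g u != T.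
  move=> u0 us; split; first by rewrite -mdist_gt0 metric_sym gs // ltW.
  apply/eqP => E; have := gs u (ltW u0) us; rewrite E NT => E1; lrao E1 us sp pi0.
have [f1 f2] := far s s0 (lexx s); have [e es] := eqpt_ex NT f1 f2.
have [xi' [h [hl he hx]]] := poledir_exl es.1.
exists h; first by rewrite hl.
apply: mdist0_eq; rewrite mdist_dir; apply: (angle0_of_agree c4 s0) => u /andP[u0 us].
have [f3 f4] := far u u0 (ltW us); have [e' eu] := eqpt_ex NT f3 f4.
have sin0' (v : R) : 0 < v -> v <= s -> 0 < sin v.
  by move=> h1 h2; apply: sin_gt0_pi; apply/andP; split; lra.
have [hu qu] := poledir_eqpt hl he (ltW u0) (le_trans (ltW us) sp).
have ee : cos (mdist e e') = 1.
  have := susp2 NT es eu; rewrite !gs ?(ltW u0) ?(ltW us) ?(ltW s0) //.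
  rewrite metric_sym geo_isom ?(ltW u0) ?(ltW us) // cosB => /addrI.
  have nz : sin s * sin u != 0 by rewrite mulf_neq0 // gt_eqF ?sin0' // ltW.
  by rewrite -{1}[sin s * sin u]mulr1 => /(mulfI nz).
have E := sph_cos1 ee; subst e'.
apply: sph_cos1; rewrite (susp2 NT qu eu) hu gs ?(ltW u0) ?(ltW us) //.
by rewrite mdistxx cos0 mulr1 -!expr2 cos2Dsin2.
Qed.

(** The space is the suspension of its equator, which is a copy of [direction N]. This is what
    induction on the dimension runs on. *)
Lemma equator_iso N T : mdist N T = pi -> exists I : direction N -> X,
  [/\ forall xi, mdist N (I xi) = pi / 2, forall xi eta, mdist (I xi) (I eta) = mdist xi eta &
   forall e, mdist N e = pi / 2 -> exists xi, I xi = e].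
Proof.
move=> NT; have /choice[I IP] := fun xi : direction N => poledir_exr xi NT.
have IN xi : mdist N (I xi) = pi / 2.
  have [h [hl he _]] := IP xi; have ph : 0 <= pi / 2 :> R by rewrite divr_ge0 // pi_ge0.
  by have [_ []] := poledir_eqpt hl he (lexx 0) ph.
exists I; split=> // [xi eta|e Ne]; first by rewrite (poledir_dist NT (IP xi) (IP eta)).
have [xi ex] := poledir_exl Ne; exists xi; apply: mdist0_eq.
by rewrite -(poledir_dist NT (IP xi) ex) mdistxx.
Qed.

End SphericalBasics.

Lemma within_continuous_ball {R : realType} (T U : pseudoMetricType R) (A : set T) (f : T -> U) :
  {within A, continuous f} <-> forall x, A x -> forall e : R, 0 < e ->
    exists2 d : R, 0 < d & forall y, A y -> ball x d y -> ball (f x) e (f y).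
Proof.
rewrite subspace_continuousP; split=> H x Ax.
  move=> e e0; have /cvg_ballP/(_ e e0) := H x Ax.
  by move=> /nbhs_ballP[d /= d0 dP]; exists d => // y Ay xy; apply: (dP y xy Ay).
apply/cvg_ballP => e e0; have [d d0 dP] := H x Ax e e0.
by apply/nbhs_ballP; exists d => //= y xy Ay; exact: dP.
Qed.

(** * Half spheres and suspensions *)

Section HalfSphere.
Context {R : realType}.

Definition dotv m (u v : 'rV[R]_m) : R := \sum_i u ord0 i * v ord0 i.

Definition consv m (a : R) (v : 'rV[R]_m) : 'rV[R]_m.+1 :=
  \row_i (if unlift ord0 i is Some j then v ord0 j else a).

Definition tailv m (v : 'rV[R]_m.+1) : 'rV[R]_m := \row_j v ord0 (lift ord0 j).

Lemma consv0 m a (v : 'rV[R]_m) : consv a v ord0 ord0 = a.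
Proof. by rewrite mxE unlift_none. Qed.

Lemma consvS m a (v : 'rV[R]_m) j : consv a v ord0 (lift ord0 j) = v ord0 j.
Proof. by rewrite mxE liftK. Qed.

Lemma consvK m (v : 'rV[R]_m.+1) : consv (v ord0 ord0) (tailv v) = v.
Proof.
apply/rowP => i; case: (unliftP ord0 i) => [j|] ->; last by rewrite consv0.
by rewrite consvS mxE.
Qed.

Lemma dotv_consv m a b (u v : 'rV[R]_m) : dotv (consv a u) (consv b v) = a * b + dotv u v.
Proof. by rewrite /dotv big_ord_recl !consv0; congr (_ + _); apply: eq_bigr => j _; rewrite !consvS. Qed.

Lemma dotvZ m a b (u v : 'rV[R]_m) : dotv (a *: u) (b *: v) = a * b * dotv u v.
Proof. by rewrite /dotv mulr_sumr; apply: eq_bigr => j _; rewrite !mxE mulrACA. Qed.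

Lemma dotv_eq0 m (u : 'rV[R]_m) : dotv u u = 0 -> u = 0.
Proof.
move=> /eqP; rewrite psumr_eq0; last by move=> i _; rewrite -expr2 sqr_ge0.
move=> /allP H; apply/rowP => i; rewrite mxE; apply/eqP.
by have := H i (mem_index_enum _); rewrite mulf_eq0 orbb.
Qed.

Lemma half_space_consv m a (v : 'rV[R]_m.+1) : half_space m.+2 (consv a v) <-> half_space m.+1 v.
Proof.
split=> H i Hi; last first.
  case: (unliftP ord0 i) Hi => [j ->|-> //]; rewrite lift0 => -[Hj].
  by rewrite consvS; apply: H; rewrite Hj.
by rewrite -(consvS a v); apply: H; rewrite lift0 Hi.
Qed.

Lemma half_space_ord_max m (v : 'rV[R]_m.+1) : half_space m.+1 v <-> 0 <= v ord0 ord_max.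
Proof.
split=> [H|H i [Hi]]; first exact: H.
by rewrite (_ : i = ord_max) //; apply: val_inj.
Qed.

(** [m] is the dimension of the ambient space, one more than that of the half sphere. The isometry
    is stated with cosines, so that suspensions just add a coordinate. *)
Definition half_sphere m (X : metricType R) : Prop := exists phi : X -> 'rV[R]_m,
  [/\ forall x, half_space m (phi x), forall x y, cos (mdist x y) = dotv (phi x) (phi y) &
   forall v, half_space m v -> dotv v v = 1 -> exists x, phi x = v].

Definition allanti (X : metricType R) : Prop := forall x : X, exists y, mdist x y = pi.

(** The center of the half sphere is the last basis vector; an antipode would have last coordinate
    -1. *)
Lemma half_sphere_not_allanti m (X : metricType R) : half_sphere m.+1 X -> ~ allanti X.
Proof.
move=> [phi [hs cosE onto]] aX; pose v : 'rV[R]_m.+1 := delta_mx ord0 ord_max.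
have vv w : dotv v w = w ord0 ord_max.
  rewrite /dotv (bigD1 ord_max) //= big1 ?addr0; first by rewrite mxE !eqxx mul1r.
  by move=> i /negPf iN; rewrite mxE eqxx iN mul0r.
have [||x xv] := onto v; first by apply/half_space_ord_max; rewrite mxE !eqxx.
  by rewrite vv mxE !eqxx.
have [y xy] := aX x; have := cosE x y; rewrite xy cospi xv vv => h.
by have /half_space_ord_max := hs y; rewrite -h; lra.
Qed.

(* Every geodesic (x, y, z) with middle point y can be prolonged beyond x to length L, measured
   from y, or else beyond z to length pi - L. *)
Definition extprop (Y : metricType R) : Prop := forall (x y z : Y) (s u L : R),
  mdist x y = s -> 0 < s -> mdist y z = u -> 0 < u -> mdist x z = s + u -> s + u < pi ->
  s < L -> u < pi - L ->
  (exists x', mdist y x' = L /\ mdist x x' = L - s) \/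
  (exists z', mdist y z' = pi - L /\ mdist z z' = pi - L - u).

End HalfSphere.

Section Suspension.
Context {R : realType} {X : metricType R} (sX : spherical X).
Implicit Types (x y z e N T : X).

Lemma half_sphere_susp m N T : mdist N T = pi -> half_sphere m.+1 (direction N) -> half_sphere m.+2 X.
Proof.
move=> NT [phi [hs cosE onto]]; have [I [IN Id Ionto]] := equator_iso sX NT.
pose last : 'rV[R]_m.+1 := delta_mx ord0 ord_max.
have [||xi0 _] := onto last; first by apply/half_space_ord_max; rewrite mxE !eqxx.
  rewrite /dotv (bigD1 ord_max) //= big1 ?addr0; first by rewrite mxE !eqxx mul1r.
  by move=> i /negPf iN; rewrite mxE eqxx iN mul0r.
have [pN pT] := eqpt_pole sX NT (IN xi0).
have /choice[J JP] : forall x, exists xi, eqpt N x (I xi).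
  move=> x; have [->|xN] := eqVneq x N; first by exists xi0.
  have [->|xT] := eqVneq x T; first by exists xi0.
  have [e xe] := eqpt_ex sX NT xN xT; have [xi xiE] := Ionto e xe.1.
  by exists xi; rewrite xiE.
pose psi x := consv (cos (mdist N x)) (sin (mdist N x) *: phi (J x)).
have sge0 x : 0 <= sin (mdist N x) by rewrite sin_ge0_pi // mdist_ge0 sph_pi.
exists psi; split.
- move=> x; apply/half_space_consv/half_space_ord_max; rewrite mxE mulr_ge0 //.
  by apply/half_space_ord_max; exact: hs.
- move=> x y; rewrite (susp2 sX NT (JP x) (JP y)) dotv_consv dotvZ -cosE.
  by rewrite Id.
move=> v hv vv; rewrite -(consvK v) in hv vv *; move: (v ord0 ord0) (tailv v) hv vv => a w /half_space_consv hw.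
rewrite dotv_consv => aw; have w0 : 0 <= dotv w w by apply: sumr_ge0 => i _; rewrite -expr2 sqr_ge0.
have a1 : -1 <= a <= 1 by rewrite -ler_norml -(@ler_pXn2r _ 2%N) ?nnegrE // real_normK ?num_real // expr1n; lra.
have /andP[b0 bpi] := acos_itv a1; have cb := acosK' a1; set b := acos a in b0 bpi cb.
have sb2 : sin b ^+ 2 = dotv w w by have := cos2Dsin2 b; rewrite cb; lra.
have [sb|sb] := eqVneq (sin b) 0.
  have [x [Nx xe]] := meridian sX NT (IN xi0) b0 bpi; exists x.
  rewrite /psi Nx cb sb scale0r; congr consv; apply/esym/dotv_eq0.
  by rewrite -sb2 sb expr0n.
have sb0 : 0 < sin b by rewrite lt_neqAle eq_sym sb sin_ge0_pi ?b0.
have [||xi xiE] := onto ((sin b)^-1 *: w).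
- apply/half_space_ord_max; rewrite mxE mulr_ge0 ?invr_ge0 ?(ltW sb0) //.
  by apply/half_space_ord_max.
- by rewrite dotvZ -sb2; field.
have [x [Nx xe]] := meridian sX NT (IN xi) b0 bpi; exists x; rewrite /psi Nx cb.
have xN : x != N by apply: contraNN sb => /eqP xN; rewrite -Nx xN mdistxx sin0.
have xT : x != T by apply: contraNN sb => /eqP xT; rewrite -Nx xT NT sinpi.
have := eqpt_uniq sX NT xN xT xe (JP x); move=> /(congr1 (mdist (I (J x)))); rewrite mdistxx Id => /mdist0_eq ->.
by rewrite xiE scalerA divff // scale1r.
Qed.

Lemma half_sphere_equator m : half_sphere m.+2 X ->
  exists N T, mdist N T = pi /\ half_sphere m.+1 (direction N).
Proof.
move=> [phi [hs cosE onto]]; pose e0 a : 'rV[R]_m.+2 := consv a 0.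
have he a : half_space m.+2 (e0 a) by apply/half_space_consv => i _; rewrite mxE.
have d0 (v : 'rV[R]_m.+1) : dotv 0 v = 0 by rewrite /dotv big1 // => i _; rewrite mxE mul0r.
have [|N EN] := onto _ (he 1); first by rewrite dotv_consv d0; ring.
have [|T ET] := onto _ (he (-1)); first by rewrite dotv_consv d0; ring.
have NT : mdist N T = pi.
  by apply: (sph_cosN1 sX); rewrite cosE EN ET dotv_consv d0; ring.
exists N, T; split=> //; have [I [IN Id Ionto]] := equator_iso sX NT.
have I0 xi : phi (I xi) ord0 ord0 = 0.
  have := cosE N (I xi); rewrite IN cos_pihalf EN -(consvK (phi (I xi))) dotv_consv d0 consv0.
  by rewrite mul1r addr0.
exists (fun xi => tailv (phi (I xi))); split.
- by move=> xi; apply/(half_space_consv (phi (I xi) ord0 ord0)); rewrite consvK.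
- move=> xi eta; rewrite -Id cosE -{1}(consvK (phi (I xi))) -{1}(consvK (phi (I eta))) dotv_consv.
  by rewrite !I0 mul0r add0r.
move=> v hv vv; have [||e Ee] := onto (consv 0 v); first exact/half_space_consv.
  by rewrite dotv_consv mul0r add0r.
have Ne : mdist N e = pi / 2.
  by apply/(sph_cos0 sX); rewrite cosE EN Ee dotv_consv d0; ring.
have [xi xiE] := Ionto e Ne; exists xi; rewrite xiE Ee; apply/rowP => j.
by rewrite mxE consvS.
Qed.

(** A geodesic from [y] through [x] runs on to the antipode of [y], so the first alternative always
    holds. *)
Lemma allanti_extprop : allanti X -> extprop X.
Proof.
move=> aX x y z s u L xy s0 yz u0 xz supi sL uL; left; have [y' yy'] := aX y.
have xy' := anti_sum sX x yy'; rewrite metric_sym xy in xy'.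
have [||||x' [xx' x'y']] := @sph_between _ _ sX x y' (L - s) (pi - L); [lra|lra|lra|lra|].
by exists x'; split=> //; have := anti_sum sX x' yy'; lra.
Qed.

(** Prolongations of equatorial geodesics stay in the equator: Stewart seen from [N] and from [T]
    bounds the cosine of the new end from both sides by 0. *)
Lemma great_circle N T a b c : mdist N T = pi -> mdist N a = pi / 2 -> mdist N b = pi / 2 ->
  mdist a b + mdist b c = mdist a c -> mdist a c < pi -> 0 < mdist a b -> mdist N c = pi / 2.
Proof.
move=> NT Na Nb abc acpi ab0; apply/(sph_cos0 sX).
have Ta : mdist T a = pi / 2 by have := anti_sum sX a NT; rewrite (metric_sym T a); lra.
have Tb : mdist T b = pi / 2 by have := anti_sum sX b NT; rewrite (metric_sym T b); lra.
have Tc : mdist T c = pi - mdist N c by have := anti_sum sX c NT; rewrite (metric_sym T c); lra.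
have := @sph_stewart _ _ sX N a c b abc acpi; have := @sph_stewart _ _ sX T a c b abc acpi.
rewrite Na Nb Ta Tb Tc cos_pihalf cos_piB !mul0r !add0r.
have s0 : 0 < sin (mdist a b).
  by apply: sin_gt0_pi; rewrite ab0 /=; have := mdist_ge0 b c; lra.
rewrite mulNr oppr_ge0 pmulr_lle0 // pmulr_lge0 // => h1 h2.
by apply/eqP; rewrite eq_le h1.
Qed.

Lemma extprop_equator N T : mdist N T = pi -> extprop X -> extprop (direction N).
Proof.
move=> NT eX; have [I [IN Id Ionto]] := equator_iso sX NT.
move=> x y z s u L xy s0 yz u0 xz supi sL uL.
have [||||||||[x' [yx' xx']]|[z' [yz' zz']]] := eX (I x) (I y) (I z) s u L; rewrite ?Id //.
- left; have [|xi xiE] := Ionto x'.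
    apply: (great_circle NT (IN y) (IN x)); rewrite ?Id ?(metric_sym y x) ?xy ?xx' ?yx' //; [ring|lra].
  by exists xi; rewrite -!Id xiE.
- right; have [|xi xiE] := Ionto z'.
    apply: (great_circle NT (IN y) (IN z)); rewrite ?Id ?yz ?zz' ?yz' //; [ring|lra].
  by exists xi; rewrite -!Id xiE.
Qed.

Lemma anti_eqpt N T w w' e : mdist N T = pi -> mdist w w' = pi -> w != N -> w != T -> eqpt N w e ->
  exists e', mdist N e' = pi / 2 /\ mdist e e' = pi.
Proof.
move=> NT ww' wN wT we.
have w'N : w' != N.
  apply/eqP => E; subst w'; have := sph_perimeter sX T N w; rewrite (metric_sym N w) ww' metric_sym NT.
  have := mdist_gt0 w T; rewrite wT; lra.
have w'T : w' != T.
  apply/eqP => E; subst w'; have := sph_perimeter sX w T N; rewrite (metric_sym T N) ww' NT.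
  have := mdist_gt0 N w; rewrite eq_sym wN; lra.
have [e' we'] := eqpt_ex sX NT w'N w'T; exists e'; split; first exact: we'.1.
have Nw' : mdist N w' = pi - mdist N w by have := anti_sum sX N ww'; rewrite (metric_sym w); lra.
have s0 : 0 < sin (mdist N w).
  apply: sin_gt0_pi; rewrite mdist_gt0 eq_sym wN /=; have := anti_sum sX w NT.
  by have := mdist_gt0 w T; rewrite wT; lra.
apply: (sph_cosN1 sX); have := susp2 sX NT we we'.
rewrite ww' cospi Nw' cos_piB sin_piB => E; have := cos2Dsin2 (mdist N w) => E2.
apply: (@mulfI _ (sin (mdist N w) * sin (mdist N w))); first by rewrite mulf_neq0 // gt_eqF.
by lra.
Qed.

Lemma anti_of_eqpt N T x e e' : mdist N T = pi -> eqpt N x e -> mdist N e' = pi / 2 ->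
  mdist e e' = pi -> exists y, mdist x y = pi.
Proof.
move=> NT xe Ne' ee'; have b0 := mdist_ge0 N x; have bpi := sph_pi sX N x.
have [||y [Ny ye]] := meridian sX NT Ne' (_ : 0 <= pi - mdist N x) _; [lra|lra|].
exists y; apply: (sph_cosN1 sX); rewrite (susp2 sX NT xe ye) Ny cos_piB sin_piB ee' cospi.
by have := cos2Dsin2 (mdist N x); lra.
Qed.

Lemma allanti_equator N T : mdist N T = pi -> allanti (direction N) -> allanti X.
Proof.
move=> NT aN x; have [I [IN Id Ionto]] := equator_iso sX NT.
have [->|xN] := eqVneq x N; first by exists T.
have [->|xT] := eqVneq x T; first by exists N; rewrite metric_sym.
have [e xe] := eqpt_ex sX NT xN xT; have [xi xiE] := Ionto e xe.1.
have [eta xieta] := aN xi; apply: (anti_of_eqpt NT xe (IN eta)).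
by rewrite -xiE Id.
Qed.

Lemma gap x : (forall y, mdist x y <> pi) -> exists2 d : R, 0 < d & forall y, mdist x y <= pi - d.
Proof.
move=> H; apply: contrapT => H2; suff [y xy] : exists y, mdist x y = pi by exact: (H y).
apply: (sph_anti_limit sX) => d d0; apply: contrapT => H3; apply: H2; exists d => // y.
by rewrite leNgt; apply/negP => h; apply: H3; exists y.
Qed.

(** Points keep the distance [d] from being antipodal to [x]. Apply [extprop] to the geodesic from
    [x] to [g (s + s)] with middle point [g s]: a prolongation at the far end would come within
    [2 * s + c < d] of being antipodal, so the geodesic extends backwards through [x], in the
    direction opposite to [dir g]. *)
Lemma nonanti_allanti x : extprop X -> (forall y, mdist x y <> pi) -> allanti (direction x).
Proof.
move=> eX xn; have [d d0 dP] := gap xn; have pi0 := @pi_gt0 R; pose c := d / 2.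
have c2 : c <= pi / 2 by have := dP x; rewrite mdistxx /c; lra.
have c0 : 0 < c by rewrite divr_gt0.
have back (g : geodesic x) : exists eta, mdist (dir g) eta = pi.
  pose s := Num.min (glen g / 2) (c / 4).
  have s0 : 0 < s by rewrite lt_min !divr_gt0 ?glen_gt0.
  have [sg sc] : s <= glen g / 2 /\ s <= c / 4 by rewrite /s !ge_min !lexx orbT.
  have [||||||||[x' [yx' xx']]|[z' [yz' zz']]] := eX x (g s) (g (s + s)) s s (s + c).
  - by rewrite geo_dist //; lra.
  - by [].
  - by rewrite geo_isom; lra.
  - by [].
  - by rewrite geo_dist //; lra.
  - by lra.
  - by lra.
  - by lra.
  - have {}xx' : mdist x x' = c by lra.
    have xx0 : x != x' by rewrite -mdist_gt0 xx'.
    have [|h [hl he]] := sph_geodesic sX xx0; first by rewrite xx'; lra.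
    exists (dir h); rewrite mdist_dir; apply: (@angle_opp_pi _ _ _ _ _ (Num.min s c)).
      by rewrite lt_min s0.
    move=> a b /andP[a0]; rewrite lt_min => /andP[as_ _] /andP[b0]; rewrite lt_min => /andP[_ bc].
    have ga : mdist (g a) (g s) = s - a by rewrite geo_isom //; lra.
    have hb : mdist (h b) x' = c - b by rewrite -he /gend hl xx' geo_isom ?hl ?xx' //; lra.
    have t1 := metric_triangle (g s) (g a) x'; have t2 := metric_triangle (g a) (h b) x'.
    have t3 := metric_triangle (g a) x (h b); rewrite (metric_sym (g s) (g a)) in t1.
    have xa : mdist x (g a) = a by rewrite geo_dist //; lra.
    have xb : mdist x (h b) = b by rewrite geo_dist // hl xx'; lra.
    rewrite (metric_sym (g a) x) in t3.
    apply/eqP; rewrite eq_le; apply/andP; split; lra.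
  - have := dP z'; have := metric_triangle (g s) x z'.
    have -> : mdist (g s) x = s by rewrite metric_sym geo_dist //; lra.
    by rewrite yz' /c in sc *; lra.
move=> zeta; have [|eta ze _] := @antipode_limit R X (alexl_curv (sph_alexl sX)) x setT zeta.
  move=> e e0; have [g gz] := dir_near zeta e0; have [eta ge] := back g.
  exists eta => //; have := metric_triangle (dir g) zeta eta; rewrite ge (metric_sym (dir g)); lra.
by exists eta.
Qed.

End Suspension.

(** * Boundary points of one-dimensional spaces *)

Section Charts.
Context {R : realType} {X : metricType R} (aX : alexl X).

(** In the chart [h] starts at the end 0 of the interval and covers an initial piece of it by the
    intermediate value theorem. So each point [g s] near [p] lies on [h], necessarily at the same
    distance from [p]. *)
Lemma chart_direction p (g h : geodesic p) : boundary 1 X p -> angle g h = 0.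
Proof.
move=> [U [f [f' [oU Up [fc _ fP _] fp]]]].
have [d d0 dU] : exists2 d : R, 0 < d & forall x, mdist p x < d -> U x.
  have /nbhs_ballP[d /= d0 dU] := open_nbhs_nbhs (conj oU Up).
  by exists d => // x px; apply: dU; rewrite ballEmdist.
pose l := Num.min (d / 2) (glen h).
have l0 : 0 < l by rewrite lt_min divr_gt0 // glen_gt0.
have [ld lh] : l < d /\ l <= glen h.
  by rewrite /l ge_min lexx orbT; split=> //; apply: le_lt_trans (_ : _ <= d / 2) _; [rewrite ge_min lexx|lra].
(* The parameter is clamped to [[0, l]], so that [h (cl s)] stays in the chart for every real
   [s]. *)
clearbody l; pose cl s := Num.max 0 (Num.min s l); pose F s := f (h (cl s)).
have clP s : 0 <= cl s <= l by rewrite le_max lexx ge_max (ltW l0) ge_min lexx orbT.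
have clE s : 0 <= s -> s <= l -> cl s = s by move=> h1 h2; rewrite /cl (min_idPl h2) (max_idPr h1).
have cl_lip s t : `|cl s - cl t| <= `|s - t|.
  rewrite /cl /Num.max /Num.min; have := ler_norm (s - t); have := ler_norm (t - s).
  rewrite (distrC t); move=> h1 h2; rewrite ler_norml.
  by do ![case: ifPn]; rewrite -?leNgt => *; apply/andP; split; lra.
have hU s : U (h (cl s)).
  have /andP[c0 cl1] := clP s; apply: dU; rewrite geo_dist; first exact: le_lt_trans ld.
  by rewrite c0 (le_trans cl1).
have F0 s : U s -> 0 <= f s.
  by move=> Us; have [] := fP s Us; rewrite /= in_itv /= => /andP[].
have Fc : {within `[0, l], continuous F}.
  apply/within_continuous_ball => s _ e e0.
  have /within_continuous_ball/(_ _ (hU s) e e0)[d' d'0 d'P] := fc.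
  exists d' => // t _ st; apply: d'P; first exact: hU.
  rewrite ballEmdist /= gcurve_isom.
  - by apply: le_lt_trans (cl_lip _ _) _; move: st; rewrite -ball_normE /=.
  - by have /andP[c0 cl1] := clP s; rewrite c0 (le_trans cl1).
  - by have /andP[c0 cl1] := clP t; rewrite c0 (le_trans cl1).
have Fl : 0 < F l.
  rewrite lt_neqAle F0 ?andbT //; apply/eqP => E.
  have [_ e1] := fP _ (hU l); have [_ e2] := fP p Up.
  have : mdist p (h (cl l)) = 0 by rewrite -e1 -[f _]/(F l) -E -fp e2 mdistxx.
  by rewrite clE ?(ltW l0) // geo_dist ?(ltW l0) // => E'; rewrite E' ltxx in l0.
have /within_continuous_ball/(_ p Up _ Fl)[c c0 cP] := fc.
pose m := Num.min (Num.min c d) (Num.min l (glen g)).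
have m0 : 0 < m by rewrite !lt_min c0 d0 l0 glen_gt0.
apply: (angle0_of_agree (alexl_curv aX) m0) => s /andP[s0].
rewrite !lt_min => /andP[/andP[sc sd] /andP[sl sg]].
have ps : mdist p (g s) = s by rewrite geo_dist // (ltW s0) ltW.
have Ug : U (g s) by apply: dU; rewrite ps.
have := cP (g s) Ug; rewrite ballEmdist /= ps => /(_ sc); rewrite fp -ball_normE /= sub0r normrN => fl.
have [|s' ] := IVT (ltW l0) Fc (_ : Num.min (F 0) (F l) <= f (g s) <= Num.max (F 0) (F l)).
  have F00 : F 0 = 0 by rewrite /F clE ?(ltW l0) // gcurve0.
  rewrite F00 ge_min le_max F0 //=; apply/orP; right; apply: le_trans (ler_norm _) (ltW fl).
rewrite in_itv /= => /andP[s'0 s'l] E.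
have [_ e1] := fP _ Ug; have [_ e2] := fP _ (hU s').
have gh : g s = h s' by rewrite -e1 -E -[F s']/(f (h (cl s'))) e2 clE.
suff -> : s = s' by rewrite -gh; congr (g _); rewrite -ps gh geo_dist // s'0 (le_trans s'l).
by rewrite -ps gh geo_dist // s'0 (le_trans s'l).
Qed.

Lemma chart_geodesic p : boundary 1 X p -> exists g : geodesic p, True.
Proof.
move=> [U [f [f' [oU Up [_ f'c fP f'P] fp]]]]; have [r r0 G] := alexl_geodesic aX p.
have i0 : `[0, 1[%classic (0 : R) by rewrite /= in_itv /= lexx ltr01.
have f'0 : f' 0 = p by have [_] := fP p Up; rewrite fp.
have /within_continuous_ball/(_ 0 i0 r r0)[d d0 dP] := f'c.
pose t := Num.min (d / 2) (1 / 2).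
have t0 : 0 < t by rewrite lt_min !divr_gt0.
have [td t1] : t <= d / 2 /\ t <= 1 / 2 by rewrite /t !ge_min !lexx orbT.
have it : `[0, 1[%classic t by rewrite /= in_itv /= (ltW t0) /=; lra.
have := dP t it; rewrite -ball_normE /= sub0r normrN gtr0_norm // f'0 ballEmdist /=.
move=> /(_ ltac:(lra)) h; have [_ ft] := f'P t it.
have [||g _] := G p (f' t) _ h; [by rewrite mdistxx| |by exists g].
by apply/eqP => E; rewrite -E fp in ft; rewrite ft ltxx in t0.
Qed.

Lemma chart_single p : boundary 1 X p -> exists xi0 : direction p, forall xi, xi = xi0.
Proof.
move=> bp; have [g _] := chart_geodesic bp; exists (dir g) => xi; apply: mdist0_eq.
apply/eqP; rewrite eq_le mdist_ge0 andbT; apply/ler_addgt0Pr => e e0; rewrite add0r.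
have [h xh] := dir_near xi e0.
have := metric_triangle xi (dir h) (dir g); rewrite mdist_dir (chart_direction h g bp); lra.
Qed.

End Charts.

Lemma half_sphere1 {R : realType} (X : metricType R) (x0 : X) : (forall x, x = x0) -> half_sphere 1 X.
Proof.
move=> H; have d1 (u v : 'rV[R]_1) : dotv u v = u ord0 ord0 * v ord0 ord0.
  by rewrite /dotv big_ord1.
exists (fun _ => const_mx 1); split.
- by move=> x i _; rewrite mxE.
- by move=> x y; rewrite (H x) (H y) mdistxx cos0 d1 !mxE mulr1.
move=> v /half_space_ord_max hv; rewrite d1 => vv; exists x0; apply/rowP => i.
rewrite mxE ord1; have E : ord_max = ord0 :> 'I_1 by exact: val_inj.
rewrite E in hv; apply/eqP; rewrite -(@eqrXn2 _ 2) // expr1n; apply/eqP.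
by rewrite expr2.
Qed.

Section Boundary.
Context {R : realType}.

(** Let [xi] be a boundary point. With an antipode, [X] is a suspension over [direction xi], a half
    sphere by induction. Without one, every direction at [xi] would have an opposite, which gives
    [extprop] at once and makes [direction xi] a half sphere, whose center has no opposite. *)
Lemma half_sphere_of_boundary m (X : metricType R) : spherical X -> extprop X ->
  boundary m.+1 X !=set0 -> half_sphere m.+2 X.
Proof.
elim: m X => [|m IH] X sX eX [xi bxi].
  have [eta0 eta0P] := chart_single (sph_alexl sX) bxi.
  have [[y xy]|/forallNP ny] := pselect (exists y, mdist xi y = pi).
    by apply: (half_sphere_susp sX xy); exact: half_sphere1 eta0P.
  have [eta] := nonanti_allanti sX eX ny eta0; rewrite (eta0P eta) mdistxx => E.
  by have := @pi_gt0 R; rewrite -E ltxx.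
have sD := direction_spherical (sph_alexl sX) (p := xi).
have [[y xy]|/forallNP ny] := pselect (exists y, mdist xi y = pi).
  by apply: (half_sphere_susp sX xy); apply: IH => //; exact: extprop_equator xy eX.
have aD := nonanti_allanti sX eX ny.
by case: (half_sphere_not_allanti (IH _ sD (allanti_extprop sD aD) bxi) aD).
Qed.

(** Induction through the equator ends at a half circle, an arc of length pi, where the distance
    from an end is a chart. *)
Lemma boundary_of_half_sphere m (X : metricType R) : spherical X -> half_sphere m.+2 X ->
  boundary m.+1 X !=set0.
Proof.
elim: m X => [|m IH] X sX hX; last first.
  have [N [T [NT hN]]] := half_sphere_equator sX hX.
  by exists N; exact: (IH _ (direction_spherical (sph_alexl sX)) hN).
have [phi [hs cosE onto]] := hX; have pi0 := @pi_gt0 R.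
pose cs t : 'rV[R]_2 := consv (cos t) (const_mx (sin t)).
have d2 (u v : 'rV[R]_1) : dotv u v = u ord0 ord0 * v ord0 ord0 by rewrite /dotv big_ord1.
have csd s t : dotv (cs s) (cs t) = cos (s - t) by rewrite dotv_consv d2 !mxE cosB.
have /choice[c cP] : forall t, exists x, 0 <= t <= pi -> phi x = cs t.
  move=> t; have [ti|_] := boolP (0 <= t <= pi).
    have [||x xE] := onto (cs t); last by exists x.
      by apply/half_space_consv => i _; rewrite mxE sin_ge0_pi.
    by rewrite csd subrr cos0.
  have [||x _] := onto (cs 0); last by exists x.
    by apply/half_space_consv => i _; rewrite mxE sin0.
  by rewrite csd subrr cos0.
have cI s t : 0 <= s <= pi -> 0 <= t <= pi -> mdist (c s) (c t) = `|s - t|.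
  move=> hs' ht; rewrite -(sph_cosK sX) cosE !cP // csd -cos_norm cosK' // normr_ge0 ler_norml.
  by move: hs' ht => /andP[? ?] /andP[? ?]; apply/andP; split; lra.
have i0 : 0 <= (0 : R) <= pi by rewrite lexx ltW.
pose xi := c 0; have xiE : phi xi = cs 0 by rewrite cP.
have ipi (t : R) : 0 <= t < 1 -> 0 <= t <= pi.
  by move=> /andP[-> t1] /=; have := @pihalf_ge1 R; lra.
have xc t : 0 <= t <= pi -> mdist xi (c t) = t.
  by move=> ti; rewrite cI // sub0r normrN ger0_norm //; case/andP: ti.
exists xi, [set x | mdist xi x < 1], (mdist xi), c; split.
- rewrite openE => x /= h; apply/nbhs_ballP; exists (1 - mdist xi x); first by rewrite /= subr_gt0.
  by move=> y; rewrite ballEmdist /= => xy; have := metric_triangle xi x y; lra.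
- by rewrite /= mdistxx.
- split.
  + apply/within_continuous_ball => x _ e e0; exists e => // y _; rewrite ballEmdist -ball_normE /=.
    apply: le_lt_trans; have := metric_triangle xi x y; have := metric_triangle xi y x.
    by rewrite (metric_sym y x) ler_norml => h1 h2; apply/andP; split; lra.
  + apply/within_continuous_ball => s; rewrite /= in_itv /= => hs' e e0; exists e => // t.
    by rewrite /= in_itv /= => ht; rewrite ballEmdist -ball_normE /= cI ?ipi.
  + move=> x /= x1; rewrite in_itv /= mdist_ge0 x1; split=> //.
    have xi1 : 0 <= mdist xi x <= pi by rewrite mdist_ge0 sph_pi.
    apply: (sph_cos1 sX); rewrite cosE cP //.
    have a : phi x ord0 ord0 = cos (mdist xi x).
      by rewrite cosE xiE -[in RHS](consvK (phi x)) dotv_consv d2 !mxE cos0 sin0 mul1r mul0r addr0.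
    have b0 : 0 <= tailv (phi x) ord0 ord0.
      have := hs x; rewrite -{1}(consvK (phi x)) => /half_space_consv/half_space_ord_max.
      by rewrite (_ : ord_max = ord0) //; exact: val_inj.
    have := cosE x x; rewrite mdistxx cos0 -{1 2}(consvK (phi x)) dotv_consv d2 a.
    move=> E; rewrite -{1}(consvK (phi x)) dotv_consv d2 a !mxE.
    have s0 : 0 <= sin (mdist xi x) by rewrite sin_ge0_pi.
    rewrite mxE in b0; rewrite mxE in E; have -> : phi x ord0 (lift ord0 ord0) = sin (mdist xi x).
      apply/eqP; rewrite -(@eqrXn2 _ 2) //; apply/eqP.
      by have := cos2Dsin2 (mdist xi x); rewrite !expr2; lra.
    by rewrite -!expr2 cos2Dsin2.
  + move=> t; rewrite /= in_itv /= => ht; rewrite xc ?ipi //.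
    by case/andP: ht => _ ->.
- by rewrite mdistxx.
Qed.

(** In a half sphere the points with an antipode form the boundary sphere, so this singles out the
    center. *)
Definition perp (X : metricType R) (x : X) : Prop :=
  forall w, (exists w', mdist w w' = pi) -> mdist w x = pi / 2.

(** A criterion that does not presuppose a boundary point. Antipodal pairs are split off as
    suspensions; this stops because a pole is at distance [pi / 2] from its equator and so lowers
    the packing number [K] by one. When no antipodal pair is left, all points satisfy [perp], and
    the space is a single point. *)
Lemma half_sphere_gen K (X : metricType R) : spherical X -> extprop X -> ~ allanti X ->
  (forall x y : X, perp x -> perp y -> mdist x y < pi / 2) ->
  (forall f : nat -> X, exists i j, [/\ (i < j)%N, (j < K)%N & mdist (f i) (f j) < pi / 2]) ->
  exists k, half_sphere k.+1 X.
Proof.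
elim: K X => [|K IH] X sX eX nX pX KX.
  have /existsNP[x _] := nX.
  by have [i [j [_]]] := KX (fun _ => x).
have pi0 := @pi_gt0 R.
have [[N [T NT]]|nW] := pselect (exists N : X, exists T, mdist N T = pi); last first.
  have pp (x : X) : perp x by move=> w [w' ww']; case: nW; exists w, w'.
  have /existsNP[x0 _] := nX; exists 0%N; apply: (@half_sphere1 _ _ x0) => x.
  apply: contrapT => /eqP xx0; have d0 : 0 < mdist x x0 by rewrite mdist_gt0.
  have d1 := pX x x0 (pp x) (pp x0).
  have [||||y [xy yx0]] := @sph_between _ _ sX x x0 (mdist x x0 / 2) (mdist x x0 / 2); [lra|lra|lra|lra|].
  (* With [L = pi / 2] either alternative of [extprop] produces a point at distance [pi / 2] from
     [y], which the bound on [perp] points forbids. *)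
  have [||||||[x' [yx' _]]|[z' [yz' _]]] := eX x y x0 _ _ (pi / 2) xy _ yx0; [lra|lra|lra|lra|lra|lra| |].
    by have := pX y x' (pp y) (pp x'); rewrite yx' ltxx.
  by have := pX y z' (pp y) (pp z'); rewrite yz'; lra.
have [I [IN Id Ionto]] := equator_iso sX NT.
have sD := direction_spherical (sph_alexl sX) (p := N).
have [||||k hk] := IH (direction N) sD.
- exact: extprop_equator NT eX.
- by move=> aN; apply: nX; exact: allanti_equator NT aN.
- have up xi : perp xi -> perp (I xi).
    move=> pxi w [w' ww']; apply/(sph_cos0 sX).
    have [->|wN] := eqVneq w N; first by rewrite IN cos_pihalf.
    have [->|wT] := eqVneq w T.
      have := anti_sum sX (I xi) NT; rewrite IN => h.
      by rewrite metric_sym (_ : mdist (I xi) T = pi / 2) ?cos_pihalf //; lra.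
    have [e we] := eqpt_ex sX NT wN wT; have [e' [Ne' ee']] := anti_eqpt sX NT ww' wN wT we.
    have [a aE] := Ionto e we.1; have [a' a'E] := Ionto e' Ne'; subst e e'.
    rewrite Id in ee'.
    rewrite (susp sX (I xi) NT we) // IN cos_pihalf mulr0 add0r Id.
    by rewrite (pxi a) ?cos_pihalf ?mulr0 //; exists a'.
  by move=> xi eta pxi peta; rewrite -Id; apply: pX; exact: up.
- move=> f; pose f' i := if i is j.+1 then I (f j) else N.
  have [[|i] [[|j] [//= ij jK]]] := KX f'; first by rewrite IN ltxx.
  by rewrite Id => h; exists i, j.
by exists k.+1; exact: half_sphere_susp NT hk.
Qed.

End Boundary.

(** * Poles *)

Section Setup.
Context {R : realType}.

Record onesided (M : metricType R) : Prop := Onesided {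
  os_alexl : alexl M ;
  os_proper : proper_space M ;
  os_approx : approx_geodesic M ;
  os_ray : forall (p : M) (xi : direction p),
    exists2 eta : direction p, eta = xi \/ mdist xi eta = pi & exists l, ray_in eta l }.

Lemma curv4_of_curvature_ge (M : metricType R) (kappa : R) : kappa <= 0 -> curvature_ge M kappa -> curv4 M.
Proof.
rewrite le_eqVlt => /orP[/eqP ->|kn] H.
  exists 1 => // p; have [U /nbhs_ballP[r /= r0 rU] HU] := H p; exists r => // a b c e pa pb pc pe abce.
  have inU x : mdist p x < r -> U x by move=> h; apply: rU; rewrite ballEmdist.
  apply: le_trans (HU a b c e (inU _ pa) (inU _ pb) (inU _ pc) (inU _ pe) abce).
  have [ab ac ae bc [be ce]] := uniq4 abce.
  have key x y : a != x -> a != y -> acos (cH 1 (mdist a x) (mdist a y) (mdist x y)) <= comparison_angle 0 a x y.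
    move=> ax ay; rewrite /comparison_angle /model_angle ltxx.
    have h1 : 0 < mdist a x by rewrite mdist_gt0.
    have h2 : 0 < mdist a y by rewrite mdist_gt0.
    have T := tri_mdist a x y; have /andP[lo _] := cE_itv h1 h2 T.
    have /andP[_ hi] := cH_itv ltr01 h1 h2 T.
    exact: (acos_ler lo (cE_le_cH ltr01 h1 h2 T) hi).
  by apply: lerD; [apply: lerD|]; exact: key.
exists (Num.sqrt (- kappa)); first by rewrite sqrtr_gt0 oppr_gt0.
move=> p; have [U /nbhs_ballP[r /= r0 rU] HU] := H p; exists r => // a b c e pa pb pc pe abce.
have inU x : mdist p x < r -> U x by move=> h; apply: rU; rewrite ballEmdist.
have := HU a b c e (inU _ pa) (inU _ pb) (inU _ pc) (inU _ pe) abce.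
by rewrite /comparison_angle /model_angle kn /cH !hypE.
Qed.

Lemma onesided_of_ob (M : metricType R) (n : nat) (kappa : R) : kappa <= 0 ->
  complete_alexandrov n kappa M -> ob_infty M = (pi / 2)%:E -> onesided M.
Proof.
move=> k0 [cM iM /(curv4_of_curvature_ge k0) c4 dM] ob.
have gM := intrinsic_approx iM.
have [s0 s00 Hs] : exists2 s0 : R, 0 < s0 & hausdorff_measure s0 [set: M] = 0%E.
  apply: contrapT => H; move: dM; rewrite /hausdorff_dim.
  rewrite (_ : [set _ | _ in _] = set0); first by rewrite ereal_inf0.
  by apply/seteqP; split=> z // [s [s0 hs] _]; apply: H; exists s.
have dM' := ldoubling_of_dim cM c4 gM s00 Hs; have pM := hopf_rinow cM gM dM'.
split=> //; last by move=> p xi; exact: one_side_ray.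
by split=> // p; exists 1 => // a b _ _ ab; exact: geodesic_ex.
Qed.

End Setup.

Section Limits.
Context {R : realType} {X : metricType R} (aX : alexl X) {p : X}.
Implicit Types (x y z w : direction p).

Let sX := direction_spherical aX (p := p).
Let c4 := alexl_curv aX.

Lemma cone_between a b c x y z : 0 < a -> 0 < b -> 0 < c ->
  cdist a b x y + cdist b c y z = cdist a c x z -> mdist x y + mdist y z = mdist x z.
Proof.
move=> a0 b0 c0 E; have [xz|xz] := eqVneq (mdist x z) pi; first by rewrite (anti_sum sX y xz).
have A2 := @cdist_sqr R X p a b x y (ltW a0) (ltW b0); have B2 := @cdist_sqr R X p b c y z (ltW b0) (ltW c0).
have D2 := @cdist_sqr R X p a c x z (ltW a0) (ltW c0); rewrite -E in D2.
apply: (planar_between a0 c0 (ltW b0) _ _ (mdist_ge0 x z) _ _ (cdist_ge0 _ _ _ _) (cdist_ge0 _ _ _ _) A2 B2 D2).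
- by rewrite mdist_ge0 sph_pi.
- by rewrite mdist_ge0 sph_pi.
- by rewrite lt_neqAle xz sph_pi.
- exact: metric_triangle.
Qed.

(** In the plane with [y] as unit vector, going from [y] the length [sin s / sin (L - s)] in the
    direction at angle [L] leads to the point with polar coordinates [sin L / sin (L - s)] and [s].
    So the line from [y] through that point tends to the direction at angle [L]. *)
Lemma cone_line_dist y x (s L : R) : mdist y x = s -> 0 < s -> s < L -> L < pi ->
  cdist 1 (sin L / sin (L - s)) y x = sin s / sin (L - s).
Proof.
move=> yx s0 sL Lpi.
have ss : 0 < sin s by apply: sin_gt0_pi; apply/andP; split; lra.
have sLs : 0 < sin (L - s) by apply: sin_gt0_pi; apply/andP; split; lra.
have LE : sin L = sin (L - s) * cos s + cos (L - s) * sin s by rewrite -sinD subrK.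
rewrite -[RHS]ger0_norm ?divr_ge0 ?ltW // -sqrtr_sqr; congr Num.sqrt; rewrite /cd2 yx.
apply: (@mulIf _ (sin (L - s) ^+ 2)); first by rewrite expf_neq0 // gt_eqF.
transitivity (sin (L - s) ^+ 2 + sin L ^+ 2 - 2 * sin L * sin (L - s) * cos s); first by field; rewrite gt_eqF.
rewrite exprMn exprVn divfK ?expf_neq0 ?gt_eqF // LE.
have E1 := cos2Dsin2 s; have E2 := cos2Dsin2 (L - s).
transitivity (sin (L - s) ^+ 2 * (1 - cos s ^+ 2) + cos (L - s) ^+ 2 * sin s ^+ 2); first by ring.
have -> : 1 - cos s ^+ 2 = sin s ^+ 2 by lra.
by rewrite -mulrDl addrC E2 mul1r.
Qed.

(* The points sigma w at distance Lam from y run along the line through y and r x as Lam grows. *)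
Lemma cone_line_limit x y (s L : R) : mdist y x = s -> 0 < s -> s < L -> L < pi ->
  let r := sin L / sin (L - s) in let A := sin s / sin (L - s) in
  (forall Lam : R, A < Lam -> exists sigma w, [/\ 0 <= sigma, cdist 1 sigma y w = Lam &
     cdist r sigma x w = Lam - A]) ->
  exists x', mdist y x' = L /\ mdist x x' = L - s.
Proof.
move=> yx s0 sL Lpi r A H.
have ss : 0 < sin s by apply: sin_gt0_pi; apply/andP; split; lra.
have sL0 : 0 < sin L by apply: sin_gt0_pi; apply/andP; split; lra.
have sLs : 0 < sin (L - s) by apply: sin_gt0_pi; apply/andP; split; lra.
have r0 : 0 < r by rewrite divr_gt0.
have A0 : 0 < A by rewrite divr_gt0.
have LE : sin L = sin (L - s) * cos s + cos (L - s) * sin s by rewrite -sinD subrK.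
have AE : cdist 1 r y x = A by exact: cone_line_dist.
pose Lam j : R := A + 2 + j%:R.
have /choice[sw swP] : forall j, exists v : R * direction p, [/\ 0 <= v.1, cdist 1 v.1 y v.2 = Lam j &
     cdist r v.1 x v.2 = Lam j - A].
  move=> j; have [|sg [w [h1 h2 h3]]] := H (Lam j); first by rewrite /Lam; have := ler0n R j; lra.
  by exists (sg, w).
have Lam2 j : 2 <= Lam j by rewrite /Lam; have := ler0n R j; lra.
have near j : `|(sw j).1 - Lam j| <= 1.
  have [h1 h2 _] := swP j; have := cdist_sqr y (sw j).2 ler01 h1; rewrite h2 /cd2.
  have := cos_le1 (mdist y (sw j).2); have := cos_geN1 (mdist y (sw j).2); have := Lam2 j.
  move: (sw j).1 (cos _) (Lam j) h1 => g c l g0 l2 c1 c2 E.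
  have h3 : (g - 1) ^+ 2 <= l ^+ 2 by rewrite E; nra.
  have h4 : l ^+ 2 <= (g + 1) ^+ 2 by rewrite E; nra.
  rewrite ler_sqr ?nnegrE in h4; [|lra|lra].
  have h5 : g - 1 <= l by rewrite -[leRHS]ger0_norm; [rewrite -sqrtr_sqr; apply: le_trans (ler_norm _) _; rewrite -sqrtr_sqr ler_wsqrtr|lra].
  by rewrite ler_norml; apply/andP; split; lra.
have sum j : s + mdist x (sw j).2 = mdist y (sw j).2.
  have [h1 h2 h3] := swP j; rewrite -yx; apply: (cone_between ltr01 r0 (c := (sw j).1)).
    by have := near j; have := Lam2 j; rewrite ler_norml => h /andP[h' _]; lra.
  by rewrite AE h3 h2; ring.
(* [planar_point] with the ratio [A / Lam j] locates the point above [x] on the segment; as [Lam j]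
   grows the formula determines the limit angle at [x]. *)
have cosb j : cos (mdist x (sw j).2) * (A * ((sw j).1 / Lam j)) = r - (1 - A / Lam j) * cos s.
  have [h1 h2 h3] := swP j; have l0' : 0 < Lam j by have := Lam2 j; lra.
  have l0 : Lam j != 0 by rewrite gt_eqF.
  have E : A + (Lam j - A) = Lam j by ring.
  have A2 := @cdist_sqr R X p 1 r y x ler01 (ltW r0); have B2 := @cdist_sqr R X p r _ x (sw j).2 (ltW r0) h1.
  have D2 := @cdist_sqr R X p 1 _ y (sw j).2 ler01 h1.
  rewrite AE /cd2 yx in A2; rewrite h3 /cd2 in B2; rewrite h2 -E /cd2 -sum in D2.
  have [|_ ->] := @planar_point R 1 (sw j).1 r (A / Lam j) _ _ _ _ (ltW r0) A2 B2 D2.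
    by rewrite E divfK.
  by field.
have [x' wx] := tbounded_utends (@direction_complete R X p) (sph_tbounded sX)
  (oou_all (fun j => I : [set: direction p] (sw j).2)).
have lam_inv : (fun j => (Lam j)^-1) @ oou --> (0 : R).
  apply: (ulim_squeeze0 _ _ inv_ulim0) => [j|]; first by rewrite invr_ge0; have := Lam2 j; lra.
  apply: oou_all => j /=; rewrite lef_pV2 ?posrE; [|by have := Lam2 j; lra|by rewrite ltr0n].
  by rewrite /Lam -[j.+1%:R]natr1; lra.
have ratio : (fun j => (sw j).1 / Lam j) @ oou --> (1 : R).
  have d0 : (fun j => `|(sw j).1 / Lam j - 1|) @ oou --> (0 : R).
    apply: (ulim_squeeze0 _ _ lam_inv) => // ; apply: oou_all => j /=.
    have l0 : 0 < Lam j by have := Lam2 j; lra.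
    rewrite (_ : _ - 1 = ((sw j).1 - Lam j) / Lam j); last by field; rewrite gt_eqF.
    by rewrite normrM [X in _ * X]gtr0_norm ?invr_gt0 // ler_piMl ?invr_ge0 // ltW.
  apply: ulimP => e e0; apply: (oou_imply _ (ulim0P d0 e0)) => j /=.
  by rewrite normr_id.
have l1 : (fun j => cos (mdist x (sw j).2) * (A * ((sw j).1 / Lam j))) @ oou --> cos (mdist x x') * (A * 1).
  apply: cvgM; first by apply: cos_ulim; exact: utends_mdist (utends_cst x) wx.
  by apply: cvgM => //; exact: ulim_cst.
have l2 : (fun j => r - (1 - A / Lam j) * cos s) @ oou --> r - (1 - A * 0) * cos s.
  apply: cvgB; first exact: ulim_cst.
  apply: cvgM; last exact: ulim_cst.
  apply: cvgB; first exact: ulim_cst.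
  by apply: cvgM => //; exact: ulim_cst.
have := ulim_uniq l1 (ulim_eq _ l2); rewrite mulr1 mulr0 subr0 mul1r.
move=> /(_ (oou_all (fun j => esym (cosb j)))) E.
have xx' : mdist x x' = L - s.
  rewrite -(sph_cosK sX) -[RHS]cosK'; last by apply/andP; split; lra.
  congr acos; apply: (@mulIf _ A); first by rewrite gt_eqF.
  rewrite E /r /A LE; field; rewrite gt_eqF //.
exists x'; split=> //.
have l3 : (fun j => s + mdist x (sw j).2) @ oou --> s + mdist x x'.
  by apply: cvgD; [exact: ulim_cst|exact: utends_mdist (utends_cst x) wx].
rewrite (ulim_uniq (utends_mdist (utends_cst y) wx) (ulim_eq _ l3)); first by rewrite xx'; ring.
by apply: oou_all => j; exact: sum.
Qed.

End Limits.

Section Rays.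
Context {R : realType} {M : metricType R} (oM : onesided M).
Implicit Types (p q : M).

Let aM := os_alexl oM.
Let pM := os_proper oM.
Let c4 := alexl_curv aM.

Definition allrays p : Prop := forall xi : direction p, exists l, ray_in xi l.

(** The directions near a non-ray direction [N] fail to reach some fixed length, so all of them have
    opposites. Every meridian from [N] starts among them, so its equatorial point has an antipode by
    [anti_eqpt], and hence so does every point of the meridian. *)
Lemma nonray_allanti p : ~ allrays p -> allanti (direction p).
Proof.
move=> /existsNP[N nN]; have sD := direction_spherical aM (p := p); have pi0 := @pi_gt0 R.
have anti (xi : direction p) : ~ (exists l, ray_in xi l) -> exists eta, mdist xi eta = pi.
  by move=> nx; have [eta [->|xe] //] := os_ray oM xi; exists eta.
have [T NT] := anti _ nN.
have [L [L0 [e e0 He]]] : exists L, 0 < L /\ exists2 e, 0 < e & forall xi, mdist N xi < e -> ~ reach L xi.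
  apply: contrapT => H; apply: nN; apply: ray_of_reach => // L L0.
  apply: (reach_closed pM c4 L0) => e e0; apply: contrapT => H2; apply: H; exists L; split=> //.
  by exists e => // xi hxi rxi; apply: H2; exists xi.
have nr (xi : direction p) : mdist N xi < e -> exists eta, mdist xi eta = pi.
  move=> h; apply: anti => -[l rl]; apply: (He xi h).
  by have [g [gL _ gx]] := rl L L0; exists g; rewrite ?gL.
move=> x; have [->|xN] := eqVneq x N; first by exists T.
have [->|xT] := eqVneq x T; first by exists N; rewrite metric_sym.
have [a xa] := eqpt_ex sD NT xN xT.
pose b := Num.min (e / 2) (pi / 2).
have b0 : 0 < b by rewrite lt_min !divr_gt0.
have [be bp] : b <= e / 2 /\ b <= pi / 2 by rewrite /b !ge_min !lexx orbT.
have [|y [Ny ya]] := meridian sD NT xa.1 (ltW b0) _; first by lra.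
have [|y' yy'] := nr y; first by rewrite Ny; lra.
have yN : y != N by rewrite -mdist_gt0 metric_sym Ny.
have yT : y != T by apply/eqP => E; rewrite E NT in Ny; lra.
have [a' [Na' aa']] := anti_eqpt sD NT yy' yN yT ya.
exact: (anti_of_eqpt sD NT xa Na' aa').
Qed.

Lemma acos_le_angle k p r (g h : geodesic p) : 0 < k -> 0 < r -> fourpt k p r ->
  glen g < r -> glen h < r ->
  acos (cH k (glen g) (glen h) (mdist (gend g) (gend h))) <= angle g h.
Proof.
move=> k0 r0 F gr hr; have := @cos_angle_le R M k p r k0 r0 F g h (glen g) (glen h).
rewrite !glen_gt0 gr hr !lexx => /(_ isT isT isT isT); rewrite /phi -/(gend g) -/(gend h) => H.
have T : tri (glen g) (glen h) (mdist (gend g) (gend h)) by apply: geo_tri; rewrite lexx ltW // glen_gt0.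
rewrite -[leRHS]cosK' ?angle_ge0 ?angle_le_pi //; apply: acos_ler => //; first exact: cos_geN1.
by have /andP[] := cH_itv k0 (glen_gt0 g) (glen_gt0 h) T.
Qed.

Lemma ray_blowup p t (y : nat -> M) (l : nat -> R -> M) (Lam : R) (eta : direction p) :
  scale t -> blowup t y 1 eta -> 0 < Lam ->
  oou [set n | l n 0 = y n /\ isom_on (l n) (Lam * t n)] ->
  exists sigma w, [/\ 0 <= sigma, blowup t (fun n => l n (Lam * t n)) sigma w &
    cdist 1 sigma eta w = Lam].
Proof.
move=> st By Lam0 Hl.
have dist n : l n 0 = y n /\ isom_on (l n) (Lam * t n) -> mdist (y n) (l n (Lam * t n)) = Lam * t n.
  move=> [<- I]; have t0 := st.1 n.
  by rewrite I ?subr0 // mulr_ge0 // ltW.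
have l12 : 1 < 2 :> R by lra.
have [|sg [w [sg0 Bw]]] := @blowup_compact _ _ aM p t (fun n => l n (Lam * t n)) (2 + Lam) eta st.
  apply: filterS2 Hl (ulim_lt (blowup_base c4 st ler01 By) l12) => n /= /dist h.
  rewrite ltr_pdivrMr ?st.1 // => h2; have := metric_triangle p (y n) (l n (Lam * t n)).
  by rewrite h mulrDl; lra.
exists sg, w; split=> //.
apply: (ulim_uniq (blowup_dist c4 st ler01 sg0 By Bw)); apply: (ulim_eq _ (@ulim_cst R Lam)).
by apply: (oou_imply _ Hl) => n /= /dist ->; rewrite mulfK // gt_eqF // st.1.
Qed.

(** Place [x], [y], [z] on one line of the cone whose ends tend to the directions at angle [L] from
    [y] on the side of [x] and [pi - L] on the side of [z]. In [M], the geodesic from the point for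
    [y] to the point for [x], or its opposite direction, prolongs to a ray. The blown-up ray runs
    along the line beyond [x] or beyond [z], and [cone_line_limit] finds the endpoint. *)
Lemma extprop_allrays p : allrays p -> extprop (direction p).
Proof.
move=> aP; have sD := direction_spherical aM (p := p); have pi0 := @pi_gt0 R.
move=> x y z s u L xy s0 yz u0 xz supi sL uL.
have Lpi : L < pi by lra.
have ss : 0 < sin s by apply: sin_gt0_pi; apply/andP; split; lra.
have su : 0 < sin u by apply: sin_gt0_pi; apply/andP; split; lra.
have sL0 : 0 < sin L by apply: sin_gt0_pi; apply/andP; split; lra.
have sLs : 0 < sin (L - s) by apply: sin_gt0_pi; apply/andP; split; lra.
have sLu : 0 < sin (L + u) by apply: sin_gt0_pi; apply/andP; split; lra.
pose r1 := sin L / sin (L - s); pose A := sin s / sin (L - s).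
pose r2 := sin L / sin (L + u); pose B := sin u / sin (L + u).
have [r10 r20] : 0 < r1 /\ 0 < r2 by rewrite !divr_gt0.
have [A0 B0] : 0 < A /\ 0 < B by rewrite !divr_gt0.
(* Seen from [z] the same line is described with [pi - L] in place of [L]. *)
have mirror : sin (pi - L) / sin (pi - L - u) = r2 /\ sin u / sin (pi - L - u) = B.
  by rewrite /r2 /B (_ : pi - L - u = pi - (L + u)) ?sin_piB //; ring.
have AE : cdist 1 r1 y x = A by apply: cone_line_dist; rewrite // metric_sym.
have BE : cdist 1 r2 y z = B.
  by rewrite -mirror.1 -mirror.2; apply: cone_line_dist; rewrite //; lra.
have ABE : cdist r1 r2 x z = A + B.
  rewrite -[RHS]ger0_norm ?addr_ge0 ?(ltW A0) ?(ltW B0) // -sqrtr_sqr; congr Num.sqrt; rewrite /cd2 xz.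
  rewrite /r1 /r2 /A /B; set a := L - s; set b := L + u.
  have -> : s + u = b - a by rewrite /a /b; ring.
  have -> : sin s = sin L * cos a - cos L * sin a by rewrite -sinB /a; congr sin; ring.
  have -> : sin u = sin b * cos L - cos b * sin L by rewrite -sinB /b; congr sin; ring.
  have Ea := cos2Dsin2 a; have Eb := cos2Dsin2 b; rewrite cosB.
  rewrite -/a -/b in sLs sLu; move: (sin L) (cos L) (cos a) (sin a) (cos b) (sin b) Ea Eb sLs sLu.
  move=> S C ca sa cb sb Ea Eb sa0 sb0; apply: (@mulIf _ (sa ^+ 2 * sb ^+ 2)).
    by rewrite mulf_neq0 ?expf_neq0 // gt_eqF.
  transitivity (S ^+ 2 * (sb ^+ 2 + sa ^+ 2 - 2 * (sa * sb) * (cb * ca + sb * sa))).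
    by field; rewrite !gt_eqF.
  transitivity (S ^+ 2 * (sb * ca - cb * sa) ^+ 2); last by field; rewrite !gt_eqF.
  have {}Ea : ca ^+ 2 = 1 - sa ^+ 2 by lra.
  have {}Eb : cb ^+ 2 = 1 - sb ^+ 2 by lra.
  congr (_ * _); transitivity (sb ^+ 2 * ca ^+ 2 + cb ^+ 2 * sa ^+ 2 - 2 * (sa * sb) * (ca * cb)); last by ring.
  by rewrite Ea Eb; ring.
have st := @scale_harmonic R; pose t n : R := n.+1%:R^-1.
have [xw Bx] := blowup_ex x st (ltW r10); have [yw By] := blowup_ex y st ler01.
have [zw Bz] := blowup_ex z st (ltW r20).
have [k [r [k0 r0 F]]] := curv4_fourpt p c4.
have yx0 : 0 < cdist 1 r1 y x by rewrite AE.
have yz0 : 0 < cdist 1 r2 y z by rewrite BE.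
have nyx := blowup_pos c4 st ler01 (ltW r10) By Bx yx0.
have nyz := blowup_pos c4 st ler01 (ltW r20) By Bz yz0.
(* [Q1]: the ray passes through the point for [x]. [Q2]: it leaves in the opposite direction. The
   ultrafilter selects one of the two. *)
pose Q1 n l := l (mdist (yw n) (xw n)) = xw n.
pose Q2 n l := exists (g : geodesic (yw n)) (eta : direction (yw n)),
  [/\ glen g = mdist (yw n) (xw n), gend g = xw n, ray_in eta l & mdist (dir g) eta = pi].
have /choice[l lP] : forall n, exists l : R -> M, yw n != xw n ->
    [/\ l 0 = yw n, forall L', isom_on l L' & Q1 n l \/ Q2 n l].
  move=> n; have [E|ne] := eqVneq (yw n) (xw n); first by exists (fun _ => p).
  have [g [gl ge]] := geodesic_ex pM (os_approx oM) ne.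
  have [eta E [l rl]] := os_ray oM (dir g); exists l => _; split.
  - exact: ray_in0 rl.
  - by move=> L' a b a0 ab bL; exact: (ray_in_isom rl).
  case: E => [E|E]; last by right; exists g, eta.
  left; rewrite /Q1 -gl -ge; apply/esym.
  by apply: (ray_in_uniq c4 rl); rewrite // ?E // ltW // glen_gt0.
have lin Lam : oou [set n | l n 0 = yw n /\ isom_on (l n) (Lam * t n)].
  by apply: (oou_imply _ nyx) => n /= /lP[h1 h2 _].
have [Q|Q] : oou [set n | Q1 n (l n)] \/ oou [set n | Q2 n (l n)].
  by apply: oou_or; apply: (oou_imply _ nyx) => n /= /lP[].
- left; apply: (@cone_line_limit _ _ aM p x y s L); rewrite // 1?metric_sym // => Lam ALam.
  have Lam0 := lt_trans A0 ALam.
  have [sg [w [sg0 Bw Ew]]] := ray_blowup st By Lam0 (lin Lam); exists sg, w; split=> //.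
  apply: (ulim_uniq (blowup_dist c4 st (ltW r10) sg0 Bx Bw)).
  have lim : (fun n => Lam - mdist (yw n) (xw n) / t n) @ oou --> Lam - A.
    by rewrite -AE; apply: cvgB; [exact: ulim_cst|exact: (blowup_dist c4 st ler01 (ltW r10) By Bx)].
  apply: (ulim_eq _ lim).
  have lt : oou [set n | mdist (yw n) (xw n) / t n < Lam].
    by apply: (ulim_lt (blowup_dist c4 st ler01 (ltW r10) By Bx)); rewrite -/(cdist _ _ _ _) AE.
  apply: filterS2 (oouI Q lt) nyx => n [/= q]; rewrite ltr_pdivrMr ?st.1 // => h /lP[_ I _].
  have t0 : 0 < t n := st.1 n.
  have E := I (Lam * t n) _ _ (mdist_ge0 (yw n) (xw n)) (ltW h) (lexx _).
  rewrite q in E; rewrite -/(t n) E mulrBl mulfK // gt_eqF //.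
right; apply: (@cone_line_limit _ _ aM p z y u (pi - L)); [exact: yz|exact: u0|lra|lra|].
rewrite /= mirror.1 mirror.2 => Lam BLam; have Lam0 := lt_trans B0 BLam.
have [sg [w [sg0 Bw Ew]]] := ray_blowup st By Lam0 (lin Lam); exists sg, w; split=> //.
have yw0 : 0 < cdist 1 sg y w by rewrite Ew.
have [_ l1] := angle_ulim c4 k0 st ler01 (ltW r10) (ltW r20) By Bx Bz yx0 yz0.
have [/andP[I1 I2] l2] := angle_ulim c4 k0 st ler01 (ltW r20) sg0 By Bz Bw yz0 yw0.
rewrite AE BE ABE in l1; rewrite BE Ew in I1 I2 l2.
have cN1 : cE A B (A + B) = -1 by rewrite /cE; field; rewrite !gt_eqF.
rewrite cN1 acosN1 in l1.
have r20' : 0 < r / 2 by rewrite divr_gt0.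
(* The angle at [y] between [x] and [z] tends to pi, and the angles of [z] with two opposite
   directions add up to pi; so the ray becomes tangent to the direction of [z]. *)
have le_pi : pi + acos (cE B Lam (cdist r2 sg z w)) <= pi.
  apply: (ulim_le (cvgD l1 l2) (@ulim_cst R pi)).
  apply: filterS2 (oouI (oouI Q nyx) (oouI nyz (blowup_close c4 st ler01 By r20')))
    (oouI (oouI (blowup_small c4 st ler01 (ltW r10) By Bx r20') (blowup_small c4 st ler01 (ltW r20) By Bz r20'))
      (scale_lt Lam st r20')).
  move=> n [[[g [eta [gl ge rl E]]] nx] [nz py]] [[/= yx yz'] Lt].
  have [h [hl he]] := geodesic_ex pM (os_approx oM) nz.
  have Lt0 : 0 < Lam * t n by rewrite mulr_gt0 // st.1.
  have [m [ml mc mx]] := rl _ Lt0; rewrite -mx mdist_dir in E.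
  have F' : fourpt k (yw n) (r / 2) by apply: (fourpt_sub F); rewrite /= in py; lra.
  have a1 := acos_le_angle k0 r20' F' (g := g) (h := h).
  have a2 := acos_le_angle k0 r20' F' (g := h) (h := m).
  rewrite gl hl ge he in a1; rewrite hl ml he /gend ml mc in a2.
  have := angle_adjacent c4 h E; rewrite (angleC h g) => adj.
  have dm : mdist (yw n) (l n (Lam * t n)) = Lam * t n.
    by rewrite -mc -ml geo_dist // lexx ltW // glen_gt0.
  have b1 := a1 yx yz'; have b2 := a2 yz' Lt.
  change (acos (cH k (mdist (yw n) (xw n)) (mdist (yw n) (zw n)) (mdist (xw n) (zw n))) +
    acos (cH k (mdist (yw n) (zw n)) (mdist (yw n) (l n (Lam * t n))) (mdist (zw n) (l n (Lam * t n)))) <= pi).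
  by rewrite dm; lra.
have c1 : cE B Lam (cdist r2 sg z w) = 1.
  have /andP[c0 _] := acos_itv (x := cE B Lam (cdist r2 sg z w)) ltac:(by rewrite I1 I2).
  rewrite -[LHS]acosK' ?I1 ?I2 // (_ : acos _ = 0) ?cos0 //.
  by apply/eqP; rewrite eq_le c0 andbT; lra.
have D0 := cdist_ge0 r2 sg z w; move: c1 D0; move: (cdist r2 sg z w) => D c1 D0.
apply/eqP; rewrite -(@eqrXn2 _ 2) //; last by lra.
apply/eqP; move: c1; rewrite /cE => /(congr1 (fun v => v * (2 * B * Lam))).
rewrite mul1r divfK; last by rewrite gt_eqF // mulr_gt0 // mulr_gt0.
by move=> E; rewrite sqrrB; lra.
Qed.

End Rays.

Lemma within_continuous_oou {R : realType} (T U : pseudoMetricType R) (A : set T) (f : T -> U) :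
  (forall x (y : nat -> T), A x -> (forall n, A (y n)) ->
    (forall d : R, 0 < d -> oou [set n | ball x d (y n)]) ->
    forall e : R, 0 < e -> oou [set n | ball (f x) e (f (y n))]) -> {within A, continuous f}.
Proof.
move=> H; apply/within_continuous_ball => x Ax e e0; apply: contrapT => nd.
have /choice[y yP] : forall n : nat, exists y, [/\ A y, ball x n.+1%:R^-1 y & ~ ball (f x) e (f y)].
  move=> n; apply: contrapT => ny; apply: nd; exists n.+1%:R^-1; first by rewrite invr_gt0 ltr0n.
  by move=> y Ay xy; apply: contrapT => nf; apply: ny; exists y.
have [||n nP] := filter_ex (H x y Ax _ _ e e0).
- by move=> n; have [] := yP n.
- move=> d d0; apply: (oou_imply _ (ulim0P inv_ulim0 d0)) => n /=.
  rewrite gtr0_norm ?invr_gt0 ?ltr0n // => nd'; have [_ h _] := yP n.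
  by apply: le_ball h; exact: ltW.
by have [_ _] := yP n; apply.
Qed.

(** * The exponential map at a pole *)

Section Exponential.
Context {R : realType} {M : metricType R} (oM : onesided M) {p : M}.
Implicit Types (xi eta : direction p).

Let aM := os_alexl oM.
Let pM := os_proper oM.
Let c4 := alexl_curv aM.
Let sD := direction_spherical aM (p := p).

(* The ray prolongs a geodesic beyond its endpoint, so nonbranching at the endpoint applies. *)
Lemma ray_through xi l (h : geodesic p) s : ray_in xi l -> glen h = s -> gend h = l s -> dir h = xi.
Proof.
move=> rl hs he; have s0 : 0 < s by rewrite -hs glen_gt0.
have s10 : 0 < s + 1 by lra.
have [g [gl gc gx]] := rl _ s10; rewrite -gc in he.
have sg : s <= glen g by rewrite gl; lra.
have [b1 [b1l b1c]] := geo_backward s0 sg.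
have sg' : s < glen g by rewrite gl; lra.
have [f1 [f1l f1c]] := geo_forward (ltW s0) sg'.
have hb : exists2 b2 : geodesic (g s), glen b2 = s & gcurve b2 = (fun u => h (s - u)).
  have [||b2 [b2l b2c]] := @mk_geodesic R M (g s) s (fun u => h (s - u)) s0; last by exists b2.
    by rewrite subr0 -he /gend hs.
  by move=> a b a0 ab bs; rewrite metric_sym geo_isom ?hs; [ring|lra|lra|lra].
move: hb => [b2 b2l b2c].
have p1 : angle b1 f1 = pi.
  apply: (@angle_opp_pi _ _ _ _ _ (Num.min s 1)); first by rewrite lt_min s0 ltr01.
  move=> a b /andP[a0]; rewrite lt_min => /andP[as_ _] /andP[b0]; rewrite lt_min => /andP[_ b1'].
  by rewrite b1c f1c geo_isom ?gl; [ring|lra|lra|lra].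
have p2 : angle b2 f1 = pi.
  apply: (@angle_opp_pi _ _ _ _ _ (Num.min s 1)); first by rewrite lt_min s0 ltr01.
  move=> a b /andP[a0]; rewrite lt_min => /andP[as_ _] /andP[b0]; rewrite lt_min => /andP[_ b1'].
  rewrite b2c f1c; have h1 := metric_triangle p (h (s - a)) (g (s + b)).
  rewrite !geo_dist ?gl ?hs in h1; [|by apply/andP; split; lra..].
  have h2 := metric_triangle (h (s - a)) (g s) (g (s + b)).
  rewrite geo_isom ?gl in h2; [|lra|lra|lra].
  have h3 : mdist (h (s - a)) (g s) = a.
    by rewrite -he /gend hs geo_isom ?hs; [ring|lra|lra|lra].
  by apply/eqP; rewrite eq_le; apply/andP; split; lra.
have E : dir b1 = dir b2.
  by apply: (@antipode_unique _ _ _ (dir f1) (dir b1) (dir b2) c4); rewrite mdist_dir angleC.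
have b12 : angle b1 b2 = 0 by rewrite -mdist_dir E mdistxx.
rewrite -gx; apply: mdist0_eq; rewrite mdist_dir; apply: (angle0_of_agree c4 s0) => u /andP[u0 us].
have := geo_nonbranching c4 b12 (s := s - u); rewrite b1l b2l b1c b2c => H.
by have := H ltac:(lra) ltac:(lra) ltac:(lra); rewrite opprB addrC subrK.
Qed.

(** Joint continuity of the exponential map: geodesics of the common length [s0 + 1] converge, and
    the limit is identified by its direction. *)
Lemma ray_cont (xi : nat -> direction p) (l : nat -> R -> M) xi0 l0 (s : nat -> R) (s0 : R) :
  (forall n, ray_in (xi n) (l n)) -> ray_in xi0 l0 -> utends xi xi0 -> (forall n, 0 <= s n) -> 0 <= s0 ->
  s @ oou --> s0 -> utends (fun n => l n (s n)) (l0 s0).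
Proof.
move=> rl rl0 xx sn0 s00 ss; have L0 : 0 < s0 + 1 by lra.
have /choice[h hP] : forall n, exists h : geodesic p, [/\ glen h = s0 + 1, gcurve h = l n & dir h = xi n].
  by move=> n; exact: rl.
have [||g [gl hg gt]] := @cauchy_geodesics R M p h (fun n => mdist (xi n) xi0) (s0 + 1) pM c4 L0 _ _ xx.
- by move=> n; have [-> _ _] := hP n.
- move=> n m; rewrite -mdist_dir; have [_ _ ->] := hP n; have [_ _ ->] := hP m.
  by rewrite (metric_sym (xi m)); exact: metric_triangle.
have gx : dir g = xi0.
  apply: mdist0_eq; apply/eqP; rewrite eq_le mdist_ge0 andbT.
  have lim : (fun n => mdist (xi n) xi0 + mdist (xi n) xi0) @ oou --> (0 : R).
    by rewrite -[X in _ --> X]addr0; apply: cvgD.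
  apply: (ulim_le (@ulim_cst R _) lim); apply: oou_all => n /=.
  have := hg n; rewrite -mdist_dir; have [_ _ ->] := hP n => h1.
  by have := metric_triangle (dir g) (xi n) xi0; rewrite (metric_sym (dir g) (xi n)); lra.
have lE : l0 s0 = g s0 by apply/esym; apply: (ray_in_uniq c4 rl0 gx) => //; rewrite gl; lra.
have ds : (fun n => `|s n - s0|) @ oou --> (0 : R).
  have h1 : (fun n => s n - s0) @ oou --> (0 : R).
    by rewrite -[X in _ --> X](subrr s0); apply: cvgB => //; exact: ulim_cst.
  apply: ulim0 => e e0; apply: (oou_imply _ (ulim0P h1 e0)) => n /=.
  by rewrite normr_id.
have lim : (fun n => `|s n - s0| + mdist (h n s0) (g s0)) @ oou --> (0 : R).
  by rewrite -[X in _ --> X]addr0; apply: cvgD => //; apply: gt; lra.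
apply: (ulim_squeeze0 _ _ lim) => [n|]; first exact: mdist_ge0.
apply: oou_all => n /=; have [_ -> _] := hP n.
apply: le_trans (metric_triangle _ (l n s0) _) _; rewrite lE lerD2r.
have [h1|h1] := leP (s n) s0; first by rewrite (ray_in_isom (rl n)) // distrC ger0_norm ?subr_ge0.
by rewrite metric_sym (ray_in_isom (rl n) s00 (ltW h1)) gtr0_norm ?subr_gt0.
Qed.

Lemma sum_ulim m (F : 'I_m -> nat -> R) (l : 'I_m -> R) : (forall i, F i @ oou --> l i) ->
  (fun n => \sum_i F i n) @ oou --> \sum_i l i.
Proof.
elim: m F l => [|m IH] F l H.
  rewrite big_ord0 (_ : (fun n => _) = (fun=> 0)); first exact: ulim_cst.
  by apply/funext => n; rewrite big_ord0.
rewrite big_ord_recl (_ : (fun n => _) = (fun n => F ord0 n + \sum_i F (lift ord0 i) n)).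
  by apply: cvgD => //; exact: IH.
by apply/funext => n; rewrite big_ord_recl.
Qed.

Lemma dotv_ulim m (u v : nat -> 'rV[R]_m) (u0 v0 : 'rV[R]_m) :
  (forall i, (fun n => u n ord0 i) @ oou --> u0 ord0 i) ->
  (forall i, (fun n => v n ord0 i) @ oou --> v0 ord0 i) ->
  (fun n => dotv (u n) (v n)) @ oou --> dotv u0 v0.
Proof.
move=> hu hv; by apply: sum_ulim => i; apply: cvgM.
Qed.

Lemma dotv_sub m (u v : 'rV[R]_m) (i : 'I_m) :
  (u ord0 i - v ord0 i) ^+ 2 <= dotv u u + dotv v v - 2 * dotv u v.
Proof.
have -> : dotv u u + dotv v v - 2 * dotv u v = \sum_j (u ord0 j - v ord0 j) ^+ 2.
  rewrite /dotv mulr_sumr -sumrN -!big_split /=; apply: eq_bigr => j _; ring.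
by rewrite (bigD1 i) //= lerDl; apply: sumr_ge0 => j _; exact: sqr_ge0.
Qed.

(** Polar coordinates: every point lies on a ray from the pole, in a unique direction by
    [ray_through]. Continuity of the inverse of the exponential map follows from compactness of the
    space of directions. *)
Lemma exp_homeo m : allrays p -> half_sphere m.+1 (direction p) ->
  exists (f : M -> 'rV[R]_m.+1) (g : 'rV[R]_m.+1 -> M), homeomorphism [set: M] (half_space m.+1) f g.
Proof.
move=> aP [phi [hs cosE onto]].
have [||xi0 _] := onto (delta_mx ord0 ord_max); first by apply/half_space_ord_max; rewrite mxE !eqxx.
  rewrite /dotv (bigD1 ord_max) //= big1 ?addr0; first by rewrite mxE !eqxx mul1r.
  by move=> i /negPf iN; rewrite mxE eqxx iN mul0r.
have unit xi : dotv (phi xi) (phi xi) = 1 by rewrite -cosE mdistxx cos0.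
have inj xi eta : phi xi = phi eta -> xi = eta by move=> E; apply: (sph_cos1 sD); rewrite cosE E unit.
have /choice[ray rayP] := aP.
have /choice[dx dxP] : forall x, exists xi, x != p ->
    exists g : geodesic p, [/\ glen g = mdist p x, gend g = x & dir g = xi].
  move=> x; have [E|xp] := eqVneq x p; first by exists xi0.
  have [|g [gl ge]] := geodesic_ex pM (os_approx oM) (x := p) (y := x); first by rewrite eq_sym.
  by exists (dir g) => _; exists g.
pose nv (v : 'rV[R]_m.+1) := Num.sqrt (dotv v v).
have dv0 (v : 'rV[R]_m.+1) : 0 <= dotv v v by apply: sumr_ge0 => i _; rewrite -expr2 sqr_ge0.
have nv0 v : 0 <= nv v by exact: sqrtr_ge0.
have nvE v : nv v ^+ 2 = dotv v v by rewrite sqr_sqrtr.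
have nv_eq0 v : nv v = 0 -> v = 0 by move=> E; apply: dotv_eq0; rewrite -nvE E expr0n.
have /choice[ps psP] : forall v, exists xi, half_space m.+1 v -> v != 0 -> phi xi = (nv v)^-1 *: v.
  move=> v; have [hv|nh] := pselect (half_space m.+1 v); last by exists xi0.
  have [E|v0] := eqVneq v 0; first by exists xi0.
  have nz : nv v != 0 by apply: contraNN v0 => /eqP/nv_eq0/eqP.
  have [||xi E] := onto ((nv v)^-1 *: v); last by exists xi.
    apply/half_space_ord_max; rewrite mxE mulr_ge0 ?invr_ge0 //; exact/half_space_ord_max.
  by rewrite dotvZ -nvE; field.
pose f x := mdist p x *: phi (dx x); pose g v := ray (ps v) (nv v).
have pg v : mdist p (g v) = nv v by rewrite (ray_in_dist (rayP _)).
have ray_dx x : ray (dx x) (mdist p x) = x.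
  have [->|xp] := eqVneq x p; first by rewrite mdistxx (ray_in0 (rayP _)).
  have [h [hl he hx]] := dxP x xp; rewrite -hl -{2}he /gend.
  by apply/esym/(ray_in_uniq c4 (rayP _) hx) => //; exact/ltW/glen_gt0.
have dx_ray xi s : 0 < s -> dx (ray xi s) = xi.
  move=> s0; have ds := ray_in_dist (rayP xi) (ltW s0).
  have xp : ray xi s != p by rewrite eq_sym -mdist_gt0 ds.
  have [h [hl he <-]] := dxP _ xp; rewrite ds in hl.
  exact: (ray_through (rayP xi) hl he).
have phi_ulim (xn : nat -> direction p) xi : utends xn xi -> forall i, (fun n => phi (xn n) ord0 i) @ oou --> phi xi ord0 i.
  move=> xx i; apply: ulimP => e e0.
  have c1 : (fun n => 2 - 2 * cos (mdist (xn n) xi)) @ oou --> (0 : R).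
    rewrite [X in _ --> X](_ : 0 = 2 - 2 * cos 0); last by rewrite cos0; ring.
    by apply: cvgB; [exact: ulim_cst|apply: cvgM; [exact: ulim_cst|exact: cos_ulim]].
  have e20 : 0 < e ^+ 2 by rewrite exprn_gt0.
  apply: (oou_imply _ (ulim_lt c1 e20)) => n /= h.
  rewrite -(ltr_pXn2r (_ : 0 < 2)%N) ?nnegrE ?(ltW e0) // real_normK ?num_real //.
  by apply: le_lt_trans (dotv_sub _ _ i) _; rewrite !unit -cosE; lra.
exists f, g; split.
- apply: within_continuous_oou => x y _ _ xy e e0.
  have yx : utends y x.
    apply: utends_of => d d0; apply: (oou_imply _ (xy d d0)) => n /=.
    by rewrite ballEmdist /= metric_sym.
  have [xi dxi] := tbounded_utends (@direction_complete R M p) (sph_tbounded sD)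
    (oou_all (fun n => I : [set: direction p] (dx (y n)))).
  have lim0 : (fun n => mdist p (y n)) @ oou --> mdist p x by exact: utends_mdist (utends_cst p) yx.
  (* The directions of the [y n] have a limit [xi]. Away from [p], continuity of the exponential map
     shows that the ray of [xi] leads to [x], so [xi] is the direction of [x]; at [p] the factor is
     0. *)
  have fx : mdist p x *: phi xi = f x.
    have [->|xp] := eqVneq x p; first by rewrite /f mdistxx !scale0r.
    rewrite /f; congr (_ *: phi _); have x0 : 0 < mdist p x by rewrite mdist_gt0 eq_sym.
    have := ray_cont (fun n => rayP (dx (y n))) (rayP xi) dxi (fun n => mdist_ge0 p (y n)) (ltW x0) lim0.
    have -> : (fun n => ray (dx (y n)) (mdist p (y n))) = y by apply/funext => n; exact: ray_dx.
    by move=> /(utends_uniq yx) ->; rewrite dx_ray.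
  have lim i : (fun n => f (y n) ord0 i) @ oou --> f x ord0 i.
    rewrite -fx mxE; rewrite (_ : (fun n => _) = (fun n => mdist p (y n) * phi (dx (y n)) ord0 i)).
      by apply: cvgM => //; exact: phi_ulim.
    by apply/funext => n; rewrite mxE.
  have ev i : oou [set n | `|f x ord0 i - f (y n) ord0 i| < e].
    have l0 : (fun n => f x ord0 i - f (y n) ord0 i) @ oou --> (0 : R).
      by rewrite -[X in _ --> X](subrr (f x ord0 i)); apply: cvgB => //; exact: ulim_cst.
    exact: ulim0P l0 e0.
  have ev' : oou [set n | forall i, `|f x ord0 i - f (y n) ord0 i| < e] by exact: filter_forall.
  apply: (oou_imply _ ev') => n /= H.
  by split=> // i j; rewrite (ord1 i) -ball_normE /=.
- apply: within_continuous_oou => v w hv hw vw e e0.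
  have wl i : (fun n => w n ord0 i) @ oou --> v ord0 i.
    apply: ulimP => d d0; apply: (oou_imply _ (vw d d0)) => n /= [_ /(_ ord0 i)].
    by rewrite -ball_normE /= distrC.
  have dl := dotv_ulim wl wl.
  have nl : (fun n => nv (w n)) @ oou --> nv v by apply: (continuous_ulim _ dl); exact: sqrt_continuous.
  suff gl : utends (fun n => g (w n)) (g v).
    by apply: (oou_imply _ (utendsP gl e0)) => n /=; rewrite ballEmdist /= metric_sym.
  have [v0|v0] := eqVneq v 0.
    have nv00 : nv v = 0 by rewrite v0 /nv /dotv big1 ?sqrtr0 // => i _; rewrite mxE mul0r.
    rewrite nv00 in nl; have -> : g v = p by rewrite /g nv00 (ray_in0 (rayP _)).
    apply: (ulim_eq _ nl); apply: oou_all => n /=.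
    by rewrite metric_sym pg.
  have nz : 0 < nv v by rewrite lt_neqAle nv0 andbT eq_sym; apply: contraNN v0 => /eqP/nv_eq0/eqP.
  apply: (ray_cont (fun n => rayP (ps (w n))) (rayP (ps v)) _ (fun n => nv0 (w n)) (nv0 v) nl).
  have nw : oou [set n | 0 < nv (w n)] := ulim_gt nl nz.
  have E : oou [set n | dotv (w n) v / (nv (w n) * nv v) = cos (mdist (ps (w n)) (ps v))].
    apply: (oou_imply _ nw) => n /= wn0.
    have w0 : w n != 0.
      by apply/eqP => E; move: wn0; rewrite E /nv /dotv big1 ?sqrtr0 ?ltxx // => i _; rewrite mxE mul0r.
    by rewrite cosE (psP _ (hw n) w0) (psP _ hv v0) dotvZ invfM mulrC.
  have vl i : (fun _ : nat => v ord0 i) @ oou --> v ord0 i by exact: ulim_cst.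
  have cl : (fun n => dotv (w n) v / (nv (w n) * nv v)) @ oou --> (1 : R).
    rewrite [X in _ --> X](_ : 1 = dotv v v / (nv v * nv v)); last by rewrite -expr2 nvE divff // -nvE expf_neq0 // gt_eqF.
    apply: cvgM; first exact: dotv_ulim wl vl.
    apply: cvgV; first by rewrite mulf_neq0 // gt_eqF.
    by apply: cvgM => //; exact: ulim_cst.
  have := acos_ulim _ _ (ulim_eq E cl); rewrite acos1 => H.
  rewrite /utends (_ : (fun n => _) = (fun n => acos (cos (mdist (ps (w n)) (ps v))))).
    apply: H; last by rewrite lexx lerN10 || (apply/andP; split; lra).
    by apply: oou_all => n /=; rewrite cos_geN1 cos_le1.
  by apply/funext => n; rewrite (sph_cosK sD).
- move=> x _; have hf : half_space m.+1 (f x).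
    apply/half_space_ord_max; rewrite mxE mulr_ge0 ?mdist_ge0 //; exact/half_space_ord_max.
  split=> //; have nf : nv (f x) = mdist p x.
    by rewrite /nv dotvZ unit mulr1 -expr2 sqrtr_sqr ger0_norm ?mdist_ge0.
  rewrite /g nf; have [->|xp] := eqVneq x p; first by rewrite mdistxx (ray_in0 (rayP _)).
  have x0 : 0 < mdist p x by rewrite mdist_gt0 eq_sym.
  have fn0 : f x != 0.
    by apply/eqP => E; move: nf; rewrite E /nv /dotv big1 ?sqrtr0 => [h|i _]; [lra|rewrite mxE mul0r].
  rewrite (_ : ps (f x) = dx x) ?ray_dx //; apply: inj.
  by rewrite (psP _ hf fn0) nf scalerA mulVf ?scale1r // gt_eqF.
- move=> v hv; split=> //; rewrite /f pg; have [v0|v0] := eqVneq v 0.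
    by rewrite v0 /nv /dotv big1 ?sqrtr0 ?scale0r // => i _; rewrite mxE mul0r.
  have nz : 0 < nv v by rewrite lt_neqAle nv0 andbT eq_sym; apply: contraNN v0 => /eqP/nv_eq0/eqP.
  by rewrite /g dx_ray // psP // scalerA divff ?scale1r // gt_eqF.
Qed.

End Exponential.

Section BoundaryPoints.
Context {R : realType} {M : metricType R} (oM : onesided M).

(** If all directions at [p] had opposites, [extprop] would be immediate and would make
    [direction p] a half sphere, whose center has none. So [p] is a pole, and then [extprop] holds
    there as well. *)
Lemma boundary_pole n (p : M) : boundary n.+1 M p -> allrays p /\ half_sphere n.+1 (direction p).
Proof.
have sD := direction_spherical (os_alexl oM) (p := p).
have pole : ~ allanti (direction p) -> allrays p.
  by move=> na; apply: contrapT => nr; apply: na; exact: nonray_allanti oM _ nr.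
case: n => [|n] bp.
  have [xi0 H] := chart_single (os_alexl oM) bp; have hs := half_sphere1 H.
  by split=> //; apply: pole; exact: half_sphere_not_allanti hs.
have na : ~ allanti (direction p).
  move=> aD; exact: (half_sphere_not_allanti (half_sphere_of_boundary sD (allanti_extprop sD aD) bp) aD).
have aP := pole na; split=> //; apply: half_sphere_of_boundary => //.
exact: extprop_allrays.
Qed.

End BoundaryPoints.

(** * Rigidity of half spheres *)

Section Vectors.
Context {R : realType}.

Definition sqd m (u v : 'rV[R]_m) : R := dotv (u - v) (u - v).

Lemma dotvC m (u v : 'rV[R]_m) : dotv u v = dotv v u.
Proof. by rewrite /dotv; apply: eq_bigr => i _; rewrite mulrC. Qed.

Lemma dotv_ge0 m (u : 'rV[R]_m) : 0 <= dotv u u.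
Proof. by apply: sumr_ge0 => i _; rewrite -expr2 sqr_ge0. Qed.

Lemma sqdE m (u v : 'rV[R]_m) : sqd u v = dotv u u + dotv v v - 2 * dotv u v.
Proof.
rewrite /sqd /dotv mulr_sumr -sumrN -!big_split /=; apply: eq_bigr => j _.
by rewrite !mxE; ring.
Qed.

Lemma sqdC m (u v : 'rV[R]_m) : sqd u v = sqd v u.
Proof. by rewrite !sqdE (dotvC u v); ring. Qed.

Lemma dotvDr m (u v w : 'rV[R]_m) : dotv u (v + w) = dotv u v + dotv u w.
Proof. by rewrite /dotv -big_split /=; apply: eq_bigr => j _; rewrite mxE; ring. Qed.

Lemma dotvZr m a (u v : 'rV[R]_m) : dotv u (a *: v) = a * dotv u v.
Proof. by rewrite /dotv mulr_sumr; apply: eq_bigr => j _; rewrite mxE; ring. Qed.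

Lemma dotv_delta m (u : 'rV[R]_m) i : dotv u (delta_mx ord0 i) = u ord0 i.
Proof.
rewrite /dotv (bigD1 i) //= big1 ?addr0; first by rewrite mxE !eqxx mulr1.
by move=> j /negPf ji; rewrite mxE eqxx ji mulr0.
Qed.

(** In [mid_contra] the second term is small while the first is about half of the bound to be
    contradicted: any first factor below 2 serves. *)
Lemma sqd_trans m (u v w : 'rV[R]_m) : sqd u w <= 3 / 2 * sqd u v + 3 * sqd v w.
Proof.
rewrite /sqd /dotv !mulr_sumr -big_split /=; apply: ler_sum => i _; rewrite !mxE.
move: (u _ _) (v _ _) (w _ _) => x y z; have := sqr_ge0 ((x - y) - 2 * (y - z)); nra.
Qed.

(* By diagonal dominance, almost orthonormal vectors are linearly independent. *)
Lemma gram_bound N d (w : 'I_N -> 'rV[R]_d) c : 0 <= c ->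
  (forall i, N%:R * c < dotv (w i) (w i)) -> (forall i j, i != j -> `|dotv (w i) (w j)| <= c) -> (N <= d)%N.
Proof.
move=> c0 wi wij; rewrite leqNgt; apply/negP => dN.
pose W := \matrix_(i < N) w i.
have /rowV0Pn[x xW x0] : kermx W != 0.
  by rewrite kermx_eq0 /row_free; apply/negP => /eqP rk; have := rank_leq_col W; rewrite rk leqNgt dN.
have xW0 : x *m W = 0 by apply/sub_kermxP.
have [i1 xi1] : exists i, x ord0 i != 0.
  apply: contrapT => /forallNP H; case/eqP: x0; apply/rowP => i; rewrite mxE.
  by apply/eqP; apply: contrapT => /negP h; exact: (H i).
pose i0 := [arg max_(i > i1) `|x ord0 i|]%O.
have mx i : `|x ord0 i| <= `|x ord0 i0|.
  by rewrite /i0; case: (@Order.TotalTheory.arg_maxP _ _ _ i1 xpredT (fun i => `|x ord0 i|)) => // j _ H; exact: H.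
have p0 : 0 < `|x ord0 i0| by apply: lt_le_trans (mx i1); rewrite normr_gt0.
have E : \sum_j x ord0 j * dotv (w j) (w i0) = 0.
  transitivity (dotv (x *m W) (w i0)); last by rewrite xW0 /dotv big1 // => l _; rewrite mxE mul0r.
  rewrite /dotv; under eq_bigr do rewrite mulr_sumr.
  rewrite exchange_big /=; apply: eq_bigr => l _; rewrite mxE mulr_suml.
  by apply: eq_bigr => j _; rewrite mxE mulrA.
have : `|x ord0 i0| * dotv (w i0) (w i0) <= `|x ord0 i0| * (N%:R * c).
  move: E; rewrite (bigD1 i0) //= => /eqP; rewrite addr_eq0 => /eqP E.
  rewrite -[X in _ * X <= _]ger0_norm ?dotv_ge0 // -normrM E normrN.
  apply: le_trans (ler_norm_sum _ _ _) _.
  apply: le_trans (_ : \sum_(j < N | j != i0) `|x ord0 i0| * c <= _).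
    by apply: ler_sum => j ji; rewrite normrM; apply: ler_pM => //; exact: wij.
  apply: le_trans (_ : \sum_(j < N) `|x ord0 i0| * c <= _); last first.
    by rewrite sumr_const card_ord -[leLHS]mulr_natl mulrCA.
  by rewrite [leRHS](bigID (fun j => j != i0)) /= lerDl; apply: sumr_ge0 => j _; rewrite mulr_ge0.
by rewrite ler_pM2l // leNgt wi.
Qed.

Lemma polar (u v : R) : 0 < u -> 0 < v -> exists r t, [/\ 0 < r, 0 < t, t < pi / 2, u = r * cos t & v = r * sin t].
Proof.
move=> u0 v0; pose r := Num.sqrt (u ^+ 2 + v ^+ 2).
have uv : 0 < u ^+ 2 + v ^+ 2 by rewrite addr_gt0 // exprn_gt0.
have r0 : 0 < r by rewrite sqrtr_gt0.
have r2 : r ^+ 2 = u ^+ 2 + v ^+ 2 by rewrite sqr_sqrtr // ltW.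
have ur : u < r by rewrite -(ltr_pXn2r (_ : 0 < 2)%N) ?nnegrE ?ltW // r2 ltrDl exprn_gt0.
have I : -1 <= u / r <= 1.
  rewrite ler_pdivlMr // ler_pdivrMr // mul1r (ltW ur) andbT mulN1r.
  by apply: le_trans (ltW u0); rewrite oppr_le0 ltW.
have c0 := acosK' I; have /andP[t0 tpi] := acos_itv I; set t := acos (u / r) in c0 t0 tpi.
have ur1 : u / r < 1 by rewrite ltr_pdivrMr // mul1r.
have tn : t != 0 by apply/eqP => E; move: c0; rewrite E cos0; lra.
have t0' : 0 < t by rewrite lt_neqAle eq_sym tn.
have t2 : t < pi / 2.
  rewrite ltNge; apply/negP => h; have := cos_ler _ h tpi; rewrite cos_pihalf c0.
  have p0 : 0 < u / r by rewrite divr_gt0.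
  have h0 : 0 <= pi / 2 :> R by rewrite divr_ge0 // pi_ge0.
  by move=> /(_ h0) h1; lra.
have s0 : 0 < sin t by apply: sin_gt0_pi; rewrite t0' /=; have := @pi_gt0 R; lra.
exists r, t; split=> //; first by rewrite c0 mulrC divfK // gt_eqF.
apply/eqP; rewrite -(@eqrXn2 _ 2) ?mulr_ge0 ?ltW //; apply/eqP.
rewrite exprMn; have := cos2Dsin2 t; rewrite c0 expr_div_n => E.
have : r ^+ 2 * (u ^+ 2 / r ^+ 2 + sin t ^+ 2) = r ^+ 2 by rewrite E mulr1.
by rewrite mulrDr mulrC divfK ?expf_neq0 ?gt_eqF // {2}r2 => /addrI.
Qed.

Lemma lt_of_sin (t c : R) : t < pi / 2 -> 0 <= t -> 0 <= c -> c <= pi / 2 -> sin t < sin c -> t < c.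
Proof.
move=> t2 t0 c0 c2 sc; rewrite ltNge; apply/negP => ct; have pi0 := @pi_gt0 R.
have := @cos_ler R (pi / 2 - t) (pi / 2 - c); rewrite !cos_pihalfB => H.
by have := H ltac:(lra) ltac:(lra) ltac:(lra); lra.
Qed.

End Vectors.

(** The gap at [x] rules out the alternative beyond [z], since it would end almost opposite to
    [x]. *)
Lemma gap_extend {R : realType} (X : metricType R) (x y z : X) (d s u v : R) : extprop X ->
  (forall w, mdist x w <= pi - d) -> mdist x y = s -> 0 < s -> mdist y z = u -> 0 < u ->
  mdist x z = s + u -> 0 < v -> 2 * s + v < d -> s + u + v < pi ->
  exists x', mdist x x' = v /\ mdist y x' = s + v.
Proof.
move=> eX xd xy s0 yz u0 xz v0 svd sup.
have [||||||||[x' [yx' xx']]|[z' [yz' zz']]] := eX x y z s u (s + v); rewrite //.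
- lra.
- lra.
- lra.
- by exists x'; split=> //; rewrite xx'; ring.
- have := xd z'; have := metric_triangle y x z'; rewrite yz' (metric_sym y x) xy; lra.
Qed.

Lemma not_allanti_arith {R : realType} (k A : R) : 0 <= k -> k <= 1 / 100 -> 1 <= (1 + k) * A ->
  4 * A <= (1 + k) * (1 + (1 + k) * A) -> False.
Proof. 
move=> k0 k1 h1 h4; have A0 : 0 < A by rewrite -(pmulr_rgt0 _ (_ : 0 < 1 + k)); lra.
have h5 : k * A <= 1 / 100 * A by rewrite ler_pM2r.
have h6 : k * (k * A) <= 1 / 100 * (k * A) by rewrite ler_wpM2r // mulr_ge0 // ltW.
lra.
 Qed.

Lemma mid_arith {R : realType} (k D T : R) : 0 <= k -> k <= 1 / 100 -> 0 < D -> D <= (1 + k) * T ->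
  D <= (1 + k) * (9 / 8 * ((1 + k) * D) - 3 / 8 * T) -> False.
Proof.
move=> k0 k1 D0 h1 h2; have h3 : D * 1 <= D * (9 / 8 * (1 + k) ^+ 2 - 3 / 8) by lra.
by move: h3; rewrite ler_pM2l // => h; nra.
Qed.

(* In the flat cone over the triangle with vertices [xi], [al] and the apex: the middle of the segment
   between two points and its mirror image in one of the points. *)
Lemma mirror_points {R : realType} {M : metricType R} (p : M) (xi al : direction p) (a a2 d c : R)
  (D := cd2 a a2 xi al) : spherical (direction p) -> extprop (direction p) ->
  (forall y, mdist xi y <= pi - d) -> 0 < a -> 0 <= a2 -> 0 < c -> c <= d / 4 -> c <= pi / 4 ->
  D <= (a * sin c / 4) ^+ 2 ->
  exists y ry b rb, [/\ 0 <= ry /\ 0 <= rb, cd2 ry a y xi = D / 4 /\ cd2 ry a2 y al = D / 4 &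
    cd2 rb a b xi = D / 4 /\ cd2 rb ry b y = D].
Proof.
move=> sD eX dP a0' a20 c0 cd cp Da; have pi0 := @pi_gt0 R.
have a0 := ltW a0'; have sc1 := sin_le1 c.
have sc0 : 0 < sin c by apply: sin_gt0_pi; rewrite c0 /=; lra.
have th0 := mdist_ge0 xi al.
have [E|E] := eqVneq (mdist xi al) 0.
  have Ea := mdist0_eq E; have DE : D = (a - a2) ^+ 2.
    by rewrite /D /cd2 E cos0; ring.
  have h : `|a - a2| <= a * sin c / 4.
    by rewrite -ler_sqr ?nnegrE ?divr_ge0 ?mulr_ge0 ?(ltW sc0) // real_normK ?num_real // -DE.
  have h2 : a * sin c / 4 <= a / 4 by rewrite ler_pM2r ?invr_gt0 // ler_piMr.
  move: h; rewrite ler_norml => /andP[h3 h4].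
  exists xi, ((a + a2) / 2), xi, (a + (a - a2) / 2).
  rewrite /cd2 -Ea !mdistxx cos0 DE; split; first by split; lra.
    by split; field.
  by split; field.
have thp : 0 < mdist xi al by rewrite lt_neqAle eq_sym E.
have th_pi : mdist xi al < pi by apply: le_lt_trans (dP al) _; lra.
set th := mdist xi al in th0 E thp th_pi *.
have sth : 0 < sin th by apply: sin_gt0_pi; rewrite thp.
have DE : D = (a2 * cos th - a) ^+ 2 + (a2 * sin th) ^+ 2.
  have := cos2Dsin2 th => e; rewrite /D /cd2 -/th exprMn.
  have -> : sin th ^+ 2 = 1 - cos th ^+ 2 by lra.
  by ring.
have asc : 0 <= a * sin c / 4 by rewrite divr_ge0 // mulr_ge0 // ltW.
have asc' : a * sin c <= a by rewrite ler_piMr.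
have u1 : `|a2 * cos th - a| <= a * sin c / 4.
  rewrite -ler_sqr ?nnegrE // real_normK ?num_real //; apply: le_trans Da.
  by rewrite DE lerDl sqr_ge0.
have v1 : `|a2 * sin th| <= a * sin c / 4.
  rewrite -ler_sqr ?nnegrE // real_normK ?num_real //; apply: le_trans Da.
  by rewrite DE lerDr sqr_ge0.
move: u1 v1; rewrite !ler_norml => /andP[u1 u2] /andP[_ v2].
have a2p : 0 < a2.
  rewrite lt_neqAle a20 andbT eq_sym; apply/eqP => E2; rewrite E2 mul0r in u1; lra.
have vp : 0 < a2 * sin th by rewrite mulr_gt0.
have cth : 0 < cos th by rewrite -(pmulr_rgt0 _ a2p); lra.
have th2 : th < pi / 2.
  rewrite ltNge; apply/negP => h; have := cos_ler _ h (ltW th_pi); rewrite cos_pihalf.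
  by have h0 : 0 <= pi / 2 :> R by [rewrite divr_ge0 // ltW]; move=> /(_ h0); lra.
have thc : th < c.
  apply: lt_of_sin => //; [exact: ltW|lra|].
  rewrite -(ltr_pM2l a2p); apply: le_lt_trans v2 _.
  apply: lt_le_trans (_ : (a * (3 / 4)) * sin c <= _); first by have := mulr_gt0 a0' sc0; lra.
  rewrite ler_pM2r //; have := cos_le1 th => c1.
  by have : a2 * cos th <= a2 by [rewrite ler_piMr]; lra.
(* With the first axis along [xi], the middle [y] is [(a + a2 cos th, a2 sin th) / 2], and its
   mirror image [b] in [(a, 0)] lies on the other side of the axis. Their polar angles are [s] and
   [- ps], so [b] is found by prolonging a geodesic beyond [xi] with [gap_extend]. *)
have [ry [s [ry0 s0 s2 Ec Es]]] := @polar R ((a + a2 * cos th) / 2) (a2 * sin th / 2) ltac:(lrao u1 a0' asc') ltac:(lrao vp).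
have [rb [ps [rb0 ps0 ps2 Fc Fs]]] := @polar R (a + (a - a2 * cos th) / 2) (a2 * sin th / 2) ltac:(lrao u2 asc' a0') ltac:(lrao vp).
have sth' : s < th.
  rewrite ltNge; apply/negP => h.
  have : 0 <= sin (s - th) by apply: sin_ge0_pi; apply/andP; split; [lrao h|lrao s2 th0 pi0].
  rewrite sinB -(pmulr_rge0 _ ry0) mulrBr !mulrA -Ec -Es => h1.
  have := mulr_gt0 a0' sth; lra.
have psc : ps < c.
  apply: lt_of_sin => //; [exact: ltW|exact: ltW|lra|].
  rewrite -(ltr_pM2l rb0) -Fs; apply: lt_le_trans (_ : (rb * cos ps) * sin c <= _).
    rewrite -Fc; apply: lt_le_trans (_ : (a * (3 / 4)) * sin c <= _); first by have := mulr_gt0 a0' sc0; lra.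
    by rewrite ler_pM2r //; lra.
  by rewrite ler_pM2r // ler_piMr ?cos_le1 // ltW.
have [||||y [xy yal]] := @sph_between _ _ sD xi al s (th - s); [lrao s0|lrao sth'|rewrite -/th; ring|lrao th_pi|].
have [|||||b [xb yb]] := @gap_extend R _ xi y al d s (th - s) ps eX dP xy s0 yal; rewrite -/th; [lrao sth'|ring|by []|lrao sth' thc psc cd c0|lrao thc psc cp pi0|].
exists y, ry, b, rb; split; first by rewrite !ltW.
- have cs2 := cos2Dsin2 s; have cth2 := cos2Dsin2 th.
  have r2 : ry ^+ 2 = ((a + a2 * cos th) / 2) ^+ 2 + (a2 * sin th / 2) ^+ 2.
    by rewrite Ec Es !exprMn -mulrDr cs2 mulr1.
  have sE : sin th ^+ 2 = 1 - cos th ^+ 2 by lra.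
  rewrite /cd2 (metric_sym y xi) xy yal DE; split.
    rewrite (_ : 2 * ry * a * cos s = 2 * a * (ry * cos s)); last by ring.
    by rewrite -Ec r2; field.
  rewrite cosB (_ : 2 * ry * a2 * _ = 2 * a2 * ((ry * cos s) * cos th + (ry * sin s) * sin th)); last by ring.
  rewrite -Ec -Es r2; move: (cos th) (sin th) sE => C S sE.
  rewrite [LHS](_ : _ = ((a2 * C - a) ^+ 2 + (a2 * S) ^+ 2) / 4 + a2 ^+ 2 * (1 - C ^+ 2 - S ^+ 2)); last by field.
  by rewrite sE; ring.
- have cs2 := cos2Dsin2 ps; have cs1 := cos2Dsin2 s.
  have r2 : rb ^+ 2 = (a + (a - a2 * cos th) / 2) ^+ 2 + (a2 * sin th / 2) ^+ 2.
    by rewrite Fc Fs !exprMn -mulrDr cs2 mulr1.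
  have r1 : ry ^+ 2 = ((a + a2 * cos th) / 2) ^+ 2 + (a2 * sin th / 2) ^+ 2.
    by rewrite Ec Es !exprMn -mulrDr cs1 mulr1.
  rewrite /cd2 (metric_sym b xi) xb (metric_sym b y) yb DE; split.
    rewrite (_ : 2 * rb * a * cos ps = 2 * a * (rb * cos ps)); last by ring.
    by rewrite -Fc r2; field.
  rewrite cosD (_ : 2 * rb * ry * _ = 2 * ((ry * cos s) * (rb * cos ps) - (ry * sin s) * (rb * sin ps))); last by ring.
  by rewrite -Ec -Es -Fc -Fs r1 r2; field.
Qed.

Section Rigidity.
Context {R : realType} {M : metricType R} (aM : alexl M) {p : M} {m : nat}.
Implicit Types (xi eta : direction p) (v w : 'rV[R]_m.+1).

(* The half space and the cone over the directions at p correspond to each other with little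
   distortion: squared distances are comparable up to the factor q. *)
Record quasi_half (q : R) (rel : 'rV[R]_m.+1 -> R -> direction p -> Prop) : Prop := QuasiHalf {
  qh_l : forall v, half_space m.+1 v -> exists a xi, 0 <= a /\ rel v a xi ;
  qh_r : forall a xi, 0 <= a -> exists v, half_space m.+1 v /\ rel v a xi ;
  qh_dist : forall v w a b xi eta, 0 <= a -> 0 <= b -> rel v a xi -> rel w b eta ->
    cd2 a b xi eta <= q * sqd v w /\ sqd v w <= q * cd2 a b xi eta ;
  qh_norm : forall v a xi, 0 <= a -> rel v a xi -> a ^+ 2 <= q * dotv v v /\ dotv v v <= q * a ^+ 2 }.

Context {k : R} {rel : 'rV[R]_m.+1 -> R -> direction p -> Prop} (Q : quasi_half (1 + k) rel)
  (k0 : 0 <= k) (k1 : k * m.+1%:R <= 1 / 100).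

Let sD := direction_spherical aM (p := p).
Let e_ i : 'rV[R]_m.+1 := delta_mx ord0 i.
Let k100 : k <= 1 / 100.
Proof. by apply: le_trans k1; rewrite ler_peMr // ler1n. Qed.

Let kk : k * k <= k / 100.
Proof. by have := ler_wpM2r k0 k100; lra. Qed.

Let q_lower (c A : R) : 0 <= c -> c <= (1 + k) * A -> c * (1 - k) <= A.
Proof.
have K0 := k0; have K100 := k100; have KK := kk.
move=> c0 cA; have kp : 0 < 1 + k by lra.
rewrite -(ler_pM2l kp); apply: le_trans cA.
have -> : (1 + k) * (c * (1 - k)) = c - c * (k * k) by ring.
by rewrite gerBl mulr_ge0 // mulr_ge0.
Qed.

Let e_half i : half_space m.+1 (e_ i).
Proof. by apply/half_space_ord_max; rewrite mxE; case: eqP => //=; case: eqP. Qed.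

Let dot_e i j : dotv (e_ i) (e_ j) = (i == j)%:R.
Proof. by rewrite dotv_delta mxE eqxx eq_sym. Qed.

(** Take the direction matched with the last basis vector. A point opposite to it in the cone, at
    the same height, would have squared distance 4 from it, but in the half space vectors of about
    unit length stay within about 2. *)
Lemma quasi_half_not_allanti : ~ allanti (direction p).
Proof.
have K0 := k0; have K100 := k100; have KK := kk.
move=> aD; have [a [xi [a0 r]]] := qh_l Q (e_half ord_max).
have [eta xe] := aD xi; have [w [hw rw]] := qh_r Q eta a0.
have [_ h1] := qh_norm Q a0 r; have [_ h2] := qh_norm Q a0 rw.
have [h3 _] := qh_dist Q a0 a0 r rw; rewrite /cd2 xe cospi sqdE dot_e eqxx (dotvC (e_ _) w) dotv_delta /= in h3.
rewrite dot_e eqxx /= in h1; move/half_space_ord_max : hw => hw.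
have h4 : 4 * a ^+ 2 <= (1 + k) * (1 + (1 + k) * a ^+ 2).
  apply: le_trans (_ : (1 + k) * (1 + dotv w w - 2 * w ord0 ord_max) <= _); first by lra.
  by rewrite ler_pM2l; lra.
exact: not_allanti_arith k0 k100 h1 h4.
Qed.

(** [y] is close to the middle [c] of a vertical segment that starts at [z] in the wall. A point [b]
    above the wall, about as far from [z] as [y], has squared distance at most about [D / 2] from
    [c], while a mirror image of [y] in [z] is at squared distance [D] from [y]. *)
Let mid_contra (z y b : 'rV[R]_m.+1) (t D : R) : z ord0 ord_max = 0 -> 0 <= b ord0 ord_max ->
  0 < t -> t ^+ 2 <= (1 + k) * D -> D <= (1 + k) * t ^+ 2 -> sqd y z <= (1 + k) * (D / 4) ->
  sqd y (z + t *: e_ ord_max) <= (1 + k) * (D / 4) -> sqd b z <= (1 + k) * (D / 4) -> D <= (1 + k) * sqd b y -> False.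
Proof.
have K0 := k0; have K100 := k100; have KK := kk.
move=> z0 b0 t0 tD Dt yz yA bz by_.
pose c := z + (t / 2) *: e_ ord_max.
have E (u : 'rV[R]_m.+1) s : sqd u (z + s *: e_ ord_max) = sqd u z - 2 * s * (u ord0 ord_max) + s ^+ 2.
  rewrite !sqdE !dotvDr !dotvZr (dotvC (z + _) z) (dotvC (z + _) (e_ _)).
  by rewrite !dotvDr !dotvZr dot_e eqxx (dotvC (e_ _) z) !dotv_delta z0 /=; ring.
have cy : sqd c y = (sqd y z + sqd y (z + t *: e_ ord_max)) / 2 - t ^+ 2 / 4.
  by rewrite sqdC !E; field.
have cb : sqd b c <= sqd b z + t ^+ 2 / 4.
  by rewrite E; have := mulr_ge0 (ltW t0) b0; lra.
have := sqd_trans b c y; have t20 : 0 < t ^+ 2 by rewrite exprn_gt0.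
move: (sqd b y) (sqd b c) (sqd c y) (sqd y z) (sqd y (z + t *: e_ ord_max)) (sqd b z) cy cb yz yA bz by_ => s1 s2 s3 s4 s5 s6.
move: (t ^+ 2) tD Dt t20 => T tD Dt T0 cy cb yz yA bz by_ h.
have q0 : 0 < (1 + k) by lra.
have h1 : s1 <= (9 / 2 * (1 + k) * (D / 4) + 3 / 2 * (T / 4)) - 3 * T / 4.
  by lra.
have h2 : D <= (1 + k) * (9 / 8 * ((1 + k) * D) - 3 / 8 * T).
  by apply: le_trans by_ _; rewrite ler_pM2l //; lra.
have D0 : 0 < D by nra.
exact: mid_arith k0 k100 D0 Dt h2.
Qed.

(** [e_ i] lies in the wall of the half space. Without an antipode, [xi] would be a point beyond
    which geodesics extend, and so mirror images in it would exist. *)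
Lemma quasi_half_anti i a xi : i != ord_max -> extprop (direction p) -> 0 <= a -> rel (e_ i) a xi ->
  exists eta, mdist xi eta = pi.
Proof.
have K0 := k0; have K100 := k100; have KK := kk.
move=> im eX a0 r; apply: contrapT => /forallNP nx; have pi0 := @pi_gt0 R.
have [d d0 dP] := gap sD nx.
have [n1 n2] := qh_norm Q a0 r; rewrite dot_e eqxx /= mulr1 in n1 n2.
have a0' : 0 < a.
  by rewrite lt_neqAle a0 andbT eq_sym; apply/eqP => E; rewrite E expr0n /= mulr0 ler10 in n2.
pose c := Num.min (d / 4) (pi / 4); have c0 : 0 < c by rewrite lt_min !divr_gt0.
have [cd cp] : c <= d / 4 /\ c <= pi / 4 by rewrite /c !ge_min !lexx orbT.
have sc0 : 0 < sin c by apply: sin_gt0_pi; rewrite c0 /=; lra.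
have sc1 := sin_le1 c.
(* Small enough for [mirror_points]: the distortion is below 4, so [D <= (2 * t) ^+ 2]. *)
pose t := a * sin c / 8; have t0 : 0 < t by rewrite divr_gt0 // mulr_gt0.
have zmax : e_ i ord0 ord_max = 0 by rewrite mxE eqxx /= eq_sym (negPf im).
have [|a2 [al [a20 ral]]] := qh_l Q (_ : half_space m.+1 (e_ i + t *: e_ ord_max)).
  by apply/half_space_ord_max; rewrite !mxE !eqxx /= (eq_sym _ i) (negPf im) add0r mulr1 ltW.
have [D1 D2] := qh_dist Q a0 a20 r ral.
have E0 : sqd (e_ i) (e_ i + t *: e_ ord_max) = t ^+ 2.
  rewrite /sqd opprD addNKr -scaleNr dotvZ dot_e eqxx /=; ring.
rewrite E0 in D1 D2; set D := cd2 a a2 xi al in D1 D2.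
(* y is the middle of the images of e_i and of e_i + t e_n, and b its mirror image in the former;
   in R^n the corresponding point would lie outside the half space. *)
suff [y [ry [b [rb [[ry0 rb0] [H1 H2] [H3 H4]]]]]] : exists y ry b rb, [/\ 0 <= ry /\ 0 <= rb,
    cd2 ry a y xi = D / 4 /\ cd2 ry a2 y al = D / 4 & cd2 rb a b xi = D / 4 /\ cd2 rb ry b y = D].
  have [vy [_ ry']] := qh_r Q y ry0; have [vb [hb rb']] := qh_r Q b rb0.
  have [_ y1] := qh_dist Q ry0 a0 ry' r; have [_ y2] := qh_dist Q ry0 a20 ry' ral.
  have [_ b1] := qh_dist Q rb0 a0 rb' r; have [b2 _] := qh_dist Q rb0 ry0 rb' ry'.
  rewrite H1 in y1; rewrite H2 in y2; rewrite H3 in b1; rewrite H4 in b2.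
  by apply: (mid_contra zmax _ t0 D2 D1 y1 y2 b1 b2); apply/half_space_ord_max.
have t20 : 0 < t ^+ 2 by rewrite exprn_gt0.
have Da : D <= (a * sin c / 4) ^+ 2.
  have -> : a * sin c / 4 = 2 * t by rewrite /t; field.
  by rewrite exprMn; apply: le_trans D1 _; rewrite ler_pM2r // expr2; lra.
exact: (mirror_points sD eX dP a0' a20 c0 cd cp Da).
Qed.

(** The directions matched with the basis vectors of the wall have antipodes, hence are orthogonal
    to [xi]; distances are distorted little, so the scalar products with them are of order [k]. *)
Lemma quasi_half_perp v xi : extprop (direction p) -> perp xi -> rel v 1 xi ->
  forall i, i != ord_max -> `|v ord0 i| <= 3 * k.
Proof.
have K0 := k0; have K100 := k100; have KK := kk.
move=> eX px rv i im; have [a [eta [a0 re]]] := qh_l Q (e_half i).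
have [eta' ee'] := quasi_half_anti im eX a0 re.
have [h1 h2] := qh_norm Q a0 re; rewrite dot_e eqxx /= mulr1 in h1 h2.
have [h3 h4] := qh_norm Q ler01 rv; rewrite expr1n mulr1 in h3 h4.
have [h5 h6] := qh_dist Q a0 ler01 re rv.
have ex : mdist eta xi = pi / 2 by apply: px; exists eta'.
rewrite /cd2 ex cos_pihalf mulr0 subr0 expr1n sqdE dot_e eqxx (dotvC (e_ i) v) dotv_delta /= in h5 h6.
move: (a ^+ 2) (dotv v v) (v ord0 i) h1 h2 h3 h4 h5 h6 => A V x; move=> h1 h2 h3 h4 h5 h6.
have A1 := q_lower ler01 h2; have V1 := q_lower ler01 h3.
have A2 : 0 <= A + 1 by lra.
have h7 := q_lower A2 h5.
have h8 : (1 - k + 1) * (1 - k) <= (A + 1) * (1 - k) by rewrite ler_wpM2r //; lra.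
have h9 : (1 + k) * (A + 1) <= (1 + k) * (1 + k + 1) by rewrite ler_wpM2l //; lra.
by rewrite ler_norml; apply/andP; split; lra.
Qed.

(** Both matched vectors are close to the last basis vector, hence to each other. *)
Lemma quasi_half_perp_diam xi eta : extprop (direction p) -> perp xi -> perp eta -> mdist xi eta < pi / 2.
Proof.
have K0 := k0; have K100 := k100; have KK := kk.
move=> eX px pe; have [v [hv rv]] := qh_r Q xi (@ler01 R); have [w [hw rw]] := qh_r Q eta (@ler01 R).
have bv := quasi_half_perp eX px rv; have bw := quasi_half_perp eX pe rw.
have [h1 h2] := qh_norm Q ler01 rv; have [h3 h4] := qh_norm Q ler01 rw.
have [h5 _] := qh_dist Q ler01 ler01 rv rw; rewrite /cd2 expr1n !mulr1 in h1 h2 h3 h4 h5.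
move/half_space_ord_max : hv => hv; move/half_space_ord_max : hw => hw.
have small (u : 'rV[R]_m.+1) c : 0 <= c -> (forall i, i != ord_max -> `|u ord0 i| <= c) ->
    dotv u u <= u ord0 ord_max ^+ 2 + m.+1%:R * c ^+ 2.
  move=> c0 H; rewrite /dotv (bigD1 ord_max) //= -expr2 lerD2l.
  apply: le_trans (_ : \sum_(j < m.+1 | j != ord_max) c ^+ 2 <= _).
    apply: ler_sum => j jm; rewrite -expr2 -[leLHS]real_normK ?num_real // ler_sqr ?nnegrE //.
    exact: H.
  apply: le_trans (_ : \sum_(j < m.+1) c ^+ 2 <= _); last by rewrite sumr_const card_ord mulr_natl.
  by rewrite [leRHS](bigID (fun j => j != ord_max)) /= lerDl; apply: sumr_ge0 => j _; exact: sqr_ge0.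
have up (u : 'rV[R]_m.+1) : u ord0 ord_max ^+ 2 <= dotv u u.
  by rewrite /dotv (bigD1 ord_max) //= -expr2 lerDl; apply: sumr_ge0 => j _; rewrite -expr2 sqr_ge0.
have k3 : 0 <= 3 * k by rewrite mulr_ge0.
have k6 : 0 <= 6 * k by rewrite mulr_ge0.
have s1 := small v _ k3 bv; have s2 := small w _ k3 bw.
have s3 : sqd v w <= (v ord0 ord_max - w ord0 ord_max) ^+ 2 + m.+1%:R * (6 * k) ^+ 2.
  rewrite /sqd; have := small (v - w) _ k6; rewrite !mxE; apply=> i im.
  by rewrite !mxE; apply: le_trans (ler_normB _ _) _; have := bv i im; have := bw i im; lra.
have u1 := up v; have u2 := up w.
have km : m.+1%:R * k ^+ 2 <= k / 100.
  by have := ler_wpM2r k0 k1; rewrite expr2 mulrA (mulrC m.+1%:R) => h; lra.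
have pi0 := @pi_gt0 R; rewrite ltNge; apply/negP => hpi.
have := cos_ler _ hpi (direction_le_pi xi eta); rewrite cos_pihalf => /(_ ltac:(lra)).
move: s1 s2 s3 u1 u2 h1 h2 h3 h4 h5 hv hw; rewrite !exprMn.
rewrite (mulrCA _ (3 ^+ 2)) (mulrCA _ (6 ^+ 2)).
move: (dotv v v) (dotv w w) (sqd v w) (v ord0 ord_max) (w ord0 ord_max) (cos _) (_ * k ^+ 2) km => V W S x y C K km.
move=> s1 s2 s3 u1 u2 h1 h2 h3 h4 h5 x0 y0 C0.
have V1 := q_lower ler01 h1; have W1 := q_lower ler01 h3.
have h6 : (x - y) ^+ 2 <= `|x ^+ 2 - y ^+ 2|.
  rewrite subr_sqr normrM -[leLHS]real_normK ?num_real // expr2 ler_wpM2l //.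
  by rewrite [leRHS]ger0_norm ?addr_ge0 // ler_norml; apply/andP; split; lra.
have h7 : `|x ^+ 2 - y ^+ 2| <= 3 * k.
  by rewrite ler_norml; move: (x ^+ 2) (y ^+ 2) u1 u2 s1 s2 => X Y u1 u2 s1 s2; apply/andP; split; lra.
have h8 : S <= 4 * k by lra.
have h9 : (1 + k) * S <= (1 + k) * (4 * k) by rewrite ler_wpM2l //; lra.
by lra.
Qed.

(** [half_sphere_gen] yields a half sphere of some dimension. Orthonormal frames on either side
    correspond to almost orthonormal ones on the other, with scalar products off by at most [3 * k],
    and [gram_bound] gives both inequalities between the dimensions; [k * m.+1%:R <= 1 / 100]
    ensures diagonal dominance. *)
Lemma quasi_half_sphere : (~ allanti (direction p) -> extprop (direction p)) -> half_sphere m.+1 (direction p).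
Proof.
have K0 := k0; have K100 := k100; have KK := kk.
move=> eX; have na := quasi_half_not_allanti; have {}eX := eX na; have pi0 := @pi_gt0 R.
have ph : 0 < pi / 2 :> R by rewrite divr_gt0.
have [N NP] := sph_tbounded sD ph.
have [d hs] := half_sphere_gen sD eX na (fun xi eta => @quasi_half_perp_diam xi eta eX) (fun f => NP f (fun _ _ => I)).
have [phi [phs cosE onto]] := hs.
have cdE a b xi eta : cd2 a b xi eta = sqd (a *: phi xi) (b *: phi eta).
  by rewrite /cd2 sqdE !dotvZ -!cosE !mdistxx cos0; ring.
have nE a xi : dotv (a *: phi xi) (a *: phi xi) = a ^+ 2 by rewrite dotvZ -cosE mdistxx cos0; ring.
have ortho (V W S c : R) : V <= (1 + k) -> 1 <= (1 + k) * V -> W <= (1 + k) -> 1 <= (1 + k) * W -> S <= (1 + k) * 2 -> 2 <= (1 + k) * S ->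
    S = V + W - 2 * c -> `|c| <= 3 * k.
  move=> h1 h2 h3 h4 h5 h6 h7; have V1 := q_lower ler01 h2; have W1 := q_lower ler01 h4.
  have S1 := q_lower (ler0n _ 2) h6.
  by rewrite ler_norml; apply/andP; split; lra.
have dom (n : nat) V : (n <= m.+2)%N -> 1 <= (1 + k) * V -> n%:R * (3 * k) < V.
  move=> nm; have : n%:R <= m.+1%:R + 1 :> R by rewrite natr1 ler_nat.
  move: k1; move: (m.+1%:R : R) (n%:R : R) (ler0n R n) => a b b0; move=> h1 h2 h3.
  have h4 : b * k <= a * k + k by have := ler_wpM2r k0 h2; rewrite mulrDl mul1r.
  by have V1 := q_lower ler01 h3; lra.
have k30 : 0 <= 3 * k by rewrite mulr_ge0.
have e2 n (i j : 'I_n) : i != j -> sqd (delta_mx ord0 i : 'rV[R]_n) (delta_mx ord0 j) = 2.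
  by move=> ij; rewrite sqdE !dotv_delta !mxE !eqxx /= eq_sym (negPf ij) mulr0 subr0.
have le1 : (m.+1 <= d.+1)%N.
  have /choice[w wP] : forall i, exists u : R * direction p, 0 <= u.1 /\ rel (e_ i) u.1 u.2.
    by move=> i; have [a [xi h]] := qh_l Q (e_half i); exists (a, xi).
  have nw i : (w i).1 ^+ 2 <= (1 + k) /\ 1 <= (1 + k) * (w i).1 ^+ 2.
    by have [h1 h2] := wP i; have := qh_norm Q h1 h2; rewrite dot_e eqxx mulr1.
  apply: (@gram_bound R m.+1 d.+1 (fun i => (w i).1 *: phi (w i).2) (3 * k)) => // [i|i j ij].
    by rewrite nE; apply: dom => //; case: (nw i).
  have [h1 h2] := wP i; have [h3 h4] := wP j.
  have [h5 h6] := qh_dist Q h1 h3 h2 h4; rewrite e2 // in h5 h6.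
  have := sqdE ((w i).1 *: phi (w i).2) ((w j).1 *: phi (w j).2); rewrite -cdE !nE.
  by apply: ortho => //; case: (nw i) => //; case: (nw j).
have le2 : (d.+1 <= m.+1)%N.
  rewrite leqNgt; apply/negP => dm.
  pose u (i : 'I_m.+2) : 'rV[R]_d.+1 := delta_mx ord0 (widen_ord dm i).
  have /choice[xi xiE] : forall i, exists xi, phi xi = u i.
    move=> i; apply: onto; last by rewrite dotv_delta mxE !eqxx.
    by apply/half_space_ord_max; rewrite mxE; case: eqP => //=; case: eqP.
  have /choice[v vP] : forall i, exists v, rel v 1 (xi i).
    by move=> i; have [v [_ h]] := qh_r Q (xi i) (@ler01 R); exists v.
  have nv i : dotv (v i) (v i) <= (1 + k) /\ 1 <= (1 + k) * dotv (v i) (v i).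
    by have [] := qh_norm Q ler01 (vP i); rewrite expr1n mulr1.
  suff : (m.+2 <= m.+1)%N by rewrite ltnn.
  apply: (@gram_bound R m.+2 m.+1 v (3 * k)) => // [i|i j ij].
    by apply: dom => //; case: (nv i).
  have [h5 h6] := qh_dist Q ler01 ler01 (vP i) (vP j).
  rewrite cdE !scale1r !xiE e2 in h5 h6; last by apply: contraNN ij => /eqP/(congr1 val)/= E; apply/eqP/val_inj.
  by apply: (ortho _ _ _ _ _ _ _ _ _ _ (sqdE _ _)) => //; case: (nv i) => //; case: (nv j).
suff -> : m = d by [].
by apply/eqP; rewrite -eqSS eqn_leq le1.
Qed.

End Rigidity.

(** * Transport along rays *)

Section Transport.
Context {R : realType} {M : metricType R} (oM : onesided M).
Implicit Types (c q x y z : M).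

Let aM := os_alexl oM.
Let pM := os_proper oM.
Let c4 := alexl_curv aM.

(* y' is y pushed by d along a ray issued from q. *)
Definition moved q (d : R) y y' : Prop := exists l u, [/\ mdist q (l 0) = 0,
  forall s t : R, 0 <= s -> 0 <= t -> mdist (l s) (l t) = `|s - t|, 0 <= u, 0 <= u + d & y = l u /\ y' = l (u + d)].

Lemma moved_sym q d y y' : moved q d y y' -> moved q (- d) y' y.
Proof.
move=> [l [u [l0 li u0 ud [-> ->]]]]; exists l, (u + d); rewrite addrK.
by split.
Qed.

Lemma moved_ray q (xi : direction q) l s d : ray_in xi l -> 0 <= s -> 0 <= s + d -> moved q d (l s) (l (s + d)).
Proof.
move=> rl s0 sd; exists l, s; split=> //; first by rewrite (ray_in0 rl) mdistxx.
move=> a b a0 b0; have [ab|/ltW ba] := leP a b.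
  by rewrite (ray_in_isom rl a0 ab) ler0_norm ?subr_le0 // opprB.
by rewrite metric_sym (ray_in_isom rl b0 ba) ger0_norm ?subr_ge0.
Qed.

Lemma moved_ex q y d : allrays q -> 0 < mdist q y -> 0 <= mdist q y + d -> exists y', moved q d y y'.
Proof.
move=> aq qy0 qd; have [|g [gl ge]] := geodesic_ex pM (os_approx oM) (x := q) (y := y).
  by rewrite -mdist_gt0.
have [l rl] := aq (dir g); exists (l (mdist q y + d)).
have -> : y = l (mdist q y).
  by rewrite -(ray_in_uniq c4 rl (erefl (dir g))) ?gl ?(ltW qy0) // -gl.
rewrite (ray_in_dist rl) ?(ltW qy0) //; apply: moved_ray rl _ _ => //; exact: ltW.
Qed.

(* Stewart's inequality minus the corresponding equality for a point y on the line through a, x and x'. *)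
Lemma stewart_step k c r a x x' y (u rho h : R) : 0 < k -> fourpt k c r -> mdist c a < r -> mdist c x < r ->
  mdist c x' < r -> mdist c y < r -> mdist x a = rho -> mdist x x' = h -> mdist a x' = rho + h ->
  0 <= h -> `|u + rho| <= mdist y a ->
  sh (k * rho) * (ch (k * mdist y x') - ch (k * (u - h))) <=
  sh (k * (rho + h)) * (ch (k * mdist y x) - ch (k * u)).
Proof.
move=> k0 F ca cx cx' cy xa xx' ax' h0 ya.
have := stewart k0 F ca cx' cx cy; rewrite xa xx' ax' => /(_ erefl) S.
have h1 : ch (k * (u + rho)) <= ch (k * mdist y a).
  rewrite -ch_abs normrM gtr0_norm // ch_ler ?mulr_ge0 ?mdist_ge0 ?(ltW k0) //.
  by rewrite ler_pM2l.
have s0 : 0 <= sh (k * h) by rewrite sh_ge0 // mulr_ge0 // ltW.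
have := ler_wpM2r s0 h1.
have -> : k * (u + rho) = k * u + k * rho by ring.
have -> : k * (u - h) = k * u - k * h by ring.
move: S; have -> : k * (rho + h) = k * rho + k * h by ring.
rewrite (metric_sym y x) chD chB shD.
move: (ch _) (ch (k * u)) (sh (k * u)) (ch (k * rho)) (sh (k * rho)) (ch (k * h)) (sh (k * h)) => *.
by nra.
Qed.

Section Local.
Context {q c : M} {k r rho : R} (k0 : 0 < k) (F : fourpt k c r) (rho0 : 0 < rho) (rr : 4 * rho <= r)
  (rq : 4 * rho <= mdist q c).

(** Push [y] first, with [z] fixed, then [z] with [y'] fixed. In the two instances of [stewart_step]
    the terms in the difference of the distances from [q] telescope, up to [ch (k * e)] on both
    sides, which may be replaced by its lower bound 1. *)
Lemma moved_ineq d y y' z z' : `|d| <= rho -> mdist c y < 2 * rho -> mdist c z < 2 * rho ->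
  moved q d y y' -> moved q d z z' ->
  sh (k * rho) ^+ 2 * (ch (k * mdist y' z') - 1) <=
  sh (k * (rho + `|d|)) ^+ 2 * (ch (k * mdist y z) - 1).
Proof.
move=> dr cy cz [l1 [u1 [l10 l1i u10 u1d [E1 E1']]]] [l2 [u2 [l20 l2i u20 u2d [E2 E2']]]].
have P0 := rho0; have RR := rr; have RQ := rq; have K0 := k0.
have qD (l : R -> M) s : mdist q (l 0) = 0 -> (forall s t : R, 0 <= s -> 0 <= t -> mdist (l s) (l t) = `|s - t|) ->
    0 <= s -> mdist q (l s) = s.
  by move=> l0 li s0; rewrite (mdist0_eq l0) li // sub0r normrN ger0_norm.
have far (l : R -> M) u y0 : mdist q (l 0) = 0 -> (forall s t : R, 0 <= s -> 0 <= t -> mdist (l s) (l t) = `|s - t|) ->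
    0 <= u -> y0 = l u -> mdist c y0 < 2 * rho -> 2 * rho < u.
  move=> l0 li u0 -> h; have := metric_triangle q (l u) c.
  by rewrite (qD l) // (metric_sym (l u) c); lra.
have U1 := far l1 u1 y l10 l1i u10 E1 cy; have U2 := far l2 u2 z l20 l2i u20 E2 cz.
have lip s t : 0 <= s -> 0 <= t -> `|s - t| <= mdist (l1 s) (l2 t).
  move=> s0 t0; have := metric_triangle q (l1 s) (l2 t); have := metric_triangle q (l2 t) (l1 s).
  rewrite (qD l1) // (qD l2) // (metric_sym (l2 t)) => h1 h2.
  by rewrite ler_norml; apply/andP; split; lra.
have ball (l : R -> M) u v y0 : (forall s t : R, 0 <= s -> 0 <= t -> mdist (l s) (l t) = `|s - t|) ->
    0 <= u -> 0 <= v -> y0 = l u -> mdist c y0 < 2 * rho -> `|u - v| <= rho -> mdist c (l v) < r.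
  by move=> li u0 v0 -> h uv; have := metric_triangle c (l u) (l v); rewrite li //; lra.
have cy' : mdist c y < r by lra.
have cz' : mdist c z < r by lra.
(* [sg] is the sign of the shift: the reference point [l (u - sg * rho)] lies behind the pushed
   point, so that inward and outward shifts are treated alike. *)
have [sg sgE dE] : exists2 sg : R, sg = 1 \/ sg = -1 & d = sg * `|d|.
  have [d0|d0] := leP 0 d; [exists 1|exists (-1)]; [by left|by rewrite mul1r ger0_norm|by right|].
  by rewrite mulN1r ltr0_norm // opprK.
move: dr dE (normr_ge0 d); move: `|d| => h dr dE h0.
have sgn (v : R) : `|sg * v| = `|v| by case: sgE => ->; rewrite ?mul1r ?mulN1r ?normrN.
have sg1 : sg * sg = 1 by case: sgE => ->; ring.
have sb : - rho <= sg * rho <= rho by case: sgE => ->; rewrite ?mul1r ?mulN1r; apply/andP; split; lra.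
have sd : - rho <= d <= rho by rewrite dE; case: sgE => ->; rewrite ?mul1r ?mulN1r; apply/andP; split; lra.
move/andP: sb => [sb1 sb2]; move/andP: sd => [sd1 sd2].
have nr : `|sg * rho| = rho by rewrite sgn gtr0_norm.
have nd : `|d| = h by rewrite dE sgn ger0_norm.
have nrd : `|sg * rho + d| = rho + h by rewrite dE -mulrDr sgn ger0_norm // addr_ge0 // ltW.
have a10 : 0 <= u1 - sg * rho by lra.
have a20 : 0 <= u2 - sg * rho by lra.
have step l l' u u' y0 z0 (e := sg * (u' - u)) :
    (forall s t : R, 0 <= s -> 0 <= t -> mdist (l s) (l t) = `|s - t|) -> 0 <= u -> 0 <= u + d -> 0 <= u' ->
    0 <= u - sg * rho -> y0 = l u -> mdist c y0 < 2 * rho -> z0 = l' u' -> mdist c z0 < r ->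
    `|u' - (u - sg * rho)| <= mdist (l' u') (l (u - sg * rho)) ->
    sh (k * rho) * (ch (k * mdist z0 (l (u + d))) - ch (k * (e - h))) <=
    sh (k * (rho + h)) * (ch (k * mdist z0 y0) - ch (k * e)).
  move=> li U0 Ud U0' Ua Ey cy0 Ez cz0 H; apply: (stewart_step k0 F (a := l (u - sg * rho))) => //.
  - by apply: (ball l u _ y0) => //; rewrite opprB addrCA subrr addr0 nr.
  - by lra.
  - by apply: (ball l u _ y0) => //; rewrite opprD addNKr normrN nd.
  - by rewrite Ey li // opprB addrCA subrr addr0 nr.
  - by rewrite Ey li // opprD addNKr normrN nd.
  - by rewrite li // (_ : u - sg * rho - (u + d) = - (sg * rho + d)) ?normrN ?nrd //; ring.
  - rewrite Ez; apply: le_trans H; rewrite -(sgn (_ - _)) (_ : sg * _ = e + sg * sg * rho); last by rewrite /e; ring.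
    by rewrite sg1 mul1r.
have S1 := step l1 l2 u1 u2 y z l1i u10 u1d u20 a10 E1 cy E2 cz'.
have S2 := step l2 l1 u2 (u1 + d) z y' l2i u20 u2d u1d a20 E2 cz E1'.
rewrite -E1' in S1; rewrite -E2' in S2.
have {}S1 := S1 ltac:(rewrite metric_sym distrC; exact: lip).
have {}S2 := S2 ltac:(rewrite E1'; apply: (ball l1 u1 _ y) => //; rewrite opprD addNKr normrN nd //) ltac:(exact: lip).
have e1 : sg * (u1 + d - u2) = - (sg * (u2 - u1) - h).
  by rewrite {1}dE !mulrBr mulrDr mulrA sg1; ring.
rewrite e1 in S2; set e := sg * (u2 - u1) in S1 S2.
have E3 : ch (k * (- (e - h) - h)) = ch (k * e) by rewrite -[RHS]chN; congr ch; ring.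
have E4 : ch (k * - (e - h)) = ch (k * (e - h)) by rewrite -[RHS]chN; congr ch; ring.
rewrite E3 E4 in S2; rewrite (metric_sym z y') (metric_sym z y) in S1.
have A0 : 0 < sh (k * rho) by rewrite sh_gt0 // mulr_gt0.
have AB : sh (k * rho) <= sh (k * (rho + h)) by rewrite sh_ler ler_pM2l //; lra.
have C1 := ch_ge1 (k * e); have {}S1 := ler_wpM2l (le_trans (ltW A0) AB) S1.
have {}S2 := ler_wpM2l (ltW A0) S2.
have AB2 : sh (k * rho) ^+ 2 <= sh (k * (rho + h)) ^+ 2 by rewrite ler_sqr // nnegrE ltW // (lt_le_trans A0 AB).
have C1' : 0 <= ch (k * e) - 1 by lra.
have := ler_wpM2r C1' AB2.
move: S1 S2; rewrite !expr2; clear.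
move: (sh _) (sh _) (ch (k * e)) (ch _) (ch _) (ch _) (ch _) => *; lra.
Qed.

Context {kap : R} (kap0 : 0 <= kap) (kap1 : kap <= 1).

Lemma moved_sqr d y y' z z' : `|d| <= rho -> sh (k * (rho + `|d|)) ^+ 2 <= (1 + kap) * sh (k * rho) ^+ 2 ->
  mdist c y < 2 * rho -> mdist c z < 2 * rho -> moved q d y y' -> moved q d z z' ->
  mdist y' z' ^+ 2 <= (1 + kap) * (mdist y z ^+ 2 * ch (k * mdist y z) ^+ 2).
Proof.
move=> dr ds cy cz yy zz; have H := moved_ineq dr cy cz yy zz.
have A0 : 0 < sh (k * rho) ^+ 2 by rewrite exprn_gt0 // sh_gt0 // mulr_gt0.
have c1 := ch_ge1 (k * mdist y z); have c0 : 0 <= ch (k * mdist y z) - 1 by lra.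
have H1 : ch (k * mdist y' z') - 1 <= (1 + kap) * (ch (k * mdist y z) - 1).
  rewrite -(ler_pM2l A0); apply: le_trans H _; rewrite mulrCA mulrA.
  by rewrite -mulrA mulrA ler_wpM2r.
have kd : 0 <= k * mdist y z <= k * mdist y z by rewrite lexx andbT mulr_ge0 ?mdist_ge0 // ltW.
have H2 := ch_le kd; have H3 := ch_ge (k * mdist y' z').
have k2 : 0 < k ^+ 2 / 2 by rewrite divr_gt0 // exprn_gt0.
rewrite -(ler_pM2l k2); have K1 : 0 <= 1 + kap by have := kap0; lra.
have := ler_wpM2l K1 H2; move: H1 H3; rewrite !exprMn; lra.
Qed.

Context {x x' : M} {d : R} (dr : `|d| <= rho) (ds : sh (k * (rho + `|d|)) ^+ 2 <= (1 + kap) * sh (k * rho) ^+ 2)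
  (cx : mdist c x < rho) {t : nat -> R} (st : scale t).

Let near (y : nat -> M) (a : R) (xi : direction x) : 0 <= a -> blowup t y a xi -> oou [set n | mdist c (y n) < 2 * rho].
Proof.
move=> a0 b; apply: (oou_imply _ (blowup_close c4 st a0 b rho0)) => n /= h.
by have := metric_triangle c x (y n); have := cx; lra.
Qed.

Lemma moved_blowup (y y' z z' : nat -> M) (a a' b b' : R) (xi eta : direction x) (xi' eta' : direction x') :
  0 <= a -> 0 <= b -> 0 <= a' -> 0 <= b' -> blowup t y a xi -> blowup t z b eta ->
  blowup t y' a' xi' -> blowup t z' b' eta' ->
  oou [set n | moved q d (y n) (y' n)] -> oou [set n | moved q d (z n) (z' n)] ->
  cd2 a' b' xi' eta' <= (1 + kap) * cd2 a b xi eta.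
Proof.
move=> a0 b0 a'0 b'0 by_ bz by' bz' my mz.
have L' := blowup_dist2 c4 st a'0 b'0 by' bz'.
have L := blowup_dist2 c4 st a0 b0 by_ bz.
have D0 : (fun n => mdist (y n) (z n)) @ oou --> (0 : R).
  apply: ulim0 => e e0; apply: (oou_imply _ (blowup_small c4 st a0 b0 by_ bz e0)) => n /=.
  by rewrite ger0_norm ?mdist_ge0.
have C := ch_ulim (k := k) D0; rewrite mulr0 ch0 in C.
have L2 : (fun n => (1 + kap) * ((mdist (y n) (z n) / t n) ^+ 2 * (ch (k * mdist (y n) (z n)) * ch (k * mdist (y n) (z n)))))
    @ oou --> (1 + kap) * (cd2 a b xi eta * (1 * 1)).
  by apply: cvgM; [exact: ulim_cst|apply: cvgM => //; apply: cvgM].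
rewrite -[cd2 a b xi eta]mulr1 -{2}[1]mulr1.
apply: (ulim_le L' L2); apply: (oou_imply _ (oouI (oouI my mz) (oouI (near a0 by_) (near b0 bz)))) => n /= [[h1 h2] [h3 h4]].
have t0 := proj1 st n; have := moved_sqr dr ds h3 h4 h1 h2.
rewrite !expr_div_n -!expr2 ler_pdivrMr ?exprn_gt0 // => h; apply: le_trans h _.
have n0 : t n != 0 by rewrite gt_eqF.
by rewrite le_eqVlt; apply/orP; left; apply/eqP; field.
Qed.

Lemma moved_compact (y y' : nat -> M) (a : R) (xi : direction x) (xi' : direction x') :
  0 <= a -> blowup t y a xi -> moved q d x x' -> oou [set n | moved q d (y n) (y' n)] ->
  exists a' eta, 0 <= a' /\ blowup t y' a' (eta : direction x').
Proof.
move=> a0 by_ mx my; have P0 := rho0; have CX := cx; have KP0 := kap0; have KP1 := kap1.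
have L := ulim_lt (blowup_base c4 st a0 by_) (_ : a < a + 1); rewrite ltrDl in L.
pose C := 2 * (ch (k * (4 * rho)) * (a + 1)).
apply: (blowup_compact aM (C := C) xi' st).
apply: (oou_imply _ (oouI my (oouI (near a0 by_) (L ltr01)))) => n /= [h1 [h2 h3]].
have cx2 : mdist c x < 2 * rho by lra.
have := moved_sqr dr ds cx2 h2 mx h1; have t0 := proj1 st n.
rewrite ltr_pdivrMr // in h3; have D4 : mdist x (y n) <= 4 * rho.
  by have := metric_triangle x c (y n); rewrite (metric_sym x c); lra.
have d0 := mdist_ge0 x (y n); have H1 : ch (k * mdist x (y n)) <= ch (k * (4 * rho)).
  by rewrite ch_ler ?mulr_ge0 ?(ltW k0) ?(ltW P0) // ler_pM2l.
have c1 := ch_ge1 (k * mdist x (y n)).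
have H2 : mdist x (y n) * ch (k * mdist x (y n)) <= (a + 1) * t n * ch (k * (4 * rho)).
  by apply: ler_pM => //; [lra|exact: ltW].
have H0 : 0 <= mdist x (y n) * ch (k * mdist x (y n)) by rewrite mulr_ge0 //; lra.
rewrite -exprMn => H3.
rewrite -ler_sqr ?nnegrE ?mdist_ge0 //; last by apply: le_trans (_ : 2 * ((a + 1) * t n * ch (k * (4 * rho))) <= _); [lra|rewrite /C; lra].
apply: le_trans H3 _; apply: le_trans (_ : (2 * (mdist x (y n) * ch (k * mdist x (y n)))) ^+ 2 <= _).
  by rewrite [leRHS]exprMn ler_wpM2r ?sqr_ge0 // expr2; lra.
rewrite ler_sqr ?nnegrE; [rewrite /C; lra|lra|rewrite /C; lra].
Qed.

(** The pushed sequence stays at a distance comparable to the scale from the pushed base point, so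
    it has a limit in the cone there. *)
Lemma moved_seq (y : nat -> M) (a : R) (xi : direction x) (xi' : direction x') :
  allrays q -> 0 <= a -> blowup t y a xi -> moved q d x x' -> exists (y' : nat -> M) (a' : R) (eta : direction x'),
  [/\ 0 <= a', blowup t y' a' eta & oou [set n | moved q d (y n) (y' n)]].
Proof.
move=> aq a0 by_ mx; have RQ := rq; have P0 := rho0.
have /choice[y' y'P] : forall n, exists z, mdist c (y n) < 2 * rho -> moved q d (y n) z.
  move=> n; have [h|h] := pselect (mdist c (y n) < 2 * rho); last by exists c.
  have h1 := metric_triangle q (y n) c; rewrite (metric_sym (y n) c) in h1.
  have [] := @moved_ex q (y n) d aq; [lra| |by move=> z mz; exists z].
  by move: (dr); rewrite ler_norml => /andP[h2 h3]; lra.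
have my : oou [set n | moved q d (y n) (y' n)] by apply: (oou_imply _ (near a0 by_)) => n; exact: y'P.
by have [a' [eta [a'0 b']]] := moved_compact xi' a0 by_ mx my; exists y', a', eta.
Qed.

End Local.

Lemma sh_near (k rho e : R) : 0 < k -> 0 < rho -> 0 < e ->
  exists2 d, 0 < d & forall h, 0 <= h -> h <= d -> sh (k * (rho + h)) ^+ 2 <= (1 + e) * sh (k * rho) ^+ 2.
Proof.
move=> k0 rho0 e0; have kr : 0 < k * rho by rewrite mulr_gt0.
have A0 : 0 < sh (k * rho) ^+ 2 by rewrite exprn_gt0 // sh_gt0.
have cts : (fun h => ch (k * (rho + h)) ^+ 2) @ (0 : R) --> ch (k * (rho + 0)) ^+ 2.
  have h1 : (fun h => ch (k * (rho + h))) @ (0 : R) --> ch (k * (rho + 0)).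
    apply: (@continuous_cvg _ _ _ _ _ (fun h => k * (rho + h)) (@ch R)); first exact: continuous_ch.
    by apply: cvgM; [exact: cvg_cst|apply: cvgD; [exact: cvg_cst|exact: cvg_id]].
  by rewrite !expr2; apply: cvgM.
have : \forall h \near (0 : R), ch (k * (rho + h)) ^+ 2 < ch (k * rho) ^+ 2 + e * sh (k * rho) ^+ 2.
  by apply: (cvgr_lt _ cts); rewrite addr0 ltrDl mulr_gt0.
move=> /nbhs_ballP[d /= d0 H]; exists (d / 2); first by rewrite divr_gt0.
move=> h h0 hd; have := H h; rewrite /ball /= sub0r normrN ger0_norm // => /(_ ltac:(lra)).
have := ch2Bsh2 (k * (rho + h)); have := ch2Bsh2 (k * rho); lra.
Qed.

Lemma blowup_const x (xi : direction x) t : scale t -> blowup t (fun=> x) 0 xi.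
Proof.
move=> st;
  have [y yP] := blowup_ex xi st (lexx 0).
  apply: (blowup_near _ yP) => e e0; apply: (oou_imply _ (ulim_lt (blowup_base c4 st (lexx 0) yP) e0)) => n /=.
  by rewrite ltr_pdivrMr ?(proj1 st) // metric_sym => /ltW.
Qed.

(** Pushing by [w = v - u] relates the cones at [l u] and [l v], and pushing back by [- w] gives the
    reverse estimates. Near [l s] the distortion is below what [quasi_half_sphere] tolerates;
    [extprop] at [l v] comes from [nonray_allanti]. *)
Lemma half_sphere_transport q (xi0 : direction q) (l : R -> M) (s : R) m : allrays q -> ray_in xi0 l -> 0 < s ->
  exists2 d, 0 < d & forall u v, `|u - s| < d -> `|v - s| < d ->
    half_sphere m.+1 (direction (l u)) -> half_sphere m.+1 (direction (l v)).
Proof.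
move=> aq rl s0; have [k k0 FF] := c4; have [r r0 F] := FF (l s).
pose rho := Num.min (s / 8) (r / 8).
have rho0 : 0 < rho by rewrite lt_min !divr_gt0.
have rs : rho <= s / 8 by rewrite ge_min lexx.
have rr : rho <= r / 8 by rewrite ge_min lexx orbT.
pose kap : R := (100 * m.+1%:R)^-1.
have kapP : 0 < kap by rewrite invr_gt0 mulr_gt0 // ltr0n.
have kapm : kap * m.+1%:R <= 1 / 100 by rewrite /kap invfM -mulrA mulVf ?pnatr_eq0 // mulr1 mul1r.
have kap1 : kap <= 1.
  by apply: le_trans (_ : 1 / 100 <= _); [apply: le_trans kapm; rewrite ler_peMr ?(ltW kapP) // ler1n|lra].
have [h0 h00 hP] := sh_near k0 rho0 kapP.
pose d := Num.min (h0 / 2) (rho / 2); exists d; first by rewrite lt_min !divr_gt0.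
have dh : d <= h0 / 2 by rewrite ge_min lexx.
have dr : d <= rho / 2 by rewrite ge_min lexx orbT.
clearbody d rho.
move=> u v us vs [phi [phs cosE onto]].
move: (us) (vs); rewrite !ltr_norml => /andP[us1 us2] /andP[vs1 vs2].
have u0 : 0 < u by lra.
have v0 : 0 < v by lra.
pose w := v - u; have vE : v = u + w by rewrite /w addrC subrK.
have wr : `|w| <= rho by rewrite ler_norml /w; apply/andP; split; lra.
have wh : sh (k * (rho + `|w|)) ^+ 2 <= (1 + kap) * sh (k * rho) ^+ 2.
  by apply: hP => //; rewrite ler_norml /w; apply/andP; split; lra.
have wr' : `|- w| <= rho by rewrite normrN.
have wh' : sh (k * (rho + `|- w|)) ^+ 2 <= (1 + kap) * sh (k * rho) ^+ 2 by rewrite normrN.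
have rr4 : 4 * rho <= r by lra.
have rq4 : 4 * rho <= mdist q (l s) by rewrite (ray_in_dist rl (ltW s0)); lra.
have dist a : 0 < a -> `|a - s| < d -> mdist (l s) (l a) < rho.
  move=> a0; rewrite ltr_norml => /andP[h1 h2]; have [ab|ab] := leP a s.
    by rewrite metric_sym (ray_in_isom rl (ltW a0) ab); lra.
  by rewrite (ray_in_isom rl (ltW s0) (ltW ab)); lra.
have cu := dist u u0 us; have cv := dist v v0 vs.
have mv : moved q w (l u) (l v) by rewrite vE; apply: moved_ray rl _ _; lra.
have mv' := moved_sym mv.
have [xiu _] : exists xi : direction (l u), True.
  have [||xi _] := onto (delta_mx ord0 ord_max); last by exists xi.
  - by apply/half_space_ord_max; rewrite mxE !eqxx.
  - by rewrite dotv_delta mxE !eqxx mulr1n.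
have [etav _] : exists xi : direction (l v), True.
  have [|g _] := geodesic_ex pM (os_approx oM) (x := l v) (y := q); last by exists (dir g).
  by rewrite eq_sym -mdist_gt0 (ray_in_dist rl (ltW v0)).
pose t n : R := n.+1%:R^-1; have st : scale t := scale_harmonic.
(* A relation instead of a map: two cone points are related when they are limits of a sequence and
   of its pushed image, and independence of the sequence need not be shown. *)
pose rel (z : 'rV[R]_m.+1) (a' : R) (xi' : direction (l v)) := exists (a : R) (xi : direction (l u)) (y y' : nat -> M),
  [/\ 0 <= a /\ z = a *: phi xi, blowup t y a xi, blowup t y' a' xi' & oou [set n | moved q w (y n) (y' n)]].
have cdE a b xi eta : cd2 a b xi eta = sqd (a *: phi xi) (b *: phi eta).
  by rewrite /cd2 sqdE !dotvZ -!cosE !mdistxx cos0; ring.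
have nE a xi : dotv (a *: phi xi) (a *: phi xi) = a ^+ 2 by rewrite dotvZ -cosE mdistxx cos0; ring.
have sym (y y' : nat -> M) : oou [set n | moved q w (y n) (y' n)] -> oou [set n | moved q (- w) (y' n) (y n)].
  by apply: oou_imply => n /=; exact: moved_sym.
have kap0 := ltW kapP.
have Q : quasi_half (1 + kap) rel.
  split.
  - move=> z hz; have zz : 0 <= dotv z z by exact: dotv_ge0.
    have [z0|z0] := eqVneq z 0.
      have [y' [a' [eta [a'0 b' my]]]] := moved_seq k0 F rho0 rr4 rq4 kap0 kap1 wr wh cu st etav aq (lexx 0) (blowup_const xiu st) mv.
      exists a', eta; split=> //; exists 0, xiu, (fun=> l u), y'; split=> //; last exact: blowup_const.
      by rewrite scale0r.
    have N0 : 0 < Num.sqrt (dotv z z).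
      by rewrite sqrtr_gt0 lt_neqAle zz andbT eq_sym; apply: contraNN z0 => /eqP/dotv_eq0/eqP.
    have [||xi xiE] := onto ((Num.sqrt (dotv z z))^-1 *: z).
    + by apply/half_space_ord_max; rewrite mxE mulr_ge0 ?invr_ge0 ?(ltW N0) //; exact/half_space_ord_max.
    + by rewrite dotvZ -{3}(sqr_sqrtr zz); field; rewrite gt_eqF.
    have [y yb] := blowup_ex xi st (ltW N0).
    have [y' [a' [eta [a'0 b' my]]]] := moved_seq k0 F rho0 rr4 rq4 kap0 kap1 wr wh cu st etav aq (ltW N0) yb mv.
    exists a', eta; split=> //; exists (Num.sqrt (dotv z z)), xi, y, y'; split=> //; split; first exact: ltW.
    by rewrite xiE scalerA divff ?scale1r // gt_eqF.
  - move=> a' xi' a'0; have [y' yb'] := blowup_ex xi' st a'0.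
    have [y [a [xi [a0 b my]]]] := moved_seq k0 F rho0 rr4 rq4 kap0 kap1 wr' wh' cv st xiu aq a'0 yb' mv'.
    exists (a *: phi xi); split.
      by apply/half_space_ord_max; rewrite mxE mulr_ge0 //; exact/half_space_ord_max.
    exists a, xi, y, y'; split=> //; apply: (oou_imply _ my) => n /= h.
    by rewrite -[w]opprK; exact: moved_sym.
  - move=> z z2 a' b' xi' eta' a'0 b'0 [a [xi [y [y' [[a0 ->] yb yb' my]]]]] [b [eta [y2 [y2' [[b0 ->] y2b y2b' my2]]]]].
    rewrite -cdE; split.
      exact: (moved_blowup k0 F rho0 rr4 rq4 kap0 wr wh cu st a0 b0 a'0 b'0 yb y2b yb' y2b' my my2).
    exact: (moved_blowup k0 F rho0 rr4 rq4 kap0 wr' wh' cv st a'0 b'0 a0 b0 yb' y2b' yb y2b (sym _ _ my) (sym _ _ my2)).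
  - move=> z a' xi' a'0 [a [xi [y [y' [[a0 ->] yb yb' my]]]]]; rewrite nE.
    have cd0 x0 (c0 : R) (xi0' eta0 : direction x0) : cd2 c0 0 xi0' eta0 = c0 ^+ 2 by rewrite /cd2; ring.
    have mc : oou [set _ : nat | moved q w (l u) (l v)] by apply: oou_all.
    rewrite -(cd0 _ a xi xiu) -(cd0 _ a' xi' etav); split.
      exact: (moved_blowup k0 F rho0 rr4 rq4 kap0 wr wh cu st a0 (lexx 0) a'0 (lexx 0) yb (blowup_const xiu st) yb' (blowup_const etav st) my mc).
    exact: (moved_blowup k0 F rho0 rr4 rq4 kap0 wr' wh' cv st a'0 (lexx 0) a0 (lexx 0) yb' (blowup_const etav st) yb (blowup_const xiu st) (sym _ _ my) (sym (fun=> l u) (fun=> l v) mc)).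
apply: (quasi_half_sphere aM Q kap0 kapm) => na; apply: extprop_allrays => //.
by apply: contrapT => nr; apply: na; exact: nonray_allanti oM _ nr.
Qed.

End Transport.

(** Connectedness of the half line, by the intermediate value theorem for the indicator function of
    [P]. *)
Lemma locally_constant {R : realType} (P : R -> Prop) :
  (forall s, 0 < s -> exists2 d, 0 < d & forall u v, `|u - s| < d -> `|v - s| < d -> P u -> P v) ->
  forall a b, 0 < a -> 0 < b -> P a -> P b.
Proof.
move=> H; suff key a b : 0 < a -> a <= b -> (if `[< P a >] then 1 else 0 : R) = (if `[< P b >] then 1 else 0).
  move=> a b a0 b0 /asboolP Pa; apply/asboolP; apply: contrapT => /negP nb.
  have [ab|/ltW ba] := leP a b; first by have := key a b a0 ab; rewrite Pa (negPf nb) => /eqP; rewrite oner_eq0.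
  by have := key b a b0 ba; rewrite Pa (negPf nb) => /eqP; rewrite eq_sym oner_eq0.
move=> a0 ab; pose f u : R := if `[< P u >] then 1 else 0.
have f01 u : f u = 0 \/ f u = 1 by rewrite /f; case: ifP; [right|left].
have cf : {within `[a, b], continuous f}.
  apply/within_continuous_ball => s /=; rewrite in_itv /= => /andP[as_ _] e e0.
  have [d d0 dP] := H s (lt_le_trans a0 as_); exists d => // u _; rewrite -ball_normE /= distrC => us.
  have ss : `|s - s| < d by rewrite subrr normr0.
  suff -> : f u = f s by rewrite subrr normr0.
  by rewrite /f; congr (if _ then _ else _); apply/asboolP/asboolP; apply: dP.
have [//|fab] := eqVneq (f a) (f b).
have [|c _ fc] := IVT ab cf (v := 1 / 2); last by case: (f01 c) => E; rewrite E in fc; lra.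
rewrite ge_min le_max; case: (f01 a) fab => ->; case: (f01 b) => ->; rewrite ?eqxx // => _.
  by apply/andP; split; apply/orP; [left|right]; lra.
by apply/andP; split; apply/orP; [right|left]; lra.
Qed.

(** * Lines in the boundary *)

Section Lines.
Context {R : realType} {M : metricType R} (oM : onesided M).
Implicit Types (p q : M).

Let aM := os_alexl oM.
Let pM := os_proper oM.
Let c4 := alexl_curv aM.
Let sD p := direction_spherical aM (p := p).

Lemma ray_split q (xi : direction q) l p (a L : R) : ray_in xi l -> l a = p -> 0 < a -> 0 < L ->
  exists b f : geodesic p, [/\ glen b = a, gcurve b = (fun u => l (a - u)), glen f = L,
    gcurve f = (fun u => l (a + u)) & angle b f = pi].
Proof.
move=> rl lp a0 L0; have aL : 0 < a + L by rewrite addr_gt0.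
have [g [gl gc _]] := rl _ aL; rewrite -gc in lp *; subst p.
have ag : a <= glen g by rewrite gl lerDl ltW.
have [b [bl bc]] := geo_backward a0 ag.
have ag' : a < glen g by rewrite gl ltrDl.
have [f [fl fc]] := geo_forward (ltW a0) ag'.
exists b, f; split=> //; first by rewrite fl gl addrC addKr.
apply: (@angle_opp_pi _ _ _ _ _ (Num.min a L)); first by rewrite lt_min a0.
move=> u v /andP[u0]; rewrite lt_min => /andP[ua _] /andP[v0]; rewrite lt_min => /andP[_ vL].
by rewrite bc fc geo_isom ?gl; [ring|lra|lra|lra].
Qed.

Lemma ray_nonbranching q q' (xi : direction q) (xi' : direction q') l l' (a a' d : R) :
  ray_in xi l -> ray_in xi' l' -> 0 < a -> 0 < a' -> 0 < d ->
  (forall u, 0 <= u -> u < d -> l (a - u) = l' (a' - u)) ->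
  forall u, 0 <= u -> l (a + u) = l' (a' + u).
Proof.
move=> rl rl' a0 a'0 d0 H u u0; have L0 : 0 < u + 1 by lra.
have E : l' a' = l a by have := H 0 (lexx 0) d0; rewrite !subr0.
have [b [f [bl bc fl fc bf]]] := ray_split rl (erefl (l a)) a0 L0.
have [b' [f' [bl' bc' fl' fc' bf']]] := ray_split rl' E a'0 L0.
have bb : dir b = dir b'.
  apply: mdist0_eq; rewrite mdist_dir; apply: (angle0_of_agree c4 d0) => v /andP[v0 vd].
  by rewrite bc bc'; apply: H => //; exact: ltW.
have ff : dir f = dir f'.
  apply: (@antipode_unique _ _ _ (dir b) (dir f) (dir f') c4); first by rewrite mdist_dir.
  by rewrite bb mdist_dir.
have f0 : angle f f' = 0 by rewrite -mdist_dir ff mdistxx.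
have := geo_nonbranching c4 f0 (s := u); rewrite fl fl' fc fc' => h.
by apply: h => //; lra.
Qed.

(** The half sphere is transported along the ray, then turned back into a boundary point. For
    [m = 0] the assumption on [l a] is contradictory: such a boundary point has a single direction,
    while the ray passes through it in two. *)
Lemma boundary_ray m q (xi : direction q) l (a b : R) : boundary m.+1 M q -> ray_in xi l ->
  0 < a -> 0 < b -> boundary m.+1 M (l a) -> boundary m.+1 M (l b).
Proof.
move=> bq rl a0 b0 ba; have [aq _] := boundary_pole oM bq; have [_ ha] := boundary_pole oM ba.
have hb := locally_constant (fun s s0 => half_sphere_transport oM m aq rl s0) a0 b0 ha.
case: m bq ba ha hb => [|m] bq ba ha hb; last by apply: boundary_of_half_sphere.
have [xi0 H] := chart_single aM ba.
have [c [f [_ _ _ _ cf]]] := ray_split rl (erefl (l a)) a0 (@ltr01 R).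
have := @pi_gt0 R; rewrite -cf -mdist_dir (H (dir c)) (H (dir f)) mdistxx ltxx //.
Qed.

Lemma boundary_line m p q : boundary m.+1 M p -> boundary m.+1 M q -> p <> q ->
  exists l : R -> M, [/\ line l, range l `<=` boundary m.+1 M, range l p & range l q].
Proof.
move=> bp bq pq; have [ap _] := boundary_pole oM bp; have [aq _] := boundary_pole oM bq.
have [|g [gl ge]] := geodesic_ex pM (os_approx oM) (x := q) (y := p); first by apply/eqP => E; exact: pq.
have d0 := glen_gt0 g; set d := glen g in gl d0 *.
have [lq rq] := aq (dir g).
have lqE u : 0 <= u -> u <= d -> lq u = g u by move=> u0 ud; rewrite (ray_in_uniq c4 rq (erefl (dir g))).
have gp : g d = p by [].
have [g' [gl' gc']] : {g' : geodesic p | glen g' = d /\ gcurve g' = (fun u => g (d - u))}.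
  apply: mk_geodesic => //; first by rewrite subr0.
  by move=> u v u0 uv vd; rewrite metric_sym geo_isom -/d; [ring|lra|lra|lra].
have [lp rp] := ap (dir g').
have lpE u : 0 <= u -> u <= d -> lp u = lq (d - u).
  by move=> u0 ud; rewrite -(ray_in_uniq c4 rp (erefl (dir g'))) ?gl' // gc' lqE //; lra.
have lqd : lq d = p by rewrite lqE ?(ltW d0).
have lpd : lp d = q by rewrite lpE ?(ltW d0) // subrr (ray_in0 rq).
have bdq u : 0 < u -> boundary m.+1 M (lq u) by move=> u0; apply: (boundary_ray bq rq d0 u0); rewrite lqd.
have bdp u : 0 < u -> boundary m.+1 M (lp u) by move=> u0; apply: (boundary_ray bp rp d0 u0); rewrite lpd.
pose l s := if 0 <= s then lq s else lp (d - s).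
have lE s : s <= d -> l s = lp (d - s).
  by rewrite /l; have [s0|//] := leP 0 s => sd; rewrite lpE; [congr lq; ring|lra|lra].
have lE' s : 0 <= s -> l s = lq s by rewrite /l => ->.
(* The points lie on the two prolongations. The point beyond [q] is again in the boundary, hence a
   pole; so the geodesic from it back to [p] continues to a ray, which follows [lq] beyond [p] by
   nonbranching. *)
have far s t : s < 0 -> d < t -> mdist (lp (d - s)) (lq t) = t - s.
  move=> s0 dt; have ds : 0 < d - s by lra.
  have [aA _] := boundary_pole oM (bdp _ ds).
  have [b [_ [bl bc _ _ _]]] := ray_split rp (erefl (lp (d - s))) ds (@ltr01 R).
  have [lA rA] := aA (dir b).
  have lAE u : 0 <= u -> u <= d - s -> lA u = lp (d - s - u).
    by move=> u0 ud; rewrite -(ray_in_uniq c4 rA (erefl (dir b))) ?bl // bc.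
  have agree : forall u, 0 <= u -> u < d -> lA (d - s - u) = lq (d - u).
    move=> u u0 ud; rewrite lAE; [|lra|lra].
    by rewrite subKr lpE // ltW.
  have td : 0 <= t - d by lra.
  have := ray_nonbranching rA rq ds d0 d0 agree td.
  have -> : d - s + (t - d) = t - s by ring.
  have -> : d + (t - d) = t by ring.
  by move=> <-; rewrite (ray_in_dist rA) //; lra.
have lt_line s t : s <= t -> mdist (l s) (l t) = t - s.
  move=> st; have [s0|s0] := leP 0 s.
    by rewrite !lE' ?(ray_in_isom rq s0 st) // (le_trans s0).
  have [td|td] := leP t d.
    rewrite !lE //; last by lra.
    by rewrite metric_sym (ray_in_isom rp); [ring|lra|lra].
  by rewrite (lE' t) ?lE ?far //; lra.
exists l; split.
- move=> s t; have [st|/ltW ts] := leP s t.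
    by rewrite lt_line // ler0_norm ?subr_le0 // opprB.
  by rewrite metric_sym lt_line // ger0_norm // subr_ge0.
- move=> _ [s _ <-]; have [s0|s0] := ltP 0 s; first by rewrite lE' ?(ltW s0) //; exact: bdq.
  by rewrite lE; [apply: bdp; lra|lra].
- by exists d => //; rewrite lE' // ltW.
- by exists 0 => //; rewrite lE' // (ray_in0 rq).
Qed.

End Lines.

Theorem theorem1p6 (R : realType) (n : nat) (kappa : R) (M : metricType R)
    (kappa_le0 : kappa <= 0)
    (M_alexandrov : complete_alexandrov n kappa M)
    (M_noncompact : ~ compact [set: M])
    (M_ob : ob_infty M = (pi / 2)%:E) :
  one_side_inj M = +oo%E /\
  (boundary n M !=set0 ->
    (exists (f : M -> 'rV[R]_n) (g : 'rV[R]_n -> M),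
       homeomorphism [set: M] (half_space n) f g) /\
    (forall p q : M, boundary n M p -> boundary n M q -> p <> q ->
       exists l : R -> M, [/\ line l, range l `<=` boundary n M,
         range l p & range l q])).
Proof.
have oM := onesided_of_ob kappa_le0 M_alexandrov M_ob; split.
  exact: one_side_inj_infty (os_proper oM) (alexl_curv (os_alexl oM)) M_ob.
case: n M_alexandrov => [|m] _; first by case.
move=> [x bx]; have [ax hx] := boundary_pole oM bx; split; first exact: (exp_homeo oM ax hx).
by move=> p q; exact: (boundary_line oM).
Qed.
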